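(* Let $p\in[1,2]$. Assume that $E[|G^1|^k]<\infty$ for some $k>2$ and that $F$ satisfies condition (Lip$_p$) (defined in the context). Let $(Y^{i,n},Z^{i,j,n})$ be the solution of the interacting BSDE system and $(Y^1,Z^1)$ the solution of the McKean-Vlasov BSDE (both defined in the context). Then for every $q\in(2,k)$ (and $q$ not one of the excluded values in the definition of $r_{n,m,q,2}$ below) there is a constant $C$, depending on $T,m,L_F$ and $E[|Y^1_t|^k]$, such that for all $n\in\mathbb N$ $$E\Big[\sup_{t\in[0,T]}|Y^{1,n}_t-Y^1_t|^2\Big]+E\Big[\int_0^T|Z^{1,1,n}_t-Z^1_t|^2\,dt\Big]\le C\,r_{n,m,q,2},$$ where $$r_{n,m,q,2}:=\begin{cases} n^{-1/2}+n^{-(q-2)/q}, & \text{if } 2>m/2 \text{ and } q\ne 4,\\ n^{-1/2}\log(1+n)+n^{-(q-2)/q}, & \text{if } 2=m/2\text{ and } q\neq 4,\\ n^{-2/m}+n^{-(q-2)/q}, & \text{if } 2<m/2\text{ and } q\ne m/(m-2).\end{cases}$$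
   Context: Fix $d,m\in\mathbb N$ and $T>0$; $|\cdot|$ denotes Euclidean norms. $\Omega:=C([0,T],\mathbb R^d)$ carries the Wiener measure. $W^1,W^2,\dots$ are independent $d$-dimensional Brownian motions (canonical processes on copies of $\Omega$), $P$ is the underlying probability, $E$ its expectation, and $\mathcal F^n$ is the completed filtration generated by $W^1,\dots,W^n$. $\mathcal L(X)$ is the law of $X$ under $P$. $\mathcal P_p(\mathbb R^m)$ is the set of probability measures on $\mathbb R^m$ with finite $p$-th moment, with the Wasserstein distance $\mathcal W_p(\mu,\nu)=\inf_\pi\left(\int|x-y|^p\,d\pi\right)^{1/p}$, the infimum being over couplings $\pi$ of $\mu,\nu$. For $\boldsymbol x=(x_1,\dots,x_n)\in(\mathbb R^m)^n$, $L^n(\boldsymbol x):=\frac1n\sum_{k=1}^n\delta_{x_k}$. $F:[0,T]\times\Omega\times\mathbb R^m\times\mathbb R^{m\times d}\times\mathcal P_2(\mathbb R^m)\to\mathbb R^m$ is such that $(t,\omega)\mapsto F_t(\omega,y,z,\mu)$ is progressively measurable for all $(y,z,\mu)$; in the equation for particle $i$, $F_u(\cdot)$ is evaluated at the path $W^i$. The $G^i$ are i.i.d. $\mathbb R^m$-valued random variables of the form $G^i=G(W^i)$, $G$ a measurable functional on $\Omega$. Interacting system: $\mathbf Y=(Y^{1,n},\dots,Y^{n,n})$ solves $$Y^{i,n}_t=G^i+\int_t^TF_u(Y^{i,n}_u,Z^{i,i,n}_u,L^n(\mathbf Y_u))\,du-\sum_{k=1}^n\int_t^TZ^{i,k,n}_u\,dW^k_u,\quad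 i=1,\dots,n.$$ McKean-Vlasov BSDE: $(Y^i,Z^i)$ solves $$Y^i_t=G^i+\int_t^TF_u(Y^i_u,Z^i_u,\mathcal L(Y^i_u))\,du-\int_t^TZ^i_u\,dW^i_u.$$ Condition (Lip$_p$), $p\in[1,2]$: there is $L_F\ge0$ such that for all $t,y,y',z,z'$ and $\mu,\mu'\in\mathcal P_p(\mathbb R^m)$ (with $F$ understood as defined for such measures), $$|F_t(y,z,\mu)-F_t(y',z',\mu')|\le L_F(|y-y'|+|z-z'|+\mathcal W_p(\mu,\mu')),\qquad |F_t(y,z,\mu)|\le L_F\Big(1+|y|+|z|+\Big(\int|x|^p\,d\mu\Big)^{1/p}\Big).$$ Under (Lip$_p$) and $E[|G^i|^2]<\infty$ both equations have unique square integrable solutions (i.e. $E\sup_t|Y_t|^2<\infty$, $E\int_0^T|Z_t|^2dt<\infty$); these are the solutions meant. *)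

(* Defs.v *)
From HB Require Import structures.
From mathcomp Require Import all_boot all_order all_algebra.
From mathcomp Require Import all_classical all_reals all_analysis.

Set Implicit Arguments.
Unset Strict Implicit.
Unset Printing Implicit Defensive.

Import Order.TTheory GRing.Theory Num.Theory.
Import numFieldNormedType.Exports.

Local Open Scope classical_set_scope.
Local Open Scope ring_scope.

(* The Borel sigma-algebra on R^m = 'rV[R]_m and on R^{m x d} = 'M[R]_(m, d). *)
HB.instance Definition _ (R : realType) (a b : nat) :=
  @isMeasurable.Build (sigma_display (@open 'M[R]_(a, b))) 'M[R]_(a, b)
    <<s open >> (@sigma_algebra0 _ setT _) (@sigma_algebraC _ _)
    (@sigma_algebra_bigcup _ setT _).

(* Euclidean (Frobenius) norm; the library norm on matrices is the sup norm. *)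
Definition enorm (R : realType) (a b : nat) (x : 'M[R]_(a, b)) : R :=
  Num.sqrt (\sum_i \sum_j x i j ^+ 2).

Section Wasserstein.
Context {R : realType} {m : nat}.
Local Notation V := 'rV[R]_m.
Local Open Scope ereal_scope.

Definition moment (p : R) (mu : probability V R) : \bar R :=
  \int[mu]_x (enorm x `^ p)%:E.

Definition finite_moment (p : R) (mu : probability V R) : Prop :=
  moment p mu < +oo.

Definition coupling (mu nu : probability V R)
    (pi : probability (V * V)%type R) : Prop :=
  forall A : set V, measurable A ->
    pi (A `*` setT) = mu A /\ pi (setT `*` A) = nu A.

Definition wasserstein (p : R) (mu nu : probability V R) : \bar R :=
  ereal_inf [set (\int[pi]_xy (enorm (xy.1 - xy.2)%R `^ p)%:E) `^ p^-1
            | pi in coupling mu nu].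

End Wasserstein.

Section Empirical.
Context {R : realType} {m : nat} (n : nat) (x : 'I_n.+1 -> 'rV[R]_m).

Definition empirical : set 'rV[R]_m -> \bar R :=
  mscale (n.+1%:R^-1)%:nng (msum (fun k => \d_(x (inord k))) n.+1).

HB.instance Definition _ := Measure.on empirical.

Let empiricalT : empirical setT = 1%E.
Proof.
rewrite /empirical /mscale /= /msum.
rewrite (eq_bigr (fun=> 1%E)) => [|i _]; last exact: diracT.
by rewrite sumEFin sumr_const card_ord -EFinM mulVf.
Qed.

HB.instance Definition _ :=
  Measure_isProbability.Build _ _ _ empirical empiricalT.

End Empirical.

(* Elements of C([0,T], R^d) are represented by total functions that are
   continuous on [0,T]; the sigma-algebras below only see their restriction
   to [0,T]. *)
Record cpath (R : realType) (T : R) (d : nat) := CPath {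
  cpath_fun :> R -> 'rV[R]_d ;
  cpath_continuous : {within `[0, T], continuous cpath_fun} }.

Lemma zero_path_continuous (R : realType) (T : R) (d : nat) :
  {within `[0, T], continuous (fun=> 0 : 'rV[R]_d)}.
Proof. by apply: continuous_subspaceT => x; exact: cvg_cst. Qed.

Section PathSpace.
Context (R : realType) (T : R) (d : nat).

HB.instance Definition _ := gen_eqMixin (cpath T d).
HB.instance Definition _ := gen_choiceMixin (cpath T d).
HB.instance Definition _ := isPointed.Build (cpath T d)
  (CPath (@zero_path_continuous R T d)).

Definition cylinders (t : R) : set (set (cpath T d)) :=
  [set A | exists s B, [/\ 0 <= s <= t, measurable B
                         & A = [set w : cpath T d | B (w s)]]].

HB.instance Definition _ :=
  @isMeasurable.Build (sigma_display (cylinders T)) (cpath T d)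
    <<s cylinders T >> (@sigma_algebra0 _ setT _) (@sigma_algebraC _ _)
    (@sigma_algebra_bigcup _ setT _).

(* Under [mu] the canonical process starts at 0 and, for s < t, its increment
   over [s, t] is independent of the past up to s with law N(0, (t - s) Id). *)
Definition is_wiener (mu : probability (cpath T d) R) : Prop :=
  {ae mu, forall w : cpath T d, w 0 = 0} /\
  forall s t : R, 0 <= s -> s < t -> t <= T ->
  forall A : set (cpath T d), <<s cylinders s >> A ->
  forall B : 'I_d -> set R, (forall j, measurable (B j)) ->
    mu (A `&` [set w : cpath T d | forall j, B j (w t 0 j - w s 0 j)]) =
    (mu A * \prod_(j < d) normal_prob 0 (Num.sqrt (t - s)) (B j))%E.

End PathSpace.

Section Filtrations.
Context {R : realType}.

(* A filtration is given by a family of generators: its sigma-algebra at time t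
   is <<s FF t >>, the sigma-algebra of [g_sigma_algebraType (FF t)]. *)
Definition adapted (X : pointedType) dV (V : measurableType dV) (T : R)
    (FF : R -> set (set X)) (h : R -> X -> V) : Prop :=
  forall t, 0 <= t <= T ->
    measurable_fun setT (h t : g_sigma_algebraType (FF t) -> V).

Definition progressive (X : pointedType) dV (V : measurableType dV) (T : R)
    (FF : R -> set (set X)) (h : R -> X -> V) : Prop :=
  forall t, 0 <= t <= T ->
    measurable_fun (`[0, t] `*` setT)
      (fun sx : R * g_sigma_algebraType (FF t) => h sx.1 sx.2).

Definition path_filtration (T : R) (d : nat) (mu : probability (cpath T d) R)
    (t : R) : set (set (cpath T d)) :=
  cylinders t `|` mu.-negligible.

Context {T : R} {d : nat} {d0 : measure_display} {Omega : measurableType d0}.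
Context {P : probability Omega R}.

Definition noise_filtration (W : nat -> {RV P >-> cpath T d}) (n : nat)
    (t : R) : set (set Omega) :=
  [set W i @^-1` A | i in [set i | (i < n)%N] & A in cylinders t]
  `|` P.-negligible.

Definition mutually_independent (W : nat -> {RV P >-> cpath T d}) : Prop :=
  forall (s : seq nat) (A : nat -> set (cpath T d)), uniq s ->
    (forall i, measurable (A i)) ->
    P (\bigcap_(i in [set` s]) W i @^-1` A i) =
    (\prod_(i <- s) P (W i @^-1` A i))%E.

End Filtrations.

Section Ito.
Context {R : realType} {d0 : measure_display} {Omega : measurableType d0}.
Context (P : probability Omega R) (T : R) (FF : R -> set (set Omega)).

Record simple_process := SimpleProcess {
  sp_size : nat ;
  sp_time : nat -> R ;
  sp_coef : nat -> Omega -> R ;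
  sp_time_range : forall i, 0 <= sp_time i <= T ;
  sp_time_mono : {homo sp_time : i j / (i <= j)%N >-> i <= j} ;
  sp_coef_meas : forall i, measurable_fun setT
    (sp_coef i : g_sigma_algebraType (FF (sp_time i)) -> R) ;
  sp_coef_bounded : forall i, exists c : R, forall w, `|sp_coef i w| <= c }.

Definition sp_value (S : simple_process) (t : R) (w : Omega) : R :=
  \sum_(i < sp_size S)
    sp_coef S i w * (sp_time S i < t <= sp_time S i.+1)%R%:R.

Definition sp_integral (S : simple_process) (B : R -> Omega -> R)
    (t : R) (w : Omega) : R :=
  \sum_(i < sp_size S) sp_coef S i w *
    (B (Num.min t (sp_time S i.+1)) w - B (Num.min t (sp_time S i)) w).

(* [M] is the (a.s. continuous) process t |-> \int_0^t h dB, as the L^2-limit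
   of the integrals of simple processes approximating [h] in L^2(dt (x) P). *)
Definition is_ito_integral (B h M : R -> Omega -> R) : Prop :=
  [/\ adapted T FF M,
      {ae P, forall w, {within `[0, T], continuous (M ^~ w)}} &
      exists S : nat -> simple_process,
        (\int[P]_w \int[lebesgue_measure]_(t in `[0%R, T])
           ((sp_value (S N) t w - h t w) ^+ 2)%:E @[N --> \oo] --> 0)%E /\
        forall t, 0 <= t <= T ->
          (\int[P]_w ((sp_integral (S N) B t w - M t w) ^+ 2)%:E
             @[N --> \oo] --> 0)%E ].

End Ito.

Section Norms.
Context {R : realType} {a b : nat}.
Context {d0 : measure_display} {Omega : measurableType d0}.
Variables (P : probability Omega R) (T : R) (X : R -> Omega -> 'M[R]_(a, b)).
Local Open Scope ereal_scope.

Definition sup_norm2 : \bar R :=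
  \int[P]_w ereal_sup [set (enorm (X t w) ^+ 2)%:E | t in `[0%R, T]].

Definition int_norm2 : \bar R :=
  \int[P]_w \int[lebesgue_measure]_(t in `[0%R, T]) (enorm (X t w) ^+ 2)%:E.

Definition sup_moment (k : R) : \bar R :=
  ereal_sup [set \int[P]_w (enorm (X t w) `^ k)%:E | t in `[0%R, T]].

End Norms.

Section BSDE.
Context {R : realType} {T : R} {d m : nat}.
Context {d0 : measure_display} {Omega : measurableType d0}.
Context {P : probability Omega R}.
Variable W : nat -> {RV P >-> cpath T d}.

(* Square integrable solution of
     Y_t = xi + \int_t^T f_u du - \sum_(k < n) \int_t^T Z^k_u dW^k_u,
   in the completed filtration of W^0, ..., W^(n-1); [f] is the driver
   evaluated along the solution, and M k j l = \int_0^. (Z^k)_(j,l) dW^(k,l). *)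
Definition bsde_solution (n : nat) (xi : Omega -> 'rV[R]_m)
    (f : R -> Omega -> 'rV[R]_m) (Y : R -> Omega -> 'rV[R]_m)
    (Z : 'I_n -> R -> Omega -> 'M[R]_(m, d)) : Prop :=
  [/\ adapted T (noise_filtration W n) Y /\
        {ae P, forall w, {within `[0, T], continuous (Y ^~ w)}},
      forall k, progressive T (noise_filtration W n) (Z k),
      (sup_norm2 P T Y < +oo)%E,
      forall k, (int_norm2 P T (Z k) < +oo)%E &
      exists M : 'I_n -> 'I_m -> 'I_d -> R -> Omega -> R,
        (forall (k : 'I_n) j l, is_ito_integral P T (noise_filtration W n)
           (fun t w => W k w t 0 l) (fun t w => Z k t w j l) (M k j l)) /\
        {ae P, forall w, forall t, 0 <= t <= T -> forall j,
           Y t w 0 j = xi w 0 j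
             + \int[lebesgue_measure]_(u in `[t, T]) f u w 0 j
             - \sum_(k < n) \sum_(l < d) (M k j l T w - M k j l t w)} ].

Variable F : R -> cpath T d -> 'rV[R]_m -> 'M[R]_(m, d) ->
  probability 'rV[R]_m R -> 'rV[R]_m.
Variable G : cpath T d -> 'rV[R]_m.

Definition interacting_solution (n : nat)
    (Y : 'I_n.+1 -> R -> Omega -> 'rV[R]_m)
    (Z : 'I_n.+1 -> 'I_n.+1 -> R -> Omega -> 'M[R]_(m, d)) : Prop :=
  forall i : 'I_n.+1,
    bsde_solution (fun w => G (W i w))
      (fun u w => F u (W i w) (Y i u w) (Z i i u w)
                    (empirical (fun l => Y l u w)))
      (Y i) (Z i).

Definition mckean_vlasov_solution (Y : R -> {RV P >-> 'rV[R]_m})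
    (Z : R -> Omega -> 'M[R]_(m, d)) : Prop :=
  bsde_solution (fun w => G (W 0%N w))
    (fun u w => F u (W 0%N w) (Y u w) (Z u w) (distribution P (Y u)))
    Y (fun _ : 'I_1 => Z).

End BSDE.

Definition driver_lipschitz (R : realType) (T : R) (d m : nat) (p LF : R)
    (F : R -> cpath T d -> 'rV[R]_m -> 'M[R]_(m, d) ->
         probability 'rV[R]_m R -> 'rV[R]_m) : Prop :=
  forall (t : R) (w : cpath T d), 0 <= t <= T ->
  (forall y y' z z' (mu mu' : probability 'rV[R]_m R),
     finite_moment p mu -> finite_moment p mu' ->
     ((enorm (F t w y z mu - F t w y' z' mu')%R)%:E <=
      LF%:E * ((enorm (y - y')%R)%:E + (enorm (z - z')%R)%:E
               + wasserstein p mu mu'))%E) /\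
  (forall y z (mu : probability 'rV[R]_m R), finite_moment p mu ->
     ((enorm (F t w y z mu))%:E <=
      LF%:E * (1 + (enorm y)%:E + (enorm z)%:E + moment p mu `^ p^-1))%E).

Section Rate.
Context {R : realType}.

Definition rate (n m : nat) (q : R) : R :=
  (if m%:R / 2 < 2 :> R then n%:R `^ (- 2^-1)
   else if m%:R / 2 == 2 :> R then n%:R `^ (- 2^-1) * ln (1 + n%:R)
   else n%:R `^ (- (2 / m%:R)))
  + n%:R `^ (- ((q - 2) / q)).

Definition rate_defined (m : nat) (q : R) : Prop :=
  (m%:R / 2 <= 2 :> R -> q != 4) /\
  (2 < m%:R / 2 :> R -> q != m%:R / (m%:R - 2)).

End Rate.

(* Main.v *)
(* The particles are compared with i.i.d. copies of the McKean-Vlasov solution, obtained by writing that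
   solution as a functional of its own noise. Orthogonality of stochastic increments and the Ito isometry on a
   short interval [s, t], together with the Lipschitz bound, control the second moment of a difference of two
   solutions at time s by the one at time t, plus (t - s) times the energy of the difference and of the source
   terms; iterating over short intervals gives a stability estimate without the Ito formula. Here the source
   is the Wasserstein distance between the law of Y_u and the empirical measure of the copies. It is at most an
   explicit transport cost, obtained by coupling two measures along a tree of dyadic cells inside dyadic
   shells, and pairwise independence bounds the mean of that cost by the rate, given a k-th moment of Y_u
   uniform in u; this moment comes from the same stability estimate, weighted by a truncated power of |Y|.
   The estimate is first applied to all particles jointly, which bounds the average over the particles of
   E|Y^{l,n}_t - Y^l_t|^2, and then to the first particle alone, with this average as a source term, so that
   exchangeability of the system is not needed. Doob's inequality finally gives the supremum over time. *)
Require Import Defs.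
From HB Require Import structures.
From mathcomp Require Import all_boot all_order all_algebra.
From mathcomp Require Import all_classical all_reals all_analysis.
From mathcomp Require Import measurable_realfun.
From mathcomp Require Import ring lra.
Import Order.TTheory GRing.Theory Num.Theory.
Import numFieldNormedType.Exports HBSimple HBNNSimple.
Local Open Scope classical_set_scope.
Local Open Scope ring_scope.
Set Implicit Arguments.
Unset Strict Implicit.
Unset Printing Implicit Defensive.

(** The rate rests on one exponent. For a cell [Q] of mass [c], the mean of |mu_n(Q) - mu(Q)| is at
    most 2c and at most (c/n)^(1/2). Interpolating both bounds gives a factor n^(-a), 0 <= a <= 1/2.
    The sum over the shells of radius 2^j converges when a < 1 - 2/k, so a = min(1/2, 1 - 2/q) is
    admissible because q < k. Along the levels of the tree the terms form a geometric sequence of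
    ratio 2^(ma - 2), which separates the dimensions below, at and above 4. Null sets and
    measurability shape the rest. The data [F] and [G] are measurable only for the completed path
    filtration, the measure argument of [F] moves with time, and suprema over all times are
    integrated without being known to be measurable. The copies are chosen separately at each time:
    their equation holds almost surely for each fixed time only, and their stochastic integrals need
    not be continuous. This suffices for the average over the particles; the maximal inequality is
    applied to the first particle, which is compared with [Y] itself. Each short step back in time
    may double the terminal value, but the number of steps depends only on T and the Lipschitz
    constant. *)

Ltac pos := repeat first [exact: sqr_ge0 | exact: powR_ge0 | apply: exprn_ge0 |
  (apply: sumr_ge0 => ? _) | assumption | (apply: ltW; assumption) | exact: ler01 |
  apply: addr_ge0 | apply: mulr_ge0 | apply: divr_ge0 | rewrite invr_ge0 | exact: ler0n | exact: normr_ge0 | done].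

(** * Euclidean norms and Borel measurability of matrix-valued maps *)

Section Matrices.
Context {R : realType}.

Lemma measurable_coord (a b : nat) (i : 'I_a) (j : 'I_b) :
  measurable_fun setT (fun A : 'M[R]_(a, b) => A i j).
Proof.
apply: (measurability _ (RGenOInfty.measurableE R)) => _ [_ [x ->] <-]; rewrite setTI.
apply: sub_sigma_algebra.
apply: open_comp => [y _|]; [exact: coord_continuous | exact: interval_open].
Qed.

(** The Borel sets are generated by the open sets, not as a product. An open set is a countable
    union of sup-norm cubes with rational centres and radii 1/(n+1), and the preimage of such a cube
    is a finite intersection of conditions on single entries. *)
Lemma measurable_fun_mx (d0 : measure_display) (X : measurableType d0) (D : set X) a b (f : X -> 'M[R]_(a, b)) :
  measurable D -> (forall i j, measurable_fun D (fun x => f x i j)) -> measurable_fun D f.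
Proof.
move=> mD mf.
apply: (@measurability _ _ X 'M[R]_(a, b) D f open) => //.
move=> _ [U oU <-].
pose B (c : 'M[rat]_(a, b) * nat) : set 'M[R]_(a, b) :=
  [set x | forall i j, `|ratr (c.1 i j) - x i j| < c.2.+1%:R^-1].
have -> : D `&` f @^-1` U = \bigcup_(c in [set c | B c `<=` U]) (D `&` f @^-1` B c).
  apply/seteqP; split => [x [Dx Ux]|x [c /= cU [Dx Bx]]]; last by split => //; exact: cU.
  have /nbhs_ballP[e /= e0 he] : nbhs (f x) U by exact: open_nbhs_nbhs.
  have [n n2e] : exists n : nat, n.+1%:R^-1 < e / 2.
    have e20 : 0 < e / 2 by rewrite divr_gt0.
    have [n _ /(_ _ (leqnn n)) h] := near_infty_natSinv_lt (PosNum e20).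
    by exists n.
  have [q hq] : exists q : 'M[rat]_(a, b), forall i j, `|ratr (q i j) - f x i j| < n.+1%:R^-1.
    have qij : forall ij : 'I_a * 'I_b, {r : rat | `|ratr r - f x ij.1 ij.2| < n.+1%:R^-1}.
      move=> ij; apply: cid.
      have n0 : 0 < n.+1%:R^-1 :> R by [].
      have [] := @dense_rat R (ball (f x ij.1 ij.2) n.+1%:R^-1).
      - by exists (f x ij.1 ij.2); exact: ballxx.
      - exact: ball_open.
      move=> y [h [r _ ry]]; exists r; rewrite ry; move: h.
      by rewrite -ball_normE /= distrC.
    exists (\matrix_(i, j) projT1 (qij (i, j))) => i j; rewrite mxE.
    exact: (projT2 (qij (i, j))).
  exists (q, n) => /= [y By|]; last by split.
  apply: he; split => // i j.
  rewrite -ball_normE /=.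
  have := hq i j; have := By i j => /= h1 h2.
  by rewrite (le_lt_trans (ler_distD (ratr (q i j)) _ _))// [e]splitr ltrD// ?(lt_trans _ n2e)// distrC.
rewrite bigcup_mkcond; apply: countable_bigcupT_measurable => [|c]; first exact: countableP.
case: ifPn => // _.
have -> : D `&` f @^-1` B c =
    \bigcap_(ij in [set: 'I_a * 'I_b]) (D `&` [set x | `|ratr (c.1 ij.1 ij.2) - f x ij.1 ij.2| < c.2.+1%:R^-1]) `&` D.
  apply/seteqP; split => [x [Dx /= Bx]|x [/= h Dx]].
    by split => // -[i j] _; split => //=; exact: Bx.
  by split => // i j; have [] := h (i, j) I.
apply: measurableI => //; apply: fin_bigcap_measurable; first exact: finite_finset.
move=> -[i j] _ /=.
have hm : measurable_fun D (fun x => `|ratr (c.1 i j) - f x i j| < (cst c.2.+1%:R^-1 : X -> R) x).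
  apply: measurable_fun_ltr; last exact: measurable_cst.
  by apply: measurableT_comp => //; apply: measurable_funB => //; exact: measurable_cst.
exact: (hm mD [set true]).
Qed.

Lemma enorm_ge0 a b (x : 'M[R]_(a, b)) : 0 <= enorm x.
Proof. exact: sqrtr_ge0. Qed.

Lemma enorm_sqr a b (x : 'M[R]_(a, b)) : enorm x ^+ 2 = \sum_i \sum_j x i j ^+ 2.
Proof.
by rewrite sqr_sqrtr// sumr_ge0// => i _; rewrite sumr_ge0// => j _; rewrite sqr_ge0.
Qed.

Lemma enormN a b (x : 'M[R]_(a, b)) : enorm (- x) = enorm x.
Proof.
by congr Num.sqrt; apply: eq_bigr => i _; apply: eq_bigr => j _; rewrite mxE sqrrN.
Qed.

Lemma enorm_sqrD a b (x y : 'M[R]_(a, b)) :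
  enorm (x + y) ^+ 2 <= 2 * enorm x ^+ 2 + 2 * enorm y ^+ 2.
Proof.
rewrite !enorm_sqr !mulr_sumr -big_split/= ler_sum// => i _.
rewrite !mulr_sumr -big_split/= ler_sum// => j _; rewrite mxE.
by have := sqr_ge0 (x i j - y i j); lra.
Qed.

Lemma coord_le_enorm a b (x : 'M[R]_(a, b)) i j : `|x i j| <= enorm x.
Proof.
rewrite -sqrtr_sqr /enorm ler_wsqrtr// (bigD1 i)//= (bigD1 j)//= -addrA lerDl.
by rewrite addr_ge0// sumr_ge0// => k _; rewrite ?sumr_ge0// => *; rewrite sqr_ge0.
Qed.

Lemma enorm_le_coord a b (x : 'M[R]_(a, b)) e : 0 <= e ->
  (forall i j, `|x i j| <= e) -> enorm x ^+ 2 <= (a * b)%:R * e ^+ 2.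
Proof.
move=> e0 h; rewrite enorm_sqr.
apply: (@le_trans _ _ (\sum_(i < a) \sum_(j < b) e ^+ 2)).
  by apply: ler_sum => i _; apply: ler_sum => j _; rewrite -real_normK ?num_real// lerXn2r ?nnegrE.
by rewrite !sumr_const !card_ord -mulrnA mulr_natl mulnC.
Qed.

Lemma measurable_enorm a b : measurable_fun setT (@enorm R a b).
Proof.
apply: measurableT_comp; first exact: continuous_measurable_fun (@sqrt_continuous R).
apply: measurable_sum => i; apply: measurable_sum => j.
by apply: measurable_funX; exact: measurable_coord.
Qed.

End Matrices.

(** * Integrals of nonnegative functions and square integrability *)

Section Integrals.
Context {R : realType} {d0 : measure_display} {X : measurableType d0} (mu : measure X R).
Local Open Scope ereal_scope.

(** A nonnegative integral is a supremum over simple functions below the integrand, and these are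
    measurable; hence only the larger function has to be. This is what allows suprema over
    uncountably many times on the left. *)
Lemma ae_le_integral_nonmeas (f g : X -> \bar R) :
  (forall x, 0 <= f x) -> (forall x, 0 <= g x) -> measurable_fun setT g ->
  {ae mu, forall x, f x <= g x} -> \int[mu]_x f x <= \int[mu]_x g x.
Proof.
move=> f0 g0 mg fg; rewrite [leLHS]ge0_integralTE//.
apply: ub_ereal_sup => _ [h /= hf <-].
rewrite -integralT_nnsfun//; apply: ae_ge0_le_integral => //.
- by move=> x _; rewrite lee_fin; exact: fun_ge0.
- exact/measurable_EFinP/measurable_funPT.
- by near=> x => _; apply: (le_trans (hf x)); near: x.
Unshelve. all: by end_near. Qed.

Lemma le_integral_nonmeas (f g : X -> \bar R) :
  (forall x, 0 <= f x) -> (forall x, f x <= g x) -> \int[mu]_x f x <= \int[mu]_x g x.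
Proof.
move=> f0 fg; rewrite !ge0_integralTE//; last by move=> x; apply: le_trans (fg x).
apply: le_ereal_sup => _ [h /= hf <-]; exists h => //= x; exact: le_trans (fg x).
Qed.

Definition sqint (f : X -> R) :=
  measurable_fun setT f /\ \int[mu]_x (f x ^+ 2)%:E < +oo.

Lemma measurable_sqE (f : X -> R) : measurable_fun setT f ->
  measurable_fun setT (fun x => (f x ^+ 2)%:E).
Proof. by move=> mf; apply/measurable_EFinP; exact: measurable_funX. Qed.

Lemma sqint_dom (f : X -> R) (g : X -> \bar R) : measurable_fun setT f ->
  (forall x, (f x ^+ 2)%:E <= g x) -> \int[mu]_x g x < +oo -> sqint f.
Proof.
move=> mf fg gy; split => //; apply: le_lt_trans gy; apply: le_integral_nonmeas => // x.
by rewrite lee_fin sqr_ge0.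
Qed.

Lemma sqint_int_sumZ (c e : R) (f g : X -> R) : (0 <= c)%R -> (0 <= e)%R ->
  measurable_fun setT f -> measurable_fun setT g ->
  \int[mu]_x (c * f x ^+ 2 + e * g x ^+ 2)%:E =
  c%:E * \int[mu]_x (f x ^+ 2)%:E + e%:E * \int[mu]_x (g x ^+ 2)%:E.
Proof.
move=> c0 e0 mf mg; rewrite -!ge0_integralZl//=; try exact: measurable_sqE;
  try by move=> x _; rewrite lee_fin sqr_ge0.
rewrite -ge0_integralD//=.
- by move=> x _; rewrite lee_fin mulr_ge0 ?sqr_ge0.
- by apply: emeasurable_funM; [exact: measurable_cst|exact: measurable_sqE].
- by move=> x _; rewrite lee_fin mulr_ge0 ?sqr_ge0.
- by apply: emeasurable_funM; [exact: measurable_cst|exact: measurable_sqE].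
Qed.

Lemma sqintD (f g : X -> R) : sqint f -> sqint g -> sqint (fun x => f x + g x)%R.
Proof.
move=> [mf fy] [mg gy].
apply: (@sqint_dom _ (fun x => (2 * f x ^+ 2 + 2 * g x ^+ 2)%:E)).
- exact: measurable_funD.
- by move=> x; rewrite lee_fin; have := sqr_ge0 (f x - g x); lra.
- by rewrite sqint_int_sumZ// lte_add_pinfty// lte_mul_pinfty.
Qed.

Lemma sqint_bndM (c : R) (f g : X -> R) : measurable_fun setT f -> (forall x, `|f x| <= c)%R ->
  sqint g -> sqint (fun x => f x * g x)%R.
Proof.
move=> mf fc [mg gy].
apply: (@sqint_dom _ (fun x => (c ^+ 2)%:E * (g x ^+ 2)%:E)).
- exact: measurable_funM.
- move=> x; rewrite -EFinM lee_fin exprMn ler_wpM2r ?sqr_ge0//.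
  by rewrite -(real_normK (num_real (f x))) lerXn2r ?nnegrE// (le_trans _ (fc x)).
- rewrite ge0_integralZl//=; [|exact: measurable_sqE|by move=> x _; rewrite lee_fin sqr_ge0|by rewrite lee_fin sqr_ge0].
  by rewrite lte_mul_pinfty// lee_fin sqr_ge0.
Qed.

Lemma sqintZ (c : R) (g : X -> R) : sqint g -> sqint (fun x => c * g x)%R.
Proof.
by move=> h; apply: (@sqint_bndM `|c|) => //; exact: measurable_cst.
Qed.

Lemma sqintN (g : X -> R) : sqint g -> sqint (fun x => - g x)%R.
Proof.
move=> h; have := @sqintZ (-1) _ h.
by rewrite (_ : (fun x => -1 * g x)%R = (fun x => - g x)%R)//; apply/funext => x; rewrite mulN1r.
Qed.

Lemma sqintB (f g : X -> R) : sqint f -> sqint g -> sqint (fun x => f x - g x)%R.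
Proof. by move=> hf hg; apply: sqintD => //; exact: sqintN. Qed.

Lemma sqint0 : sqint (fun=> 0%R).
Proof.
split; first exact: measurable_cst.
under eq_integral do rewrite expr0n/=.
by rewrite integral0.
Qed.

Lemma sqint_sum (I : Type) (s : seq I) (f : I -> X -> R) :
  (forall i, sqint (f i)) -> sqint (fun x => \sum_(i <- s) f i x)%R.
Proof.
move=> h; elim: s => [|i s IH].
  by under eq_fun do rewrite big_nil; exact: sqint0.
by under eq_fun do rewrite big_cons; exact: sqintD.
Qed.

Lemma sqint_mul_integrable (f g : X -> R) : sqint f -> sqint g ->
  mu.-integrable setT (fun x => (f x * g x)%:E).
Proof.
move=> [mf fy] [mg gy].
apply: (@le_integrable _ _ _ _ setT _ _ (fun x => (1 * f x ^+ 2 + 1 * g x ^+ 2)%:E)) => //.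
- by apply/measurable_EFinP; exact: measurable_funM.
- move=> x _; rewrite /= lee_fin normrM [leRHS]ger0_norm; last by pos.
  have := sqr_ge0 (`|f x| - `|g x|)%R; rewrite sqrrB !real_normK ?num_real//.
  have : (0 <= `|f x| * `|g x|)%R by rewrite mulr_ge0.
  move: (f x ^+ 2)%R (g x ^+ 2)%R (`|f x| * `|g x|)%R => a b c; rewrite -mulr_natr; lra.
- apply/integrableP; split.
    by apply/measurable_EFinP; apply: measurable_funD; apply: measurable_funM; try exact: measurable_cst; exact: measurable_funX.
  under eq_integral => x _ do (rewrite /= ger0_norm; last by pos).
  by rewrite sqint_int_sumZ// lte_add_pinfty// lte_mul_pinfty.
Qed.

(* From (a + b)^2 <= (1 + e) a^2 + (1 + 1/e) b^2 for all e > 0. *)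
Lemma sqint_cvg (f_ : nat -> X -> R) (f : X -> R) :
  (forall n, measurable_fun setT (f_ n)) -> sqint f ->
  \int[mu]_x ((f_ n x - f x) ^+ 2)%:E @[n --> \oo] --> 0 ->
  \int[mu]_x ((f_ n x) ^+ 2)%:E @[n --> \oo] --> \int[mu]_x (f x ^+ 2)%:E.
Proof.
move=> mf_ [mf fy] h.
have Ifin : \int[mu]_x (f x ^+ 2)%:E \is a fin_num.
  by rewrite ge0_fin_numE// integral_ge0// => x _; rewrite lee_fin sqr_ge0.
have md n : measurable_fun setT (fun x => f_ n x - f x)%R by exact: measurable_funB.
have key (e : R) (g1 g2 g3 : X -> R) : (0 < e)%R ->
    measurable_fun setT g1 -> measurable_fun setT g2 -> measurable_fun setT g3 ->
    (forall x, g3 x ^+ 2 <= g1 x ^+ 2 + e * f x ^+ 2 + (2 / e + e) * g2 x ^+ 2)%R ->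
    \int[mu]_x (g3 x ^+ 2)%:E <= \int[mu]_x (g1 x ^+ 2)%:E + e%:E * \int[mu]_x (f x ^+ 2)%:E
      + (2 / e + e)%:E * \int[mu]_x (g2 x ^+ 2)%:E.
  move=> e0 m1 m2 m3 hle.
  have c0 : (0 <= 2 / e + e)%R by rewrite addr_ge0 ?divr_ge0// ltW.
  rewrite -[X in X + _ + _]mul1e -sqint_int_sumZ// ?(ltW e0)// -ge0_integralZl//=; last 2 first.
    exact: measurable_sqE.
    by move=> x _; rewrite lee_fin sqr_ge0.
  rewrite -ge0_integralD//=; last 4 first.
    by move=> x _; rewrite lee_fin; pos.
    apply/measurable_EFinP; apply: measurable_funD; apply: measurable_funM; try exact: measurable_cst; exact: measurable_funX.
    by move=> x _; rewrite lee_fin; pos.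
    by apply/measurable_EFinP; apply: measurable_funM; [exact: measurable_cst|exact: measurable_funX].
  apply: le_integral_nonmeas => [x|x]; first by rewrite lee_fin sqr_ge0.
  by rewrite lee_fin mul1r.
(* One constant serves both directions: 2/e + e dominates the 1 + 1/e of the expansion, since 1/e +
   e >= 2. *)
have ineq (e x y : R) : (0 < e -> x ^+ 2 <= y ^+ 2 + e * y ^+ 2 + (2 / e + e) * (x - y) ^+ 2 /\
     y ^+ 2 <= x ^+ 2 + e * y ^+ 2 + (2 / e + e) * (x - y) ^+ 2)%R.
  move=> e0; have : (0 <= e^-1 * (e * y - (x - y)) ^+ 2)%R by pos.
  have -> : (e^-1 * (e * y - (x - y)) ^+ 2 = e * y ^+ 2 - 2 * y * (x - y) + e^-1 * (x - y) ^+ 2)%R.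
    by field; rewrite gt_eqF.
  have : (0 <= e^-1 * (e * y + (x - y)) ^+ 2)%R by pos.
  have -> : (e^-1 * (e * y + (x - y)) ^+ 2 = e * y ^+ 2 + 2 * y * (x - y) + e^-1 * (x - y) ^+ 2)%R.
    by field; rewrite gt_eqF.
  have : (0 <= (e^-1 - 1) ^+ 2 / e^-1 * (x - y) ^+ 2)%R.
    by apply: mulr_ge0; [apply: divr_ge0; pos|pos].
  have -> : ((e^-1 - 1) ^+ 2 / e^-1 * (x - y) ^+ 2 = (e^-1 + e - 2) * (x - y) ^+ 2)%R.
    by field; rewrite gt_eqF.
  have : (0 <= e^-1 * (x - y) ^+ 2)%R by pos.
  have : (0 <= e * (x - y) ^+ 2)%R by pos.
  have -> : (x ^+ 2 = y ^+ 2 + 2 * y * (x - y) + (x - y) ^+ 2)%R by ring.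
  move: (x - y)%R => u *; split; nra.
move/fine_cvgP : h => [afin acvg].
have Ff n : \int[mu]_x ((f_ n x - f x) ^+ 2)%:E \is a fin_num -> \int[mu]_x (f_ n x ^+ 2)%:E \is a fin_num.
  move=> an; rewrite ge0_fin_numE; last by apply: integral_ge0 => x _; rewrite lee_fin sqr_ge0.
  apply: le_lt_trans (key 1%R f (fun x => f_ n x - f x)%R (f_ n) ltr01 mf (md n) (mf_ n) _) _.
    by move=> x; exact: (ineq 1%R (f_ n x) (f x) ltr01).1.
  by rewrite mul1e -(fineK Ifin) -(fineK an) -EFinM -!EFinD ltry.
rewrite -(fineK Ifin); apply/fine_cvgP; split; first by near=> n; apply: Ff; near: n.
set I0 := fine _; have I00 : (0 <= I0)%R by apply: fine_ge0; apply: integral_ge0 => x _; rewrite lee_fin sqr_ge0.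
apply/cvgrPdist_le => eps eps0.
pose e := (eps / (2 * (I0 + 1)))%R.
have e0 : (0 < e)%R by rewrite divr_gt0// mulr_gt0// ltr_wpDl.
have c0 : (0 < 2 / e + e)%R by rewrite addr_gt0// divr_gt0.
have eI : (e * I0 <= eps / 2)%R.
  have : (e * (I0 + 1) = eps / 2)%R by rewrite /e; field; rewrite gt_eqF// ltr_wpDl.
  by move: e0; nra.
near=> n.
have an : \int[mu]_x ((f_ n x - f x) ^+ 2)%:E \is a fin_num by near: n.
have A2 : (fine (\int[mu]_x ((f_ n x - f x) ^+ 2)%:E) <= eps / 2 / (2 / e + e))%R.
  near: n; move/cvgrPdist_le : acvg => /(_ (eps / 2 / (2 / e + e))%R).
  have -> : (0 < eps / 2 / (2 / e + e))%R by rewrite !divr_gt0.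
  move=> /(_ isT); apply: filterS => n; rewrite sub0r normrN; exact: le_trans (ler_norm _).
have Fn := Ff _ an.
have K1 := key e f (fun x => f_ n x - f x)%R (f_ n) e0 mf (md n) (mf_ n) (fun x => (ineq e (f_ n x) (f x) e0).1).
have K2 := key e (f_ n) (fun x => f_ n x - f x)%R f e0 (mf_ n) (md n) mf (fun x => (ineq e (f_ n x) (f x) e0).2).
move: K1 K2 A2; rewrite -(fineK Ifin) -(fineK Fn) -(fineK an) -!EFinM -!EFinD !lee_fin -/I0 /=.
set A := fine _; set B := fine _; rewrite ler_pdivlMr// => K1 K2 A2.
by rewrite ler_norml; apply/andP; split; lra.
Unshelve. all: by end_near. Qed.

End Integrals.

(** * Tree couplings and transport costs *)

Section TreeCoupling.
Context {R : realFieldType} {K : finType} {A : eqType}.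
Implicit Types (p r : K -> R) (w : K -> K -> R) (g : K -> A).

Let mass p g v := \sum_(a | g a == v) p a.
Let block w g v := \sum_(a | g a == v) \sum_(b | g b == v) w a b.

Let mass_ge0 p g v : (forall a, 0 <= p a) -> 0 <= mass p g v.
Proof. by move=> p0; apply: sumr_ge0. Qed.

Let block_row w g v : (forall a b, g a != g b -> w a b = 0) ->
  block w g v = mass (fun a => \sum_b w a b) g v.
Proof.
move=> supp; apply: eq_bigr => a /eqP ga.
rewrite [RHS](bigID (fun b => g b == v))/= [X in _ + X]big1 ?addr0// => b gb.
by rewrite supp// ga eq_sym.
Qed.

Let block_col w g v : (forall a b, g a != g b -> w a b = 0) ->
  block w g v = mass (fun b => \sum_a w a b) g v.
Proof.
move=> supp; rewrite /block exchange_big/=; apply: eq_bigr => b /eqP gb.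
rewrite [RHS](bigID (fun a => g a == v))/= [X in _ + X]big1 ?addr0// => a ga.
by rewrite supp// gb.
Qed.

Let massD p r g v : mass (fun a => p a - r a) g v = mass p g v - mass r g v.
Proof. by rewrite /mass sumrB. Qed.

(** In each cell of [g] take the product of the two measures divided by the larger of the two
    masses. The side with the smaller mass is used up completely, so the mass matched in the cell is
    the minimum. In a cell without mass the quotient is 0 by convention. *)
Let level p r g : (forall a, 0 <= p a) -> (forall a, 0 <= r a) ->
  exists w, [/\ forall a b, 0 <= w a b, forall a, \sum_b w a b <= p a,
    forall b, \sum_a w a b <= r b, forall a b, g a != g b -> w a b = 0 &
    forall v, block w g v = Num.min (mass p g v) (mass r g v)].
Proof.
move=> p0 r0.
pose mx v := Num.max (mass p g v) (mass r g v).
have mx0 v : 0 <= mx v by rewrite le_max mass_ge0.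
pose w a b := if g a == g b then p a * r b / mx (g a) else 0.
have w0 a b : 0 <= w a b.
  by rewrite /w; case: ifP => // _; rewrite divr_ge0 ?mulr_ge0.
have supp a b : g a != g b -> w a b = 0 by rewrite /w => /negPf ->.
have row a : \sum_b w a b = p a * mass r g (g a) / mx (g a).
  rewrite (bigID (fun b => g b == g a))/= [X in _ + X]big1 ?addr0; last first.
    by move=> b gb; rewrite supp// eq_sym.
  rewrite /mass mulr_sumr mulr_suml; apply: eq_bigr => b /eqP gb.
  by rewrite /w gb eqxx.
have col b : \sum_a w a b = mass p g (g b) * r b / mx (g b).
  rewrite (bigID (fun a => g a == g b))/= [X in _ + X]big1 ?addr0; last first.
    by move=> a gb; rewrite supp.
  rewrite /mass !mulr_suml; apply: eq_bigr => a /eqP gb.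
  by rewrite /w gb eqxx.
exists w; split => //.
- move=> a; rewrite row -mulrA ler_piMr//.
  have [->|mn0] := eqVneq (mx (g a)) 0; first by rewrite invr0 mulr0.
  have mp : 0 < mx (g a) by rewrite lt0r mn0 mx0.
  by rewrite ler_pdivrMr// mul1r /mx le_max lexx orbT.
- move=> b; rewrite col mulrAC ler_piMl//.
  have [->|mn0] := eqVneq (mx (g b)) 0; first by rewrite invr0 mulr0.
  have mp : 0 < mx (g b) by rewrite lt0r mn0 mx0.
  by rewrite ler_pdivrMr// mul1r /mx le_max lexx.
- move=> v; rewrite block_row//.
  have -> : mass (fun a => \sum_b w a b) g v = mass p g v * mass r g v / mx v.
    rewrite [in RHS]/mass !mulr_suml; apply: eq_bigr => a /eqP ga.
    by rewrite row ga.
  rewrite /mx; have := mass_ge0 g v p0; have := mass_ge0 g v r0.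
  move: (mass p g v) (mass r g v) => x y y0 x0.
  case: (leP x y) => xy.
    rewrite -mulrA; have [y00|yn0] := eqVneq y 0.
      by rewrite y00 in xy *; rewrite (_ : x = 0) ?mul0r//; apply/le_anti; rewrite xy x0.
    by rewrite divff// mulr1.
  by rewrite mulrAC divff ?mul1r// gt_eqF// (le_lt_trans y0).
Qed.

(** The invariant is the last clause: in every cell of a level already treated, one of the two
    leftover masses vanishes. Matching the leftovers in a coarser cell therefore adds nothing to the
    diagonal block of a finer one, and the minimum reached there persists. *)
Let tree p r (h : nat -> K -> A) :
  (forall a, 0 <= p a) -> (forall a, 0 <= r a) ->
  (forall i a b, h i a = h i b -> h i.+1 a = h i.+1 b) ->
  forall i, exists w, [/\ forall a b, 0 <= w a b,
    forall a, \sum_b w a b <= p a, forall b, \sum_a w a b <= r b,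
    forall a b, h i a != h i b -> w a b = 0 &
    forall i' v, (i' <= i)%N ->
      block w (h i') v = Num.min (mass p (h i') v) (mass r (h i') v) /\
      (mass (fun a => p a - \sum_b w a b) (h i') v = 0 \/
       mass (fun b => r b - \sum_a w a b) (h i') v = 0)].
Proof.
move=> p0 r0 nested.
have base w g v : (forall a b, g a != g b -> w a b = 0) ->
    block w g v = Num.min (mass p g v) (mass r g v) ->
    mass (fun a => p a - \sum_b w a b) g v = 0 \/
       mass (fun b => r b - \sum_a w a b) g v = 0.
  move=> supp e; rewrite !massD -block_row// -block_col// e.
  by case: (leP (mass p g v) (mass r g v)) => _; rewrite subrr; [left|right].
elim=> [|i [w [w0 wp wr wsupp wb]]].
  have [w [w0 wp wr wsupp wb]] := level (h 0%N) p0 r0.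
  exists w; split => // i' v; rewrite leqn0 => /eqP ->; split => //.
  exact: base.
set p' := fun a => p a - \sum_b w a b.
set r' := fun b => r b - \sum_a w a b.
have p'0 a : 0 <= p' a by rewrite subr_ge0.
have r'0 a : 0 <= r' a by rewrite subr_ge0.
have [u [u0 up ur usupp ub]] := level (h i.+1) p'0 r'0.
have wsupp' a b : h i.+1 a != h i.+1 b -> w a b = 0.
  move=> hab; apply: wsupp; apply: contra hab => /eqP/nested ->//.
have sumrow a : \sum_b (w a b + u a b) = \sum_b w a b + \sum_b u a b by rewrite big_split.
have sumcol b : \sum_a (w a b + u a b) = \sum_a w a b + \sum_a u a b by rewrite big_split.
have bl g v : block (fun a b => w a b + u a b) g v = block w g v + block u g v.
  by rewrite /block -big_split; apply: eq_bigr => a _; rewrite big_split.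
exists (fun a b => w a b + u a b); split.
- by move=> a b; rewrite addr_ge0.
- by move=> a; rewrite sumrow -lerBrDl.
- by move=> b; rewrite sumcol -lerBrDl.
- by move=> a b hab; rewrite wsupp'// usupp// addr0.
- move=> i' v; rewrite leq_eqVlt => /orP[/eqP ->|].
    have e : block (fun a b => w a b + u a b) (h i.+1) v =
        Num.min (mass p (h i.+1) v) (mass r (h i.+1) v).
      rewrite bl ub !massD -block_row// -block_col//.
      by rewrite addr_minr !subrKC.
    by split => //; apply: base => // a b hab; rewrite wsupp'// usupp// addr0.
  rewrite ltnS => i'i; have [wb1 wb2] := wb i' v i'i.
  have ule1 a b : u a b <= p' a.
    by apply: le_trans (up a); rewrite (bigD1 b)//= lerDl sumr_ge0.
  have ule2 a b : u a b <= r' b.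
    by apply: le_trans (ur b); rewrite (bigD1 a)//= lerDl sumr_ge0.
  split.
    rewrite bl wb1 [X in _ + X]big1 ?addr0// => a ha; apply: big1 => b hb.
    apply/le_anti; rewrite u0 andbT.
    case: wb2 => e.
      apply: le_trans (ule1 a b) _; rewrite -e /mass (bigD1 a)//= lerDl.
      by apply: sumr_ge0 => c _; exact: p'0.
    apply: le_trans (ule2 a b) _; rewrite -e /mass (bigD1 b)//= lerDl.
    by apply: sumr_ge0 => c _; exact: r'0.
  case: wb2 => /eqP; rewrite eq_le => /andP[e _]; [left|right]; apply/le_anti; apply/andP; split.
  - apply: le_trans e; apply: ler_sum => a _; rewrite /= sumrow opprD addrA.
    by have : 0 <= \sum_b u a b by [apply: sumr_ge0]; lra.
  - by apply: sumr_ge0 => a _; rewrite subr_ge0 sumrow -lerBrDl.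
  - apply: le_trans e; apply: ler_sum => b _; rewrite /= sumcol opprD addrA.
    by have : 0 <= \sum_a u a b by [apply: sumr_ge0]; lra.
  - by apply: sumr_ge0 => a _; rewrite subr_ge0 sumcol -lerBrDl.
Qed.

(* Greedy matching: cells of [h 0] (the finest partition) are matched first, and
   the mass left over in a cell is matched inside the next coarser cell. *)
Lemma tree_coupling p r (h : nat -> K -> A) n :
  (forall a, 0 <= p a) -> (forall a, 0 <= r a) -> \sum_a p a = \sum_a r a ->
  (forall i a b, h i a = h i b -> h i.+1 a = h i.+1 b) ->
  (forall a b, h n a = h n b) ->
  exists w, [/\ forall a b, 0 <= w a b,
    forall a, \sum_b w a b = p a, forall b, \sum_a w a b = r b &
    forall i v, (i <= n)%N ->
      \sum_(a | h i a == v) \sum_(b | h i b == v) w a b =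
      Num.min (\sum_(a | h i a == v) p a) (\sum_(a | h i a == v) r a)].
Proof.
move=> p0 r0 pr nested top.
have [w [w0 wp wr _ wb]] := tree p0 r0 nested n.
(* The top level is a single cell in which both masses agree, so no mass is left over. The
   nonnegative deficits of the rows and of the columns then sum to zero and vanish one by one. *)
have tot : \sum_a \sum_b w a b = \sum_a p a.
  have [/existsP[a0 _]|] := boolP [exists a : K, true]; last first.
    rewrite negb_exists => /forallP h0.
    by rewrite !big1// => a _; have := h0 a.
  have [+ _] := wb n (h n a0) (leqnn n); rewrite /block /mass.
  have e : (fun a => h n a == h n a0) =1 predT by move=> a; apply/eqP; exact: top.
  rewrite !(eq_bigl _ _ e) -pr minxx => <-; apply: eq_bigr => a _.
  by rewrite (eq_bigl _ _ e).
exists w; split => //.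
- move=> a; apply/eqP; rewrite -subr_eq0 -oppr_eq0 opprB.
  have /eqP : \sum_a (p a - \sum_b w a b) = 0 by rewrite sumrB tot subrr.
  rewrite psumr_eq0; last by move=> ? _; rewrite subr_ge0.
  by move=> /allP/(_ a (mem_index_enum _)).
- move=> a; apply/eqP; rewrite -subr_eq0 -oppr_eq0 opprB.
  have /eqP : \sum_b (r b - \sum_a w a b) = 0.
    by rewrite sumrB exchange_big/= tot pr subrr.
  rewrite psumr_eq0; last by move=> ? _; rewrite subr_ge0.
  by move=> /allP/(_ a (mem_index_enum _)).
- by move=> i v i_n; have [] := wb i v i_n.
Qed.

End TreeCoupling.

(** * Summation over shells and levels *)

Section RateBound.
Context {R : realType}.

(** Geometric mean of the bounds [2 * y] and (xy)^(1/2) with weights 1 - 2a and 2a; a <= 1/2 keeps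
    the first weight nonnegative. In use, [z] is the mean discrepancy of one shell at one level, [y]
    the mass of the shell, and [x] the number of cells over n. *)
Lemma interpolate (a x y z : R) : 0 <= a <= 2^-1 -> 0 <= z <= 2 * y -> 0 <= x ->
  z ^+ 2 <= x * y -> z <= 2 * (y `^ (1 - a) * x `^ a).
Proof.
move=> /andP[a0 a12] /andP[z0 zy] x0 zxy.
have y0 : 0 <= y by move: (le_trans z0 zy); rewrite pmulr_rge0.
have [->|zn0] := eqVneq z 0; first by rewrite !mulr_ge0 ?powR_ge0.
have zp : 0 < z by rewrite lt0r zn0.
have -> : z = z `^ (1 - 2 * a) * (z ^+ 2) `^ a.
  by rewrite -powR_mulrn// -powRrM -powRD ?subrK ?powRr1// zn0 implybT.
apply: (@le_trans _ _ ((2 * y) `^ (1 - 2 * a) * (x * y) `^ a)).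
  by rewrite ler_pM ?powR_ge0// ge0_ler_powR ?nnegrE ?mulr_ge0 ?sqr_ge0// ?subr_ge0; lra.
have -> : 1 - a = (1 - 2 * a) + a by ring.
have yn0 : y != 0.
  by apply: contraTneq zp => y00; rewrite -leNgt (le_trans zy)// y00 mulr0.
rewrite !powRM//.
have -> : y `^ (1 - 2 * a + a) = y `^ (1 - 2 * a) * y `^ a by rewrite powRD// yn0 implybT.
rewrite (_ : _ * _ = 2 `^ (1 - 2 * a) * (y `^ (1 - 2 * a) * y `^ a * x `^ a)); last by ring.
rewrite ler_wpM2r ?mulr_ge0 ?powR_ge0//.
rewrite -[leRHS]powRr1// ler_powR//; lra.
Qed.

Lemma geo_sum_le (s : R) N : 0 <= s < 1 -> \sum_(j < N) s ^+ j <= (1 - s)^-1.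
Proof.
move=> /andP[s0 s1]; have s10 : 0 < 1 - s by rewrite subr_gt0.
rewrite -[leRHS]mul1r ler_pdivlMr// mulrC -opprB mulNr -subrX1 opprB.
by rewrite gerBl exprn_ge0.
Qed.

Lemma geo_sum_ge1 (s : R) N : 1 < s -> \sum_(j < N.+1) s ^+ j <= s / (s - 1) * s ^+ N.
Proof.
move=> s1; have s10 : 0 < s - 1 by rewrite subr_gt0.
rewrite mulrAC -exprS ler_pdivlMr// mulrC -subrX1.
by rewrite gerBl.
Qed.

Lemma expr_powR (x y : R) j : 0 <= x -> (x `^ y) ^+ j = x `^ (y * j%:R).
Proof. by move=> x0; rewrite -powR_mulrn ?powR_ge0// -powRrM. Qed.

Lemma powR2_lt1 (x : R) : x < 0 -> 2 `^ x < 1.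
Proof. by move=> x0; rewrite /powR pnatr_eq0/= -[ltRHS]expR0 ltr_expR nmulr_rlt0// ln_gt0 ?ltr1n. Qed.

Lemma four_expr j : 4 ^+ j = 2 `^ (2 * j%:R) :> R.
Proof. by rewrite powRrM powR_mulrn// powR_mulrn ?sqr_ge0//; congr (_ ^+ _); ring. Qed.

(** The terms are dominated by a geometric sequence of ratio 2^(2 - k(1 - a)), which is below 1
    exactly when a < 1 - 2/k. As B >= 1, the power B^(1 - a) is at most B. *)
Lemma shell_sum (k a : R) : 0 < k -> 0 <= a <= 2^-1 -> a < 1 - 2 / k ->
  exists2 C, 0 <= C & forall B N (nu : nat -> R), 1 <= B ->
  (forall j, (j < N)%N -> 0 <= nu j <= B * 2 `^ (- (k * j%:R))) ->
  \sum_(j < N) 4 ^+ j * nu j `^ (1 - a) <= C * B.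
Proof.
move=> k0 /andP[a0 a12] ak.
pose s : R := 2 `^ (2 - k * (1 - a)).
have kak : 2 < k * (1 - a).
  move: ak; rewrite -subr_gt0 -(pmulr_rgt0 _ k0) => h.
  rewrite -subr_gt0; move: h; rewrite -subr_gt0 (_ : _ - 0 = k * (1 - a) - 2 * (k / k)); last by ring.
  by rewrite divff ?gt_eqF// mulr1.
have s01 : 0 <= s < 1 by rewrite powR_ge0/= powR2_lt1// subr_lt0.
exists (1 - s)^-1; first by rewrite invr_ge0 subr_ge0; case/andP: s01 => _ /ltW.
move=> B N nu B1 hnu; rewrite mulrC.
apply: (@le_trans _ _ (\sum_(j < N) B * s ^+ j)); last first.
  rewrite -mulr_sumr ler_wpM2l//; first lra.
  exact: geo_sum_le.
apply: ler_sum => j _; have /andP[nu0 nu1] := hnu j (ltn_ord j).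
have B0 : 0 <= B := le_trans ler01 B1.
have a1 : 0 <= 1 - a by lra.
apply: (@le_trans _ _ (4 ^+ j * (B * 2 `^ (- (k * j%:R) * (1 - a))))).
  rewrite ler_wpM2l ?exprn_ge0//.
  apply: (@le_trans _ _ ((B * 2 `^ (- (k * j%:R))) `^ (1 - a))).
    by rewrite ge0_ler_powR// nnegrE ?mulr_ge0 ?powR_ge0.
  rewrite powRM ?powR_ge0// -powRrM ler_wpM2r ?powR_ge0//.
  by rewrite ler1_powR//; lra.
rewrite expr_powR// mulrCA ler_wpM2l// four_expr -powRD ?implybT//; last by rewrite pnatr_eq0 implybT.
by rewrite le_eqVlt; apply/orP; left; apply/eqP; congr (_ `^ _); ring.
Qed.

Lemma natpow_powR (m l : nat) : (2 ^ (m * l))%:R = 2 `^ (m%:R * l%:R) :> R.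
Proof. by rewrite natrX -natrM powR_mulrn. Qed.

(** Interpolation turns each discrepancy into a factor depending on the shell times n^(-a) 2^(mla),
    so the double sum factors: the shells contribute a constant and the levels a geometric sum.
    [shell_sum] is used twice, with exponent 0 for the finest scale and with [a] for the
    discrepancies. *)
Lemma admissible_bound (k a : R) m : 2 < k -> 0 <= a <= 2^-1 -> a < 1 - 2 / k ->
  exists2 C, 0 <= C & forall n L B N (nu : nat -> R) (dl : nat -> nat -> R),
  (0 < n)%N -> 1 <= B ->
  (forall j, (j < N)%N -> 0 <= nu j <= B * 2 `^ (- (k * j%:R))) ->
  (forall l j, (l <= L)%N -> (j < N)%N -> 0 <= dl l j <= 2 * nu j /\
      dl l j ^+ 2 <= (2 ^ (m * l))%:R / n%:R * nu j) ->
  \sum_(j < N) 4 ^+ j * (4 ^- L * nu j + \sum_(l < L.+1) 4 ^- l * dl l j) <=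
   C * B * (4 ^- L + n%:R `^ (- a) * \sum_(l < L.+1) (2 `^ (m%:R * a - 2)) ^+ l).
Proof.
move=> k2 a01 ak; have k0 : 0 < k by apply: lt_trans k2.
have h0 : 0 <= (0:R) <= 2^-1 by rewrite lexx invr_ge0 ler0n.
have hk : 0 < 1 - 2 / k by rewrite subr_gt0 ltr_pdivrMr// mul1r.
have [C0 C00 hC0] := shell_sum k0 h0 hk.
have [Ca Ca0 hCa] := shell_sum k0 a01 ak.
exists (C0 + 2 * Ca); first by pos.
move=> n L B N nu dl n0 B1 hnu hdl.
have B0 : 0 <= B := le_trans ler01 B1.
have n0' : 0 < n%:R :> R by rewrite ltr0n.
have s0 : \sum_(j < N) 4 ^+ j * nu j <= C0 * B.
  rewrite (le_trans _ (hC0 B N nu B1 hnu))//; apply: ler_sum => j _.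
  by rewrite subr0 powRr1//; case/andP: (hnu j (ltn_ord j)).
have sa := hCa B N nu B1 hnu.
have dle l j : (l <= L)%N -> (j < N)%N ->
    dl l j <= 2 * nu j `^ (1 - a) * (n%:R `^ (- a) * 2 `^ (m%:R * l%:R * a)).
  move=> lL jN; have [d1 d2] := hdl l j lL jN.
  have := interpolate a01 d1 _ d2; rewrite divr_ge0// => /(_ isT) h.
  apply: le_trans h _; rewrite powRM ?invr_ge0// natpow_powR -powRrM.
  rewrite powRN (_ : n%:R^-1 `^ a = (n%:R `^ a)^-1); last first.
    by rewrite -[n%:R^-1]powR_inv1 ?ltW// -powRrM mulN1r powRN.
  by rewrite le_eqVlt; apply/orP; left; apply/eqP; ring.
have -> : (C0 + 2 * Ca) * B * (4 ^- L + n%:R `^ (- a) * \sum_(l < L.+1) (2 `^ (m%:R * a - 2)) ^+ l) =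
  C0 * B * 4 ^- L + 2 * (Ca * B) * (n%:R `^ (- a) * \sum_(l < L.+1) (2 `^ (m%:R * a - 2)) ^+ l) +
  (2 * Ca * B * 4 ^- L + C0 * B * (n%:R `^ (- a) * \sum_(l < L.+1) (2 `^ (m%:R * a - 2)) ^+ l)).
  by ring.
have t0 : 0 <= n%:R `^ (- a) * \sum_(l < L.+1) (2 `^ (m%:R * a - 2)) ^+ l.
  by rewrite mulr_ge0 ?powR_ge0 ?sumr_ge0// => l _; rewrite exprn_ge0 ?powR_ge0.
apply: ler_wpDr.
  by pos.
under eq_bigr do rewrite mulrDr.
rewrite big_split/=; apply: lerD.
  apply: (@le_trans _ _ (\sum_(j < N) 4 ^+ j * nu j * 4 ^- L)).
    by apply: ler_sum => j _; rewrite le_eqVlt; apply/orP; left; apply/eqP; ring.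
  by rewrite -mulr_suml ler_wpM2r ?invr_ge0 ?exprn_ge0.
apply: (@le_trans _ _ (\sum_(j < N) (4 ^+ j * nu j `^ (1 - a)) * (2 * (n%:R `^ (- a) *
    \sum_(l < L.+1) (2 `^ (m%:R * a - 2)) ^+ l)))); last first.
  rewrite -mulr_suml (_ : 2 * (Ca * B) * _ = Ca * B * (2 * (n%:R `^ (- a) *
    \sum_(l < L.+1) (2 `^ (m%:R * a - 2)) ^+ l))); last by ring.
  by apply: ler_wpM2r => //; exact: mulr_ge0.
apply: ler_sum => j _; rewrite -mulrA ler_wpM2l ?exprn_ge0// mulrCA 2!mulr_sumr mulr_sumr.
apply: ler_sum => l _.
apply: (@le_trans _ _ (4 ^- l * (2 * nu j `^ (1 - a) * (n%:R `^ (- a) * 2 `^ (m%:R * l%:R * a))))).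
  by rewrite ler_wpM2l ?invr_ge0 ?exprn_ge0// dle// -ltnS.
rewrite le_eqVlt; apply/orP; left; apply/eqP.
rewrite expr_powR// four_expr -powRN.
have -> : (m%:R * a - 2) * l%:R = - (2 * l%:R) + m%:R * l%:R * a by ring.
have -> : 2 `^ (- (2 * l%:R) + m%:R * l%:R * a) = 2 `^ (- (2 * l%:R)) * 2 `^ (m%:R * l%:R * a).
  by rewrite powRD// pnatr_eq0 implybT.
ring.
Qed.



(** What remains is to choose the exponent and the depth [L] of the tree. The depth may depend on n,
    but not on the masses: the same tree has to serve for the laws at all times. *)
Lemma rate_sum (m : nat) (k q : R) : 2 < q < k -> (0 < m)%N ->
  exists2 C, 0 <= C & forall n, (0 < n)%N -> exists L, forall B N (nu : nat -> R) (dl : nat -> nat -> R),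
  1 <= B ->
  (forall j, (j < N)%N -> 0 <= nu j <= B * 2 `^ (- (k * j%:R))) ->
  (forall l j, (l <= L)%N -> (j < N)%N -> 0 <= dl l j <= 2 * nu j /\
      dl l j ^+ 2 <= (2 ^ (m * l))%:R / n%:R * nu j) ->
  \sum_(j < N) 4 ^+ j * (4 ^- L * nu j + \sum_(l < L.+1) 4 ^- l * dl l j) <= C * B * rate n m q.
Proof.
move=> /andP[q2 qk] m0; have k2 : 2 < k by apply: lt_trans qk.
have q0 : 0 < q by apply: lt_trans q2. have k0 : 0 < k by apply: lt_trans k2.
have m0' : 0 < m%:R :> R by rewrite ltr0n.
suff [a [C2 [a01 ak C20 h]]] : exists a C2 : R, [/\ 0 <= a <= 2^-1, a < 1 - 2 / k, 0 <= C2 &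
    forall n, (0 < n)%N -> exists L,
    4 ^- L + n%:R `^ (- a) * \sum_(l < L.+1) (2 `^ (m%:R * a - 2)) ^+ l <= C2 * rate n m q].
  have [C C0 hC] := admissible_bound m k2 a01 ak.
  exists (C * C2); first by pos.
  move=> n n0; have [L hL] := h n n0; exists L => B N nu dl B1 hnu hdl.
  apply: le_trans (hC n L B N nu dl n0 B1 hnu hdl) _.
  rewrite (_ : C * C2 * B * _ = C * B * (C2 * rate n m q)); last by ring.
  by rewrite ler_wpM2l// mulr_ge0//; lra.
have kq : 2 / k < 2 / q by rewrite ltr_pM2l// ltf_pV2.
have q1 : 0 < 2 / q < 1 by rewrite divr_gt0//= ltr_pdivrMr// mul1r.
have eq_q : (q - 2) / q = 1 - 2 / q by rewrite mulrBl divff// gt_eqF.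
(* The largest exponent allowed by both terms of the rate. It lies strictly below 1 - 2/k because q
   < k. *)
pose a := Num.min (2^-1) (1 - 2 / q).
have a01 : 0 <= a <= 2^-1.
  by rewrite le_min ge_min lexx invr_ge0 ler0n/= andbT; lra.
have ak : a < 1 - 2 / k by rewrite gt_min; apply/orP; right; lra.
have n1 n : (0 < n)%N -> 1 <= n%:R :> R by move=> n0; rewrite ler1n.
have powle n (x y : R) : (0 < n)%N -> y <= x -> n%:R `^ (- x) <= n%:R `^ (- y).
  by move=> n0 xy; rewrite ler_powR ?n1// lerN2.
have rate2 n : (0 < n)%N -> n%:R `^ (- (1 - 2 / q)) <= rate n m q.
  move=> n0; rewrite /rate eq_q lerDr.
  case: ifP => _; first exact: powR_ge0.
  case: ifP => _; last exact: powR_ge0.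
  by rewrite mulr_ge0 ?powR_ge0// ln_ge0// lerDl.
have [ma|ma] := ltP (m%:R * a) 2.
  set t := 2 `^ (m%:R * a - 2).
  have t01 : 0 <= t < 1 by rewrite powR_ge0 powR2_lt1// subr_lt0.
  exists a, (1 + (1 - t)^-1); split => //.
    by rewrite addr_ge0// invr_ge0; lra.
  (* With ratio 2^(ma - 2) below 1 the levels sum up for any depth, and n levels make 4^(-L) smaller
     than 1/n. *)
  move=> n n0; exists n.
  have h1 : 4 ^- n <= n%:R `^ (- a).
    have : 4 ^- n <= n%:R^-1 :> R.
      by rewrite lef_pV2 ?posrE ?exprn_gt0 ?ltr0n// -natrX ler_nat ltnW// ltn_expl.
    move/le_trans; apply; rewrite -powR_inv1// powle//; lra.
  have h2 : n%:R `^ (- a) <= rate n m q.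
    have [e|e] := leP (2^-1) (1 - 2 / q); last first.
      by rewrite /a (min_idPr (ltW e)) rate2.
    rewrite /a (min_idPl e) /rate.
    have -> : m%:R / 2 < 2 :> R by move: ma; rewrite /a (min_idPl e); lra.
    by rewrite lerDl powR_ge0.
  rewrite mulrDl mul1r; apply: lerD; first exact: le_trans h2.
  apply: (@le_trans _ _ (n%:R `^ (- a) * (1 - t)^-1)).
    by rewrite ler_wpM2l ?powR_ge0// geo_sum_le.
  by rewrite mulrC ler_wpM2l// invr_ge0; lra.
have m4 : 4 <= m%:R :> R.
  rewrite (le_trans _ (_ : 2 / a <= _))//; last first.
    rewrite ler_pdivrMr// lt0r; case/andP: a01 => ->; rewrite andbT => _.
    by apply: contraTneq ma => ->; rewrite mulr0 -ltNge.
  rewrite ler_pdivlMr; first by case/andP: a01; lra.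
  rewrite lt0r; case/andP: a01 => ->; rewrite andbT => _.
  by apply: contraTneq ma => ->; rewrite mulr0 -ltNge.
have [m4'|m4'] := eqVneq (m%:R : R) 4.
  have a12 : a = 2^-1 by move: ma; rewrite m4'; case/andP: a01; lra.
  have ln2 : 0 < ln 2 :> R by rewrite ln_gt0// ltr1n.
  exists a, (4 / ln 2); split => //; first by rewrite divr_ge0// ltW.
  (* Critical dimension: the ratio is 1, so every level contributes equally and the number of levels
     produces the logarithm. The 4 in the constant absorbs the three additive units of [T.+3], each
     at most ln(1 + n) / ln 2. *)
  move=> n n0; exists (trunc_log 2 n).+1.
  have /andP[l1 l2] := trunc_log_bounds (isT : (1 < 2)%N) n0.
  set T := trunc_log 2 n in l1 l2 *.
  rewrite m4' a12 (_ : 4 * 2^-1 - 2 = 0 :> R) ?powRr0; last by field.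
  rewrite (eq_bigr (fun=> 1)) => [|l _]; last by rewrite expr1n.
  rewrite sumr_const card_ord.
  have lnn : T%:R * ln 2 <= ln (1 + n%:R) :> R.
    rewrite mulr_natl -lnXn// ler_ln ?posrE ?exprn_gt0 ?ltr_wpDr//.
    by rewrite -natrX (le_trans (_ : _ <= n%:R)) ?ler_nat ?lerDr.
  have lnn2 : ln 2 <= ln (1 + n%:R) :> R.
    by rewrite ler_ln ?posrE ?ltr_wpDr// -[2]/(1 + 1) lerD2l n1.
  have h1 : 4 ^- T.+1 <= n%:R `^ (- 2^-1) :> R.
    have : 4 ^- T.+1 <= n%:R^-1 :> R.
      rewrite lef_pV2 ?posrE ?exprn_gt0 ?ltr0n// -natrX ler_nat (leq_trans (ltnW l2))//.
      by rewrite leq_exp2r.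
    move/le_trans; apply; rewrite -powR_inv1// powle//; lra.
  rewrite /rate m4'.
  have -> : (4 / 2 < 2 :> R) = false by apply/negbTE; rewrite -leNgt; lra.
  have -> : (4 / 2 == 2 :> R) by apply/eqP; lra.
  apply: (@le_trans _ _ (4 / ln 2 * (n%:R `^ (- 2^-1) * ln (1 + n%:R)))); last first.
    by rewrite ler_wpM2l ?divr_ge0 ?(ltW ln2)// lerDl powR_ge0.
  apply: (@le_trans _ _ (n%:R `^ (- 2^-1) * T.+3%:R)).
    have -> : T.+3%:R = T.+2%:R + 1 :> R by rewrite natr1.
    by move: h1; move: (T.+2%:R) (n%:R `^ _) => x y; lra.
  rewrite mulrCA ler_wpM2l ?powR_ge0//.
  rewrite mulrAC ler_pdivlMr// -(addn3 T) natrD mulrDl.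
  by rewrite -[X in _ <= X](_ : ln (1 + n%:R) + 3 * ln (1 + n%:R) = _); [lra|ring].
have m4'' : 4 < m%:R :> R by rewrite lt_neqAle eq_sym m4'.
(* Now the levels grow. An exponent strictly above 2/m makes the sum comparable with its last term,
   and the midpoint of 1 - 2/q and 1 - 2/k leaves room for that below 1 - 2/k. *)
pose b := Num.min (2^-1) ((1 - 2 / q + (1 - 2 / k)) / 2).
have b01 : 0 <= b <= 2^-1.
  by rewrite le_min ge_min lexx invr_ge0 ler0n/= andbT; lra.
have bk : b < 1 - 2 / k by rewrite gt_min; apply/orP; right; lra.
have mb : 2 / m%:R < b.
  rewrite lt_min; apply/andP; split.
    by rewrite ltr_pdivrMr//; lra.
  have : 2 / m%:R <= 1 - 2 / q.
    by rewrite ler_pdivrMr// mulrC (le_trans ma)// ler_wpM2l ?(ltW m0')// ge_min lexx orbT.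
  by lra.
have mb2 : 2 < m%:R * b by move: mb; rewrite ltr_pdivrMr// mulrC.
set t := 2 `^ (m%:R * b - 2).
have t1 : 1 < t.
  rewrite -[ltRHS]invrK -powRN invf_gt1 ?powR_gt0// ?powR2_lt1//; lra.
have mb3 : 0 <= b - 2 / m%:R by lra.
pose D : R := t / (t - 1) * (2 ^ m)%:R `^ (b - 2 / m%:R).
have D0 : 0 <= D by rewrite /D mulr_ge0 ?powR_ge0// divr_ge0//; lra.
exists b, (1 + D); split => //; first by pos.
move=> n n0; have p1 : (1 < 2 ^ m)%N by rewrite -{1}(expn0 2) ltn_exp2l.
(* At this depth 2^(mL) is n up to a factor 2^m. Hence 4^(-L) and n^(-b) 2^((mb - 2)L) are both of
   order n^(-2/m). *)
exists (trunc_log (2 ^ m) n).+1.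
have /andP[l1 l2] := trunc_log_bounds p1 n0.
set T := trunc_log (2 ^ m) n in l1 l2 *.
have e1 : n%:R `^ (- (2 / m%:R)) <= rate n m q.
  rewrite /rate.
  have -> : (m%:R / 2 < 2 :> R) = false by apply/negbTE; rewrite -leNgt; lra.
  have -> : (m%:R / 2 == 2 :> R) = false by apply/negbTE; rewrite gt_eqF//; lra.
  by rewrite lerDl powR_ge0.
have e2 : (2 ^ m)%:R = 2 `^ m%:R :> R by rewrite natrX powR_mulrn.
have l2' : n%:R <= 2 `^ (m%:R * T.+1%:R) :> R by rewrite powRrM -e2 powR_mulrn// -natrX ler_nat ltnW.
have l3' : 2 `^ (m%:R * T.+1%:R) <= (2 ^ m)%:R * n%:R :> R.
  by rewrite powRrM -e2 powR_mulrn// -natrX -natrM ler_nat expnS leq_mul.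
rewrite mulrDl mul1r; apply: lerD.
  apply: le_trans e1.
  rewrite four_expr -powRN.
  have -> : - (2 * T.+1%:R) = m%:R * T.+1%:R * - (2 / m%:R) :> R by field; rewrite gt_eqF.
  rewrite powRrM !powRN lef_pV2 ?posrE ?powR_gt0 ?ltr0n//.
  by rewrite ge0_ler_powR ?nnegrE ?powR_ge0 ?divr_ge0.
apply: (@le_trans _ _ (n%:R `^ (- b) * (t / (t - 1) * t ^+ T.+1))).
  by rewrite ler_wpM2l ?powR_ge0// geo_sum_ge1.
have -> : t ^+ T.+1 = (2 `^ (m%:R * T.+1%:R)) `^ (b - 2 / m%:R).
  by rewrite expr_powR// -powRrM; congr (_ `^ _); field; rewrite gt_eqF.
apply: (@le_trans _ _ (n%:R `^ (- b) * (t / (t - 1) * ((2 ^ m)%:R * n%:R) `^ (b - 2 / m%:R)))).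
  rewrite ler_wpM2l ?powR_ge0// ler_wpM2l//; first by rewrite divr_ge0//; lra.
  by rewrite ge0_ler_powR ?nnegrE ?powR_ge0 ?mulr_ge0.
rewrite powRM// (_ : _ * _ = D * (n%:R `^ (- b) * n%:R `^ (b - 2 / m%:R))); last by rewrite /D; ring.
rewrite -powRD; last by rewrite pnatr_eq0 -lt0n n0 implybT.
by rewrite addrA addNr add0r ler_wpM2l.
Qed.

End RateBound.

(** * From weights on cells to couplings of measures *)

Section Mixtures.
Context {R : realType} {d0 : measure_display} {X : measurableType d0}.

Lemma mixture_exists (I : finType) (c : I -> R) (mu : I -> measure X R) :
  (forall i, 0 <= c i) -> (\sum_i (c i)%:E * mu i setT = 1)%E ->
  exists pi : probability X R,
    (forall A, pi A = \sum_i (c i)%:E * mu i A)%E /\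
    (forall f : X -> \bar R, (forall x, 0 <= f x)%E -> measurable_fun setT f ->
      (\int[pi]_x f x = \sum_i (c i)%:E * \int[mu i]_x f x)%E).
Proof.
move=> c0 tot.
have [i0 _|I0] := pickP (@predT I); last first.
  by move: tot; rewrite big1 => [/eqP|i]; [rewrite eq_sym onee_eq0|have := I0 i].
pose m k : measure X R := mscale (NngNum (c0 (nth i0 (enum I) k))) (mu (nth i0 (enum I) k)).
have sumE (F : I -> \bar R) : (\sum_(k < #|I|) F (nth i0 (enum I) k) = \sum_i F i)%E.
  by rewrite -[RHS]big_enum (big_nth i0)/= big_mkord -cardE.
have E A : msum m #|I| A = (\sum_i (c i)%:E * mu i A)%E.
  by rewrite /msum -(sumE (fun i => (c i)%:E * mu i A)%E).
have T1 : msum m #|I| setT = 1%E by rewrite E.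
pose pi : probability X R := HB.pack (msum m #|I|) (Measure_isProbability.Build _ _ _ (msum m #|I|) T1).
exists pi; split => [A|f f0 mf]; first exact: E.
rewrite (@ge0_integral_measure_sum _ _ _ m setT)//.
rewrite -(sumE (fun i => (c i)%:E * \int[mu i]_x f x)%E); apply: eq_bigr => k _.
by rewrite ge0_integral_mscale.
Qed.


Lemma fiber_sum (K : finType) (kap : X -> K) (mu : measure X R) (A : set X) :
  (forall a, measurable (kap @^-1` [set a])) -> measurable A ->
  (mu A = \sum_a mu (A `&` kap @^-1` [set a]))%E.
Proof.
move=> mk mA.
have mAk a : measurable (A `&` kap @^-1` [set a]) by exact: measurableI.
rewrite -[A in LHS]setIT -integral_indic//.
rewrite (eq_integral (fun x => \sum_(a <- index_enum K) (\1_(A `&` kap @^-1` [set a]) x)%:E)%E); last first.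
  move=> x _; rewrite sumEFin; congr _%:E.
  rewrite (bigD1 (kap x))//= big1 => [|a ax].
    have e : x \in kap @^-1` [set kap x] by apply/mem_set.
    by rewrite addr0 !indicE in_setI e andbT.
  have e : (x \in kap @^-1` [set a]) = false.
    by apply/negP => /set_mem /= e; rewrite e eqxx in ax.
  by rewrite indicE in_setI e andbF.
rewrite ge0_integral_sum//=; last first.
  by move=> a; apply/measurable_EFinP; exact: measurable_indic.
by apply: eq_bigr => a _; rewrite integral_indic// setIT.
Qed.

End Mixtures.

Section MeasureTreeCoupling.
Context {R : realType} {d0 : measure_display} {V : measurableType d0}.

(** The finite coupling [w] of the cell masses is spread over the space by the density
    [w a b / (p a * r b)] with respect to the product measure on each product of cells, so the two
    points are conditionally independent given their cells. Cells of mass zero carry no weight,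
    which makes division by zero harmless. *)
Lemma measure_tree_coupling (K : finType) (A : eqType) (kap : V -> K) (h : nat -> K -> A) n
    (mu nu : probability V R) :
  (forall a, measurable (kap @^-1` [set a])) ->
  (forall i a b, h i a = h i b -> h i.+1 a = h i.+1 b) ->
  (forall a b, h n a = h n b) ->
  exists pi : probability (V * V)%type R,
    (forall B, measurable B -> pi (B `*` setT) = mu B /\ pi (setT `*` B) = nu B) /\
    (forall i v, (i <= n)%N -> let Q := [set x | h i (kap x) = v] in
       fine (pi (Q `*` Q)) = Num.min (fine (mu Q)) (fine (nu Q))).
Proof.
move=> mk nested top.
pose Q a := kap @^-1` [set a].
pose p a := fine (mu (Q a)); pose r a := fine (nu (Q a)).
have muE B : measurable B -> (fine (mu B))%:E = mu B by move=> mB; rewrite fineK// fin_num_measure.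
have nuE B : measurable B -> (fine (nu B))%:E = nu B by move=> mB; rewrite fineK// fin_num_measure.
have p0 a : 0 <= p a by apply: fine_ge0; exact: measure_ge0.
have r0 a : 0 <= r a by apply: fine_ge0; exact: measure_ge0.
have fsum (la : probability V R) B : measurable B -> fine (la B) = \sum_a fine (la (B `&` Q a)).
  move=> mB; rewrite (fiber_sum la mk mB).
  rewrite (eq_bigr (fun a => (fine (la (B `&` Q a)))%:E)); first by rewrite sumEFin.
  by move=> a _; rewrite fineK// fin_num_measure//; apply: measurableI => //; exact: mk.
have tot (la : probability V R) : \sum_a fine (la (Q a)) = 1.
  have := fsum la setT measurableT; rewrite probability_setT/= => ->.
  by apply: eq_bigr => a _; rewrite setTI.
have pr : \sum_a p a = \sum_a r a by rewrite /p /r !tot.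
have [w [w0 row col wb]] := tree_coupling p0 r0 pr nested top.
pose c (ab : K * K) : R := w ab.1 ab.2 / (p ab.1 * r ab.2).
have c0 ab : 0 <= c ab by rewrite divr_ge0// mulr_ge0.
have wp a b : p a = 0 -> w a b = 0.
  move=> pa; apply/le_anti; rewrite w0 andbT -pa -(row a) (bigD1 b)//= lerDl.
  by apply: sumr_ge0.
have wr a b : r b = 0 -> w a b = 0.
  move=> pa; apply/le_anti; rewrite w0 andbT -pa -(col b) (bigD1 a)//= lerDl.
  by apply: sumr_ge0.
have cE a b : c (a, b) * (p a * r b) = w a b.
  rewrite /c/=; have [pa|pa] := eqVneq (p a) 0; first by rewrite pa mul0r mulr0 wp.
  have [ra|ra] := eqVneq (r b) 0; first by rewrite ra mulr0 mulr0 wr.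
  by rewrite divfK// mulf_neq0.
have cp a b : c (a, b) * r b * p a = w a b by rewrite -cE; ring.
have mQQ ab : measurable (Q ab.1 `*` Q ab.2) by apply: measurableX; exact: mk.
pose m (ab : K * K) : measure (V * V)%type R := mrestr (mu \x nu)%E (mQQ ab).
have mrect ab B C : measurable B -> measurable C ->
    ((c ab)%:E * m ab (B `*` C) = (c ab * (fine (mu (B `&` Q ab.1)) * fine (nu (C `&` Q ab.2))))%:E)%E.
  move=> mB mC; rewrite /m /= /mrestr -setXI product_measure1E; try by apply: measurableI => //; exact: mk.
  rewrite [RHS]EFinM; congr (_ * _)%E; rewrite [RHS]EFinM muE; last by apply: measurableI => //; exact: mk.
  by rewrite nuE//; apply: measurableI => //; exact: mk.
have summ B C : measurable B -> measurable C ->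
    (\sum_ab (c ab)%:E * m ab (B `*` C) =
     (\sum_a \sum_b c (a, b) * (fine (mu (B `&` Q a)) * fine (nu (C `&` Q b))))%:E)%E.
  move=> mB mC; rewrite (eq_bigr (fun ab => (c ab * (fine (mu (B `&` Q ab.1)) * fine (nu (C `&` Q ab.2))))%:E)).
    by rewrite sumEFin pair_bigA/=; congr _%:E; apply: eq_bigr => -[].
  by move=> ab _; exact: mrect.
have massT : (\sum_ab (c ab)%:E * m ab setT = 1)%E.
  rewrite -setXTT summ//; congr _%:E; rewrite -[RHS](tot mu); apply: eq_bigr => a _.
  by rewrite -/(p a) -(row a); apply: eq_bigr => b _; rewrite !setTI cE.
have [pi [piA _]] := mixture_exists c0 massT.
have le_mu a B : measurable B -> p a = 0 -> fine (mu (B `&` Q a)) = 0.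
  move=> mB pa; apply/le_anti/andP; split; last by apply: fine_ge0; exact: measure_ge0.
  rewrite -pa; apply: fine_le; rewrite ?fin_num_measure//; try by apply: measurableI => //; exact: mk.
    exact: mk.
  apply: le_measure; rewrite ?inE//; last exact: mk.
  by apply: measurableI => //; exact: mk.
have le_nu a B : measurable B -> r a = 0 -> fine (nu (B `&` Q a)) = 0.
  move=> mB pa; apply/le_anti/andP; split; last by apply: fine_ge0; exact: measure_ge0.
  rewrite -pa; apply: fine_le; rewrite ?fin_num_measure//; try by apply: measurableI => //; exact: mk.
    exact: mk.
  apply: le_measure; rewrite ?inE//; last exact: mk.
  by apply: measurableI => //; exact: mk.
exists pi; split => [B mB|i v i_n Qv].
- rewrite !piA !summ// -muE// -nuE//; split; congr _%:E.
    rewrite (fsum mu)//; apply: eq_bigr => a _.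
    have [pa|pa] := eqVneq (p a) 0.
      by rewrite le_mu// big1// => b _; rewrite mul0r mulr0.
    transitivity ((fine (mu (B `&` Q a)) / p a) * \sum_b w a b); last by rewrite row divfK.
    rewrite mulr_sumr; apply: eq_bigr => b _.
    by rewrite setTI -/(r b) -cE; move: (fine _) => y; field.
  rewrite (fsum nu)// exchange_big/=; apply: eq_bigr => b _.
  have [rb|rb] := eqVneq (r b) 0.
    by rewrite le_nu// big1// => a _; rewrite mulr0 mulr0.
  transitivity ((fine (nu (B `&` Q b)) / r b) * \sum_a w a b); last by rewrite col divfK.
  rewrite mulr_sumr; apply: eq_bigr => a _.
  by rewrite setTI -/(p a) -cE; move: (fine (nu _)) => y; field.
- have mQv : measurable Qv.
    rewrite (_ : Qv = \bigcup_(a in [set a | h i a = v]) Q a); last first.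
      apply/seteqP; split => [x xv|x [a ha xa]]; first by exists (kap x).
      by rewrite /Qv/= xa.
    by apply: fin_bigcup_measurable => // a _; exact: mk.
  have QvI a : Qv `&` Q a = if h i a == v then Q a else set0.
    case: ifPn => [/eqP hav|/eqP hav]; apply/seteqP; split => x //=.
    - by case.
    - by move=> xa; split => //; rewrite /Qv/= xa.
    - by move=> [xv xa]; apply: hav; rewrite -xa.
  have massv (la : probability V R) : fine (la Qv) = \sum_(a | h i a == v) fine (la (Q a)).
    rewrite fsum// [RHS]big_mkcond/=; apply: eq_bigr => a _; rewrite QvI.
    by case: ifP => // _; rewrite measure0.
  rewrite piA summ// !massv -wb//=.
  rewrite [RHS]big_mkcond/=; apply: eq_bigr => a _; rewrite QvI.
  case: ifPn => _; last by rewrite big1// => b _; rewrite measure0/= mul0r mulr0.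
  rewrite [RHS]big_mkcond/=; apply: eq_bigr => b _; rewrite QvI.
  by case: ifPn => _; [exact: cE|rewrite measure0/= !mulr0].
Qed.

End MeasureTreeCoupling.

(** * Wasserstein distances through quadratic costs *)

Section LpComparison.
Context {R : realType} {d0 : measure_display} {X : measurableType d0} (P : probability X R).

(** As a function of x^2 the left side is concave, since p/2 <= 1; the right side is its tangent at
    x = c. Young's inequality with exponents 2/p and 2/(2 - p) gives it for p < 2. *)
Lemma powR_le_tangent (p c x : R) : 1 <= p <= 2 -> 0 < c -> 0 <= x ->
  x `^ p <= c `^ p * (p / 2 * (x / c) ^+ 2 + (1 - p / 2)).
Proof.
move=> /andP[p1 p2] c0 x0; have p0 : 0 < p by apply: lt_le_trans p1.
set y := x / c; have y0 : 0 <= y by rewrite divr_ge0// ltW.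
have -> : x = c * y by rewrite /y mulrC divfK// gt_eqF.
rewrite powRM ?(ltW c0)// ler_wpM2l ?powR_ge0//.
have [->|pn2] := eqVneq p 2; first by rewrite powR_mulrn// divff// mul1r subrr addr0.
have p2' : p < 2 by rewrite lt_neqAle pn2.
have h := @conjugate_powR R (y `^ p) 1 (2 / p) (2 / (2 - p)) (powR_ge0 _ _) ler01.
have h1 : 0 < 2 / p by rewrite divr_gt0.
have h2 : 0 < 2 / (2 - p) by rewrite divr_gt0// subr_gt0.
have h3 : (2 / p)^-1 + (2 / (2 - p))^-1 = 1 by rewrite !invf_div -mulrDl addrC subrK divff.
move: (h h1 h2 h3); rewrite mulr1 powR1 -powRrM mulrCA divff ?gt_eqF// mulr1 powR_mulrn//.
move/le_trans; apply; rewrite !invf_div mul1r mulrC lerD2l mulrBl divff//.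
Qed.

(** Integrating the tangent bound at c^2 = D gives Jensen's inequality. The tangent needs c > 0, so
    for D = 0 every positive c is used instead. *)
Lemma Lp_le_L2 (p D : R) (f : X -> R) : 1 <= p <= 2 -> 0 <= D -> measurable_fun setT f ->
  (forall x, 0 <= f x) -> (\int[P]_x (f x ^+ 2)%:E <= D%:E)%E ->
  ((\int[P]_x (f x `^ p)%:E) `^ p^-1 <= (Num.sqrt D)%:E)%E.
Proof.
move=> p12 D0 mf f0 hD; have p0 : 0 < p by case/andP: p12; lra.
have key c : 0 < c -> D <= c ^+ 2 -> ((\int[P]_x (f x `^ p)%:E) `^ p^-1 <= c%:E)%E.
  move=> c0 Dc.
  have ple : (\int[P]_x (f x `^ p)%:E <= (c `^ p)%:E)%E.
    apply: (@le_trans _ _ (\int[P]_x ((c `^ p * (1 - p / 2))%:E + (c `^ p * (p / 2 / c ^+ 2))%:E * (f x ^+ 2)%:E))%E).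
      apply: le_integral_nonmeas => x; first by rewrite lee_fin powR_ge0.
      rewrite -EFinM -EFinD lee_fin (le_trans (powR_le_tangent p12 c0 (f0 x)))//.
      by rewrite expr_div_n le_eqVlt; apply/orP; left; apply/eqP; ring.
    have c10 : 0 <= c `^ p * (1 - p / 2).
      by rewrite mulr_ge0 ?powR_ge0// subr_ge0 ler_pdivrMr// mul1r; case/andP: p12.
    have c20 : 0 <= c `^ p * (p / 2 / c ^+ 2) by rewrite mulr_ge0 ?powR_ge0// !divr_ge0// ?sqr_ge0// ltW.
    rewrite ge0_integralD//=; last 2 first.
      by move=> x _; rewrite mule_ge0// lee_fin sqr_ge0.
      by apply: emeasurable_funM; [exact: measurable_cst|exact: measurable_sqE].
    rewrite integral_cst//= probability_setT mule1 ge0_integralZl//=; last 2 first.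
      exact: measurable_sqE.
      by move=> x _; rewrite lee_fin sqr_ge0.
    apply: (@le_trans _ _ ((c `^ p * (1 - p / 2))%:E + (c `^ p * (p / 2 / c ^+ 2))%:E * (c ^+ 2)%:E)%E).
      by rewrite leeD2l// lee_wpmul2l// (le_trans hD).
    rewrite -EFinM -EFinD lee_fin le_eqVlt; apply/orP; left; apply/eqP; field.
    by rewrite gt_eqF.
  apply: (@le_trans _ _ ((c `^ p)%:E `^ p^-1)%E).
    rewrite gt0_ler_poweR ?invr_ge0 ?(ltW p0)//= in_itv/= ?leey ?andbT.
      by apply: integral_ge0 => x _; rewrite lee_fin powR_ge0.
    by rewrite lee_fin powR_ge0.
  by rewrite poweR_EFin -powRrM divff ?gt_eqF// powRr1// ltW.
have [D00|D00] := eqVneq D 0.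
  rewrite D00 sqrtr0; apply/lee_addgt0Pr => e e0; rewrite add0e; apply: key => //.
  by rewrite D00 sqr_ge0.
by apply: key; rewrite ?sqr_sqrtr// sqrtr_gt0 lt0r D00.
Qed.

End LpComparison.

Section WassersteinBounds.
Context {R : realType} {m : nat}.
Local Notation V := 'rV[R]_m.

Lemma measurable_dist : measurable_fun setT (fun xy : V * V => enorm (xy.1 - xy.2)).
Proof.
apply: measurableT_comp; first exact: measurable_enorm.
apply: measurable_fun_mx => // i j.
under eq_fun do rewrite !mxE.
apply: measurable_funB.
  by apply: (measurableT_comp (measurable_coord i j)); exact: measurable_fst.
by apply: (measurableT_comp (measurable_coord i j)); exact: measurable_snd.
Qed.

(** Since p <= 2, every coupling bounds the distance through its quadratic cost; all later couplings
    are evaluated with that cost. *)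
Lemma wasserstein_le (p D : R) (mu nu : probability V R) (pi : probability (V * V)%type R) :
  1 <= p <= 2 -> 0 <= D -> coupling mu nu pi ->
  (\int[pi]_xy (enorm (xy.1 - xy.2) ^+ 2)%:E <= D%:E)%E ->
  (wasserstein p mu nu <= (Num.sqrt D)%:E)%E.
Proof.
move=> p12 D0 cpl hD; apply: ereal_inf_le; eexists; first by exists pi.
by apply: Lp_le_L2 => //; [exact: measurable_dist|move=> xy; exact: enorm_ge0].
Qed.

(** The coupling is uniform on the pairs of points with the same index. *)
Lemma wasserstein_empirical (p : R) n (x y : 'I_n.+1 -> V) : 1 <= p <= 2 ->
  (wasserstein p (empirical x) (empirical y) <=
   (Num.sqrt (n.+1%:R^-1 * \sum_i enorm (x i - y i) ^+ 2))%:E)%E.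
Proof.
move=> p12.
pose mu (i : 'I_n.+1) : measure (V * V)%type R := \d_(x i, y i).
have [||pi [piA piI]] := @mixture_exists R _ (V * V)%type 'I_n.+1 (fun=> n.+1%:R^-1) mu.
- by move=> _; rewrite invr_ge0.
- under eq_bigr do rewrite /mu /= diracT mule1.
  by rewrite sumEFin sumr_const card_ord -[_ *+ _]mulr_natr mulVf.
have empE0 (z : 'I_n.+1 -> V) A : empirical z A = (\sum_i (n.+1%:R^-1)%:E * \d_(z i) A)%E.
  rewrite /empirical/mscale/=/msum ge0_sume_distrr//=.
  by apply: eq_bigr => i _; rewrite inord_val.
have empE (z : 'I_n.+1 -> V) A : (empirical z : probability V R) A =
  (\sum_i (n.+1%:R^-1)%:E * \d_(z i) A)%E by exact: empE0.
apply: (@wasserstein_le _ _ _ _ pi) => //.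
- by rewrite mulr_ge0 ?invr_ge0// sumr_ge0// => i _; exact: sqr_ge0.
- move=> A mA; rewrite !piA !empE; split; apply: eq_bigr => i _; congr (_ * _)%E.
    rewrite /mu /= !diracE; congr ((nat_of_bool _)%:R%:E)%R.
    by apply/idP/idP => /set_mem h; apply/mem_set => //; case: h.
  rewrite /mu /= !diracE; congr ((nat_of_bool _)%:R%:E)%R.
  by apply/idP/idP => /set_mem h; apply/mem_set => //; case: h.
- rewrite piI; last 2 first.
    by move=> ?; rewrite lee_fin sqr_ge0.
    by apply: measurable_sqE; exact: measurable_dist.
  rewrite mulr_sumr -sumEFin; apply: lee_sum => i _.
  rewrite integral_dirac//=; last by apply: measurable_sqE; exact: measurable_dist.
  by rewrite diracT mul1e.
Qed.

Lemma wasserstein_law (p D : R) (d0 : measure_display) (X : measurableType d0)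
    (P : probability X R) (Y Z : {RV P >-> V}) : 1 <= p <= 2 -> 0 <= D ->
  (\int[P]_w (enorm (Y w - Z w) ^+ 2)%:E <= D%:E)%E ->
  (wasserstein p (distribution P Y) (distribution P Z) <= (Num.sqrt D)%:E)%E.
Proof.
move=> p12 D0 hD.
have mYZ : measurable_fun setT (fun w => (Y w, Z w)) by apply: measurable_fun_pair.
pose YZ : {RV P >-> (V * V)%type} := HB.pack (fun w => (Y w, Z w)) (isMeasurableFun.Build _ _ _ _ _ mYZ).
apply: (@wasserstein_le _ _ _ _ (distribution P YZ)) => //.
- by move=> A mA; split; rewrite /distribution /pushforward/=; congr (P _); apply/seteqP; split => w //= -[].
- rewrite (ge0_integral_distribution YZ (measurable_sqE measurable_dist))//.
  by move=> z; rewrite lee_fin sqr_ge0.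
Qed.

End WassersteinBounds.

(** * Dyadic shells and dyadic cells *)

Section Cells.
Context {R : realType} {m : nat} (N L : nat).
Local Notation V := 'rV[R]_m.
Let b := (2 ^ L)%N.
Let b0 : (0 < b)%N. Proof. by rewrite expn_gt0. Qed.

Definition supn (x : V) : R := \big[Num.max/0]_(e < m) `|x 0 e|.

(** [find] returns [N] if no radius 2^i with i < N fits, so shell [N] is the unbounded rest. *)
Definition shell (x : V) : nat := find (fun i => supn x <= 2 ^+ i) (iota 0 N).

(** In a shell j < N the shifted coordinate lies in the closed interval [0, 2^(j+1)]. Dividing by
    2^(j+2) leaves a factor 2 to spare, so that the upper face also has an index below 2^L. The
    remainder changes the index only in the unbounded shell. *)
Definition cell_coord (x : V) (e : 'I_m) : 'I_b :=
  Ordinal (ltn_pmod (Num.truncn ((x 0 e + 2 ^+ shell x) / 2 ^+ (shell x).+2 * 2 ^+ L)) b0).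

Definition cell (x : V) : 'I_N.+1 * {ffun 'I_m -> 'I_b} :=
  (inord (shell x), [ffun e => cell_coord x e]).

(* [coarsen 0] is the finest level; at level [i <= L] a cell of the shell of
   radius 2^j has side 2^(j + 2 + i - L); level L + 1 is the whole space. *)
Definition coarsen (i : nat) (c : 'I_N.+1 * {ffun 'I_m -> 'I_b}) : 'I_N.+1 * {ffun 'I_m -> nat} :=
  if (i <= L)%N then (c.1, [ffun e => (c.2 e %/ 2 ^ i)%N]) else (ord0, [ffun=> 0%N]).

Lemma coarsen_nested i a c : coarsen i a = coarsen i c -> coarsen i.+1 a = coarsen i.+1 c.
Proof.
rewrite /coarsen; case: (leqP i.+1 L) => // iL; rewrite (ltnW iL) => -[-> h].
congr (_, _); apply/ffunP => e; rewrite !ffunE expnSr !divnMA.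
by move/ffunP/(_ e) : h; rewrite !ffunE => ->.
Qed.

Lemma coarsen_top a c : coarsen L.+1 a = coarsen L.+1 c.
Proof. by rewrite /coarsen ltnn. Qed.

Lemma supn_ge0 x : 0 <= supn x.
Proof. by rewrite /supn; elim/big_ind: _ => // a c a0 c0; rewrite le_max a0. Qed.

Lemma coord_le_supn (x : V) e : `|x 0 e| <= supn x.
Proof. by rewrite /supn (bigD1 e)//= le_max lexx. Qed.

Lemma supn_le_enorm x : supn x <= enorm x.
Proof.
rewrite /supn; elim/big_ind: _ => [|a c ha hc|e _]; first exact: enorm_ge0.
  by rewrite ge_max ha.
exact: coord_le_enorm.
Qed.

Lemma shell_le x : (shell x <= N)%N.
Proof. by rewrite -[leqRHS](size_iota 0) find_size. Qed.

Lemma shell_supn x : (shell x < N)%N -> supn x <= 2 ^+ shell x.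
Proof.
move=> jN; have : has (fun i => supn x <= 2 ^+ i) (iota 0 N) by rewrite has_find size_iota.
by move/(nth_find 0%N); rewrite nth_iota// add0n.
Qed.

Lemma supn_shell x i : (i < shell x)%N -> 2 ^+ i < supn x.
Proof.
move=> ix; have iN : (i < N)%N by rewrite (leq_trans ix (shell_le x)).
by have := before_find 0%N ix; rewrite nth_iota// add0n => /negbT; rewrite -ltNge.
Qed.

Lemma shellP x j : (shell x == j) = (j <= N)%N && (((j < N)%N ==> (supn x <= 2 ^+ j)) &&
  [forall i : 'I_N, (i < j)%N ==> (2 ^+ i < supn x)]).
Proof.
apply/eqP/andP => [<-|[jN /andP[h /forallP g]]].
  split; first exact: shell_le.
  apply/andP; split; first by apply/implyP; exact: shell_supn.
  by apply/forallP => i; apply/implyP; exact: supn_shell.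
apply/eqP; rewrite eqn_leq; apply/andP; split.
  rewrite leqNgt; apply/negP => js.
  have jN' : (j < N)%N by rewrite (leq_trans js (shell_le x)).
  by have := supn_shell js; rewrite ltNge (implyP h jN').
rewrite leqNgt; apply/negP => sj.
have sN : (shell x < N)%N by rewrite (leq_trans sj).
by have := implyP (g (Ordinal sN)) sj; rewrite ltNge shell_supn.
Qed.

Lemma cell_shell x : ((cell x).1 : nat) = shell x.
Proof. by rewrite /= inordK// ltnS shell_le. Qed.

(** Both points lie in a cube of side 2^(j+2+i-L), where j is their shell; the 16 is the square of
    the 2^2 in that side and m the number of coordinates. *)
Lemma same_cell_dist x y i : (shell x < N)%N -> (i <= L)%N ->
  coarsen i (cell x) = coarsen i (cell y) ->
  enorm (x - y) ^+ 2 <= 16 * m%:R * 4 ^+ shell x * (4 ^+ i / 4 ^+ L).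
Proof.
move=> sN iL; rewrite /coarsen iL => -[/(congr1 val)].
rewrite /= !inordK ?ltnS ?shell_le// => sxy /ffunP h.
set j := shell x in sN sxy *.
have two0 n : 0 < 2 ^+ n :> R by rewrite exprn_gt0.
pose X (z : V) e := (z 0 e + 2 ^+ j) / 2 ^+ j.+2 * 2 ^+ L.
have Xb (z : V) e : shell z = j -> 0 <= X z e /\ (Num.truncn (X z e) < b)%N.
  move=> zj; have : `|z 0 e| <= 2 ^+ j by rewrite (le_trans (coord_le_supn z e))// -zj shell_supn// zj.
  rewrite ler_norml => /andP[h1 h2].
  have X0 : 0 <= X z e.
    apply: mulr_ge0; last exact: ltW.
    apply: divr_ge0; last exact: ltW.
    lra.
  split => //; rewrite -(@ltr_nat R); apply: le_lt_trans (_ : X z e < _).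
    by have := truncn_itv X0; case/andP.
  rewrite /X /b natrX gtr_pMl// ltr_pdivrMr// mul1r 2!exprS; have := two0 j; lra.
have q e : (Num.truncn (X x e) %/ 2 ^ i)%N = (Num.truncn (X y e) %/ 2 ^ i)%N.
  have := h e; rewrite !ffunE /= -/j -sxy -/(X x e) -/(X y e) !modn_small//.
    by have [] := Xb y e (esym sxy).
  by have [] := Xb x e erefl.
have Xd e : `|X x e - X y e| <= 2 ^+ i.
  have blk z : 0 <= X z e -> (Num.truncn (X z e) %/ 2 ^ i)%:R * 2 ^+ i <= X z e <
      (Num.truncn (X z e) %/ 2 ^ i)%:R * 2 ^+ i + 2 ^+ i.
    move=> /truncn_itv /andP[h1 h2]; apply/andP; split.
      by apply: le_trans h1; rewrite -natrX -natrM ler_nat leq_trunc_div.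
    apply: (lt_le_trans h2); rewrite -natrX -natrM -natrD ler_nat addnC -mulSn.
    by rewrite -ltn_divLR ?expn_gt0.
  have [Xx _] := Xb x e erefl; have [Xy _] := Xb y e (esym sxy).
  have /andP[a1 a2] := blk x Xx; have := blk y Xy; rewrite -q => /andP[a3 a4].
  by rewrite ler_norml; apply/andP; split; lra.
have d0 : 0 <= 2 ^+ i * 2 ^+ j.+2 / 2 ^+ L :> R.
  exact: divr_ge0 (mulr_ge0 (ltW (two0 i)) (ltW (two0 j.+2))) (ltW (two0 L)).
apply: le_trans (enorm_le_coord d0 _) _.
  move=> o e; rewrite ord1 !mxE.
  have -> : x 0 e - y 0 e = (X x e - X y e) * (2 ^+ j.+2 / 2 ^+ L).
    by rewrite /X; field; rewrite !gt_eqF.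
  rewrite normrM [X in _ * X]ger0_norm ?divr_ge0 ?exprn_ge0// -mulrA.
  by rewrite ler_wpM2r ?divr_ge0 ?exprn_ge0.
have f n : 4 ^+ n = (2 ^+ n) ^+ 2 :> R by rewrite -exprM mulnC exprM; congr (_ ^+ _); ring.
have -> : 2 ^+ j.+2 = 4 * 2 ^+ j :> R by rewrite 2!exprS; ring.
rewrite mul1n !f; have := two0 L; move: (2 ^+ i) (2 ^+ j) (2 ^+ L) => u v w w0.
by rewrite le_eqVlt; apply/orP; left; apply/eqP; field; rewrite gt_eqF.
Qed.

Lemma supn_sq_enorm x : enorm x ^+ 2 <= m%:R * supn x ^+ 2.
Proof.
have := @enorm_le_coord R 1 m x (supn x) (supn_ge0 x); rewrite mul1n; apply.
by move=> i e; rewrite ord1; exact: coord_le_supn.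
Qed.

Definition crossing (i j : nat) (x y : V) : R :=
  ((shell x == j) && (coarsen i (cell x) != coarsen i (cell y)))%:R.

Definition outer (x : V) : R := enorm x ^+ 2 * (shell x == N)%:R.

(** In a common shell, let i + 1 be the first level at which the cells agree: the diameter of that
    level is charged to the crossing at level i, whence 64 = 4 x 16; agreement at level 0 costs the
    finest diameter. For different shells the distance is split into the two norms, and each is
    charged to a crossing at level [L] seen from its own shell. Points in the unbounded shell are
    charged to [outer]. *)
Lemma dist_le_cells x y : enorm (x - y) ^+ 2 <=
  \sum_(j < N) 4 ^+ j * (16 * m%:R / 4 ^+ L * (shell x == j)%:R +
     \sum_(i < L.+1) 64 * m%:R * (4 ^+ i / 4 ^+ L) * crossing i j x y
     + 2 * m%:R * crossing L j y x)
  + 2 * outer x + 2 * outer y.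
Proof.
have cr0 i j x' y' : 0 <= crossing i j x' y' by [].
have t0 n : 0 <= 4 ^+ n :> R by rewrite exprn_ge0.
have q0 i : 0 <= 4 ^+ i / 4 ^+ L :> R by rewrite divr_ge0.
pose term (x y : V) (j : nat) := 4 ^+ j * (16 * m%:R / 4 ^+ L * (shell x == j)%:R +
     \sum_(i < L.+1) 64 * m%:R * (4 ^+ i / 4 ^+ L) * crossing i j x y
     + 2 * m%:R * crossing L j y x) : R.
have term0 (x' y' : V) j : 0 <= term x' y' j.
  rewrite /term !mulr_ge0// !addr_ge0// ?mulr_ge0 ?invr_ge0 ?exprn_ge0//.
  by apply: sumr_ge0 => i _; rewrite !mulr_ge0 ?invr_ge0.
have out0 (x' : V) : 0 <= outer x' by rewrite /outer mulr_ge0// sqr_ge0.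
have le1 (j : nat) : (j < N)%N -> term x y j <= \sum_(j < N) term x y j.
  by move=> jN; rewrite (bigD1 (Ordinal jN))//= lerDl sumr_ge0.
have S0 : 0 <= \sum_(j < N) term x y j by apply: sumr_ge0.
have d2 : enorm (x - y) ^+ 2 <= 2 * enorm x ^+ 2 + 2 * enorm y ^+ 2.
  by have := enorm_sqrD x (- y); rewrite enormN.
have inner (z : V) : (shell z < N)%N -> enorm z ^+ 2 <= m%:R * 4 ^+ shell z.
  move=> zN; rewrite (le_trans (supn_sq_enorm z))// ler_wpM2l//.
  have -> : 4 ^+ shell z = (2 ^+ shell z) ^+ 2 :> R by rewrite -exprM mulnC exprM; congr (_ ^+ _); ring.
  by rewrite lerXn2r ?nnegrE ?supn_ge0 ?exprn_ge0// shell_supn.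
change (enorm (x - y) ^+ 2 <= \sum_(j < N) term x y j + 2 * outer x + 2 * outer y).
have [sxy|sxy] := eqVneq (shell x) (shell y).
  have [xN|xN] := ltnP (shell x) N; last first.
    have ex : shell x = N by apply/eqP; rewrite eqn_leq shell_le.
    rewrite /outer -sxy ex eqxx !mulr1; lra.
  apply: (@le_trans _ _ (term x y (shell x))); last by have := le1 _ xN; have := out0 x; have := out0 y; lra.
  have t1 : 0 <= 2 * m%:R * crossing L (shell x) y x by rewrite !mulr_ge0.
  rewrite /term eqxx mulr1.
  have [e0|e0] := eqVneq (coarsen 0 (cell x)) (coarsen 0 (cell y)).
    apply: le_trans (same_cell_dist xN (leq0n L) e0) _.
    rewrite expr0 mul1r (_ : _ * _ = 4 ^+ shell x * (16 * m%:R / 4 ^+ L)); last by ring.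
    rewrite ler_wpM2l// -addrA lerDl addr_ge0//; apply: sumr_ge0 => i _; by rewrite !mulr_ge0 ?invr_ge0.
  have ex : exists i, (coarsen i (cell x) == coarsen i (cell y)).
    by exists L.+1; apply/eqP; exact: coarsen_top.
  case: (ex_minnP ex) => -[|i]; first by rewrite (negbTE e0).
  move=> ei mini.
  (* At level [L] all indices have been divided down to 0, so points of one shell agree there; the
     minimal level of agreement is at most [L]. *)
  have iL : (i < L)%N.
    apply: mini; apply/eqP; rewrite /coarsen leqnn; congr (_, _).
      by apply: val_inj; rewrite /= !inordK ?ltnS ?shell_le.
    by apply/ffunP => e; rewrite !ffunE !divn_small.
  have ni : coarsen i (cell x) != coarsen i (cell y).
    by apply/negP => /mini; rewrite ltnn.
  apply: le_trans (same_cell_dist xN iL (eqP ei)) _.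
  rewrite (_ : _ * _ = 4 ^+ shell x * (16 * m%:R * (4 ^+ i.+1 / 4 ^+ L))); last by ring.
  rewrite ler_wpM2l//.
  have iL1 : (i < L.+1)%N by rewrite ltnS ltnW.
  rewrite (bigD1 (Ordinal iL1))//= /crossing eqxx ni mulr1.
  have -> : 16 * m%:R * (4 ^+ i.+1 / 4 ^+ L) = 64 * m%:R * (4 ^+ i / 4 ^+ L) :> R by rewrite exprS; ring.
  have t2 : 0 <= 16 * m%:R / 4 ^+ L :> R by rewrite !mulr_ge0 ?invr_ge0.
  rewrite -!addrA ler_wpDl// lerDl addr_ge0//.
  by apply: sumr_ge0 => i0 _; rewrite !mulr_ge0 ?invr_ge0.
(* Up to level [L] cells keep their shell, so such a pair crosses at every level. Level [L] is used
   because there the weight 4^i / 4^L equals 1. *)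
have cx i z z' : shell z != shell z' -> (i <= L)%N -> crossing i (shell z) z z' = 1.
  move=> zz iL; rewrite /crossing eqxx /=; case: eqP => //; rewrite /coarsen iL => -[/(congr1 val)].
  by rewrite /= !inordK ?ltnS ?shell_le// => /eqP; rewrite (negbTE zz).
have bx : 2 * enorm x ^+ 2 <= (if (shell x < N)%N then 4 ^+ shell x * (64 * m%:R) else 0) + 2 * outer x.
  case: ltnP => xN.
    have := inner x xN; have := out0 x; have : 0 <= m%:R * 4 ^+ shell x :> R by rewrite mulr_ge0.
    lra.
  have ex : shell x = N by apply/eqP; rewrite eqn_leq shell_le.
  by rewrite add0r /outer ex eqxx mulr1.
have by' : 2 * enorm y ^+ 2 <= (if (shell y < N)%N then 4 ^+ shell y * (2 * m%:R) else 0) + 2 * outer y.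
  case: ltnP => xN.
    have := inner y xN; have := out0 y; lra.
  have ex : shell y = N by apply/eqP; rewrite eqn_leq shell_le.
  by rewrite add0r /outer ex eqxx mulr1.
have tx : (if (shell x < N)%N then 4 ^+ shell x * (64 * m%:R) else 0) <=
    \sum_(j < N) 4 ^+ j * (64 * m%:R * crossing L j x y).
  case: ltnP => xN; last by apply: sumr_ge0 => j _; rewrite !mulr_ge0.
  rewrite (bigD1 (Ordinal xN))//= cx// mulr1 lerDl.
  by apply: sumr_ge0 => j _; rewrite !mulr_ge0.
have ty : (if (shell y < N)%N then 4 ^+ shell y * (2 * m%:R) else 0) <=
    \sum_(j < N) 4 ^+ j * (2 * m%:R * crossing L j y x).
  case: ltnP => xN; last by apply: sumr_ge0 => j _; rewrite !mulr_ge0.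
  rewrite (bigD1 (Ordinal xN))//= cx 1?eq_sym// mulr1 lerDl.
  by apply: sumr_ge0 => j _; rewrite !mulr_ge0.
have txy : \sum_(j < N) 4 ^+ j * (64 * m%:R * crossing L j x y) +
   \sum_(j < N) 4 ^+ j * (2 * m%:R * crossing L j y x) <= \sum_(j < N) term x y j.
  rewrite -big_split/=; apply: ler_sum => j _; rewrite -mulrDr ler_wpM2l// lerD2r.
  apply: ler_wpDl; first by rewrite !mulr_ge0 ?invr_ge0.
  have e1 : 4 ^+ L / 4 ^+ L = 1 :> R by rewrite divff// gt_eqF// exprn_gt0.
  rewrite (bigD1 ord_max)//= e1 mulr1 lerDl.
  by apply: sumr_ge0 => i _; rewrite !mulr_ge0 ?invr_ge0.
apply: le_trans d2 _; apply: le_trans (lerD bx by') _.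
by rewrite addrACA -[leRHS]addrA lerD2r (le_trans (lerD tx ty)).
Qed.

End Cells.

(** * Second moments and bounds on integrals *)

Section InnerProduct.
Context {R : realType} {d0 : measure_display} {X : measurableType d0} (mu : measure X R).

Definition ip (f g : X -> R) : R := \int[mu]_x (f x * g x).

Lemma ipE (f g : X -> R) : sqint mu f -> sqint mu g ->
  (ip f g)%:E = (\int[mu]_x (f x * g x)%:E)%E.
Proof.
move=> hf hg; rewrite /ip /Rintegral fineK//.
by apply: integrable_fin_num => //; exact: sqint_mul_integrable.
Qed.

Lemma ip_sqr (f : X -> R) : sqint mu f -> (ip f f)%:E = (\int[mu]_x (f x ^+ 2)%:E)%E.
Proof. by move=> hf; rewrite ipE//; apply: eq_integral => x _; rewrite expr2. Qed.

Lemma ipC (f g : X -> R) : ip f g = ip g f.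
Proof. by apply: eq_Rintegral => x _; rewrite mulrC. Qed.

Lemma ipDl (f1 f2 g : X -> R) : sqint mu f1 -> sqint mu f2 -> sqint mu g ->
  ip (fun x => f1 x + f2 x) g = ip f1 g + ip f2 g.
Proof.
move=> h1 h2 hg; rewrite /ip -RintegralD//; try exact: sqint_mul_integrable.
by apply: eq_Rintegral => x _; rewrite mulrDl.
Qed.

Lemma ip0l (g : X -> R) : ip (fun=> 0) g = 0.
Proof.
transitivity (\int[mu]_x (0 : R)); last by rewrite Rintegral_cst// mul0r.
by apply: eq_Rintegral => x _; rewrite mul0r.
Qed.

Lemma ip_suml (I : Type) (s : seq I) (f : I -> X -> R) (g : X -> R) :
  (forall i, sqint mu (f i)) -> sqint mu g ->
  ip (fun x => \sum_(i <- s) f i x) g = \sum_(i <- s) ip (f i) g.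
Proof.
move=> hf hg; elim: s => [|i s IH].
  by rewrite big_nil -[RHS](ip0l g); congr ip; apply/funext => x; rewrite big_nil.
rewrite big_cons -IH -ipDl//; last exact: sqint_sum.
by congr ip; apply/funext => x; rewrite big_cons.
Qed.

Lemma integral_sqr_sum (I : Type) (s : seq I) (f : I -> X -> R) :
  (forall i, sqint mu (f i)) ->
  (\int[mu]_x ((\sum_(i <- s) f i x) ^+ 2)%:E =
   (\sum_(i <- s) \sum_(j <- s) ip (f i) (f j))%:E)%E.
Proof.
move=> hf; rewrite -ip_sqr; last exact: sqint_sum.
congr _%:E; rewrite ip_suml//; last exact: sqint_sum.
apply: eq_bigr => i _; rewrite ipC ip_suml//; apply: eq_bigr => j _; exact: ipC.
Qed.

Lemma ip_sqrD (f g : X -> R) : sqint mu f -> sqint mu g ->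
  (\int[mu]_x ((f x + g x) ^+ 2)%:E =
   \int[mu]_x (f x ^+ 2)%:E + (2 * ip f g)%:E + \int[mu]_x (g x ^+ 2)%:E)%E.
Proof.
move=> hf hg; have hfg := sqintD hf hg.
rewrite -!ip_sqr// -!EFinD; congr _%:E.
rewrite ipDl// [ip f _]ipC [ip g _]ipC !ipDl// [ip g f]ipC; ring.
Qed.

End InnerProduct.

Section IntegralBounds.
Context {R : realType} {d0 : measure_display} {X : measurableType d0} (mu : measure X R).

(** Collects what is needed to add bounds on integrals term by term, so that a pointwise sum such as
    the transport cost is integrated by following its shape. *)
Definition ibound (f : X -> R) (c : R) := [/\ measurable_fun setT f, forall x, 0 <= f x &
  (\int[mu]_x (f x)%:E <= c%:E)%E].

Lemma iboundD f g a b : ibound f a -> ibound g b -> ibound (fun x => f x + g x) (a + b).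
Proof.
move=> [mf f0 fa] [mg g0 gb]; split; first exact: measurable_funD.
  by move=> x; exact: addr_ge0.
under eq_integral do rewrite EFinD.
rewrite ge0_integralD//= ?EFinD ?leeD//; try by move=> x _; rewrite lee_fin.
  exact/measurable_EFinP.
exact/measurable_EFinP.
Qed.

Lemma iboundZ c f a : 0 <= c -> ibound f a -> ibound (fun x => c * f x) (c * a).
Proof.
move=> c0 [mf f0 fa]; split; first by apply: measurable_funM => //; exact: measurable_cst.
  by move=> x; exact: mulr_ge0.
under eq_integral do rewrite EFinM.
rewrite ge0_integralZl//= ?EFinM ?lee_wpmul2l ?lee_fin//; first exact/measurable_EFinP.
by move=> x _; rewrite lee_fin.
Qed.

Lemma ibound0 : ibound (fun=> 0) 0.
Proof. by split => //; rewrite integral0. Qed.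

Lemma ibound_sum (I : Type) (s : seq I) (f : I -> X -> R) (c : I -> R) :
  (forall i, ibound (f i) (c i)) ->
  ibound (fun x => \sum_(i <- s) f i x) (\sum_(i <- s) c i).
Proof.
move=> h; elim: s => [|i s IH].
  by rewrite big_nil; under eq_fun do rewrite big_nil; exact: ibound0.
by rewrite big_cons; under eq_fun do rewrite big_cons; exact: iboundD.
Qed.

Lemma ibound_le (f g : X -> R) c : measurable_fun setT f -> (forall x, 0 <= f x <= g x) ->
  ibound g c -> ibound f c.
Proof.
move=> mf fg [mg g0 gc]; split => //; first by move=> x; case/andP: (fg x).
apply: le_trans gc; apply: le_integral_nonmeas => x; rewrite lee_fin; by case/andP: (fg x).
Qed.

Lemma ibound_leW f c c' : c <= c' -> ibound f c -> ibound f c'.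
Proof. by move=> cc [? ? h]; split => //; apply: le_trans h _; rewrite lee_fin. Qed.

Lemma measurable_fun_fin (K : finType) (kap : X -> K) (g : K -> R) :
  (forall a, measurable (kap @^-1` [set a])) -> measurable_fun setT (fun x => g (kap x)).
Proof.
move=> mk _ B mB; rewrite setTI.
rewrite (_ : _ @^-1` B = \bigcup_(a in [set a | B (g a)]) (kap @^-1` [set a])).
  by apply: fin_bigcup_measurable; [exact: finite_finset|move=> a _; exact: mk].
apply/seteqP; split => [x xB|x [a /= Ba xa]]; first by exists (kap x).
by rewrite /= xa.
Qed.

End IntegralBounds.

Section SecondMoment.
Context {R : realType} {d0 : measure_display} {X : measurableType d0} (P : probability X R).

Lemma sqint_cst (c : R) : sqint P (fun=> c).
Proof.
split; first exact: measurable_cst.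
by rewrite integral_cst//= probability_setT mule1 ltry.
Qed.

Lemma sqint_bounded (c : R) (f : X -> R) : measurable_fun setT f ->
  (forall x, `|f x| <= c) -> sqint P f.
Proof.
move=> mf fc; have := sqint_bndM mf fc (sqint_cst 1).
by congr sqint; apply/funext => x; rewrite mulr1.
Qed.

Lemma sqint_integrable (f : X -> R) : sqint P f -> P.-integrable setT (EFin \o f).
Proof.
move=> hf; have := sqint_mul_integrable hf (sqint_cst 1).
by congr integrable; apply/funext => x /=; rewrite mulr1.
Qed.

(** The centred indicators are orthogonal by pairwise independence, so the variance of their mean is
    (c - c^2) / (n+1). The second bound is the triangle inequality; it is the better one in cells of
    mass below 1/n. *)
Lemma empirical_frequency (n : nat) (E : 'I_n.+1 -> set X) (c : R) :
  (forall k, measurable (E k)) -> (forall k, P (E k) = c%:E) ->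
  (forall k l, k != l -> P (E k `&` E l) = (c * c)%:E) ->
  (\int[P]_x ((n.+1%:R^-1 * \sum_k \1_(E k) x - c) ^+ 2)%:E <= (c / n.+1%:R)%:E)%E /\
  (\int[P]_x `|n.+1%:R^-1 * \sum_k \1_(E k) x - c|%:E <= (2 * c)%:E)%E.
Proof.
move=> mE hE hEE.
have n0 : n.+1%:R != 0 :> R by rewrite pnatr_eq0.
have c0 : 0 <= c by rewrite -lee_fin -(hE ord0); exact: measure_ge0.
pose xi k x : R := \1_(E k) x - c.
have mI k : measurable_fun setT (\1_(E k) : X -> R) by exact: measurable_indic.
have sI k : sqint P (\1_(E k) : X -> R).
  by apply: (@sqint_bounded 1) => // x; rewrite indicE; case: (_ \in _); rewrite ?normr1 ?normr0.
have sxi k : sqint P (xi k) by apply: sqintB => //; exact: sqint_cst.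
have intI A : measurable A -> \int[P]_x (\1_A x : R) = fine (P A).
  by move=> mA; rewrite /Rintegral integral_indic// setIT.
have iI A : measurable A -> P.-integrable setT (EFin \o (\1_A : X -> R)).
  by move=> mA; apply: sqint_integrable; apply: (@sqint_bounded 1) => // x; rewrite indicE; case: (_ \in _); rewrite ?normr1 ?normr0.
have ipxi k l : ip P (xi k) (xi l) = fine (P (E k `&` E l)) - c * c.
  have mkl : measurable (E k `&` E l) by exact: measurableI.
  transitivity (\int[P]_x (\1_(E k `&` E l) x - c * \1_(E k) x - c * \1_(E l) x + c * c)).
    by apply: eq_Rintegral => x _; rewrite /xi indicI /=; ring.
  have icst : P.-integrable setT (EFin \o (fun=> c * c : R)) by apply: sqint_integrable; exact: sqint_cst.
  have iZ j : P.-integrable setT (EFin \o (fun x => c * \1_(E j) x : R)).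
    by apply: sqint_integrable; exact: sqintZ.
  have i1 : P.-integrable setT (EFin \o (fun x => \1_(E k `&` E l) x - c * \1_(E k) x : R)).
    by apply: sqint_integrable; apply: sqintB; [|exact: sqintZ]; apply: (@sqint_bounded 1) => // x; rewrite indicE; case: (_ \in _); rewrite ?normr1 ?normr0.
  have i2 : P.-integrable setT (EFin \o (fun x => \1_(E k `&` E l) x - c * \1_(E k) x - c * \1_(E l) x : R)).
    by apply: sqint_integrable; apply: sqintB; [apply: sqintB; [|exact: sqintZ]|exact: sqintZ]; apply: (@sqint_bounded 1) => // x; rewrite indicE; case: (_ \in _); rewrite ?normr1 ?normr0.
  rewrite RintegralD// [X in _ + X = _]Rintegral_cst// RintegralB// RintegralB//; last exact: iI.
  rewrite !RintegralZl//; try exact: iI.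
  by rewrite !intI// !hE /= probability_setT/=; ring.
have eqf x : n.+1%:R^-1 * \sum_k \1_(E k) x - c = n.+1%:R^-1 * \sum_k xi k x.
  rewrite /xi sumrB sumr_const card_ord -[c *+ _]mulr_natl.
  by rewrite mulrBr mulrA mulVf// mul1r.
split.
- under eq_integral => x _ do rewrite eqf exprMn EFinM.
  rewrite ge0_integralZl//; last 2 first.
  + by apply: measurable_sqE; apply: measurable_sum => k; case: (sxi k).
  + by move=> x _; rewrite lee_fin sqr_ge0.
  rewrite integral_sqr_sum// -EFinM lee_fin.
  rewrite (eq_bigr (fun k => c - c * c)) => [|k _]; last first.
    rewrite (bigD1 k)//= big1 => [|l lk]; first by rewrite ipxi setIid hE addr0.
    by rewrite ipxi hEE 1?eq_sym// subrr.
  rewrite sumr_const card_ord -[(c - c * c) *+ _]mulr_natl.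
  rewrite (_ : n.+1%:R^-1 ^+ 2 * (n.+1%:R * (c - c * c)) = (c - c * c) / n.+1%:R); last by field.
  by rewrite ler_wpM2r ?invr_ge0// gerBl mulr_ge0.
- apply: (@le_trans _ _ (\int[P]_x ((n.+1%:R^-1)%:E * (\sum_k \1_(E k) x)%:E + c%:E))%E).
    apply: le_integral_nonmeas => x; first by rewrite lee_fin.
    rewrite -EFinM -EFinD lee_fin (le_trans (ler_normB _ _))// ger0_norm; last first.
      by rewrite mulr_ge0 ?invr_ge0// sumr_ge0.
    by rewrite ger0_norm.
  rewrite ge0_integralD//=; last 2 first.
  + by move=> x _; rewrite -EFinM lee_fin mulr_ge0 ?invr_ge0 ?sumr_ge0.
  + by apply: emeasurable_funM => //; apply/measurable_EFinP; exact: measurable_sum.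
  rewrite integral_cst//= probability_setT mule1 ge0_integralZl//=; last 2 first.
  + by apply/measurable_EFinP; exact: measurable_sum.
  + by move=> x _; rewrite lee_fin sumr_ge0.
  under eq_integral do rewrite -sumEFin.
  rewrite ge0_integral_sum//=; last by move=> k; apply/measurable_EFinP.
  rewrite (eq_bigr (fun=> c%:E)) => [|k _]; last by rewrite integral_indic// setIT; exact: hE.
  rewrite sumEFin sumr_const card_ord -EFinM -EFinD lee_fin -[c *+ _]mulr_natl mulKf//.
  by rewrite mulr2n mulrDl mul1r.
Qed.

End SecondMoment.

(** * The transport cost of two measures *)

Section Transport.
Context {R : realType} {m : nat}.
Local Notation V := 'rV[R]_m.

Lemma measurable_supn : measurable_fun setT (@supn R m).
Proof.
rewrite /supn; elim: (index_enum _) => [|e s IH].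
  by under eq_fun do rewrite big_nil; exact: measurable_cst.
under eq_fun do rewrite big_cons.
by apply: measurable_maxr => //; apply: measurableT_comp => //; exact: measurable_coord.
Qed.

Context (N L : nat).
Let sh := @shell R m N.

Lemma measurable_shell j : measurable [set x : V | shell N x = j].
Proof.
have m1 c : measurable [set x : V | supn x <= c].
  have h : measurable_fun setT (fun x : V => supn x <= (cst c : V -> R) x).
    by apply: measurable_fun_ler; [exact: measurable_supn|exact: measurable_cst].
  by rewrite -[X in measurable X]setTI; exact: (h measurableT [set true]).
have m2 c : measurable [set x : V | c < supn x].
  rewrite (_ : [set x | _] = ~` [set x | supn x <= c]); first exact: measurableC.
  by apply/seteqP; split => x /=; rewrite ltNge => /negP.
have [jN|jN] := leqP j N; last first.
  rewrite (_ : [set x | _] = set0)//; apply/seteqP; split => x //= e.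
  by have := shell_le N x; rewrite e leqNgt jN.
rewrite (_ : [set x | _] = (if (j < N)%N then [set x | supn x <= 2 ^+ j] else setT) `&`
   \bigcap_(i in [set i | (i < j)%N]) [set x | 2 ^+ i < supn x]).
  apply: measurableI; first by case: ifP.
  have [j0|j0] := eqVneq j 0%N.
    by rewrite j0 (_ : [set i | _] = set0) ?bigcap_set0//; apply/seteqP; split.
  apply: bigcap_measurable => // ; exists 0%N; by rewrite /= lt0n.
apply/seteqP; split => x /=.
  move=> e; split; last by move=> i /= ij; apply: (@supn_shell R m N); rewrite e.
  by case: ifP => // jN'; rewrite /= -e shell_supn// e.
move=> [h1 h2]; apply/eqP; rewrite shellP jN /=; apply/andP; split.
  by apply/implyP => jN'; move: h1; rewrite jN'.
by apply/forallP => i; apply/implyP => ij; exact: h2.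
Qed.

(** The scaling of a cell depends on the shell, but once the shell is fixed it is constant, and
    truncation is monotone, hence measurable. *)
Lemma measurable_cell c : measurable [set x : V | cell N L x = c].
Proof.
case: c => j v.
pose X e (x : V) : R := (x 0 e + 2 ^+ j) / 2 ^+ j.+2 * 2 ^+ L.
pose S e : set R := [set n%:R | n in [set n | (n %% 2 ^ L)%N = v e]].
have mS e : measurable (S e).
  apply: countable_measurable => //; apply: card_le_trans (card_image_le _ _) _.
  exact: countableP.
have mt : measurable_fun setT (fun r : R => (Num.truncn r)%:R : R).
  apply: nondecreasing_measurable => // r s rs; rewrite ler_nat; exact: le_truncn.
rewrite (_ : [set x | _] = [set x | shell N x = j] `&`
   \bigcap_(e in [set: 'I_m]) ((fun x => (Num.truncn (X e x))%:R : R) @^-1` S e)).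
  apply: measurableI; first exact: measurable_shell.
  apply: fin_bigcap_measurable; first exact: finite_finset.
  move=> e _; rewrite -[Y in measurable Y]setTI.
  have : measurable_fun setT (fun x => (Num.truncn (X e x))%:R : R).
    apply: (measurableT_comp mt).
    apply: measurable_funM; last exact: measurable_cst.
    apply: measurable_funM; last exact: measurable_cst.
    by apply: measurable_funD; [exact: measurable_coord|exact: measurable_cst].
  exact.
apply/seteqP; split => x /=.
  rewrite /cell => -[sj /ffunP hv].
  have sj' : shell N x = j by rewrite -sj inordK// ltnS shell_le.
  split => // e _; exists (Num.truncn (X e x)) => //=.
  by rewrite -hv ffunE /= /X sj'.
move=> [sj hv]; rewrite /cell; congr (_, _).
  by apply: val_inj; rewrite /= inordK// ltnS shell_le.
apply/ffunP => e; rewrite ffunE; apply: val_inj => /=.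
have [n /= nv /eqP] := hv e I; rewrite eqr_nat => /eqP nX.
by rewrite -nv nX /X sj.
Qed.

Lemma coupling_fst (mu nu : probability V R) (pi : probability (V * V)%type R) (f : V -> \bar R) :
  coupling mu nu pi -> (forall x, (0 <= f x)%E) -> measurable_fun setT f ->
  (\int[pi]_z f z.1 = \int[mu]_x f x)%E.
Proof.
move=> cpl f0 mf.
transitivity (\int[pushforward pi (@fst V V)]_x f x)%E.
  by rewrite ge0_integral_pushforward//; exact: measurable_fst.
apply: eq_measure_integral => A mA _; rewrite /pushforward.
transitivity (pi (A `*` setT)); last exact: (cpl A mA).1.
by rewrite /= /pushforward; congr (pi _); apply/seteqP; split => z //= -[].
Qed.

Lemma coupling_snd (mu nu : probability V R) (pi : probability (V * V)%type R) (f : V -> \bar R) :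
  coupling mu nu pi -> (forall x, (0 <= f x)%E) -> measurable_fun setT f ->
  (\int[pi]_z f z.2 = \int[nu]_x f x)%E.
Proof.
move=> cpl f0 mf.
transitivity (\int[pushforward pi (@snd V V)]_x f x)%E.
  by rewrite ge0_integral_pushforward//; exact: measurable_snd.
apply: eq_measure_integral => A mA _; rewrite /pushforward.
transitivity (pi (setT `*` A)); last exact: (cpl A mA).2.
by rewrite /= /pushforward; congr (pi _); apply/seteqP; split => z //= -[].
Qed.

(** At level [i] the indices run below 2^(L-i), so the family over [q] lists the cells of shell [j];
    its size 2^(m(L-i)) is the factor in the Cauchy-Schwarz bound. *)
Definition subcell (i j : nat) (q : {ffun 'I_m -> 'I_(2 ^ (L - i))}) : set V :=
  [set x | coarsen i (cell N L x) = (inord j, [ffun e => q e : nat])].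

Definition cell_gap (i j : nat) (mu nu : set V -> \bar R) : R :=
  \sum_q `|fine (mu (@subcell i j q)) - fine (nu (@subcell i j q))|.

Lemma measurable_coarsen i v : measurable [set x : V | coarsen i (cell N L x) = v].
Proof.
rewrite (_ : [set x | _] = \bigcup_(c in [set c | coarsen i c = v]) [set x | cell N L x = c]); last first.
  by apply/seteqP; split => [x xv|x [c /= cv xc]]; [exists (cell N L x)|rewrite /= xc].
by apply: fin_bigcup_measurable; [exact: finite_finset|move=> c _; exact: measurable_cell].
Qed.

Lemma subcell_cover i j x : (j < N)%N -> (i <= L)%N -> shell N x = j ->
  exists q : {ffun 'I_m -> 'I_(2 ^ (L - i))}, subcell j q x.
Proof.
move=> jN iL xj.
have lt e : ((cell N L x).2 e %/ 2 ^ i < 2 ^ (L - i))%N.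
  by rewrite ltn_divLR ?expn_gt0// -expnD subnK.
exists [ffun e => Ordinal (lt e)]; rewrite /subcell /coarsen /= iL; congr (_, _).
  by rewrite xj.
by apply/ffunP => e; rewrite !ffunE /= ffunE.
Qed.

Lemma subcell_shell i j q x : (j < N)%N -> (i <= L)%N -> @subcell i j q x -> shell N x = j.
Proof.
move=> jN iL; rewrite /subcell /coarsen iL /= => -[/(congr1 val)].
by rewrite /= !inordK ?ltnS ?shell_le// ltnW.
Qed.

Lemma subcell_uniq i j q q' x : @subcell i j q x -> @subcell i j q' x -> q = q'.
Proof.
rewrite /subcell /= => -> [/ffunP h]; apply/ffunP => e; apply: val_inj.
by have := h e; rewrite !ffunE.
Qed.

(** The pointwise bound [dist_le_cells] integrated against the tree coupling, with each crossing
    probability replaced by a sum of mass differences. Only masses of cells and tail integrals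
    occur, so the cost is measurable in parameters of the two measures and its mean can be bounded
    cell by cell. *)
Definition transport_cost (mu nu : probability V R) : R :=
  \sum_(j < N) 4 ^+ j * (16 * m%:R / 4 ^+ L * fine (mu [set x | shell N x = j]) +
     \sum_(i < L.+1) 64 * m%:R * (4 ^+ i / 4 ^+ L) * cell_gap i j mu nu
     + 2 * m%:R * cell_gap L j mu nu)
  + 2 * fine (\int[mu]_x (outer N x)%:E)%E + 2 * fine (\int[nu]_x (outer N x)%:E)%E.

Lemma measurable_outer : measurable_fun setT (@outer R m N).
Proof.
apply: measurable_funM; first by apply: measurable_funX; exact: measurable_enorm.
have := measurable_fun_fin (fun c : 'I_N.+1 * {ffun 'I_m -> 'I_(2 ^ L)} => (c.1 == N :> nat)%:R : R) measurable_cell.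
by under eq_fun do rewrite cell_shell.
Qed.

Lemma cell_gap_ge0 i j mu nu : 0 <= cell_gap i j mu nu.
Proof. exact: sumr_ge0. Qed.

(** A pair that crosses leaves the cell [S] of its first point. The coupling keeps min(mu S, nu S)
    inside [S] x [S], so the mass leaving [S] is mu S minus this minimum, at most |mu S - nu S|;
    likewise in the other direction. *)
Lemma crossing_bound (mu nu : probability V R) (pi : probability (V * V)%type R) i j :
  (j < N)%N -> (i <= L)%N -> coupling mu nu pi ->
  (forall i v, (i <= L.+1)%N -> let Q := [set x | coarsen i (cell N L x) = v] in
       fine (pi (Q `*` Q)) = Num.min (fine (mu Q)) (fine (nu Q))) ->
  ibound pi (fun z => @crossing R m N L i j z.1 z.2) (cell_gap i j mu nu) /\
  ibound pi (fun z => @crossing R m N L i j z.2 z.1) (cell_gap i j mu nu).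
Proof.
move=> jN iL cpl hpi.
have mQ q : measurable (@subcell i j q) by exact: measurable_coarsen.
have gap q (S := @subcell i j q) : fine (pi (S `*` S)) = Num.min (fine (mu S)) (fine (nu S)).
  by apply: hpi; exact: leqW.
have fcell (g : _ -> _ -> R) : measurable_fun setT (fun z : V * V => g (cell N L z.1) (cell N L z.2)).
  apply: (@measurable_fun_fin _ _ _ _ (fun z : V * V => (cell N L z.1, cell N L z.2)) (fun c => g c.1 c.2)) => -[a c].
  rewrite (_ : _ @^-1` _ = [set x | cell N L x = a] `*` [set x | cell N L x = c]).
    by apply: measurableX; exact: measurable_cell.
  by apply/seteqP; split => z /= [-> ->].
have mcr : measurable_fun setT (fun z : V * V => @crossing R m N L i j z.1 z.2).
  rewrite /crossing.
  have := fcell (fun a c => ((a.1 == j :> nat) && (coarsen i a != coarsen i c))%:R).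
  by under eq_fun do rewrite cell_shell.
have mcr' : measurable_fun setT (fun z : V * V => @crossing R m N L i j z.2 z.1).
  rewrite /crossing.
  have := fcell (fun a c => ((c.1 == j :> nat) && (coarsen i c != coarsen i a))%:R).
  by under eq_fun do rewrite cell_shell.
have le_ind (x y : V) : crossing N L i j x y <= \sum_q \1_(@subcell i j q) x * \1_(~` (@subcell i j q)) y.
  rewrite /crossing; case: eqP => [xj|_]; last by apply: sumr_ge0.
  case: eqP => [_|xy] /=; first by apply: sumr_ge0.
  have [q xq] := subcell_cover jN iL xj.
  rewrite (bigD1 q)//= !indicE (mem_set xq) (mem_set (_ : (~` _) y)) ?mulr1.
    by rewrite lerDl sumr_ge0.
  by move=> yq; apply: xy; rewrite xq yq.
have rect q A B : measurable A -> measurable B ->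
    ibound pi (fun z => \1_A z.1 * \1_B z.2) (fine (pi (A `*` B))).
  move=> mA mB; split.
  - apply: measurable_funM.
      by apply: measurableT_comp; [exact: measurable_indic|exact: measurable_fst].
    by apply: measurableT_comp; [exact: measurable_indic|exact: measurable_snd].
  - by move=> z; rewrite mulr_ge0.
  - rewrite fineK ?fin_num_measure//; last exact: measurableX.
    rewrite -[A `*` B]setIT -integral_indic//; last exact: measurableX.
    rewrite le_eqVlt; apply/orP; left; apply/eqP; apply: eq_integral => z _.
    by rewrite !indicE in_setX -natrM mulnb.
have muf A : measurable A -> (fine (pi (A `*` ~` A)) = fine (mu A) - fine (pi (A `*` A))) /\
    (fine (pi (~` A `*` A)) = fine (nu A) - fine (pi (A `*` A))).
  move=> mA; have mAc : measurable (~` A) by exact: measurableC.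
  have [c1 _] := cpl A mA; have [_ c2] := cpl A mA.
  split.
    rewrite -c1 (_ : A `*` setT = (A `*` A) `|` (A `*` ~` A)); last first.
      apply/seteqP; split => -[x y] /= => [[xA _]|[[]|[]]//].
    by have [yA|yA] := pselect (A y); [left|right].
    rewrite measureU//; try exact: measurableX; last first.
      by apply/seteqP; split => z //= [[_ ?] [_]].
    by rewrite fineD ?fin_num_measure//; try exact: measurableX; rewrite addrC addKr.
  rewrite -c2 (_ : setT `*` A = (A `*` A) `|` (~` A `*` A)); last first.
    apply/seteqP; split => -[x y] /= => [[_ yA]|[[]|[]]//].
    by have [xA|xA] := pselect (A x); [left|right].
  rewrite measureU//; try exact: measurableX; last first.
    by apply/seteqP; split => z //= [[? _] []].
  by rewrite fineD ?fin_num_measure//; try exact: measurableX; rewrite addrC addKr.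
have cr01 x y : 0 <= crossing N L i j x y by [].
split.
- apply: (@ibound_le _ _ _ _ _ (fun z => \sum_q \1_(@subcell i j q) z.1 * \1_(~` (@subcell i j q)) z.2)) => //.
    by move=> z; rewrite cr01 le_ind.
  rewrite /cell_gap; apply: ibound_sum => q; apply: (ibound_leW _ (rect _ q _ _ (mQ q) (measurableC (mQ q)))).
  rewrite (muf _ (mQ q)).1 gap.
  have [h|h] := leP (fine (mu (@subcell i j q))) (fine (nu (@subcell i j q))).
    by rewrite subrr.
  exact: ler_norm.
- apply: (@ibound_le _ _ _ _ _ (fun z => \sum_q \1_(~` (@subcell i j q)) z.1 * \1_((@subcell i j q)) z.2)) => //.
    move=> z; rewrite cr01/= (le_trans (le_ind _ _))// le_eqVlt; apply/orP; left; apply/eqP.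
    by apply: eq_bigr => q _; rewrite mulrC.
  rewrite /cell_gap; apply: ibound_sum => q; apply: (ibound_leW _ (rect _ q _ _ (measurableC (mQ q)) (mQ q))).
  rewrite (muf _ (mQ q)).2 gap.
  have [h|h] := leP (fine (mu (@subcell i j q))) (fine (nu (@subcell i j q))).
    by rewrite distrC ler_norm.
  by rewrite subrr.
Qed.

Lemma wasserstein_transport (p : R) (mu nu : probability V R) : 1 <= p <= 2 ->
  (\int[mu]_x (enorm x ^+ 2)%:E < +oo)%E -> (\int[nu]_x (enorm x ^+ 2)%:E < +oo)%E ->
  (wasserstein p mu nu <= (Num.sqrt (transport_cost mu nu))%:E)%E.
Proof.
move=> p12 mu2 nu2.
have [pi [cpl hpi]] := @measure_tree_coupling R _ V _ _ (@cell R m N L) (@coarsen m N L) L.+1 mu nu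
  measurable_cell (@coarsen_nested _ _ _) (@coarsen_top _ _ _).
have out0 (x : V) : 0 <= outer N x by rewrite /outer mulr_ge0// sqr_ge0.
have outfin (la : probability V R) : (\int[la]_x (enorm x ^+ 2)%:E < +oo)%E ->
    (\int[la]_x (outer N x)%:E)%E \is a fin_num.
  move=> h; rewrite ge0_fin_numE; last by apply: integral_ge0 => x _; rewrite lee_fin.
  apply: le_lt_trans h; apply: le_integral_nonmeas => x; rewrite lee_fin//.
  by rewrite /outer ler_piMr ?sqr_ge0//; case: (_ == _).
have b1 : ibound pi (fun z => outer N z.1) (fine (\int[mu]_x (outer N x)%:E)%E).
  split => [|//|].
    by apply: (measurableT_comp measurable_outer); exact: measurable_fst.
  rewrite fineK ?outfin// le_eqVlt; apply/orP; left; apply/eqP.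
  apply: (coupling_fst (f := fun x => (outer N x)%:E) cpl) => [x|]; first by rewrite lee_fin.
  by apply/measurable_EFinP; exact: measurable_outer.
have b2 : ibound pi (fun z => outer N z.2) (fine (\int[nu]_x (outer N x)%:E)%E).
  split => [|//|].
    by apply: (measurableT_comp measurable_outer); exact: measurable_snd.
  rewrite fineK ?outfin// le_eqVlt; apply/orP; left; apply/eqP.
  apply: (coupling_snd (f := fun x => (outer N x)%:E) cpl) => [x|]; first by rewrite lee_fin.
  by apply/measurable_EFinP; exact: measurable_outer.
have b3 j : ibound pi (fun z => (shell N z.1 == j)%:R) (fine (mu [set x | shell N x = j])).
  have ms := measurable_shell j.
  have e (x : V) : ((shell N x == j)%:R : R) = \1_[set x | shell N x = j] x.
    rewrite indicE; congr (nat_of_bool _)%:R; apply/eqP/idP => [h|/set_mem//]; exact/mem_set.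
  under eq_fun do rewrite e.
  split => //.
    by apply: measurableT_comp; [exact: measurable_indic|exact: measurable_fst].
  have -> := coupling_fst (f := fun x => (\1_[set x | shell N x = j] x)%:E) cpl.
  - by rewrite integral_indic// setIT fineK// fin_num_measure.
  - by move=> x; rewrite lee_fin.
  - by apply/measurable_EFinP; exact: measurable_indic.
have D0 : 0 <= transport_cost mu nu.
  rewrite /transport_cost; apply: addr_ge0; [apply: addr_ge0|].
  - apply: sumr_ge0 => j _; apply: mulr_ge0; first exact: exprn_ge0.
    apply: addr_ge0; [apply: addr_ge0|].
    + by rewrite !mulr_ge0 ?invr_ge0 ?exprn_ge0 ?fine_ge0 ?measure_ge0.
    + by apply: sumr_ge0 => i _; rewrite !mulr_ge0 ?invr_ge0 ?exprn_ge0 ?cell_gap_ge0.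
    + by rewrite !mulr_ge0 ?cell_gap_ge0.
  - by rewrite mulr_ge0// fine_ge0// integral_ge0// => x _; rewrite lee_fin.
  - by rewrite mulr_ge0// fine_ge0// integral_ge0// => x _; rewrite lee_fin.
apply: (wasserstein_le p12 D0 cpl).
have [] : ibound pi (fun z => \sum_(j < N) 4 ^+ j * (16 * m%:R / 4 ^+ L * (shell N z.1 == j)%:R +
     \sum_(i < L.+1) 64 * m%:R * (4 ^+ i / 4 ^+ L) * crossing N L i j z.1 z.2
     + 2 * m%:R * crossing N L L j z.2 z.1)
  + 2 * outer N z.1 + 2 * outer N z.2) (transport_cost mu nu).
  apply: iboundD; last by apply: iboundZ.
  apply: iboundD; last by apply: iboundZ.
  apply: ibound_sum => j; apply: iboundZ; first exact: exprn_ge0.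
  apply: iboundD; [apply: iboundD|].
  - by apply: iboundZ => //; rewrite !mulr_ge0 ?invr_ge0 ?exprn_ge0.
  - apply: ibound_sum => i; apply: iboundZ; first by rewrite !mulr_ge0 ?invr_ge0 ?exprn_ge0.
    by apply: (crossing_bound (ltn_ord j) _ cpl hpi).1; rewrite -ltnS.
  - apply: iboundZ; first by rewrite !mulr_ge0.
    exact: (crossing_bound (ltn_ord j) (leqnn L) cpl hpi).2.
move=> _ _; apply: le_trans; apply: le_integral_nonmeas => z; rewrite lee_fin ?sqr_ge0//.
exact: dist_le_cells.
Qed.

End Transport.

(** * Rate of convergence of empirical measures *)

Section EmpiricalRate.
Context {R : realType} {m : nat}.
Local Notation V := 'rV[R]_m.

Lemma sqr_sum_le (I : finType) (e : I -> R) : (\sum_i e i) ^+ 2 <= #|I|%:R * \sum_i e i ^+ 2.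
Proof.
rewrite expr2 mulr_suml.
apply: (@le_trans _ _ (\sum_i \sum_j (e i ^+ 2 + e j ^+ 2) / 2)).
  apply: ler_sum => i _; rewrite mulr_sumr; apply: ler_sum => j _.
  by have := sqr_ge0 (e i - e j); lra.
set S := \sum_i e i ^+ 2.
rewrite (eq_bigr (fun i => (#|I|%:R * e i ^+ 2 + S) / 2)).
  by rewrite -mulr_suml big_split/= sumr_const -mulr_sumr -[S *+ _]mulr_natl -/S; lra.
by move=> i _; rewrite -mulr_suml big_split/= sumr_const mulr_natl.
Qed.

Lemma empiricalE n (x : 'I_n.+1 -> V) A :
  fine (empirical x A) = n.+1%:R^-1 * \sum_k (\1_A (x k) : R).
Proof.
rewrite /empirical/mscale/=/msum ge0_sume_distrr//=.
rewrite (eq_bigr (fun i : 'I_n.+1 => (n.+1%:R^-1 * (\1_A (x i) : R))%:E)).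
  by rewrite sumEFin mulr_sumr.
by move=> i _; rewrite inord_val.
Qed.

Lemma integral_empirical n (x : 'I_n.+1 -> V) (f : V -> R) : measurable_fun setT f ->
  (forall z, 0 <= f z) ->
  (\int[empirical x]_z (f z)%:E = (n.+1%:R^-1 * \sum_k f (x k))%:E)%E.
Proof.
move=> mf f0; rewrite /empirical.
have mfE : measurable_fun setT (fun z => (f z)%:E) by exact/measurable_EFinP.
rewrite ge0_integral_mscale//; last by move=> z _; rewrite lee_fin.
rewrite ge0_integral_measure_sum//; last by move=> z _; rewrite lee_fin.
rewrite (eq_bigr (fun i : 'I_n.+1 => (f (x i))%:E)); first by rewrite sumEFin.
by move=> i _; rewrite integral_dirac// diracT mul1e inord_val.
Qed.

Section Moments.
Context (N L : nat) (nu : probability V R) (k M : R).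
Hypothesis (k2 : 2 < k) (M0 : 0 <= M).
Hypothesis hM : (\int[nu]_x (enorm x `^ k)%:E <= M%:E)%E.
Let S j := [set x : V | shell N x = j].

Let k0 : 0 < k. Proof. exact: lt_trans k2. Qed.

Lemma measurable_enorm_powR : measurable_fun setT (fun x : V => enorm x `^ k).
Proof. by apply: (measurableT_comp (measurable_powR k)); exact: measurable_enorm. Qed.

(** Markov's inequality: on shell j > 0 the norm exceeds 2^(j-1), and the shift from j - 1 to j
    costs 2^k. The summand 1 covers shell 0. *)
Lemma shell_mass j : fine (nu (S j)) <= (1 + M) * 2 `^ k * 2 `^ (- (k * j%:R)).
Proof.
have mS : measurable (S j) by exact: measurable_shell.
have p1 : 1 <= 2 `^ k :> R by rewrite -[leLHS](powRr0 2) ler_powR ?ler1n// ltW.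
case: j mS => [|j] mS.
  rewrite mulr0 oppr0 powRr0 mulr1; apply: (@le_trans _ _ 1).
    by rewrite -lee_fin fineK ?fin_num_measure// probability_le1.
  by rewrite -[leLHS]mulr1 ler_pM// lerDl.
rewrite -lee_fin fineK ?fin_num_measure//.
rewrite -[S _]setIT -integral_indic//.
apply: (@le_trans _ _ (\int[nu]_x ((2 `^ (- (k * j%:R)))%:E * (enorm x `^ k)%:E))%E).
  apply: le_integral_nonmeas => x; first by rewrite lee_fin.
  rewrite -EFinM lee_fin indicE; case: (boolP (x \in S _)) => [/set_mem xS|_]; last by rewrite mulr_ge0 ?powR_ge0.
  have := @supn_shell R m N x j; rewrite xS ltnSn => /(_ isT) h.
  have h2 : 2 `^ (k * j%:R) <= enorm x `^ k.
    rewrite mulrC powRrM powR_mulrn// ge0_ler_powR ?(ltW k0)// ?nnegrE ?exprn_ge0 ?enorm_ge0//.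
    by rewrite (le_trans (ltW h))// supn_le_enorm.
  change (1 <= 2 `^ (- (k * j%:R)) * enorm x `^ k).
  by rewrite powRN mulrC ler_pdivlMr ?powR_gt0// mul1r.
rewrite ge0_integralZl//=; last 2 first.
- by apply/measurable_EFinP; exact: measurable_enorm_powR.
- by move=> x _; rewrite lee_fin powR_ge0.
apply: (@le_trans _ _ ((2 `^ (- (k * j%:R)))%:E * M%:E)%E).
  by rewrite lee_wpmul2l// lee_fin powR_ge0.
rewrite -EFinM lee_fin.
have -> : - (k * j%:R) = k + - (k * j.+1%:R) by rewrite -natr1; ring.
rewrite powRD ?pnatr_eq0 ?implybT// mulrC mulrA ler_wpM2r ?powR_ge0// ler_wpM2r ?powR_ge0//; lra.
Qed.

(** In shell [N] the norm exceeds 2^(N-1), so its square is at most its k-th power times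
    2^(-(k-2)(N-1)). *)
Lemma outer_tail : (0 < N)%N -> (\int[nu]_x (outer N x)%:E <= (M * 2 `^ (- (k - 2) * N.-1%:R))%:E)%E.
Proof.
move=> N0; pose c : R := 2 `^ (- (k - 2) * N.-1%:R).
apply: (@le_trans _ _ (\int[nu]_x (c%:E * (enorm x `^ k)%:E))%E).
  apply: le_integral_nonmeas => x; first by rewrite lee_fin /outer mulr_ge0 ?sqr_ge0.
  rewrite -EFinM lee_fin /outer; case: eqP => xN; last by rewrite mulr0 mulr_ge0 ?powR_ge0.
  have := @supn_shell R m N x N.-1; rewrite xN (ltn_predL) N0 => /(_ isT) h.
  have e0 : 0 < enorm x by apply: lt_le_trans (supn_le_enorm x); apply: lt_trans h; rewrite exprn_gt0.
  have -> : enorm x ^+ 2 * true%:R = enorm x `^ (- (k - 2)) * enorm x `^ k.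
    rewrite -powRD; last by rewrite (gt_eqF e0) implybT.
    rewrite (_ : - (k - 2) + k = 2%:R); last by ring.
    by rewrite powR_mulrn ?mulr1// ltW.
  rewrite ler_wpM2r ?powR_ge0// /c mulNr !powRN lef_pV2 ?posrE ?powR_gt0//.
  rewrite mulrC powRrM powR_mulrn// ge0_ler_powR ?nnegrE ?exprn_ge0 ?(ltW e0)//.
    by rewrite subr_ge0 ltW.
  by rewrite (le_trans (ltW h))// supn_le_enorm.
rewrite ge0_integralZl//=; last 3 first.
- by apply/measurable_EFinP; exact: measurable_enorm_powR.
- by move=> x _; rewrite lee_fin powR_ge0.
- by rewrite lee_fin powR_ge0.
by rewrite mulrC EFinM lee_wpmul2l// lee_fin powR_ge0.
Qed.

Lemma subcell_mass i j : (j < N)%N -> (i <= L)%N ->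
  \sum_q fine (nu (@subcell R m N L i j q)) <= fine (nu (S j)).
Proof.
move=> jN iL; have mQ q : measurable (@subcell R m N L i j q) by exact: measurable_coarsen.
have mS : measurable (S j) by exact: measurable_shell.
rewrite -lee_fin -sumEFin fineK ?fin_num_measure//.
rewrite (eq_bigr (fun q => \int[nu]_x (\1_(@subcell R m N L i j q) x)%:E)%E); last first.
  by move=> q _; rewrite fineK ?fin_num_measure// integral_indic// setIT.
rewrite -ge0_integral_sum//=; last by move=> q; apply/measurable_EFinP; exact: measurable_indic.
rewrite -[S j]setIT -integral_indic//; apply: le_integral_nonmeas => x.
  by rewrite sumEFin lee_fin sumr_ge0.
rewrite sumEFin lee_fin.
have [/existsP[q /asboolP xq]|] := boolP [exists q, `[< @subcell R m N L i j q x >]].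
  rewrite (bigD1 q)//= big1 => [|q' q'q].
    rewrite addr0 indicE (mem_set xq) indicE mem_set//.
    exact: (subcell_shell jN iL xq).
  rewrite indicE memNset// => xq'; move: q'q; rewrite (subcell_uniq xq' xq) eqxx//.
rewrite negb_exists => /forallP h; rewrite big1 // => q _.
by rewrite indicE memNset// => xq; have := h q; rewrite asboolT.
Qed.

Context {d0 : measure_display} {X : measurableType d0} (P : probability X R).
Context (n : nat) (Y : 'I_n.+1 -> X -> V).
Hypothesis mY : forall l, measurable_fun setT (Y l).
Hypothesis lawY : forall l A, measurable A -> P (Y l @^-1` A) = nu A.
Hypothesis indY : forall l l' A, l != l' -> measurable A ->
  P (Y l @^-1` A `&` Y l' @^-1` A) = (nu A * nu A)%E.

(** In each cell the mean discrepancy is at most 2c, and its square at most c / (n+1) by the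
    variance bound. Summing the first over the cells gives the linear bound; Cauchy-Schwarz over the
    2^(m(L-i)) cells gives the quadratic one. *)
Lemma cell_gap_expectation i j : (j < N)%N -> (i <= L)%N -> exists dl,
  [/\ ibound P (fun w => @cell_gap R m N L i j nu (empirical (fun l => Y l w))) dl,
      0 <= dl <= 2 * fine (nu (S j)) &
      dl ^+ 2 <= (2 ^ (m * (L - i)))%:R / n.+1%:R * fine (nu (S j))].
Proof.
move=> jN iL; have mQ q : measurable (@subcell R m N L i j q) by exact: measurable_coarsen.
pose E q l : set X := Y l @^-1` (@subcell R m N L i j q).
have mE q l : measurable (E q l) by rewrite -[E q l]setTI; exact: mY.
pose c q := fine (nu (@subcell R m N L i j q)).
have c0 q : 0 <= c q by apply: fine_ge0; exact: measure_ge0.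
pose f q w := n.+1%:R^-1 * \sum_l (\1_(E q l) w : R) - c q.
have mf q : measurable_fun setT (f q).
  apply: measurable_funB; last exact: measurable_cst.
  apply: measurable_funM; first exact: measurable_cst.
  by apply: measurable_sum => l; exact: measurable_indic.
have ef q : (\int[P]_w ((f q w) ^+ 2)%:E <= (c q / n.+1%:R)%:E)%E /\
            (\int[P]_w `|f q w|%:E <= (2 * c q)%:E)%E.
  apply: empirical_frequency => [l//|l|l l' ll'].
    by rewrite /c fineK ?fin_num_measure//; exact: lawY.
  rewrite EFinM /c fineK ?fin_num_measure//; exact: indY.
pose e q := fine (\int[P]_w `|f q w|%:E)%E.
have eE q : (e q)%:E = (\int[P]_w `|f q w|%:E)%E.
  rewrite /e fineK// ge0_fin_numE; last by apply: integral_ge0 => w _; rewrite lee_fin.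
  by apply: le_lt_trans (ef q).2 _; rewrite ltry.
have e0 q : 0 <= e q by rewrite -lee_fin eE; apply: integral_ge0 => w _; rewrite lee_fin.
have e1 q : e q <= 2 * c q by rewrite -lee_fin eE (ef q).2.
have e2 q : e q ^+ 2 <= c q / n.+1%:R.
  have D0 : 0 <= c q / n.+1%:R by rewrite divr_ge0.
  have mfa : measurable_fun setT (fun w => `|f q w|) by exact: measurableT_comp.
  have := @Lp_le_L2 _ _ _ P 1 (c q / n.+1%:R) (fun w => `|f q w|).
  rewrite lexx ler1n => /(_ isT D0 mfa (fun w => normr_ge0 _)).
  under eq_integral do rewrite real_normK ?num_real//.
  move=> /(_ (ef q).1); rewrite invr1 poweRe1; last by apply: integral_ge0 => w _; rewrite lee_fin powR_ge0.
  under eq_integral do rewrite powRr1//.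
  rewrite -eE lee_fin => h.
  by rewrite -(sqr_sqrtr D0) lerXn2r ?nnegrE ?sqrtr_ge0.
exists (\sum_q e q); split.
- rewrite (_ : (fun w => _) = (fun w => \sum_q `|f q w|)).
    by apply: ibound_sum => q; split; [exact: measurableT_comp|move=> w; exact: normr_ge0|rewrite eE].
  apply/funext => w; apply: eq_bigr => q _; rewrite empiricalE distrC /f; congr (`| _ * _ - _ |).
- rewrite sumr_ge0//=; apply: (@le_trans _ _ (2 * \sum_q c q)).
    by rewrite mulr_sumr ler_sum.
  by rewrite ler_wpM2l// subcell_mass.
- apply: (le_trans (sqr_sum_le _)); rewrite card_ffun !card_ord -expnM mulnC -mulrA ler_wpM2l//.
  rewrite mulrC ler_pdivlMr// mulr_suml.
  apply: le_trans (subcell_mass jN iL); apply: ler_sum => q _.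
  by rewrite -ler_pdivlMr.
Qed.

End Moments.

(** As (q-2)/q < 1, the second term of the rate already exceeds 1/n; errors of order 1/n, such as
    the truncated tails, can be added freely. *)
Lemma rate_ge n (q : R) : 2 < q -> n.+1%:R^-1 <= rate n.+1 m q.
Proof.
move=> q2; have q0 : 0 < q by exact: lt_trans q2.
apply: (@le_trans _ _ (n.+1%:R `^ (- ((q - 2) / q)))).
  rewrite -[n.+1%:R^-1]powR_inv1// ler_powR ?ler1n// lerN2 ler_pdivrMr// mul1r; lra.
rewrite /rate lerDr; case: ifP => _; first exact: powR_ge0.
case: ifP => _; last exact: powR_ge0.
by rewrite mulr_ge0 ?powR_ge0// ln_ge0// lerDl.
Qed.

Lemma integral_law d0 (X : measurableType d0) (P : probability X R) (Y : X -> V)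
    (nu : probability V R) (f : V -> R) : measurable_fun setT Y ->
  (forall A, measurable A -> P (Y @^-1` A) = nu A) ->
  measurable_fun setT f -> (forall x, 0 <= f x) ->
  (\int[P]_w (f (Y w))%:E = \int[nu]_x (f x)%:E)%E.
Proof.
move=> mY hY mf f0.
rewrite -(@ge0_integral_pushforward _ _ _ _ R Y mY P setT (fun x => (f x)%:E))//=.
- by apply: eq_measure_integral => A mA _; exact: hY.
- exact/measurable_EFinP.
- by move=> x _; rewrite lee_fin.
Qed.

Lemma ibound_cst d0 (X : measurableType d0) (P : probability X R) (c : R) : 0 <= c -> ibound P (fun=> c) c.
Proof.
move=> c0; split; [exact: measurable_cst|by []|].
by rewrite integral_cst//= probability_setT mule1.
Qed.

(** The order of the quantifiers matters: [C] is independent of n, and the truncation [N] and the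
    depth [L] depend on n but not on the measure. One cost function then serves at all times and can
    be integrated over time. *)
Lemma empirical_transport_rate (k q : R) : (0 < m)%N -> 2 < q < k ->
  exists2 C : R, 0 <= C & forall n, exists N L, forall (nu : probability V R) (M : R), 0 <= M ->
  (\int[nu]_x (enorm x `^ k)%:E <= M%:E)%E ->
  forall (d0 : measure_display) (X : measurableType d0) (P : probability X R)
    (Y : 'I_n.+1 -> X -> V),
  (forall l, measurable_fun setT (Y l)) ->
  (forall l A, measurable A -> P (Y l @^-1` A) = nu A) ->
  (forall l l' A, l != l' -> measurable A ->
    P (Y l @^-1` A `&` Y l' @^-1` A) = (nu A * nu A)%E) ->
  ibound P (fun w => transport_cost N L nu (empirical (fun l => Y l w)))
    (C * (1 + M) * rate n.+1 m q).
Proof.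
move=> m0 qk; have /andP[q2 qk'] := qk.
have k2 : 2 < k by exact: lt_trans qk'.
have [C C0 hC] := rate_sum qk m0.
exists (66 * m%:R * C * 2 `^ k + 4); first by rewrite addr_ge0// !mulr_ge0 ?powR_ge0.
move=> n; have [L hL] := hC n.+1 (ltn0Sn n).
(* The shells stop where the tail of the second moment, relative to [M], is below 1/(n+1). *)
have [N N0 hN] : exists2 N, (0 < N)%N & 2 `^ (- (k - 2) * N.-1%:R) <= n.+1%:R^-1.
  have s1 : 2 `^ (- (k - 2)) < 1 by rewrite powR2_lt1// oppr_lt0 subr_gt0.
  have : (2 `^ (- (k - 2))) ^+ n0 @[n0 --> \oo] --> (0 : R).
    by apply: cvg_expr; rewrite ger0_norm ?powR_ge0.
  move/cvgrPdist_le => /(_ n.+1%:R^-1); rewrite invr_gt0 ltr0n => /(_ isT)[N _ hN].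
  exists N.+1 => //=; have := hN N (leqnn N).
  by rewrite /= sub0r normrN ger0_norm ?exprn_ge0 ?powR_ge0// expr_powR.
exists N, L => nu M M0 hM d0 X P Y mY lawY indY.
have B1 : 1 <= (1 + M) * 2 `^ k.
  have p1 : 1 <= 2 `^ k :> R by rewrite -[leLHS](powRr0 2) ler_powR ?ler1n// ltW// (lt_trans _ k2).
  by rewrite -[leLHS]mulr1 ler_pM// lerDl.
pose ok (j : nat) := fun dli : nat -> R => forall i, (j < N)%N -> (i <= L)%N ->
  [/\ ibound P (fun w => @cell_gap R m N L i j nu (empirical (fun l => Y l w))) (dli i),
      0 <= dli i <= 2 * fine (nu [set x | shell N x = j]) &
      dli i ^+ 2 <= (2 ^ (m * (L - i)))%:R / n.+1%:R * fine (nu [set x | shell N x = j])].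
have [dl hdl] : {dl : nat -> nat -> R & forall j, ok j (dl j)}.
  apply: (@choice _ _ ok) => j.
  have /choice[f hf] : forall i, exists x : R, (j < N)%N -> (i <= L)%N ->
    [/\ ibound P (fun w => @cell_gap R m N L i j nu (empirical (fun l => Y l w))) x,
      0 <= x <= 2 * fine (nu [set x | shell N x = j]) &
      x ^+ 2 <= (2 ^ (m * (L - i)))%:R / n.+1%:R * fine (nu [set x | shell N x = j])].
    move=> i; have [/andP[jN iL]|h] := boolP ((j < N) && (i <= L))%N.
      by have [x hx] := @cell_gap_expectation N L nu d0 X P n Y mY lawY indY i j jN iL; exists x.
    by exists 0 => jN iL; move: h; rewrite jN iL.
  by exists f => i; exact: hf.
pose v j := fine (nu [set x : V | shell N x = j]).
have h1 j : (j < N)%N -> 0 <= v j <= (1 + M) * 2 `^ k * 2 `^ (- (k * j%:R)).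
  by move=> jN; rewrite fine_ge0 ?measure_ge0//= shell_mass.
(* The summation lemma counts levels from the coarsest, [coarsen] from the finest; hence [L - l]. *)
have h2 l j : (l <= L)%N -> (j < N)%N -> 0 <= dl j (L - l)%N <= 2 * v j /\
    dl j (L - l)%N ^+ 2 <= (2 ^ (m * l))%:R / n.+1%:R * v j.
  move=> lL jN; have [_ h3 h4] := hdl j (L - l)%N jN (leq_subr _ _).
  by split => //; move: h4; rewrite subKn.
have := hL _ N v (fun l j => dl j (L - l)%N) B1 h1 h2; rewrite /v {h1 h2 v}.
move=> hS.
set tail := M * n.+1%:R^-1.
have tail0 : 0 <= tail by rewrite mulr_ge0// invr_ge0.
have tailE : (\int[nu]_x (outer N x)%:E <= tail%:E)%E.
  by apply: le_trans (outer_tail k2 hM N0) _; rewrite lee_fin ler_wpM2l.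
have out0 (x : V) : 0 <= outer N x by rewrite /outer mulr_ge0// sqr_ge0.
have mout := measurable_outer (R := R) (m := m) N 0%N.
have out_nu : fine (\int[nu]_x (outer N x)%:E)%E <= tail.
  rewrite -lee_fin fineK// ge0_fin_numE; last by apply: integral_ge0 => x _; rewrite lee_fin.
  by apply: le_lt_trans tailE _; rewrite ltry.
pose S := \sum_(j < N) 4 ^+ j * (16 * m%:R / 4 ^+ L * fine (nu [set x | shell N x = j]) +
     \sum_(i < L.+1) 64 * m%:R * (4 ^+ i / 4 ^+ L) * dl j i + 2 * m%:R * dl j L).
have Sb : ibound P (fun w => transport_cost N L nu (empirical (fun l => Y l w))) (S + 2 * tail + 2 * (n.+1%:R^-1 * \sum_(l < n.+1) tail)).
  rewrite /transport_cost.
  apply: iboundD; [apply: iboundD|].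
  - apply: ibound_sum => j; apply: iboundZ; first exact: exprn_ge0.
    apply: iboundD; [apply: iboundD|].
    + by apply: ibound_cst; rewrite !mulr_ge0 ?invr_ge0 ?exprn_ge0 ?fine_ge0 ?measure_ge0.
    + apply: ibound_sum => i; apply: iboundZ; first by rewrite !mulr_ge0 ?invr_ge0 ?exprn_ge0.
      by case: (hdl j i (ltn_ord j)) => //; rewrite -ltnS.
    + apply: iboundZ; first by rewrite !mulr_ge0.
      by case: (hdl j L (ltn_ord j)).
  - apply: ibound_leW (ibound_cst P _); first by rewrite ler_wpM2l// out_nu.
    by rewrite mulr_ge0// fine_ge0// integral_ge0// => x _; rewrite lee_fin.
  - apply: iboundZ => //; rewrite (_ : (fun _ => _) = (fun w => n.+1%:R^-1 * \sum_(l < n.+1) outer N (Y l w))).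
      apply: iboundZ; first by rewrite invr_ge0.
      apply: ibound_sum => l; split; [exact: (measurableT_comp mout (mY l))|by []|].
      by rewrite (integral_law (mY l) (lawY l) mout out0).
    by apply/funext => w; rewrite integral_empirical.
apply: ibound_leW Sb.
have -> : n.+1%:R^-1 * \sum_(l < n.+1) tail = tail.
  by rewrite sumr_const card_ord -[tail *+ _]mulr_natl mulrA mulVf ?mul1r// pnatr_eq0.
have tr : tail <= (1 + M) * rate n.+1 m q.
  by rewrite /tail ler_pM ?invr_ge0//; [lra|exact: rate_ge].
have d0' j i : (j < N)%N -> (i <= L)%N -> 0 <= dl j i.
  by move=> jN iL; have [_ /andP[]] := hdl j i jN iL.
have pw a b : (b <= a)%N -> 4 ^+ (a - b) / 4 ^+ a = 4 ^- b :> R.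
  by move=> ba; rewrite -{2}(subnK ba) exprD invfM mulrA divff ?expf_neq0// mul1r.
(* 66 = 64 + 2: the extra crossing at level [L] joins the term l = 0 of the sum over levels. *)
have : S <= 66 * m%:R * (C * ((1 + M) * 2 `^ k) * rate n.+1 m q).
  apply: (@le_trans _ _ (66 * m%:R * (\sum_(j < N) 4 ^+ j * (4 ^- L * fine (nu [set x | shell N x = j]) + \sum_(l < L.+1) 4 ^- l * dl j (L - l)%N)))); last first.
    by rewrite ler_wpM2l// mulr_ge0.
  rewrite /S mulr_sumr ler_sum// => j _.
  rewrite mulrCA ler_wpM2l ?exprn_ge0//.
  set v := fine _; have v0 : 0 <= v by rewrite fine_ge0// measure_ge0.
  have -> : \sum_(i < L.+1) 64 * m%:R * (4 ^+ i / 4 ^+ L) * dl j i = 64 * m%:R * \sum_(l < L.+1) 4 ^- l * dl j (L - l)%N.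
    rewrite (reindex_inj rev_ord_inj)/= mulr_sumr; apply: eq_bigr => i _.
    rewrite subSS -!mulrA; congr (_ * (_ * _)); rewrite mulrA; congr (_ * _).
    have iL : (i <= L)%N by rewrite -ltnS.
    exact: pw.
  rewrite big_ord_recl/= expr0 invr1 mul1r subn0.
  set Sg := \sum_(_ < _) _.
  have Sg0 : 0 <= Sg by apply: sumr_ge0 => i _; rewrite mulr_ge0 ?invr_ge0 ?exprn_ge0// d0' ?leq_subr.
  have D0 : 0 <= dl j L by rewrite d0'.
  have : 0 <= 4 ^- L * v by rewrite mulr_ge0 ?invr_ge0 ?exprn_ge0.
  set u := 4 ^- L * v => u0.
  have -> : 16 * m%:R / 4 ^+ L * v = 16 * m%:R * u by rewrite /u mulrA.
  rewrite -subr_ge0 (_ : _ - _ = m%:R * (50 * u + 2 * Sg)); last by ring.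
  by rewrite mulr_ge0// addr_ge0// mulr_ge0.
move: tr; set r := rate _ _ _ => tr h.
have -> : (66 * m%:R * C * 2 `^ k + 4) * (1 + M) * r = 66 * m%:R * (C * ((1 + M) * 2 `^ k) * r) + 4 * ((1 + M) * r) by ring.
by rewrite -addrA lerD//; lra.
Qed.

End EmpiricalRate.

Section ComparisonSets.
Context {R : realType} {d0 : measure_display} {X : measurableType d0}.
Variables (f g : X -> R).
Hypotheses (mf : measurable_fun setT f) (mg : measurable_fun setT g).

Lemma measurable_le_set : measurable [set x | f x <= g x].
Proof.
have h : measurable_fun setT (fun x => f x <= g x) by exact: measurable_fun_ler.
by rewrite -[X in measurable X]setTI; exact: (h measurableT [set true]).
Qed.

Lemma measurable_lt_set : measurable [set x | f x < g x].
Proof.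
have h : measurable_fun setT (fun x => f x < g x) by exact: measurable_fun_ltr.
by rewrite -[X in measurable X]setTI; exact: (h measurableT [set true]).
Qed.

End ComparisonSets.

(** * Increments of the noise and stochastic integrals *)

Section NormalMoments.
Context {R : realType}.
Local Notation leb := (@lebesgue_measure R).

(** Write f(x) as the length of the interval [0, f(x)[ and exchange the integrals; this leaves the
    normal measure of a set, which is the integral of the density by definition. *)
Lemma integral_normal_prob (s : R) (f : R -> R) : measurable_fun setT f -> (forall x, 0 <= f x) ->
  (\int[normal_prob 0 s]_x (f x)%:E = \int[leb]_x (f x * normal_pdf 0 s x)%:E)%E.
Proof.
move=> mf f0.
pose A : set (R * R) := [set z | 0 <= z.2] `&` [set z | z.2 < f z.1].
have mf1 : measurable_fun setT (fun z : R * R => f z.1) by apply: measurableT_comp => //; exact: measurable_fst.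
have mA : measurable A.
  apply: measurableI; first exact: measurable_le_set.
  by apply: measurable_lt_set.
have lam x : (\int[leb]_y (\1_A (x, y))%:E = (f x)%:E)%E.
  transitivity (\int[leb]_(y in `[0%R, f x[) 1%E)%E.
    rewrite [RHS]integral_mkcond; apply: eq_integral => y _; rewrite patchE indicE; case: ifPn => [/set_mem/=|].
      by rewrite in_itv/= => /andP[h1 h2]; rewrite mem_set.
    move=> h; rewrite memNset// => -[/= h1 h2]; move/negP: h; apply; apply/mem_set => /=.
    by rewrite in_itv/= h1.
  rewrite integral_cst//= lebesgue_measure_itv/= mul1e lte_fin.
  by rewrite oppr0 adde0; case: ltP => // h; congr _%:E; apply/eqP; rewrite eq_le f0.
under eq_integral do rewrite -lam.
rewrite (@fubini_tonelli _ _ _ _ _ (normal_prob 0 s) leb (fun z => (\1_A z)%:E))//; last first.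
  by apply/measurable_EFinP; exact: measurable_indic.
transitivity (\int[leb]_y \int[leb]_x ((\1_A (x, y) * normal_pdf 0 s x)%:E))%E.
  apply: eq_integral => y _.
  have mAy : measurable (ysection A y) by exact: measurable_ysection.
  rewrite (_ : (fun x => (\1_A (x, y))%:E) = (fun x => (\1_(ysection A y) x)%:E)); last first.
    by apply/funext => x; rewrite !indicE -mem_ysection.
  rewrite integral_indic// setIT /normal_prob [LHS]integral_mkcond; apply: eq_integral => x _.
  by rewrite patchE indicE -mem_ysection; case: ifP; rewrite ?mul1r ?mul0r.
have mp := @measurable_normal_pdf R 0 s.
rewrite -(@fubini_tonelli _ _ _ _ _ leb leb (fun z => (\1_A z * normal_pdf 0 s z.1)%:E)); last 2 first.
- apply/measurable_EFinP/measurable_funM; first exact: measurable_indic.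
  by apply: measurableT_comp => //; exact: measurable_fst.
- by move=> z; rewrite lee_fin mulr_ge0// normal_pdf_ge0.
apply: eq_integral => x _.
transitivity ((normal_pdf 0 s x)%:E * \int[leb]_y (\1_A (x, y))%:E)%E; last by rewrite lam -EFinM mulrC.
have mAx : measurable_fun setT (fun y : R => (\1_A (x, y) : R)).
  by apply: measurableT_comp; [exact: measurable_indic|exact: measurable_pair1].
rewrite -ge0_integralZl//.
- by apply: eq_integral => y _; rewrite -EFinM mulrC.
- exact/measurable_EFinP.
- by rewrite lee_fin normal_pdf_ge0.
Qed.

Context (s : R) (s0 : 0 < s).
Let p := normal_pdf 0 s.
Let p0 x : 0 <= p x. Proof. exact: normal_pdf_ge0. Qed.
Let cp : continuous p. Proof. by apply: continuous_normal_pdf; rewrite gt_eqF. Qed.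
Let pE x : p x = normal_peak s * expR (- x ^+ 2 / (s ^+ 2 *+ 2)).
Proof. by rewrite /p normal_pdfE ?gt_eqF// /normal_fun subr0. Qed.

Let dp (x : R) : is_derive x 1 (fun x => - s ^+ 2 * p x) (x * p x).
Proof.
rewrite (_ : (fun x => _) = (fun x => - s ^+ 2 * (normal_peak s * expR (- x ^+ 2 / (s ^+ 2 *+ 2))))); last first.
  by apply/funext => y; rewrite pE.
apply: is_derive_eq.
rewrite pE scaler0 add0r.
transitivity (- s ^+ 2 * (normal_peak s * (expR (- x ^+ 2 / (s ^+ 2 *+ 2)) * ((s ^+ 2 *+ 2)^-1 * - (x * 1 + x * 1))))) => //.
have : s != 0 by rewrite gt_eqF.
by move=> ?; field.
Qed.

Let p_cvg0 : p x @[x --> +oo] --> (0 : R).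
Proof.
rewrite (_ : p = (fun x => normal_peak s * gauss_fun (x * (Num.sqrt (s ^+ 2 *+ 2))^-1))).
  rewrite -[X in _ --> X](mulr0 (normal_peak s)); apply: cvgM; first exact: cvg_cst.
  apply: (cvg_comp _ gauss_fun); last exact: cvg_gauss_fun.
  by apply: gt0_cvgMly => //; rewrite invr_gt0 sqrtr_gt0 mulrn_wgt0// exprn_gt0.
apply/funext => x; rewrite pE /gauss_fun exprMn exprVn sqr_sqrtr ?mulNr//.
by rewrite mulrn_wge0// sqr_ge0.
Qed.

(** An antiderivative of x p(x) is -s^2 p(x), which vanishes at infinity. *)
Let half_mean y : 0 <= y -> (\int[leb]_(x in `[y, +oo[) (x * p x)%:E = (s ^+ 2 * p y)%:E)%E.
Proof.
move=> y0.
rewrite (@ge0_continuous_FTC2y _ _ (fun x => - s ^+ 2 * p x) y 0).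
- by rewrite -EFinB sub0r mulNr opprK.
- by move=> x yx; rewrite mulr_ge0// (le_trans y0).
- by apply: continuous_subspaceT => x; apply: cvgM; [exact: cvg_id|exact: cp].
- by rewrite -[X in _ --> X](mulr0 (- s ^+ 2)); apply: cvgM; [exact: cvg_cst|exact: p_cvg0].
- by move=> x _; have [] := dp x.
- by apply: cvg_at_right_filter; apply: cvgM; [exact: cvg_cst|exact: cp].
- by move=> x _; rewrite derive1E; have [_ ->] := dp x.
Qed.

Let p_even x : p (- x) = p x. Proof. by rewrite !pE sqrrN. Qed.

(** One factor x of x^2 is the integral of 1 over [0, x]. After exchanging the integrals,
    [half_mean] evaluates the inner one, which replaces an integration by parts. *)
Let half_var : (\int[leb]_(x in `[0%R, +oo[) (x ^+ 2 * p x)%:E = (s ^+ 2)%:E * \int[leb]_(x in `[0%R, +oo[) (p x)%:E)%E.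
Proof.
pose A : set (R * R) := [set z | 0 <= z.2] `&` [set z | z.2 <= z.1].
have mA : measurable A.
  apply: measurableI; first exact: measurable_le_set.
  by apply: measurable_le_set.
have mp := @measurable_normal_pdf R 0 s.
have mp1 : measurable_fun setT (fun z : R * R => z.1 * p z.1).
  by apply: measurable_funM; [|apply: measurableT_comp => //]; exact: measurable_fst.
pose f z := (\1_A z * (z.1 * p z.1))%:E.
have mf : measurable_fun setT f.
  by apply/measurable_EFinP/measurable_funM => //; exact: measurable_indic.
have f0 z : (0 <= f z)%E.
  rewrite /f lee_fin indicE; case: (boolP (z \in A)) => [/set_mem[/= h1 h2]|_]; last by rewrite mul0r.
  by rewrite mul1r mulr_ge0// (le_trans h1).
transitivity (\int[leb]_x \int[leb]_y f (x, y))%E.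
  rewrite integral_mkcond; apply: eq_integral => x _; rewrite patchE; case: ifPn => [/set_mem/=|].
    rewrite in_itv/= andbT => x0.
    transitivity (\int[leb]_(y in `[0%R, (x : R)]) (x * p x)%:E)%E.
      rewrite integral_cst//= lebesgue_measure_itv/= lte_fin.
      case: ltP => [_|h]; first by rewrite oppr0 adde0 -EFinM; congr _%:E; ring.
      have -> : x = 0 by apply/eqP; rewrite eq_le h x0.
      by rewrite mul0r mul0e expr0n mul0r.
    rewrite integral_mkcond; apply: eq_integral => y _; rewrite patchE /f indicE.
    case: ifPn => [/set_mem/=|]; first by rewrite in_itv/= => /andP[h1 h2]; rewrite mem_set ?mul1r.
    move=> h; rewrite memNset ?mul0r// => -[/= h1 h2]; move/negP: h; apply; apply/mem_set => /=.
    by rewrite in_itv/= h1.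
  move=> h; rewrite integral0_eq// => y _; rewrite /f indicE memNset ?mul0r// => -[/= h1 h2].
  by move/negP: h; apply; apply/mem_set; rewrite /= in_itv/= andbT (le_trans h1).
rewrite fubini_tonelli// -ge0_integralZl//=; last 3 first.
- by apply/measurable_EFinP; apply: measurable_funTS.
- by move=> x _; rewrite lee_fin.
- by rewrite lee_fin sqr_ge0.
rewrite [RHS]integral_mkcond; apply: eq_integral => y _; rewrite patchE; case: ifPn => [/set_mem/=|].
  rewrite in_itv/= andbT => y0; rewrite -EFinM -half_mean// [RHS]integral_mkcond.
  apply: eq_integral => x _; rewrite patchE /f indicE; case: ifPn => [/set_mem/=|].
    by rewrite in_itv/= andbT => h; rewrite mem_set ?mul1r.
  move=> h; rewrite memNset ?mul0r// => -[/= h1 h2]; move/negP: h; apply; apply/mem_set => /=.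
  by rewrite in_itv/= h2.
move=> h; rewrite integral0_eq// => x _; rewrite /f indicE memNset ?mul0r// => -[/= h1 h2].
by move/negP: h; apply; apply/mem_set; rewrite /= in_itv/= andbT.
Qed.

Lemma normal_second_moment : (\int[normal_prob 0 s]_x (x ^+ 2)%:E = (s ^+ 2)%:E)%E.
Proof.
have mp := @measurable_normal_pdf R 0 s.
rewrite integral_normal_prob//; last first.
- by move=> x; exact: sqr_ge0.
have T0 : [set x : R | 0 <= x] = `[0, +oo[%classic.
  by apply/seteqP; split => x /=; rewrite in_itv/= andbT.
rewrite ge0_symfun_integralT//; last 3 first.
- by move=> x; rewrite mulr_ge0 ?sqr_ge0// p0.
- by move=> x; apply: cvgM; [exact: sqr_continuous|exact: cp].
- by move=> x; rewrite /= sqrrN -/p p_even.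
rewrite T0 half_var muleCA -T0 -ge0_symfun_integralT//; last by move=> x /=; rewrite p_even.
by rewrite integral_normal_pdf mule1.
Qed.

Lemma sqint_normal : sqint (normal_prob 0 s) id.
Proof. by split => //; rewrite normal_second_moment ltry. Qed.

Lemma normal_mean : (\int[normal_prob 0 s]_x x%:E = 0)%E.
Proof.
have mp := @measurable_normal_pdf R 0 s.
have mpos : measurable_fun setT (fun x : R => Num.max x 0) by exact: measurable_maxr.
have mneg : measurable_fun setT (fun x : R => Num.max (- x) 0) by apply: measurable_maxr => //; exact: measurable_oppr.
have maxge (x : R) : 0 <= Num.max x 0 by rewrite le_max lexx orbT.
rewrite integralE.
have -> : (\int[normal_prob 0 s]_x (EFin^\+)%E x = \int[normal_prob 0 s]_x (Num.max x 0)%:E)%E.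
  by apply: eq_integral => x _; rewrite funeposE EFin_max.
have -> : (\int[normal_prob 0 s]_x (EFin^\-)%E x = \int[normal_prob 0 s]_x (Num.max (- x) 0)%:E)%E.
  by apply: eq_integral => x _; rewrite funenegE EFin_max.
rewrite !integral_normal_prob//.
have -> : (\int[leb]_x (Num.max x 0 * normal_pdf 0 s x)%:E = (s ^+ 2 * p 0)%:E)%E.
  rewrite -half_mean// [RHS]integral_mkcond; apply: eq_integral => x _; rewrite patchE.
  case: ifPn => [/set_mem/=|]; first by rewrite in_itv/= andbT => h; rewrite max_l.
  by move=> /negP h; rewrite max_r ?mul0r// leNgt; apply/negP => x0; apply: h; apply/mem_set; rewrite /= in_itv/= andbT ltW.
have -> : (\int[leb]_x (Num.max (- x) 0 * normal_pdf 0 s x)%:E = (s ^+ 2 * p 0)%:E)%E.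
  rewrite -half_mean//.
  transitivity (\int[leb]_(x in `[0%R, +oo[) (((fun x => - x * p x) \o -%R) x)%:E)%E.
    rewrite -ge0_integration_by_substitutionNy; last 2 first.
    - by apply: continuous_subspaceT => x; apply: cvgM; [apply: cvgN; exact: cvg_id|exact: cp].
    - by move=> x; rewrite in_itv/= oppr0 => x0; rewrite mulr_ge0// oppr_ge0 ltW.
    rewrite oppr0 [RHS]integral_mkcond; apply: eq_integral => x _; rewrite patchE.
    case: ifPn => [/set_mem/=|]; first by rewrite in_itv/= => h; rewrite max_l// oppr_ge0.
    move=> /negP h; rewrite max_r ?mul0r// oppr_le0 leNgt; apply/negP => x0; apply: h; apply/mem_set.
    by rewrite /= in_itv/= ltW.
  by apply: eq_integral => x _ /=; rewrite opprK p_even.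
by rewrite subee.
Qed.

End NormalMoments.

Section SubSigmaAlgebra.
Context {X : pointedType}.
Implicit Types G : set (set X).

Definition smeas G dV (V : measurableType dV) (f : X -> V) :=
  measurable_fun setT (f : g_sigma_algebraType G -> V).

Lemma smeas_sub G G' dV (V : measurableType dV) (f : X -> V) :
  G `<=` <<s G' >> -> smeas G f -> smeas G' f.
Proof.
move=> GG' mf _ B mB; apply: (smallest_sub _ GG') => //; last exact: mf.
exact: smallest_sigma_algebra.
Qed.

End SubSigmaAlgebra.

Lemma smeas_measurable {d0} {X : measurableType d0} (G : set (set X)) dV (V : measurableType dV)
    (f : X -> V) : G `<=` measurable -> smeas G f -> measurable_fun setT f.
Proof.
move=> GG' mf _ B mB.
have : <<s G >> (setT `&` f @^-1` B) by exact: mf.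
by apply: smallest_sub => //; exact: sigma_algebra_measurable.
Qed.

Lemma ae_set_eq {R : realType} {d0} {X : measurableType d0} (P : probability X R) (A B : set X) :
  measurable A -> measurable B -> {ae P, forall w, A w <-> B w} -> P A = P B.
Proof.
move=> mA mB AB; rewrite -[A]setIT -[B]setIT -!integral_indic//.
apply: ae_eq_integral => //; try by apply/measurable_EFinP; exact: measurable_indic.
apply: filterS AB => w h _; rewrite !indicE; congr (_%:R%:E).
by have -> : (w \in A) = (w \in B) by apply/idP/idP => /set_mem/h/mem_set.
Qed.

Section IndependentProduct.
Context {R : realType} {d0 : measure_display} {Omega : measurableType d0} (P : probability Omega R).
Context {dV : measure_display} {V : measurableType dV}.
Variables (X : Omega -> R) (Y : Omega -> V) (m2 : probability V R) (f : V -> R).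
Hypotheses (mX : measurable_fun setT X) (mY : measurable_fun setT Y) (mf : measurable_fun setT f).
Hypothesis hind : forall (A : set R) (B : set V), measurable A -> measurable B ->
  P (X @^-1` A `&` Y @^-1` B) = (P (X @^-1` A) * m2 B)%E.
Hypothesis iX : P.-integrable setT (EFin \o X).
Hypothesis jf : m2.-integrable setT (EFin \o f).

(** The hypothesis on rectangles identifies the joint law of (X, Y) with the product of the law of
    [X] and [m2]; the expectation then splits by Fubini. *)
Lemma indep_integral : P.-integrable setT (fun w => (X w * f (Y w))%:E) /\
  (\int[P]_w (X w * f (Y w))%:E = \int[P]_w (X w)%:E * \int[m2]_y (f y)%:E)%E.
Proof.
have mZ : measurable_fun setT (fun w => (X w, Y w)) by exact: measurable_fun_pair.
pose X' : {RV P >-> R} := HB.pack X (isMeasurableFun.Build _ _ _ _ _ mX).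
pose Z' : {RV P >-> (R * V)%type} := HB.pack (fun w => (X w, Y w)) (isMeasurableFun.Build _ _ _ _ _ mZ).
pose m1 := distribution P X'.
have hm C : measurable C -> (m1 \x m2)%E C = distribution P Z' C.
  by apply: product_measure_unique => A B mA mB; exact: hind.
pose F (z : R * V) := (z.1 * f z.2)%:E.
have mF : measurable_fun setT F.
  apply/measurable_EFinP; apply: measurable_funM; first exact: measurable_fst.
  by apply: measurableT_comp => //; exact: measurable_snd.
have mXa : measurable_fun setT (fun x : R => `|x|%:E).
  by apply/measurable_EFinP; exact: normr_measurable.
have mfa : measurable_fun setT (fun x : V => `|f x|%:E).
  by apply/measurable_EFinP; exact: measurableT_comp.
pose c := (\int[m2]_y `|f y|%:E)%E.
have cfin : (c < +oo)%E by have /integrableP[_] := jf.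
have c0 : (0 <= c)%E by apply: integral_ge0 => y _; rewrite lee_fin.
have iF : (m1 \x m2)%E.-integrable setT F.
  apply/integrable12ltyP => //.
  under eq_integral => x _.
    under eq_integral do rewrite /F/= normrM EFinM.
    rewrite ge0_integralZl//.
    over.
  rewrite ge0_integralZr// ge0_integral_distribution//.
  have /integrableP[_ h] := iX.
  have a0 : (0 <= \int[P]_x ((fun y : R => `|y|%:E) \o X') x)%E by apply: integral_ge0 => w _; rewrite lee_fin.
  by apply: lte_mul_pinfty => //; rewrite ge0_fin_numE.
have nF : (\int[distribution P Z']_z `|F z| < +oo)%E.
  have /integrableP[_] := iF; rewrite (@eq_measure_integral _ _ _ _ (distribution P Z'))// => A mA _.
  exact: hm.
have iFZ : P.-integrable setT (fun w => (X w * f (Y w))%:E).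
  apply/integrableP; split.
    by apply/measurable_EFinP; apply: measurable_funM => //; exact: measurableT_comp.
  move: nF; rewrite ge0_integral_distribution//.
  exact: measurableT_comp.
split => //.
transitivity (\int[distribution P Z']_z F z)%E.
  by rewrite [RHS](@integral_pushforward _ _ _ _ _ _ mZ P setT F).
rewrite (@eq_measure_integral _ _ _ _ (m1 \x m2)%E); last by move=> A mA _; apply/esym; exact: hm.
rewrite -integral12_prod_meas1//.
have fin2 : (\int[m2]_y (f y)%:E)%E \is a fin_num by exact: integrable_fin_num.
transitivity (\int[m1]_x (x%:E * \int[m2]_y (f y)%:E))%E.
  apply: eq_integral => x _; rewrite -integralZl//; apply: eq_integral => y _.
have iX1 : m1.-integrable setT (fun x : R => x%:E).
  by apply: (@integrable_pushforward _ _ _ _ _ _ mX P setT) => //; exact/measurable_EFinP.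
rewrite -(fineK fin2) integralZr//; congr (_ * _)%E.
by rewrite [LHS](@integral_pushforward _ _ _ _ _ _ mX P setT)//; exact/measurable_EFinP.
Qed.

End IndependentProduct.

Section Noise.
Context {R : realType} {T : R} {d : nat} {mu : probability (cpath T d) R}.
Hypothesis hmu : is_wiener mu.
Context {d0 : measure_display} {Omega : measurableType d0} {P : probability Omega R}.
Hypothesis cP : measure_is_complete P.
Variable W : nat -> {RV P >-> cpath T d}.
Hypothesis lawW : forall i A, measurable A -> distribution P (W i) A = mu A.
Hypothesis indW : mutually_independent W.
Variable n : nat.
Local Notation NF := (noise_filtration W n.+1).
Local Notation cyl := (@cylinders R T d).

Lemma cyl_le s t : s <= t -> <<s cyl s >> `<=` <<s cyl t >>.
Proof.
move=> st; apply: sub_sigma_algebra2 => _ [u [B [/andP[u0 us] mB ->]]].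
by exists u, B; split => //; rewrite u0 (le_trans us).
Qed.

Lemma cylT s : <<s cyl s >> setT.
Proof. exact: (@measurableT _ (g_sigma_algebraType (cyl s))). Qed.

Lemma cyl_measurable s : s <= T -> <<s cyl s >> `<=` measurable.
Proof. exact: cyl_le. Qed.

Lemma smeas_eval s t l : 0 <= t <= s -> smeas (cyl s) (fun x : cpath T d => x t 0 l).
Proof.
move=> ts; have h : smeas (cyl s) (fun x : cpath T d => x t).
  by move=> _ B mB; rewrite setTI; apply: sub_sigma_algebra; exists t, B.
exact: (measurableT_comp (measurable_coord 0 l) h).
Qed.

Lemma measurable_eval t l : 0 <= t <= T -> measurable_fun setT (fun x : cpath T d => x t 0 l).
Proof. by move=> tT; exact: (smeas_eval l tT). Qed.

Lemma measurable_noise i : measurable_fun setT (W i : Omega -> cpath T d).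
Proof. exact: measurable_funPT. Qed.

Definition incr (k : nat * 'I_d) (s t : R) (w : Omega) : R := W k.1 w t 0 k.2 - W k.1 w s 0 k.2.

Lemma measurable_incr k s t : 0 <= s <= T -> 0 <= t <= T -> measurable_fun setT (incr k s t).
Proof.
move=> sT tT; apply: measurable_funB.
  exact: (measurableT_comp (measurable_eval k.2 tT) (measurable_noise k.1)).
exact: (measurableT_comp (measurable_eval k.2 sT) (measurable_noise k.1)).
Qed.

Lemma noise_measurable t : t <= T -> NF t `<=` measurable.
Proof.
move=> tT A [[i _ [C [u [B [/andP[u0 ut] mB ->]]] <-]]|nA]; last exact: cP.
rewrite -[X in measurable X]setTI; apply: (measurable_noise i) => //.
by apply: (cyl_measurable tT); apply: sub_sigma_algebra; exists u, B; split => //; rewrite u0.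
Qed.

Lemma noise_le s t : s <= t -> NF s `<=` <<s NF t >>.
Proof.
move=> st A [[i hi [C [u [B [/andP[u0 us] mB ->]]] <-]]|nA].
  apply: sub_sigma_algebra; left; exists i => //; exists [set w : cpath T d | B (w u)] => //.
  by exists u, B; split => //; rewrite u0 (le_trans us).
by apply: sub_sigma_algebra; right.
Qed.

Lemma smeas_path s i dV (V : measurableType dV) (f : cpath T d -> V) : (i < n.+1)%N ->
  smeas (cyl s) f -> smeas (NF s) (fun w => f (W i w)).
Proof.
move=> iN mf _ B mB; rewrite setTI.
change (<<s NF s >> (W i @^-1` (f @^-1` B))).
have : <<s cyl s >> (f @^-1` B) by rewrite -[X in <<s _ >> X]setTI; exact: mf.
move: (f @^-1` B) => C hC.
suff : <<s cyl s >> `<=` [set C | <<s NF s >> (W i @^-1` C)] by move=> /(_ C hC).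
apply: smallest_sub => [|D hD].
  split => [/=|A /= hA|F /= hF].
  - by rewrite preimage_set0; exact: sigma_algebra0.
  - by rewrite setTD preimage_setC -setTD; exact: sigma_algebraCD.
  - by rewrite preimage_bigcup; exact: sigma_algebra_bigcup.
by apply: sub_sigma_algebra; left; exists i => //; exists D.
Qed.

Lemma smeas_incr k s t u : (k.1 < n.+1)%N -> 0 <= s <= u -> 0 <= t <= u ->
  smeas (NF u) (incr k s t).
Proof.
move=> kn su tu; apply: measurable_funB.
  exact: (smeas_path kn (smeas_eval k.2 tu)).
exact: (smeas_path kn (smeas_eval k.2 su)).
Qed.

Definition rect s t (A : nat -> set (cpath T d)) (B : nat -> 'I_d -> set R) : set Omega :=
  [set w | forall k : 'I_n.+1, A k (W k w) /\ forall l, B k l (incr (val k, l) s t w)].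

Local Notation N s t := (normal_prob 0 (Num.sqrt (t - s))).

Section Increment.
Variables (s t : R).
Hypotheses (s0 : 0 <= s) (st : s < t) (tT : t <= T).
Let sT : 0 <= s <= T. Proof. by rewrite s0 (le_trans (ltW st)). Qed.
Let tT' : 0 <= t <= T. Proof. by rewrite tT (le_trans s0 (ltW st)). Qed.

(** Independence of the paths reduces the event to one path at a time, and there the Wiener property
    separates the past from the increments of the d coordinates. *)
Lemma rect_prob A B : (forall k, <<s cyl s >> (A k)) -> (forall k l, measurable (B k l)) ->
  measurable (rect s t A B) /\
  P (rect s t A B) = (\prod_(k < n.+1) mu (A k) * \prod_(p : 'I_n.+1 * 'I_d) N s t (B p.1 p.2))%E.
Proof.
move=> hA hB.
pose C k := A k `&` [set x : cpath T d | forall l, B k l (x t 0 l - x s 0 l)].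
have mC k : measurable (C k).
  apply: measurableI; first by apply: cyl_measurable (hA k); case/andP: sT.
  rewrite (_ : [set x | _] = \bigcap_(l in [set: 'I_d]) ((fun x : cpath T d => x t 0 l - x s 0 l) @^-1` B k l)).
    apply: fin_bigcap_measurable; first exact: finite_finset.
    move=> l _; rewrite -[X in measurable X]setTI.
    by apply: measurable_funB => //; exact: measurable_eval.
  by apply/seteqP; split => x /= h l; [move=> _; exact: h|exact: h].
have memi i : (i \in iota 0 n.+1) = (i < n.+1)%N by rewrite mem_iota.
have rE : rect s t A B = \bigcap_(i in [set` iota 0 n.+1]) W i @^-1` C i.
  apply/seteqP; split => w /= h.
    move=> i hi; have {}hi : (i < n.+1)%N by rewrite -memi.
    by have [h1 h2] := h (Ordinal hi); split.
  by move=> k; apply: (h k); apply/(etrans (memi k)); exact: ltn_ord.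
rewrite rE; split.
  apply: fin_bigcap_measurable; first exact: finite_seq.
  by move=> i _; rewrite -[X in measurable X]setTI; apply: (measurable_noise i).
rewrite indW ?iota_uniq//.
rewrite -[iota 0 n.+1]/(index_iota 0 n.+1) big_mkord.
rewrite -(pair_big xpredT xpredT (fun k l => N s t (B (val k) l)))/= -big_split/=.
apply: eq_bigr => k _; rewrite -(hmu.2 s t s0 st tT _ (hA k) (B k) (hB k)).
exact: (lawW k (mC k)).
Qed.

(** A system closed under intersection that generates more than the past up to [s]: it also contains
    the increments over [s, t] of all coordinates other than [k]. This makes products of increments
    of different coordinates accessible. Equality is asked only almost everywhere, to admit the null
    sets of the completed filtration. *)
Definition past (k : nat * 'I_d) : set (set Omega) :=
  [set E | measurable E /\ exists A B, [/\ forall i, <<s cyl s >> (A i),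
     forall i l, measurable (B i l), B k.1 k.2 = setT & {ae P, forall w, E w <-> rect s t A B w}]].

Variable k : nat * 'I_d.
Hypothesis kn : (k.1 < n.+1)%N.

Lemma past_setI : setI_closed (past k).
Proof.
move=> E E' [mE [A [B [hA hB Bk ae1]]]] [mE' [A' [B' [hA' hB' Bk' ae2]]]].
split; first exact: measurableI.
exists (fun i => A i `&` A' i), (fun i l => B i l `&` B' i l); split.
- move=> i; apply: (@measurableI _ (g_sigma_algebraType (cyl s))); [exact: hA|exact: hA'].
- by move=> i l; exact: measurableI.
- by rewrite Bk Bk' setIT.
- apply: filterS2 ae1 ae2 => w h1 h2; split.
    by move=> [/h1 h3 /h2 h4] i; have [? ?] := h3 i; have [? ?] := h4 i; split => // l; split.
  move=> h; split; [apply/h1|apply/h2] => i; have [[? ?] h3] := h i; split => // l; by have [] := h3 l.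
Qed.

Lemma past_indep_gen E D : past k E -> measurable D ->
  P (E `&` incr k s t @^-1` D) = (P E * N s t D)%E.
Proof.
move=> [mE [A [B [hA hB Bk ae1]]]] mD.
pose B' i l := if (i == k.1) && (l == k.2) then D else B i l.
have hB' i l : measurable (B' i l) by rewrite /B'; case: ifP.
have mID : measurable (incr k s t @^-1` D).
  by rewrite -[X in measurable X]setTI; apply: measurable_incr.
have -> : P (E `&` incr k s t @^-1` D) = P (rect s t A B').
  apply: ae_set_eq; [exact: measurableI|exact: (rect_prob hA hB').1|].
  apply: filterS ae1 => w h; split.
    move=> [/h h1 h2] i; have [h3 h4] := h1 i; split => // l; rewrite /B'.
    by case: ifP => // /andP[/eqP ei /eqP el]; move: h2; rewrite /= ei el -surjective_pairing.
  move=> h1; split.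
    apply/h => i; have [h3 h4] := h1 i; split => // l; have := h4 l; rewrite /B'.
    by case: ifP => // /andP[/eqP -> /eqP ->] _; rewrite Bk.
  by have [_ /(_ k.2)] := h1 (Ordinal kn); rewrite /B'/= !eqxx/= -surjective_pairing.
rewrite (ae_set_eq mE (rect_prob hA hB).1 ae1) (rect_prob hA hB).2 (rect_prob hA hB').2 -muleA.
congr (_ * _)%E.
rewrite (bigD1 (Ordinal kn, k.2))//= [X in (_ = X * _)%E](bigD1 (Ordinal kn, k.2))//=.
rewrite /B' !eqxx/= Bk probability_setT mul1e muleC; congr (_ * _)%E.
apply: eq_bigr => -[i l]/=; case: ifP => // /andP[/eqP ei /eqP el] /negP[]; apply/eqP.
by congr (_, _) => //; exact: val_inj.
Qed.

Lemma past_measurable : <<s past k >> `<=` measurable.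
Proof. by apply: smallest_sub => [|E []//]; exact: sigma_algebra_measurable. Qed.

Lemma past_indep E D : <<s past k >> E -> measurable D ->
  P (E `&` incr k s t @^-1` D) = (P E * N s t D)%E.
Proof.
move=> hE mD.
have mID : measurable (incr k s t @^-1` D).
  by rewrite -[X in measurable X]setTI; apply: measurable_incr.
have hT : past k setT.
  split => //; exists (fun=> setT), (fun _ _ => setT); split => //.
  - by move=> i; exact: cylT.
  - by apply: aeW => w; split.
apply: (@dynkin_induction _ (g_sigma_algebraType (past k)) (past k)
  (fun E => P (E `&` incr k s t @^-1` D) = (P E * N s t D)%E)) => //.
- exact: past_setI.
- exact: past_indep_gen.
- by move=> F hF; exact: past_indep_gen.
- move=> F hF ih; have mF := past_measurable hF.
  rewrite probability_setC// setIC -setDE measureD//; last first.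
    by rewrite (le_lt_trans (probability_le1 _ _))// ltry.
  rewrite [X in (_ - P X)%E]setIC ih.
  have := past_indep_gen hT mD; rewrite setTI probability_setT mul1e => e1; rewrite [X in (X - _)%E = _]e1.
  have -> : P F = (fine (P F))%:E by rewrite fineK// fin_num_measure.
  have -> : N s t D = (fine (N s t D))%:E by rewrite fineK// fin_num_measure.
  move: (fine (P F)) (fine (N s t D)) => x c.
  by transitivity (((1 - x) * c)%:E) => //; rewrite mulrBl mul1r.
- move=> F hF tF ih.
  have mF i := past_measurable (hF i).
  rewrite setI_bigcupl measure_bigcup//; last 2 first.
  - by move=> i _; exact: measurableI.
  - by apply: trivIset_setIr.
  have [c hc] : exists c, N s t D = c%:E by exists (fine (N s t D)); rewrite fineK// fin_num_measure.
  transitivity (c%:E * \big[+%E/0%E]_(0 <= i <oo | i \in [set: nat]) P (F i))%E.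
    by rewrite -nneseriesZl//; apply: eq_eseriesr => i _; rewrite -hc muleC; exact: ih.
  by rewrite hc muleC -measure_bigcup.
Qed.

Lemma noise_past : NF s `<=` past k.
Proof.
have sT2 : s <= T by case/andP: sT.
have cT : <<s cyl s >> setT by exact: cylT.
move=> E hE; split; first exact: noise_measurable hE.
case: hE => [[i hi [C hC <-]]|nE].
  exists (fun j => if j == i then C else setT), (fun _ _ => setT); split => //.
  - by move=> j; case: eqP => // _; exact: sub_sigma_algebra.
  - apply: aeW => w; split => [h j|h].
      by split => //; case: eqP => // ->.
    by have [] := h (Ordinal hi); rewrite /= eqxx.
(* A null event agrees almost everywhere with the empty rectangle. *)
exists (fun=> set0), (fun _ _ => setT); split => //.
- by move=> i; exact: sigma_algebra0.
- have : {ae P, forall w, ~ E w} by apply: negligibleS nE => w /= /contrapT.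
  by apply: filterS => w h; split => // /(_ ord0)[].
Qed.

Lemma incr_past k' D : k' != k -> (k'.1 < n.+1)%N -> measurable D -> past k (incr k' s t @^-1` D).
Proof.
move=> k'k kn' mD; split.
  by rewrite -[X in measurable X]setTI; apply: measurable_incr.
exists (fun=> setT), (fun i l => if (i, l) == k' then D else setT); split => //.
- by move=> i; exact: cylT.
- by move=> i l; case: ifP.
- by case: eqP => // e; move/eqP: k'k; rewrite -e -surjective_pairing.
- apply: aeW => w; split => [h i|h].
    by split => // l; case: eqP => // e; rewrite e.
  by have [_ /(_ k'.2)] := h (Ordinal kn'); rewrite /= -surjective_pairing eqxx.
Qed.

Lemma smeas_noise_past (X : Omega -> R) : smeas (NF s) X -> smeas (past k) X.
Proof. by apply: smeas_sub => E /noise_past; exact: sub_sigma_algebra. Qed.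

Lemma past_incr_integral (X : Omega -> R) (f : R -> R) : smeas (past k) X ->
  measurable_fun setT f -> P.-integrable setT (EFin \o X) -> (N s t).-integrable setT (EFin \o f) ->
  P.-integrable setT (fun w => (X w * f (incr k s t w))%:E) /\
  (\int[P]_w (X w * f (incr k s t w))%:E = \int[P]_w (X w)%:E * \int[N s t]_y (f y)%:E)%E.
Proof.
move=> mX mf iX jf; apply: (indep_integral (m2 := normal_prob 0 _)) => //.
- by apply: smeas_measurable mX => E hE; apply: past_measurable; exact: sub_sigma_algebra.
- exact: measurable_incr.
- move=> A B mA mB; apply: past_indep => //.
  by have := mX measurableT _ mA; rewrite setTI.
Qed.

End Increment.
End Noise.

(** * Elementary stochastic integrals and their isometry *)

Section Elementary.
Context {R : realType} {T : R} {d : nat} {mu : probability (cpath T d) R}.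
Hypothesis hmu : is_wiener mu.
Context {d0 : measure_display} {Omega : measurableType d0} {P : probability Omega R}.
Hypothesis cP : measure_is_complete P.
Variable W : nat -> {RV P >-> cpath T d}.
Hypothesis lawW : forall i A, measurable A -> distribution P (W i) A = mu A.
Hypothesis indW : mutually_independent W.
Variable n : nat.
Local Notation NF := (noise_filtration W n.+1).
Local Notation leb := (@lebesgue_measure R).
Local Notation K := ('I_n.+1 * 'I_d)%type.
Local Notation dB k := (incr W (nat_of_ord k.1, k.2)).

Definition bounded_coef (s : R) (c : Omega -> R) := smeas (NF s) c /\ exists M : R, forall w, `|c w| <= M.

Lemma noise_measurable_fun s (X : Omega -> R) : s <= T -> smeas (NF s) X -> measurable_fun setT X.
Proof. by move=> sT; apply: smeas_measurable; exact: noise_measurable. Qed.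

Lemma smeas_noise_le s t (X : Omega -> R) : s <= t -> smeas (NF s) X -> smeas (NF t) X.
Proof. by move=> st; apply: smeas_sub; exact: noise_le. Qed.

Lemma bounded_coef_le s t c : s <= t -> bounded_coef s c -> bounded_coef t c.
Proof. by move=> st [h1 h2]; split => //; exact: smeas_noise_le h1. Qed.

Lemma bounded_coefM s c c' : bounded_coef s c -> bounded_coef s c' -> bounded_coef s (fun w => c w * c' w).
Proof.
move=> [m1 [M1 h1]] [m2 [M2 h2]]; split; first exact: measurable_funM.
by exists (M1 * M2) => w; rewrite normrM ler_pM.
Qed.

Lemma bounded_coef0 s : bounded_coef s (fun=> 0).
Proof. by split; [exact: measurable_cst|exists 0 => w; rewrite normr0]. Qed.

Lemma bounded_coef_sqint s c : s <= T -> bounded_coef s c -> sqint P c.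
Proof. by move=> sT [mc [M hM]]; apply: sqint_bounded hM; exact: noise_measurable_fun mc. Qed.

Lemma bounded_coefM_sqint s c X : s <= T -> bounded_coef s c -> sqint P X -> sqint P (fun w => X w * c w).
Proof.
move=> sT [mc [M hM]] hX; under eq_fun do rewrite mulrC.
by apply: (sqint_bndM _ hM hX); exact: noise_measurable_fun mc.
Qed.

Lemma incr_refl k s w : incr W k s s w = 0.
Proof. by rewrite /incr subrr. Qed.

Lemma incrD k s t u w : incr W k s u w = incr W k s t w + incr W k t u w.
Proof. by rewrite /incr; ring. Qed.

Let kn (k : K) : ((nat_of_ord k.1, k.2).1 < n.+1)%N. Proof. exact: ltn_ord. Qed.

Let integrable_sq s t : s < t ->
  (normal_prob 0 (Num.sqrt (t - s))).-integrable setT (EFin \o (fun x : R => x ^+ 2)).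
Proof.
move=> st; have [mx hx] := @sqint_normal R (Num.sqrt (t - s)) (ltac:(by rewrite sqrtr_gt0 subr_gt0)).
apply/integrableP; split; first by apply/measurable_EFinP.
by under eq_integral do rewrite /= ger0_norm ?sqr_ge0//.
Qed.

Section Basic.
Variables (s t : R).
Hypotheses (s0 : 0 <= s) (st : s <= t) (tT : t <= T).
Let sT : s <= T. Proof. exact: le_trans tT. Qed.
Let sT' : 0 <= s <= T. Proof. by rewrite s0. Qed.
Let tT' : 0 <= t <= T. Proof. by rewrite tT (le_trans s0). Qed.

Lemma incr_sqr_integral (k : K) X : bounded_coef s X ->
  (\int[P]_w (X w * dB k s t w ^+ 2)%:E = (fine (\int[P]_w (X w)%:E) * (t - s))%:E)%E.
Proof.
move=> [mX [M hM]].
have iX : P.-integrable setT (EFin \o X).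
  by apply: sqint_integrable; apply: sqint_bounded hM; exact: noise_measurable_fun mX.
have [st'|] := ltP s t; last first.
  move=> ts; have <- : s = t by apply/eqP; rewrite eq_le st.
  under eq_integral do rewrite incr_refl expr0n mulr0.
  by rewrite integral0 subrr mulr0.
have [] := past_incr_integral hmu lawW indW s0 st' tT (kn k) (smeas_noise_past cP s0 st' tT mX)
  (exprn_measurable 2) iX (integrable_sq st').
move=> _ ->; rewrite normal_second_moment ?sqrtr_gt0 ?subr_gt0// sqr_sqrtr ?subr_ge0//.
by rewrite EFinM fineK//; exact: integrable_fin_num.
Qed.

Lemma incr_sqint (k : K) : sqint P (dB k s t).
Proof.
split; first exact: measurable_incr.
have b1 : bounded_coef s (fun=> 1) by split; [exact: measurable_cst|exists 1 => w; rewrite normr1].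
have <- : (\int[P]_w (1 * dB k s t w ^+ 2)%:E = \int[P]_w (dB k s t w ^+ 2)%:E)%E.
  by apply: eq_integral => w _; rewrite mul1r.
by rewrite (incr_sqr_integral k b1) ltry.
Qed.

Lemma incr_ip0 (k : K) X : sqint P X -> smeas (NF s) X -> ip P X (dB k s t) = 0.
Proof.
move=> hX mX; have [st'|] := ltP s t; last first.
  move=> ts; have <- : s = t by apply/eqP; rewrite eq_le st.
  rewrite ipC -[RHS](ip0l P X); congr ip; apply/funext => w; exact: incr_refl.
have s1 : 0 < Num.sqrt (t - s) by rewrite sqrtr_gt0 subr_gt0.
have [] := past_incr_integral hmu lawW indW s0 st' tT (kn k) (smeas_noise_past cP s0 st' tT mX)
  (@measurable_id _ _ setT) (sqint_integrable hX) (sqint_integrable (sqint_normal s1)).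
by move=> _; rewrite normal_mean// mule0 /ip /Rintegral => ->.
Qed.

Lemma incr_ip_sqr (k : K) c c' : bounded_coef s c -> bounded_coef s c' ->
  ip P (fun w => c w * dB k s t w) (fun w => c' w * dB k s t w) = (t - s) * ip P c c'.
Proof.
move=> hc hc'; have := incr_sqr_integral k (bounded_coefM hc hc').
rewrite mulrC => /(congr1 (@fine R)) /= <-.
by rewrite /ip /Rintegral; congr fine; apply: eq_integral => w _; congr _%:E; ring.
Qed.

(** The increment of [k] belongs to the enlarged past of [k'], so the whole product but the last
    factor is independent of the increment of [k'], whose mean is zero. *)
Lemma incr_ip_cross (k k' : K) c c' : k != k' -> bounded_coef s c -> bounded_coef s c' ->
  ip P (fun w => c w * dB k s t w) (fun w => c' w * dB k' s t w) = 0.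
Proof.
move=> kk' hc hc'; have [st'|] := ltP s t; last first.
  move=> ts; have <- : s = t by apply/eqP; rewrite eq_le st.
  rewrite ipC -[RHS](ip0l P (fun w => c w * dB k s s w)); congr ip; apply/funext => w.
  by rewrite incr_refl mulr0.
have s1 : 0 < Num.sqrt (t - s) by rewrite sqrtr_gt0 subr_gt0.
pose X w := c w * c' w * dB k s t w.
have hX : sqint P X.
  rewrite /X; under eq_fun do rewrite mulrC.
  exact: bounded_coefM_sqint sT (bounded_coefM hc hc') (incr_sqint k).
have mX : smeas (past W n s t (nat_of_ord k'.1, k'.2)) X.
  have h1 : smeas (past W n s t (nat_of_ord k'.1, k'.2)) (fun w => c w * c' w).
    by apply: smeas_noise_past => //; case: (bounded_coefM hc hc').
  apply: (measurable_funM h1); move=> _ D mD; rewrite setTI; apply: sub_sigma_algebra.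
  exact: incr_past.
have [] := past_incr_integral hmu lawW indW s0 st' tT (kn k') mX
  (@measurable_id _ _ setT) (sqint_integrable hX) (sqint_integrable (sqint_normal s1)).
rewrite normal_mean// mule0 => _ h.
transitivity (fine (\int[P]_w (X w * dB k' s t w)%:E)%E); last by rewrite h.
by rewrite /ip/Rintegral; congr fine; apply: eq_integral => w _; congr _%:E; rewrite /X; ring.
Qed.

End Basic.

(** One summand of an elementary integrand: the coefficient [pc] on ]pa, pb] in the noise coordinate
    [pk]. The intervals of several pieces may overlap, so adding integrands is concatenating lists
    and no common subdivision is needed. *)
Record piece := Piece { pk : K ; pa : R ; pb : R ; pc : Omega -> R ;
  piece_ab : 0 <= pa <= pb ; piece_bT : pb <= T ; piece_c : bounded_coef pa pc }.

Definition pint e w : R := pc e w * dB (pk e) (pa e) (pb e) w.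
Definition pval (k : K) e u w : R := (pk e == k)%:R * pc e w * (pa e < u <= pb e)%R%:R.
Definition ppart t e w : R := pc e w * dB (pk e) (Num.min t (pa e)) (Num.min t (pb e)) w.

Let pa0 e : 0 <= pa e. Proof. by case/andP: (piece_ab e). Qed.
Let pab e : pa e <= pb e. Proof. by case/andP: (piece_ab e). Qed.
Let paT e : pa e <= T. Proof. exact: le_trans (pab e) (piece_bT e). Qed.

Lemma pc_sqint e : sqint P (pc e).
Proof. exact: bounded_coef_sqint (paT e) (piece_c e). Qed.

Lemma pint_sqint e : sqint P (pint e).
Proof.
rewrite /pint; under eq_fun do rewrite mulrC.
exact: bounded_coefM_sqint (paT e) (piece_c e) (incr_sqint (pa0 e) (pab e) (piece_bT e) _).
Qed.

Lemma ip_pint_before s e X : s <= pa e -> sqint P X -> smeas (NF s) X -> ip P X (pint e) = 0.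
Proof.
move=> se hX mX.
have h := incr_ip0 (pa0 e) (pab e) (piece_bT e) (pk e) (bounded_coefM_sqint (paT e) (piece_c e) hX)
  (measurable_funM (smeas_noise_le se mX) (piece_c e).1).
by rewrite -[RHS]h; apply: eq_Rintegral => w _; rewrite /pint mulrA.
Qed.

Definition overlap (a b a' b' : R) := Num.max 0 (Num.min b b' - Num.max a a').

Let disjoint_ip (k k' : K) a b a' b' c c' : 0 <= a -> a <= b -> b <= a' -> a' <= b' -> b' <= T ->
  bounded_coef a c -> bounded_coef a' c' ->
  ip P (fun w => c w * dB k a b w) (fun w => c' w * dB k' a' b' w) = 0.
Proof.
move=> a0 ab ba' ab' bT hc hc'; have aT' : a' <= T by exact: le_trans bT.
have b0 : 0 <= b by exact: le_trans ab.
have h1 : sqint P (fun w => dB k a b w * c w * c' w).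
  apply: bounded_coefM_sqint hc' _ => //; apply: (@bounded_coefM_sqint a) => //.
    by rewrite (le_trans ab)// (le_trans ba').
  by apply: incr_sqint => //; rewrite (le_trans ba').
have h2 : smeas (NF a') (fun w => dB k a b w * c w * c' w).
  apply: measurable_funM; last exact: hc'.1.
  apply: measurable_funM.
    by apply: smeas_incr; rewrite ?kn ?a0 ?b0//= (le_trans ab).
  by apply: smeas_noise_le hc.1; rewrite (le_trans ab).
rewrite -[RHS](incr_ip0 (le_trans b0 ba') ab' bT k' h1 h2).
by apply: eq_Rintegral => w _; ring.
Qed.

Let sqint_term (k : K) a b c s : 0 <= s -> s <= a -> a <= b -> b <= T -> bounded_coef s c -> sqint P (fun w => c w * dB k a b w).
Proof.
move=> s0 sa ab bT hc; under eq_fun do rewrite mulrC.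
apply: bounded_coefM_sqint hc _; first by rewrite (le_trans sa)// (le_trans ab).
by apply: incr_sqint => //; exact: le_trans sa.
Qed.

Let left_ip (k k' : K) s b b' c c' : 0 <= s -> s <= b -> s <= b' -> b <= T -> b' <= T ->
  bounded_coef s c -> bounded_coef s c' ->
  ip P (fun w => c w * dB k s b w) (fun w => c' w * dB k' s b' w) =
  (k == k')%:R * (Num.min b b' - s) * ip P c c'.
Proof.
wlog bb' : k k' b b' c c' / b <= b' => [hw|] s0 sb sb' bT bT' hc hc'.
  have [h|h] := leP b b'; first by rewrite hw// min_l.
  by rewrite ipC hw// ?(ltW h)// min_l ?(ltW h)// eq_sym [ip P c' c]ipC.
rewrite min_l//.
have -> : (fun w => c' w * dB k' s b' w) = (fun w => c' w * dB k' s b w + c' w * dB k' b b' w).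
  by apply/funext => w; rewrite (incrD _ s b b') mulrDr.
have b0 : 0 <= b by exact: le_trans sb.
rewrite ipC ipDl; [|exact: sqint_term hc'|exact: sqint_term hc'|exact: sqint_term hc].
rewrite -[X in _ + X]ipC [X in _ + X]disjoint_ip ?addr0//; last exact: bounded_coef_le hc'.
rewrite ipC; case: eqP => [->|/eqP kk'].
  by rewrite incr_ip_sqr// mul1r.
by rewrite incr_ip_cross// !mul0r.
Qed.

(** Cut the earlier interval at the left end of the later one. The part before is orthogonal to the
    later piece; the rest shares its left end, and only the shorter of the two intervals
    contributes. *)
Lemma ip_pint e e' : ip P (pint e) (pint e') =
  (pk e == pk e')%:R * overlap (pa e) (pb e) (pa e') (pb e') * ip P (pc e) (pc e').
Proof.
wlog aa' : e e' / pa e <= pa e' => [hw|].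
  have [h|h] := leP (pa e) (pa e'); first exact: hw.
  rewrite ipC hw ?(ltW h)// eq_sym [ip P (pc e') _]ipC; congr (_ * _ * _).
  by rewrite /overlap (minC (pb e')) (maxC (pa e')).
rewrite /overlap (max_r aa'); have [ba'|a'b] := leP (pb e) (pa e').
  rewrite /pint disjoint_ip//; [|exact: piece_bT|exact: piece_c|exact: piece_c].
  rewrite max_l ?mulr0 ?mul0r// subr_le0 ge_min ba' //.
have -> : pint e = (fun w => pc e w * dB (pk e) (pa e) (pa e') w + pc e w * dB (pk e) (pa e') (pb e) w).
  by apply/funext => w; rewrite /pint (incrD _ (pa e) (pa e') (pb e)) mulrDr.
have a'b' := ltW a'b.
rewrite ipDl; last exact: pint_sqint.
- rewrite /pint disjoint_ip ?add0r//; [|exact: piece_bT|exact: piece_c|exact: piece_c].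
  rewrite left_ip//; [|exact: piece_bT|exact: piece_bT|exact: bounded_coef_le (piece_c e)|exact: piece_c].
  by rewrite max_r// subr_ge0 le_min a'b' pab.
- exact: sqint_term (pa0 e) _ _ _ (piece_c e).
- by apply: sqint_term (pa0 e) _ _ _ (piece_c e) => //; exact: piece_bT.
Qed.

Let ind (a b : R) : R -> R := fun u => (a < u <= b)%R%:R.

Lemma indE (a b u : R) : (a < u <= b)%R%:R = \1_(`]a, b]%classic : set R) u :> R.
Proof.
rewrite indicE; congr (nat_of_bool _)%:R; apply/idP/idP => [h|/set_mem/=]; first by apply/mem_set; rewrite /= in_itv.
by rewrite in_itv.
Qed.

Lemma measurable_ind a b : measurable_fun setT (ind a b).
Proof.
rewrite (_ : ind a b = \1_(`]a, b]%classic : set R)); first exact: measurable_indic.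
by apply/funext => u; rewrite /ind indE.
Qed.

Lemma ind_int a b : (\int[leb]_u (ind a b u)%:E = (Num.max 0 (b - a))%:E)%E.
Proof.
transitivity (\int[leb]_u (\1_(`]a, b]%classic) u)%:E)%E.
  by apply: eq_integral => u _; rewrite /ind indE.
rewrite integral_indic//= setIT lebesgue_measure_itv/= lte_fin; case: ltP => h.
  by rewrite -EFinB max_r// subr_ge0 ltW.
by rewrite max_l// subr_le0.
Qed.

Lemma ind_sqint (c : R) a b : sqint leb (fun u => c * ind a b u).
Proof.
apply: sqintZ; split; first exact: measurable_ind.
have -> : (\int[leb]_u (ind a b u ^+ 2)%:E = (Num.max 0 (b - a))%:E)%E; last by rewrite ltry.
by rewrite -ind_int; apply: eq_integral => u _; rewrite /ind; case: (a < u <= b); rewrite ?expr1n ?expr0n.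
Qed.

Lemma ip_ind (c c' a b a' b' : R) :
  ip leb (fun u => c * ind a b u) (fun u => c' * ind a' b' u) = overlap a b a' b' * (c * c').
Proof.
transitivity (\int[leb]_u ((c * c') * ind (Num.max a a') (Num.min b b') u)).
  apply: eq_Rintegral => u _; rewrite /ind gt_max le_min.
  by case: (a < u); case: (a' < u); case: (u <= b); case: (u <= b'); rewrite /= ?mulr0 ?mul0r ?mulr1//.
rewrite RintegralZl//; last first.
  have [mi hi] := ind_sqint 1 (Num.max a a') (Num.min b b').
  apply/integrableP; split; first by apply/measurable_EFinP; exact: measurable_ind.
  under eq_integral do rewrite /= ger0_norm ?ler0n//.
  by rewrite ind_int ltry.
by rewrite mulrC /Rintegral ind_int.
Qed.

Lemma pval_energy (k : K) (es : seq piece) :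
  (\int[P]_w \int[leb]_u ((\sum_(e <- es) pval k e u w) ^+ 2)%:E =
   (\sum_(e <- es) \sum_(e' <- es) (pk e == k)%:R * (pk e' == k)%:R *
      overlap (pa e) (pb e) (pa e') (pb e') * ip P (pc e) (pc e'))%:E)%E.
Proof.
pose q e e' := (pk e == k)%:R * (pk e' == k)%:R * overlap (pa e) (pb e) (pa e') (pb e').
transitivity (\int[P]_w (\sum_(e <- es) (\sum_(e' <- es) (q e e' * (pc e w * pc e' w))%:E)))%E.
  apply: eq_integral => w _.
  have hs e : sqint leb (fun u => ((pk e == k)%:R * pc e w) * ind (pa e) (pb e) u) by exact: ind_sqint.
  rewrite (integral_sqr_sum es hs) -sumEFin; apply: eq_bigr => e _; rewrite sumEFin; congr _%:E.
  by apply: eq_bigr => e' _; rewrite ip_ind /q; ring.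
have iq e e' : P.-integrable setT (fun w => (q e e' * (pc e w * pc e' w))%:E).
  under eq_fun do rewrite EFinM.
  by apply: integrableZl => //; apply: sqint_mul_integrable; exact: pc_sqint.
rewrite integral_sum//; last by move=> e; exact: integrable_sum.
rewrite -sumEFin; apply: eq_bigr => e _; rewrite integral_sum// -sumEFin; apply: eq_bigr => e' _.
rewrite EFinM ipE; [|exact: pc_sqint|exact: pc_sqint].
rewrite -integralZl//; last by apply: sqint_mul_integrable; exact: pc_sqint.
Qed.

(** Both sides expand into the same double sum over pairs of pieces, overlap times mean of the
    product of coefficients. Summing the energies over the coordinates keeps the pairs with equal
    coordinate. *)
Lemma elementary_isometry (es : seq piece) :
  (\int[P]_w ((\sum_(e <- es) pint e w) ^+ 2)%:E =
   \sum_(k : K) \int[P]_w \int[leb]_u ((\sum_(e <- es) pval k e u w) ^+ 2)%:E)%E.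
Proof.
rewrite (integral_sqr_sum es pint_sqint).
rewrite [RHS](eq_bigr (fun k : K => (\sum_(e <- es) \sum_(e' <- es) (pk e == k)%:R * (pk e' == k)%:R *
      overlap (pa e) (pb e) (pa e') (pb e') * ip P (pc e) (pc e'))%:E)); last by move=> k _; rewrite pval_energy.
rewrite sumEFin; congr _%:E; rewrite [RHS]exchange_big/=; apply: eq_bigr => e _.
rewrite [RHS]exchange_big/=; apply: eq_bigr => e' _.
rewrite -!mulr_suml ip_pint; congr (_ * _ * _).
rewrite (bigD1 (pk e))//= eqxx mul1r big1 ?addr0 1?eq_sym// => k /negPf hk.
by rewrite eq_sym hk mul0r.
Qed.

(** Every later piece is orthogonal to what is known at time [s], so the square of the sum has no
    cross term. This identity is the source of all energy estimates below. *)
Lemma elementary_pythagoras s (X : Omega -> R) (I : Type) (r : seq I) (f : I -> piece) :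
  sqint P X -> smeas (NF s) X -> (forall i, s <= pa (f i)) ->
  (\int[P]_w ((X w + \sum_(i <- r) pint (f i) w) ^+ 2)%:E =
   \int[P]_w (X w ^+ 2)%:E +
   \sum_(k : K) \int[P]_w \int[leb]_u ((\sum_(i <- r) pval k (f i) u w) ^+ 2)%:E)%E.
Proof.
move=> hX mX hf.
rewrite ip_sqrD//; last by apply: sqint_sum => i; exact: pint_sqint.
rewrite ipC ip_suml//; last by move=> i; exact: pint_sqint.
rewrite big1 ?mulr0 ?adde0; last by move=> i _; rewrite ipC (ip_pint_before (hf i)).
congr (_ + _)%E.
rewrite (eq_integral (fun w => ((\sum_(e <- map f r) pint e w) ^+ 2)%:E)); last first.
  by move=> w _; rewrite big_map.
rewrite elementary_isometry; apply: eq_bigr => k _; apply: eq_integral => w _; apply: eq_integral => u _.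
by rewrite big_map.
Qed.

(** Restricting a piece to [s, t] and multiplying it by a bounded weight known at [s] gives again a
    piece. Thus a weighted increment of an elementary integral is itself an elementary integral. *)
Lemma clip_exists s t (th : Omega -> R) (e : piece) : 0 <= s -> s <= t -> t <= T -> bounded_coef s th ->
  exists e', [/\ s <= pa e', forall w, pint e' w = th w * (ppart t e w - ppart s e w) &
    forall k u w, pval k e' u w = th w * pval k e u w * (s < u <= t)%R%:R].
Proof.
move=> s0 st tT hth; pose a' := Num.min t (Num.max s (pa e)); pose b' := Num.min t (Num.max s (pb e)).
have ab' : 0 <= a' <= b'.
  apply/andP; split; first by rewrite le_min (le_trans s0 st) le_max s0.
  by rewrite le_min ge_min lexx/= ge_min ge_max !le_max lexx/= (pab e) orbT orbT.
have bT' : b' <= T by rewrite ge_min tT.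
have sa' : s <= a' by rewrite le_min st le_max lexx.
(* If the clipped interval is empty, its left end can lie before [pa e], where the coefficient need
   not be measurable; it is set to 0. Otherwise [a'] is the maximum of [s] and [pa e]. *)
pose c' := if a' < b' then (fun w => th w * pc e w) else (fun=> 0).
have hc' : bounded_coef a' c'.
  rewrite /c'; case: ifP => h; last exact: bounded_coef0.
  apply: bounded_coefM; first exact: bounded_coef_le hth.
  apply: bounded_coef_le (piece_c e).
  have at' : a' < t by rewrite (lt_le_trans h)// ge_min lexx.
  by move: at'; rewrite /a' gt_min ltxx/= => h'; rewrite min_r ?(ltW h')// le_max lexx orbT.
exists (Piece (pk e) ab' bT' hc'); split => // [w|k u w].
  rewrite /pint/ppart/=.
  have E : dB (pk e) (Num.min t (pa e)) (Num.min t (pb e)) w - dB (pk e) (Num.min s (pa e)) (Num.min s (pb e)) w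
     = dB (pk e) a' b' w.
    rewrite /incr /a' /b' /=.
    have hh x : W (pk e).1 w (Num.min t (Num.max s x)) 0 (pk e).2 = W (pk e).1 w (Num.min t x) 0 (pk e).2 +
       W (pk e).1 w s 0 (pk e).2 - W (pk e).1 w (Num.min s x) 0 (pk e).2.
      have [xs|sx] := leP x s.
        by rewrite (min_r (le_trans xs st)) (min_r st); ring.
      by ring.
    by rewrite !hh; ring.
  rewrite /c'; case: ifPn => h; first by rewrite -mulrBr -E; ring.
  have e1 : a' = b' by apply/eqP; rewrite eq_le -leNgt in h *; case/andP: ab' => _ ->.
  by rewrite mul0r -mulrBr E e1 incr_refl !mulr0.
rewrite /pval/= /c'; case: ifPn => hab.
  have a't : a' < t by rewrite (lt_le_trans hab)// ge_min lexx.
  have a'E : a' = Num.max s (pa e).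
    by move: a't; rewrite /a' gt_min ltxx/= => h; rewrite min_r ?(ltW h).
  have b'E : b' = Num.min t (pb e).
    rewrite /b' max_r// leNgt; apply/negP => bs; move: hab; rewrite ltNge /b' max_l ?(ltW bs)//.
    by rewrite min_r// sa'.
  rewrite a'E b'E gt_max le_min.
  case: (s < u); case: (pa e < u); case: (u <= t); case: (u <= pb e); rewrite /= ?mulr0 ?mulr1 ?mul0r//; ring.
rewrite mulr0 mul0r; case: (ltP s u) => su; rewrite ?mulr0//.
case: (leP u t) => ut; rewrite ?mulr0//.
case: (ltP (pa e) u) => au; rewrite ?mulr0 ?mul0r//.
case: (leP u (pb e)) => ub; rewrite ?mulr0 ?mul0r//.
move: hab; rewrite -leNgt => hab.
have h1 : a' < u by rewrite gt_min gt_max su au orbT.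
have h2 : u <= b' by rewrite le_min ut le_max ub orbT.
by move: (lt_le_trans h1 h2); rewrite ltNge hab.
Qed.

End Elementary.

Section L2Convergence.
Context {R : realType} {d0 : measure_display} {X : measurableType d0} (mu : measure X R).
Local Open Scope ereal_scope.

Definition l2cvg (f_ : nat -> X -> R) (f : X -> R) :=
  [/\ forall n, measurable_fun setT (f_ n), measurable_fun setT f &
      \int[mu]_x ((f_ n x - f x) ^+ 2)%:E @[n --> \oo] --> 0].

Lemma l2cvg_dom (c : R) (f_ : nat -> X -> R) (f : X -> R) (g_ : nat -> X -> R) (g : X -> R) :
  (forall n, measurable_fun setT (g_ n)) -> measurable_fun setT g -> (0 <= c)%R ->
  (forall n x, (g_ n x - g x) ^+ 2 <= c * (f_ n x - f x) ^+ 2)%R ->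
  l2cvg f_ f -> l2cvg g_ g.
Proof.
move=> mg_ mg c0 gf [mf_ mf cf]; split => //.
have lim0 : c%:E * \int[mu]_x ((f_ n x - f x) ^+ 2)%:E @[n --> \oo] --> 0.
  by rewrite -[X in _ --> X](mule0 c%:E); apply: cvgeZl.
apply: (squeeze_cvge _ (cvg_cst 0) lim0); near=> n; apply/andP; split.
  by apply: integral_ge0 => x _; rewrite lee_fin sqr_ge0.
rewrite -ge0_integralZl//.
- by apply: le_integral_nonmeas => x; rewrite ?lee_fin ?sqr_ge0.
- by apply/measurable_EFinP/measurable_funX/measurable_funB.
- by move=> x _; rewrite lee_fin sqr_ge0.
Unshelve. all: by end_near. Qed.

Lemma l2cvgD f_ f g_ g : l2cvg f_ f -> l2cvg g_ g ->
  l2cvg (fun n x => f_ n x + g_ n x)%R (fun x => f x + g x)%R.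
Proof.
move=> [mf_ mf cf] [mg_ mg cg]; split; [by move=> n; exact: measurable_funD|exact: measurable_funD|].
have lim0 : 2%:E * \int[mu]_x ((f_ n x - f x) ^+ 2)%:E + 2%:E * \int[mu]_x ((g_ n x - g x) ^+ 2)%:E
     @[n --> \oo] --> 0.
  have e0 (a : nat -> \bar R) : a n @[n --> \oo] --> 0 -> 2%:E * a n @[n --> \oo] --> 0.
    by move=> h; rewrite -[X in _ --> X](mule0 2%:E); apply: cvgeZl.
  by rewrite -[X in _ --> X]adde0; apply: cvgeD => //; exact: e0.
apply: (squeeze_cvge _ (cvg_cst 0) lim0); near=> n; apply/andP; split.
  by apply: integral_ge0 => x _; rewrite lee_fin sqr_ge0.
rewrite -sqint_int_sumZ//; [|exact: measurable_funB|exact: measurable_funB].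
apply: le_integral_nonmeas => x; rewrite lee_fin ?sqr_ge0//.
by have := sqr_ge0 ((f_ n x - f x) - (g_ n x - g x)); lra.
Unshelve. all: by end_near. Qed.

Lemma l2cvgM (c : R) (h : X -> R) f_ f : measurable_fun setT h -> (forall x, `|h x| <= c)%R ->
  l2cvg f_ f -> l2cvg (fun n x => h x * f_ n x)%R (fun x => h x * f x)%R.
Proof.
move=> mh hc hf; have [mf_ mf _] := hf.
apply: (l2cvg_dom _ _ _ _ hf (c := c ^+ 2)).
- by move=> n; exact: measurable_funM.
- exact: measurable_funM.
- exact: sqr_ge0.
- move=> n x; rewrite -mulrBr exprMn ler_wpM2r ?sqr_ge0// -[leLHS]real_normK ?num_real//.
  by rewrite lerXn2r ?nnegrE// (le_trans (normr_ge0 (h x))).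
Qed.

Lemma l2cvg_cst f : measurable_fun setT f -> l2cvg (fun=> f) f.
Proof.
move=> mf; split => //; rewrite (_ : (fun _ => _) = (fun=> 0)); first exact: cvg_cst.
by apply/funext => n; apply: integral0_eq => x _; rewrite subrr expr0n.
Qed.

Lemma l2cvgB f_ f g_ g : l2cvg f_ f -> l2cvg g_ g ->
  l2cvg (fun n x => f_ n x - g_ n x)%R (fun x => f x - g x)%R.
Proof.
move=> hf hg; apply: l2cvgD => //; have [mg_ mg _] := hg.
apply: (l2cvg_dom _ _ _ _ hg (c := 1%R)).
- by move=> n; apply: measurableT_comp => //; case: hg.
- exact: measurableT_comp.
- by [].
- by move=> n x; rewrite mul1r -opprD sqrrN.
Qed.

Lemma l2cvg_sqr f_ f : sqint mu f -> l2cvg f_ f ->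
  \int[mu]_x ((f_ n x) ^+ 2)%:E @[n --> \oo] --> \int[mu]_x (f x ^+ 2)%:E.
Proof. by move=> hf [h1 h2 h3]; exact: sqint_cvg. Qed.

End L2Convergence.

Lemma cvg_sum_ge0 {R : realType} (I : Type) (r : seq I) (a : nat -> I -> \bar R) (l : I -> \bar R) :
  (forall n i, (0 <= a n i)%E) -> (forall i, (0 <= l i)%E) ->
  (forall i, a n i @[n --> \oo] --> l i) ->
  (\sum_(i <- r) a n i)%E @[n --> \oo] --> (\sum_(i <- r) l i)%E.
Proof.
move=> a0 l0 al; elim: r => [|i r IH].
  by rewrite big_nil; under eq_fun do rewrite big_nil; exact: cvg_cst.
rewrite big_cons; under eq_fun do rewrite big_cons.
by apply: cvgeD => //; apply: ge0_adde_def; rewrite inE ?sume_ge0.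
Qed.

(** * Stochastic integrals against all noise coordinates *)

Section ItoSums.
Context {R : realType} {T : R} {d : nat} {mu : probability (cpath T d) R}.
Hypothesis hmu : is_wiener mu.
Context {d0 : measure_display} {Omega : measurableType d0} {P : probability Omega R}.
Hypothesis cP : measure_is_complete P.
Variable W : nat -> {RV P >-> cpath T d}.
Hypothesis lawW : forall i A, measurable A -> distribution P (W i) A = mu A.
Hypothesis indW : mutually_independent W.
Variable n : nat.
Local Notation NF := (noise_filtration W n.+1).
Local Notation leb := (@lebesgue_measure R).
Local Notation K := ('I_n.+1 * 'I_d)%type.
Local Notation piece := (piece W n).
Local Notation PL := (P \x leb)%E.

Definition cut (s t : R) (V : R -> Omega -> R) (z : Omega * R) : R := V z.2 z.1 * (s < z.2 <= t)%R%:R.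

Definition eval (es : seq piece) (k : K) u w : R := \sum_(e <- es) pval k e u w.
Definition epart (es : seq piece) t w : R := \sum_(e <- es) ppart t e w.

Lemma measurable_window s t : measurable_fun setT (fun z : Omega * R => (s < z.2 <= t)%R%:R : R).
Proof.
exact: (measurableT_comp (@measurable_ind R s t) (@measurable_snd _ _ Omega R)).
Qed.

Lemma pc_measurable (e : piece) : measurable_fun setT (pc e).
Proof. by have [] := pc_sqint cP e. Qed.

Lemma measurable_eval_process es k : measurable_fun setT (fun z : Omega * R => eval es k z.2 z.1).
Proof.
apply: measurable_sum => e; apply: measurable_funM; last exact: measurable_window.
apply: measurable_funM; first exact: measurable_cst.
by apply: measurableT_comp; [exact: pc_measurable|exact: measurable_fst].
Qed.

Lemma ppart_sqint t (e : piece) : 0 <= t <= T -> sqint P (ppart t e).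
Proof.
move=> /andP[t0 tT]; have /andP[a0 ab] := piece_ab e.
have hc : bounded_coef W n 0 (fun=> 1) by split; [exact: measurable_cst|exists 1 => w; rewrite normr1].
have [e' [_ h _]] := clip_exists e (lexx 0) t0 tT hc.
have := pint_sqint hmu cP lawW indW e'; congr sqint; apply/funext => w.
rewrite h mul1r [X in _ - X](_ : _ = 0) ?subr0// /ppart !min_l ?incr_refl ?mulr0//.
exact: le_trans ab.
Qed.

Lemma epart_sqint t es : 0 <= t <= T -> sqint P (epart es t).
Proof. by move=> tT; apply: sqint_sum => e; exact: ppart_sqint. Qed.

Lemma int_cut (V : R -> Omega -> R) s t : measurable_fun setT (cut s t V) ->
  (\int[PL]_z (cut s t V z ^+ 2)%:E = \int[P]_w \int[leb]_u (cut s t V (w, u) ^+ 2)%:E)%E.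
Proof.
move=> mV; rewrite fubini_tonelli1//; last by move=> z; rewrite lee_fin sqr_ge0.
exact: measurable_sqE.
Qed.

(* [J] is the integral of [H] against all coordinates of the noise, as an L^2-limit of elementary integrals;
   unlike in [is_ito_integral] it need not be continuous. *)
Record ito_sum (H : K -> R -> Omega -> R) (J : R -> Omega -> R) : Prop := ItoSum {
  ito_measurable : forall k, measurable_fun setT (cut 0 T (H k)) ;
  ito_finite : forall k, sqint PL (cut 0 T (H k)) ;
  ito_adapted : forall t, 0 <= t <= T -> smeas (NF t) (J t) ;
  ito_sqint : forall t, 0 <= t <= T -> sqint P (J t) ;
  ito_approx : exists es : nat -> seq piece,
    (forall k, l2cvg PL (fun N z => eval (es N) k z.2 z.1) (cut 0 T (H k))) /\
    (forall t, 0 <= t <= T -> l2cvg P (fun N => epart (es N) t) (J t)) }.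

Lemma cutM s t s' t' (V : R -> Omega -> R) : s' <= s -> t <= t' ->
  cut s t V = (fun z => (s < z.2 <= t)%R%:R * cut s' t' V z).
Proof.
move=> ss tt; apply/funext => z; rewrite /cut; case: (boolP (s < z.2 <= t)) => [/andP[h1 h2]|_]; last by rewrite mulr0 mul0r.
by rewrite (le_lt_trans ss h1) (le_trans h2 tt) mul1r.
Qed.

Lemma ind_le1 (b : bool) : `|b%:R| <= 1 :> R.
Proof. by case: b; rewrite ?normr1 ?normr0. Qed.

(** The identity [elementary_pythagoras] for the clipped pieces, passed to the limit on both sides.
    Allowing a term [X] and a weight [th] known at [s] makes one statement yield the isometry, the
    martingale property and the energy step of the stability estimate. *)
Lemma ito_pythagoras H J s t th X : ito_sum H J -> 0 <= s -> s <= t -> t <= T ->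
  bounded_coef W n s th -> sqint P X -> smeas (NF s) X ->
  (\int[P]_w ((X w + th w * (J t w - J s w)) ^+ 2)%:E =
   \int[P]_w (X w ^+ 2)%:E +
   \sum_(k : K) \int[P]_w \int[leb]_u ((th w * (H k u w * (s < u <= t)%R%:R)) ^+ 2)%:E)%E.
Proof.
move=> [mH fH aJ sJ [es [cH cJ]]] s0 st tT hth hX mX.
have sT : 0 <= s <= T by rewrite s0 (le_trans st).
have tT' : 0 <= t <= T by rewrite tT (le_trans s0).
have mth : measurable_fun setT th by apply: (noise_measurable_fun cP (le_trans st tT)); exact: hth.1.
have [M hM] := hth.2.
have [f hf] := @choice _ _ _ (fun e => clip_exists e s0 st tT hth).
have lhs : (\int[P]_w ((X w + th w * (epart (es N) t w - epart (es N) s w)) ^+ 2)%:E)%E @[N --> \oo] -->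
    (\int[P]_w ((X w + th w * (J t w - J s w)) ^+ 2)%:E)%E.
  apply: l2cvg_sqr.
    apply: sqintD => //; apply: (sqint_bndM mth hM); apply: sqintB; exact: sJ.
  apply: l2cvgD; first by apply: l2cvg_cst; case: hX.
  by apply: (l2cvgM mth hM); apply: l2cvgB; exact: cJ.
have mth1 : measurable_fun setT (fun z : Omega * R => th z.1).
  by apply: measurableT_comp => //; exact: measurable_fst.
have mwin := measurable_window s t.
have prodE (V : Omega * R -> R) : measurable_fun setT V ->
    (\int[PL]_z (V z ^+ 2)%:E = \int[P]_w \int[leb]_u (V (w, u) ^+ 2)%:E)%E.
  move=> mV; rewrite fubini_tonelli1//; last by move=> z; rewrite lee_fin sqr_ge0.
  exact: measurable_sqE.
pose hk k (z : Omega * R) := th z.1 * ((s < z.2 <= t)%R%:R * cut 0 T (H k) z).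
pose ek N k (z : Omega * R) := th z.1 * ((s < z.2 <= t)%R%:R * eval (es N) k z.2 z.1).
have sh k : sqint PL (hk k).
  apply: (@sqint_bndM _ _ _ PL M (fun z => th z.1)) => //.
  by apply: (@sqint_bndM _ _ _ PL 1 (fun z => (s < z.2 <= t)%R%:R)) => // z; exact: ind_le1.
have ch k : l2cvg PL (fun N => ek N k) (hk k).
  apply: (@l2cvgM _ _ _ PL M (fun z => th z.1)) => //.
  by apply: (@l2cvgM _ _ _ PL 1 (fun z => (s < z.2 <= t)%R%:R)) => // z; exact: ind_le1.
have me N k : measurable_fun setT (ek N k) by have [h _ _] := ch k; exact: h.
have rhs : (\int[P]_w (X w ^+ 2)%:E + \sum_(k : K) \int[PL]_z (ek N k z ^+ 2)%:E)%E @[N --> \oo] -->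
    (\int[P]_w (X w ^+ 2)%:E + \sum_(k : K) \int[PL]_z (hk k z ^+ 2)%:E)%E.
  apply: cvgeD; last 2 first.
  - exact: cvg_cst.
  - apply: cvg_sum_ge0 => [N k|k|k]; last exact: l2cvg_sqr.
      by apply: integral_ge0 => z _; rewrite lee_fin sqr_ge0.
    by apply: integral_ge0 => z _; rewrite lee_fin sqr_ge0.
  - apply: ge0_adde_def; rewrite inE.
      by apply: integral_ge0 => z _; rewrite lee_fin sqr_ge0.
    by apply: sume_ge0 => k _; apply: integral_ge0 => z _; rewrite lee_fin sqr_ge0.
have eqN N : (\int[P]_w ((X w + th w * (epart (es N) t w - epart (es N) s w)) ^+ 2)%:E =
    \int[P]_w (X w ^+ 2)%:E + \sum_(k : K) \int[PL]_z (ek N k z ^+ 2)%:E)%E.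
  have := elementary_pythagoras hmu cP lawW indW (es N) hX mX (fun e => let: And3 h _ _ := hf e in h).
  move=> h; transitivity (\int[P]_w ((X w + \sum_(i <- es N) pint (f i) w) ^+ 2)%:E)%E.
    apply: eq_integral => w _; congr ((_ + _) ^+ 2)%:E.
    rewrite /epart -sumrB mulr_sumr; apply: eq_bigr => e _; have [_ -> _] := hf e.
    by [].
  rewrite h; congr (_ + _)%E; apply: eq_bigr => k _; rewrite prodE//.
  apply: eq_integral => w _; apply: eq_integral => u _; congr (_ ^+ 2)%:E.
  rewrite /ek /eval/= mulrCA !mulr_sumr; apply: eq_bigr => e _; have [_ _ ->] := hf e; ring.
move: lhs; rewrite (funext eqN) => lhs.
rewrite (cvg_unique (@ereal_hausdorff R) lhs rhs).
congr (_ + _)%E; apply: eq_bigr => k _; rewrite prodE; last exact: (sh k).1.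
apply: eq_integral => w _; apply: eq_integral => u _; rewrite /hk/= -/(cut s t (H k) (w, u)).
by rewrite (@cutM s t 0 T (H k)).
Qed.

Lemma ito_sum0 : ito_sum (fun _ _ _ => 0) (fun _ _ => 0).
Proof.
have c0 : cut 0 T (fun=> fun=> 0) = (fun=> 0) by apply/funext => z; rewrite /cut mul0r.
split.
- by move=> k; rewrite c0; exact: measurable_cst.
- by move=> k; rewrite c0; exact: sqint0.
- by move=> t _; exact: measurable_cst.
- by move=> t _; exact: sqint0.
- exists (fun=> [::]); split => [k|t _].
    rewrite c0 (_ : (fun N => _) = (fun=> fun=> 0)); first by apply: l2cvg_cst; exact: measurable_cst.
    by apply/funext => N; apply/funext => z; rewrite /eval big_nil.
  rewrite (_ : (fun N => _) = (fun=> fun=> 0)); first by apply: l2cvg_cst; exact: measurable_cst.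
  by apply/funext => N; apply/funext => z; rewrite /epart big_nil.
Qed.

Lemma ito_sumD H J H' J' : ito_sum H J -> ito_sum H' J' ->
  ito_sum (fun k u w => H k u w + H' k u w) (fun t w => J t w + J' t w).
Proof.
move=> [mH fH aJ sJ [es [cH cJ]]] [mH' fH' aJ' sJ' [es' [cH' cJ']]].
have cE k : cut 0 T (fun u w => H k u w + H' k u w) = (fun z => cut 0 T (H k) z + cut 0 T (H' k) z).
  by apply/funext => z; rewrite /cut mulrDl.
split.
- by move=> k; rewrite cE; exact: measurable_funD.
- by move=> k; rewrite cE; exact: sqintD.
- by move=> t tT; exact: (measurable_funD (aJ t tT) (aJ' t tT)).
- by move=> t tT; apply: sqintD; [exact: sJ|exact: sJ'].
- exists (fun N => es N ++ es' N); split => [k|t tT].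
    rewrite cE; have := l2cvgD (cH k) (cH' k); congr l2cvg.
    by apply/funext => N; apply/funext => z; rewrite /eval big_cat.
  have := l2cvgD (cJ t tT) (cJ' t tT); congr l2cvg.
  by apply/funext => N; apply/funext => z; rewrite /epart big_cat.
Qed.

Definition piece_opp (e : piece) : piece.
Proof.
apply: (@Piece _ _ _ _ _ _ W n (pk e) (pa e) (pb e) (fun w => - pc e w) (piece_ab e) (piece_bT e)).
have [h [M hM]] := piece_c e; split; first exact: (measurableT_comp (@oppr_measurable R setT) h).
by exists M => w; rewrite normrN.
Defined.

Lemma ito_sumN H J : ito_sum H J -> ito_sum (fun k u w => - H k u w) (fun t w => - J t w).
Proof.
move=> [mH fH aJ sJ [es [cH cJ]]].
have cE k : cut 0 T (fun u w => - H k u w) = (fun z => 0 - cut 0 T (H k) z).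
  by apply/funext => z; rewrite /cut mulNr sub0r.
split.
- by move=> k; rewrite cE; apply: measurable_funB => //; exact: measurable_cst.
- by move=> k; rewrite cE; apply: sqintB => //; exact: sqint0.
- by move=> t tT; exact: (measurableT_comp (@oppr_measurable R setT) (aJ t tT)).
- by move=> t tT; apply: sqintN; exact: sJ.
- exists (fun N => map piece_opp (es N)); split => [k|t tT].
    rewrite cE; have := l2cvgB (l2cvg_cst PL (measurable_cst (0 : R))) (cH k); congr l2cvg.
    apply/funext => N; apply/funext => z; rewrite /eval big_map sub0r -sumrN; apply: eq_bigr => e _.
    by rewrite /pval/=; ring.
  have := l2cvgB (l2cvg_cst P (measurable_cst (0 : R))) (cJ t tT).
  rewrite (_ : (fun x => 0 - J t x) = (fun x => - J t x)); last by apply/funext => w; rewrite sub0r.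
  congr l2cvg; apply/funext => N; apply/funext => z; rewrite /epart big_map sub0r -sumrN; apply: eq_bigr => e _.
  by rewrite /ppart/=; ring.
Qed.

Lemma ito_sum_sum (I : Type) (r : seq I) (H : I -> K -> R -> Omega -> R) (J : I -> R -> Omega -> R) :
  (forall i, ito_sum (H i) (J i)) ->
  ito_sum (fun k u w => \sum_(i <- r) H i k u w) (fun t w => \sum_(i <- r) J i t w).
Proof.
move=> h; elim: r => [|i r IH].
  have := ito_sum0; congr ito_sum.
    by apply/funext => k; apply/funext => u; apply/funext => w; rewrite big_nil.
  by apply/funext => u; apply/funext => w; rewrite big_nil.
have := ito_sumD (h i) IH; congr ito_sum.
  by apply/funext => k; apply/funext => u; apply/funext => w; rewrite big_cons.
by apply/funext => u; apply/funext => w; rewrite big_cons.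
Qed.

Lemma ito_martingale H J s t X : ito_sum H J -> 0 <= s -> s <= t -> t <= T ->
  sqint P X -> smeas (NF s) X -> ip P X (fun w => J t w - J s w) = 0.
Proof.
move=> hI s0 st tT hX mX.
have sT : 0 <= s <= T by rewrite s0 (le_trans st).
have tT' : 0 <= t <= T by rewrite tT (le_trans s0).
have hth : bounded_coef W n s (fun=> 1) by split; [exact: measurable_cst|exists 1 => w; rewrite normr1].
have h1 := ito_pythagoras hI s0 st tT hth hX mX.
have m0 : smeas (NF s) (fun=> 0 : R) by exact: measurable_cst.
have h2 := ito_pythagoras hI s0 st tT hth (sqint0 P) m0.
have hJ : sqint P (fun w => 1 * (J t w - J s w)).
  by apply: sqintZ; apply: sqintB; exact: ito_sqint hI _ _.
move: h1; rewrite ip_sqrD//.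
have e0 : (\int[P]_w ((0 + 1 * (J t w - J s w)) ^+ 2)%:E = \int[P]_w ((1 * (J t w - J s w)) ^+ 2)%:E)%E.
  by apply: eq_integral => w _; rewrite add0r.
move: h2; rewrite e0; under [X in (X + _)%E]eq_integral do rewrite expr0n/=.
rewrite integral0 add0e => <-.
rewrite -(ip_sqr hX) -(ip_sqr hJ) -!EFinD => -[].
set b := ip P X (fun w => 1 * _) => h.
have -> : ip P X (fun w => J t w - J s w) = b.
  by rewrite /b; congr ip; apply/funext => w; rewrite mul1r.
lra.
Qed.

End ItoSums.

(** * Doob's maximal inequality *)

Section RunningMaximum.
Context {R : realType}.
Implicit Types x : nat -> R.

Fixpoint rmax x k := if k is k'.+1 then Num.max (rmax x k') (x k) else x 0%N.

Lemma rmax_ge x j k : (j <= k)%N -> x j <= rmax x k.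
Proof.
elim: k => [|k IH]; first by rewrite leqn0 => /eqP ->.
by rewrite leq_eqVlt ltnS => /orP[/eqP ->|/IH h] /=; rewrite le_max ?lexx ?orbT ?h.
Qed.

Lemma rmax_le x k b : (forall j, (j <= k)%N -> x j <= b) -> rmax x k <= b.
Proof.
elim: k => [|k IH] h; first exact: h.
by rewrite /= ge_max IH ?h// => j jk; apply: h; exact: leqW.
Qed.

(* Summation by parts: the sum equals [rmax x N * x N] minus the increments of [rmax x ^+ 2 / 2], up to a nonnegative term. *)
Lemma rmax_sqr x N :
  rmax x N ^+ 2 + 4 * \sum_(k < N) rmax x k * (x k.+1 - x k) <= 4 * x N ^+ 2.
Proof.
suff h : \sum_(k < N) rmax x k * (x k.+1 - x k) <= rmax x N * x N - rmax x N ^+ 2 / 2.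
  by have := sqr_ge0 (2 * x N - rmax x N); nra.
elim: N => [|N IH]; first by rewrite big_ord0 /=; have := sqr_ge0 (x 0%N); nra.
rewrite big_ord_recr/=; have [h|h] := leP (x N.+1) (rmax x N); first by nra.
by have := sqr_ge0 (x N.+1 - rmax x N); nra.
Qed.

(** The sign of [a], taken as 1 at 0, is a subgradient of the absolute value at [a]. This stands in
    for the submartingale property of |M|. *)
Lemma sign_mul_le (a b : R) : (2 * (0 <= a)%R%:R - 1) * (b - a) <= `|b| - `|a|.
Proof.
case: (leP 0 a) => h; rewrite /=.
  by rewrite (ger0_norm h); have := ler_norm b; lra.
by rewrite (ltr0_norm h); have := ler_norm (- b); rewrite normrN; lra.
Qed.

End RunningMaximum.

Lemma le_ereal_sup_mem {R : realType} (S : set (\bar R)) x y : S y -> (x <= y)%E -> (x <= ereal_sup S)%E.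
Proof. by move=> Sy xy; apply: le_trans xy _; exact: ereal_sup_ubound. Qed.

Lemma within_cvg_seq {R : realType} (V : topologicalType) (A : set R) (f : R -> V) (u : nat -> R) x :
  {within A, continuous f} -> A x -> (forall n, A (u n)) -> u n @[n --> \oo] --> x ->
  f (u n) @[n --> \oo] --> f x.
Proof.
move=> /subspace_continuousP cf Ax Au ux.
apply: (cvg_comp u f _ (cf x Ax)) => B hB.
have [N _ hN] := ux [set t | A t -> B t] hB.
by exists N => // m /= Nm; exact: (hN m Nm (Au m)).
Qed.

Section Doob.
Context {R : realType} {T : R} {d : nat} {mu : probability (cpath T d) R}.
Hypothesis hmu : is_wiener mu.
Context {d0 : measure_display} {Omega : measurableType d0} {P : probability Omega R}.
Hypothesis cP : measure_is_complete P.
Variable W : nat -> {RV P >-> cpath T d}.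
Hypothesis lawW : forall i A, measurable A -> distribution P (W i) A = mu A.
Hypothesis indW : mutually_independent W.
Variable n : nat.
Local Notation NF := (noise_filtration W n.+1).
Local Notation leb := (@lebesgue_measure R).
Local Notation K := ('I_n.+1 * 'I_d)%type.
Variables (H : K -> R -> Omega -> R) (J : R -> Omega -> R).
Hypothesis hI : ito_sum W H J.
Let M t w := J t w - J 0 w.

(** A pathwise inequality plus a martingale transform. In [rmax_sqr] for |M|, the increments of |M|
    are bounded below by sign times the increments of M; the resulting sum has an integrand known at
    the left end of each step, hence mean zero. *)
Lemma discrete_doob (t : nat -> R) N : (forall k, 0 <= t k <= T) -> {homo t : i j / (i <= j)%N >-> i <= j} ->
  measurable_fun setT (fun w => rmax (fun k => `|M (t k) w|) N) /\
  (\int[P]_w ((rmax (fun k => `|M (t k) w|) N) ^+ 2)%:E <= 4%:E * \int[P]_w (M (t N) w ^+ 2)%:E)%E.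
Proof.
move=> tT tm.
have t0T (i : nat) : 0 <= T by have /andP[h1 h2] := tT i; exact: le_trans h2.
have z0 : (0 : R) <= 0 <= T by rewrite lexx (t0T 0%N).
have mM i j : (i <= j)%N -> smeas (NF (t j)) (M (t i)).
  move=> ij; apply: measurable_funB.
    by apply: (smeas_noise_le (tm _ _ ij)); exact: ito_adapted hI _ (tT i).
  have h0 : 0 <= t j by case/andP: (tT j).
  by apply: (smeas_noise_le h0); exact: ito_adapted hI _ z0.
have sM i : sqint P (M (t i)) by apply: sqintB; apply: ito_sqint hI _ _.
have mR i j : (i <= j)%N -> smeas (NF (t j)) (fun w => rmax (fun k => `|M (t k) w|) i).
  elim: i => [|i IH] ij /=; first exact: (measurableT_comp (@normr_measurable R setT) (mM _ _ ij)).
  apply: (measurable_maxr (IH (ltnW ij))).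
  exact: (measurableT_comp (@normr_measurable R setT) (mM _ _ ij)).
have tjT j : t j <= T by case/andP: (tT j).
have mR' i : measurable_fun setT (fun w => rmax (fun k => `|M (t k) w|) i).
  by apply: (noise_measurable_fun cP (tjT i)); exact: (mR i i (leqnn i)).
have R0 i w : 0 <= rmax (fun k => `|M (t k) w|) i.
  by apply: le_trans (rmax_ge _ (leq0n i)).
have sR i : sqint P (fun w => rmax (fun k => `|M (t k) w|) i).
  elim: i => [|i [mi IH]].
    apply: (@sqint_dom _ _ _ _ _ (fun w => (M (t 0%N) w ^+ 2)%:E)) (mR' 0%N) _ (sM 0%N).2.
    by move=> w; rewrite /= lee_fin real_normK// num_real.
  apply: (@sqint_dom _ _ _ _ _ (fun w => (1 * rmax (fun k => `|M (t k) w|) i ^+ 2 + 1 * M (t i.+1) w ^+ 2)%:E)) (mR' i.+1) _ _.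
    move=> w; rewrite /= lee_fin !mul1r.
    have [h|h] := leP (rmax (fun k => `|M (t k) w|) i) `|M (t i.+1) w|.
      by rewrite real_normK ?num_real// lerDr sqr_ge0.
    by rewrite lerDl sqr_ge0.
  rewrite sqint_int_sumZ//; last exact: (sM i.+1).1.
  by rewrite !mul1e lte_add_pinfty//; exact: (sM i.+1).2.
split; first exact: mR'.
pose sg i w : R := 2 * \1_[set w | 0 <= M (t i) w] w - 1.
have msg i : smeas (NF (t i)) (sg i).
  apply: measurable_funB; last exact: measurable_cst.
  apply: measurable_funM; first exact: measurable_cst.
  apply: measurable_indic; apply: (@measurable_le_set _ _ (g_sigma_algebraType (NF (t i))) (fun=> 0)); first exact: measurable_cst.
  exact: mM.
have sg1 i w : `|sg i w| <= 1.
  rewrite /sg indicE; case: (w \in _); last by rewrite mulr0 sub0r normrN normr1.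
  by rewrite mulr1 (_ : 2 - 1 = 1 :> R) ?normr1//; ring.
pose phi i w := rmax (fun k => `|M (t k) w|) i * sg i w.
have sphi i : sqint P (phi i).
  rewrite /phi; under eq_fun do rewrite mulrC.
  by apply: sqint_bndM (sg1 i) (sR i); by apply: (noise_measurable_fun cP (tjT i)); exact: msg.
have mphi i : smeas (NF (t i)) (phi i) by exact: (measurable_funM (mR i i (leqnn i)) (msg i)).
have sJ i : sqint P (fun w => J (t i.+1) w - J (t i) w) by apply: sqintB; apply: ito_sqint hI _ _.
have ip0 i : ip P (phi i) (fun w => J (t i.+1) w - J (t i) w) = 0.
  apply: (ito_martingale hmu cP lawW indW hI) => //; first by case/andP: (tT i).
  exact: tm.
have path w : rmax (fun k => `|M (t k) w|) N ^+ 2 +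
    4 * \sum_(i < N) phi i w * (J (t i.+1) w - J (t i) w) <= 4 * M (t N) w ^+ 2.
  have := rmax_sqr (fun k => `|M (t k) w|) N; rewrite real_normK ?num_real//.
  apply: le_trans; rewrite lerD2l ler_wpM2l//; apply: ler_sum => i _.
  rewrite /phi -mulrA ler_wpM2l//.
  have -> : J (t i.+1) w - J (t i) w = M (t i.+1) w - M (t i) w by rewrite /M; ring.
  rewrite /sg indicE (_ : (w \in _) = (0 <= M (t i) w)); first exact: sign_mul_le.
  by apply/idP/idP => [/set_mem|/mem_set].
have iphi i : P.-integrable setT (fun w => (phi i w * (J (t i.+1) w - J (t i) w))%:E).
  exact: sqint_mul_integrable.
have iS : P.-integrable setT (fun w => (4 * \sum_(i < N) phi i w * (J (t i.+1) w - J (t i) w))%:E).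
  under eq_fun do rewrite EFinM -sumEFin.
  by apply: integrableZl => //; apply: integrable_sum => // i _; exact: iphi.
have iS0 : (\int[P]_w (4 * \sum_(i < N) phi i w * (J (t i.+1) w - J (t i) w))%:E = 0)%E.
  under eq_integral do rewrite EFinM -sumEFin.
  rewrite integralZl//; last by apply: integrable_sum => // i _; exact: iphi.
  rewrite integral_sum// big1 ?mule0// => i _.
  by rewrite -ipE// ip0.
have iR : P.-integrable setT (fun w => (rmax (fun k => `|M (t k) w|) N ^+ 2)%:E).
  have := sqint_mul_integrable (sR N) (sR N); congr integrable; apply/funext => w; by rewrite -expr2.
have iM : P.-integrable setT (fun w => (M (t N) w ^+ 2)%:E).
  have := sqint_mul_integrable (sM N) (sM N); congr integrable; apply/funext => w; by rewrite -expr2.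
rewrite -integralZl//.
have -> : (\int[P]_w (rmax (fun k => `|M (t k) w|) N ^+ 2)%:E = \int[P]_w ((rmax (fun k => `|M (t k) w|) N ^+ 2)%:E +
    (4 * \sum_(i < N) phi i w * (J (t i.+1) w - J (t i) w))%:E))%E.
  by rewrite integralD// iS0 adde0.
apply: le_integral => //; first exact: integrableD.
  exact: integrableZl.
by move=> w _; rewrite -EFinD -EFinM lee_fin.
Qed.

(** The supremum over all times need not be measurable, so a measurable majorant [L] is produced:
    the supremum along the dyadic grids, integrated by monotone convergence. Continuity of the paths
    extends the bound to all times outside a null set. *)
Lemma doob : 0 < T -> {ae P, forall w, {within `[0, T], continuous (J ^~ w)}} ->
  exists2 L : Omega -> \bar R,
    [/\ measurable_fun setT L, forall w, (0 <= L w)%E & (\int[P]_w L w <=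
   4%:E * \sum_(k : K) \int[P]_w \int[leb]_u ((H k u w * (0 < u <= T)%R%:R) ^+ 2)%:E)%E] &
    {ae P, forall w, forall t, 0 <= t <= T -> (((J t w - J 0 w) ^+ 2)%:E <= L w)%E}.
Proof.
move=> T0 cJ.
have energy : (\int[P]_w (M T w ^+ 2)%:E =
    \sum_(k : K) \int[P]_w \int[leb]_u ((H k u w * (0 < u <= T)%R%:R) ^+ 2)%:E)%E.
  have hth : bounded_coef W n 0 (fun=> 1) by split; [exact: measurable_cst|exists 1 => w; rewrite normr1].
  have m0 : smeas (NF 0) (fun=> 0 : R) by exact: measurable_cst.
  have := ito_pythagoras hmu cP lawW indW hI (lexx 0) (ltW T0) (lexx T) hth (sqint0 P) m0.
  under [X in (X + _)%E]eq_integral do rewrite expr0n/=.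
  rewrite integral0 add0e => e1.
  transitivity (\int[P]_w ((0 + 1 * (J T w - J 0 w)) ^+ 2)%:E)%E.
    by apply: eq_integral => w _; rewrite add0r mul1r.
  rewrite e1; apply: eq_bigr => k _; apply: eq_integral => w _; apply: eq_integral => u _.
  by rewrite mul1r.
(* Dyadic points of [0, T], stopped at T. Point k of one grid is point 2k of the next, which makes
   the running maxima increase with N. *)
pose t N k : R := T * (minn k (2 ^ N))%:R / (2 ^ N)%:R.
have p0 N : 0 < (2 ^ N)%:R :> R by rewrite ltr0n expn_gt0.
have tT N k : 0 <= t N k <= T.
  rewrite /t divr_ge0 ?mulr_ge0 ?(ltW T0) ?(ltW (p0 _))//= ler_pdivrMr//.
  by rewrite ler_wpM2l ?(ltW T0)// ler_nat geq_minr.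
have tm N : {homo t N : i j / (i <= j)%N >-> i <= j}.
  move=> i j ij; rewrite /t ler_wpM2r ?invr_ge0 ?(ltW (p0 _))// ler_wpM2l ?(ltW T0)// ler_nat.
  by rewrite leq_min geq_minr andbT (leq_trans (geq_minl _ _)).
pose D N w := rmax (fun k => `|M (t N k) w|) (2 ^ N).
have tN N : t N (2 ^ N)%N = T by rewrite /t minnn mulfK// gt_eqF.
have mD N : measurable_fun setT (D N) := (discrete_doob (2 ^ N) (tT N) (tm N)).1.
have hD N : (\int[P]_w (D N w ^+ 2)%:E <= 4%:E * \int[P]_w (M T w ^+ 2)%:E)%E.
  by have := (discrete_doob (2 ^ N) (tT N) (tm N)).2; rewrite tN.
have D0 N w : 0 <= D N w by apply: le_trans (rmax_ge _ (leq0n _)).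
have tS N k : t N k = t N.+1 (2 * k)%N.
  rewrite /t expnS -minnMr natrM [in RHS]natrM invfM.
  by have := p0 N; have : (2 : R) != 0 by []; move=> h1 h2; field; rewrite gt_eqF.
have Dmon w N : D N w <= D N.+1 w.
  apply: rmax_le => k kN; rewrite tS; apply: (@rmax_ge _ (fun k => `|M (t N.+1 k) w|)).
  by rewrite expnS leq_mul2l kN orbT.
have Dmono w : {homo (fun N => (D N w ^+ 2)%:E) : i j / (i <= j)%N >-> (i <= j)%E}.
  apply/nondecreasing_seqP => N; rewrite lee_fin lerXn2r ?nnegrE//.
pose L w := ereal_sup (range (fun N => (D N w ^+ 2)%:E)).
have Dcvg w : (D N w ^+ 2)%:E @[N --> \oo] --> L w by exact: ereal_nondecreasing_cvgn.
have mDE N : measurable_fun setT (fun w => (D N w ^+ 2)%:E) by exact: measurable_sqE.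
have Lcvg : (\int[P]_w (D N w ^+ 2)%:E)%E @[N --> \oo] --> (\int[P]_w L w)%E.
  have -> : (\int[P]_w L w = \int[P]_w (limn (fun N => (D N w ^+ 2)%:E)))%E.
    by apply: eq_integral => w _; apply/esym/cvg_lim.
  apply: cvg_monotone_convergence => //.
  - by move=> N w _; rewrite lee_fin sqr_ge0.
have Lle : (\int[P]_w L w <= 4%:E * \int[P]_w (M T w ^+ 2)%:E)%E.
  rewrite -(cvg_lim _ Lcvg)//; apply: lime_le; first by apply/cvg_ex; eexists; exact: Lcvg.
  by near=> N; exact: hD.
have mL : measurable_fun setT L.
  apply: (emeasurable_fun_cvg (fun N w => (D N w ^+ 2)%:E)) => //.
exists L; first split => //.
- move=> w; apply: (@le_ereal_sup_mem _ _ _ (D 0%N w ^+ 2)%:E); last by rewrite lee_fin sqr_ge0.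
  by exists 0%N.
- by rewrite -energy.
apply: filterS cJ => w cw x xT'.
have xT : `[0, T]%classic x by rewrite /= in_itv.
have /andP[x0 xT2] := xT'.
(* Index of the last grid point not after [x]. *)
pose k N := Num.truncn (x / T * (2 ^ N)%:R).
have kb N : (k N)%:R <= x / T * (2 ^ N)%:R < (k N).+1%:R.
  by apply: truncn_itv; rewrite !mulr_ge0 ?invr_ge0 ?(ltW T0) ?(ltW (p0 _)).
have kN N : (k N <= 2 ^ N)%N.
  rewrite -(ler_nat R); apply: (le_trans (proj1 (andP (kb N)))).
  by rewrite ler_piMl ?(ltW (p0 _))// ler_pdivrMr// mul1r.
have tkE N : t N (k N) = T * (k N)%:R / (2 ^ N)%:R by rewrite /t (minn_idPl (kN N)).
have tkc : t N (k N) @[N --> \oo] --> x.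
  apply/cvgrPdist_le => e e0.
  have : (2^-1 : R) ^+ N @[N --> \oo] --> (0 : R).
    by apply: cvg_expr; rewrite ger0_norm ?invr_ge0// invf_lt1// ltr1n.
  move/cvgrPdist_le => /(_ (e / T)); rewrite divr_gt0// => /(_ isT).
  apply: filterS => N; rewrite sub0r normrN ger0_norm ?exprn_ge0 ?invr_ge0// => hN.
  have /andP[k1 k2] := kb N; rewrite tkE.
  have E1 : x = T * (x / T * (2 ^ N)%:R) / (2 ^ N)%:R.
    by field; rewrite !gt_eqF.
  have E2 : x - T * (k N)%:R / (2 ^ N)%:R = T / (2 ^ N)%:R * (x / T * (2 ^ N)%:R - (k N)%:R).
    by rewrite {1}E1; field; rewrite !gt_eqF.
  have c0 : 0 <= T / (2 ^ N)%:R by rewrite divr_ge0 ?(ltW T0) ?(ltW (p0 _)).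
  rewrite E2 ger0_norm; last by rewrite mulr_ge0// subr_ge0.
  apply: (@le_trans _ _ (T / (2 ^ N)%:R * 1)).
    by rewrite ler_wpM2l// lerBlDr addrC natr1 ltW.
  by move: hN; rewrite ler_pdivlMr// mulr1 exprVn natrX mulrC.
have Jc : J (t N (k N)) w @[N --> \oo] --> J x w.
  apply: (within_cvg_seq cw xT _ tkc) => N; rewrite /= in_itv/=; exact: tT.
have Mc : ((J (t N (k N)) w - J 0 w) ^+ 2)%:E @[N --> \oo] --> ((J x w - J 0 w) ^+ 2)%:E.
  apply: cvg_EFin; first by near=> N.
  have cB : J (t N (k N)) w - J 0 w @[N --> \oo] --> J x w - J 0 w.
    by apply: cvgB => //; exact: cvg_cst.
  exact: (cvgM cB cB).
rewrite -(cvg_lim _ Mc)//; apply: lime_le; first by apply/cvg_ex; eexists; exact: Mc.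
near=> N; apply: (@le_ereal_sup_mem _ _ _ (D N w ^+ 2)%:E); first by exists N.
rewrite lee_fin -[leLHS]real_normK ?num_real// lerXn2r ?nnegrE//.
exact: (@rmax_ge _ (fun k => `|M (t N k) w|)).
Unshelve. all: by end_near. Qed.

End Doob.

(** * Stability of backward equations *)

Section BackwardIteration.
Context {R : realType}.

(** A Gronwall statement backwards in time. Here [a s] stands for the second moment of a difference
    at time s, [b s t] for the energy of its integrand on [s, t], [rho] for the total source, and
    [M] for a bound of [a] on the step. It is stated for all functions at once, so that [K] depends
    on T and c only and can be fixed before the probability space. *)
Definition stability_constant (T c K : R) := 0 <= K /\
  forall (s0 : R) (a : R -> R) (b : R -> R -> R) (rho : R), s0 <= T -> 0 <= s0 -> 0 <= rho ->
  (forall s, s0 <= s <= T -> 0 <= a s) ->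
  (exists M, forall s, s0 <= s <= T -> a s <= M) ->
  (forall s t, s0 <= s -> s <= t -> t <= T -> 0 <= b s t) ->
  (forall r s t, s0 <= r -> r <= s -> s <= t -> t <= T -> b r t = b r s + b s t) ->
  (forall s t M, s0 <= s -> s <= t -> t <= T -> (forall u, s <= u <= t -> a u <= M) ->
    a s + b s t <= 2 * a t + c * (t - s) * (M + b s t + rho)) ->
  forall s, s0 <= s <= T -> a s + rho + b s T <= K * (a T + rho).

(* Over steps of length at most 1/(4(c+1)) the one-step inequality can be solved for its own right-hand side;
   each such step multiplies [a + rho + b] by at most 12. *)
Lemma backward_iteration (T c : R) : 0 <= T -> 0 <= c -> exists K : R, stability_constant T c K.
Proof.
move=> T0 c0.
(* Step length with c h <= 1/4, which lets a quarter of the right-hand side be absorbed. *)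
pose h : R := (4 * (c + 1))^-1.
have c1 : 0 < 4 * (c + 1) by lra.
have h0 : 0 < h by rewrite invr_gt0.
have ch : c * h <= 4^-1.
  by rewrite /h ler_pdivrMr// ; lra.
pose N := (Num.truncn (T / h)).+1.
have NT : T <= N%:R * h.
  have Th : 0 <= T / h by rewrite divr_ge0// ltW.
  by rewrite -ler_pdivrMr// ltW//; have /andP[_ ->] := truncn_itv Th.
exists (12 ^+ N); split => [|s0 a b rho s0T s00 rho0 a0 [Mb hMb] b0 badd hstep]; first exact: exprn_ge0.
(* With 11 for one step, adding the energy of the remaining interval gives the factor 12 per
   step. *)
have short s t : s0 <= s -> s <= t -> t <= T -> t - s <= h ->
    a s + rho + b s t <= 11 * (a t + rho).
  move=> s0s st tT tsh.
  pose S := sup [set a u | u in [set u | s <= u <= t]].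
  have hub : has_ubound [set a u | u in [set u | s <= u <= t]].
    exists Mb => _ [u /= /andP[su ut] <-]; apply: hMb; rewrite (le_trans s0s su) (le_trans ut tT) //.
  have inS u : s <= u <= t -> a u <= S by move=> ut; apply: ub_le_sup => //; exists u.
  have at0 : 0 <= a t by apply: a0; rewrite tT (le_trans s0s).
  have S0 : 0 <= S by apply: le_trans (inS t _) => //; rewrite st lexx.
  have key u : s <= u <= t -> a u + b u t <= 2 * a t + 4^-1 * (S + b u t + rho).
    move=> /andP[su ut].
    have hb : 0 <= b u t by apply: b0 => //; exact: le_trans su.
    apply: le_trans (hstep u t S _ ut tT _) _.
    - exact: le_trans su.
    - by move=> v /andP[uv vt]; apply: inS; rewrite (le_trans su).
    - rewrite lerD2l ler_wpM2r//; first lra.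
      apply: le_trans ch; rewrite ler_wpM2l//; lra.
  (* The one-step inequality holds from every starting time in [s, t], so the supremum can be taken
     on the left and its quarter on the right absorbed. Boundedness of [a] makes the supremum
     finite. *)
  have SS : S <= 2 * a t + 4^-1 * (S + rho).
    apply: ge_sup; first by exists (a t); exists t => //=; rewrite st lexx.
    move=> _ [u /= hu <-]; have := key u hu.
    have : 0 <= b u t by case/andP: hu => su ut; apply: b0 => //; exact: le_trans su.
    lra.
  have := key s; rewrite lexx st => /(_ isT).
  have : 0 <= b s t by exact: b0.
  have : 0 <= a s by apply: a0; rewrite s0s (le_trans st).
  lra.
have bTT : b T T = 0 by have := badd T T T s0T (lexx _) (lexx _) (lexx _); lra.
have aT0 : 0 <= a T by apply: a0; rewrite s0T lexx.
have main j s : s0 <= s <= T -> T - s <= j%:R * h -> a s + rho + b s T <= 12 ^+ j * (a T + rho).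
  elim: j s => [|j IH] s /andP[s0s sT].
    rewrite mul0r subr_le0 => Ts; have -> : s = T by apply/eqP; rewrite eq_le sT.
    by rewrite bTT addr0 mul1r.
  move=> hs; pose t := Num.min T (s + h).
  have st : s <= t by rewrite le_min sT lerDl ltW.
  have tT : t <= T by rewrite ge_min lexx.
  have s0t : s0 <= t by exact: le_trans st.
  have ts : t - s <= h by rewrite lerBlDl ge_min lexx orbT.
  have tj : T - t <= j%:R * h.
    have [h3|h3] := leP T (s + h).
      by rewrite /t min_l// subrr mulr_ge0 ?ler0n ?(ltW h0).
    by rewrite /t min_r ?(ltW h3)//; move: hs; rewrite -natr1 mulrDl mul1r; lra.
  have h1 := short s t s0s st tT ts.
  have h2 := IH t (introT andP (conj s0t tT)) tj.
  have at0 : 0 <= a t by apply: a0; rewrite s0t.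
  have bt0 : 0 <= b t T by exact: b0.
  rewrite (badd s t T) // exprS -mulrA; lra.
move=> s hs; apply: main => //; case/andP: hs => s0s sT.
by apply: le_trans NT; lra.
Qed.

End BackwardIteration.

(** * Discretisation in time and joint measurability *)

Section MeasurableCodes.
Context {dS : measure_display} {S : measurableType dS} (D : set S) (mD : measurable D).

(** A function chosen from a countable family by a measurable code is measurable; all
    discretisations below are of this form. *)
Lemma measurable_code dV (V : measurableType dV) (C : countType) (c : S -> C) (g : C -> S -> V) :
  (forall a, measurable (D `&` c @^-1` [set a])) -> (forall a, measurable_fun D (g a)) ->
  measurable_fun D (fun s => g (c s) s).
Proof.
move=> mc mg _ B mB.
rewrite (_ : _ `&` _ = \bigcup_(a in [set: C]) ((D `&` c @^-1` [set a]) `&` (D `&` g a @^-1` B))).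
  apply: countable_bigcupT_measurable; first exact: countableP.
  by move=> a; apply: measurableI => //; exact: mg.
apply/seteqP; split => [s [Ds Bs]|s [a _ [[Ds /= <-] [_ Bs]]]]; last by split.
by exists (c s).
Qed.

End MeasurableCodes.

Section TimeGrid.
Context {R : realType} (T : R) (T0 : 0 < T).

Definition grid_point (N k : nat) : R := T * (minn k N.+1)%:R / N.+1%:R.
Definition grid_code (N : nat) (u : R) : nat := Num.truncn (u / T * N.+1%:R).
Definition grid N u := grid_point N (grid_code N u).

Lemma grid_range N k : 0 <= grid_point N k <= T.
Proof.
rewrite /grid_point divr_ge0 ?mulr_ge0 ?(ltW T0)//= ler_pdivrMr ?ltr0n//.
by rewrite ler_wpM2l ?(ltW T0)// ler_nat geq_minr.
Qed.

Lemma grid_cvg u : 0 <= u <= T -> grid N u @[N --> \oo] --> u.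
Proof.
move=> /andP[u0 uT]; apply/cvgrPdist_le => e e0.
have : (N.+1%:R^-1 : R) @[N --> \oo] --> (0 : R) by exact: cvg_harmonic.
move/cvgrPdist_le => /(_ (e / T)); rewrite divr_gt0// => /(_ isT).
apply: filterS => N; rewrite sub0r normrN ger0_norm ?invr_ge0// => hN.
have x0 : 0 <= u / T * N.+1%:R by rewrite !mulr_ge0 ?invr_ge0 ?(ltW T0).
have /andP[k1 k2] := truncn_itv x0.
have kN : (grid_code N u <= N.+1)%N.
  rewrite -(ler_nat R); apply: (le_trans k1).
  by rewrite ler_piMl// ler_pdivrMr// mul1r.
rewrite /grid /grid_point (minn_idPl kN).
have E2 : u - T * (grid_code N u)%:R / N.+1%:R = T / N.+1%:R * (u / T * N.+1%:R - (grid_code N u)%:R).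
  have N0 : (N.+1%:R : R) != 0 by rewrite pnatr_eq0.
  have T1 : T != 0 by rewrite gt_eqF.
  by move: (N.+1%:R : R) N0 => M M0; field; rewrite M0 T1.
have c0 : 0 <= T / N.+1%:R by rewrite divr_ge0 ?(ltW T0).
rewrite E2 ger0_norm; last by rewrite mulr_ge0// subr_ge0.
apply: (@le_trans _ _ (T / N.+1%:R * 1)).
  by rewrite ler_wpM2l// lerBlDr addrC natr1 ltW.
by move: hN; rewrite ler_pdivlMr// mulr1 mulrC.
Qed.

Lemma measurable_grid_code N k : measurable (grid_code N @^-1` [set k]).
Proof.
have mono : {homo (fun u : R => (grid_code N u)%:R : R) : x y / x <= y}.
  move=> x y xy; rewrite ler_nat; apply: le_truncn.
  by rewrite ler_wpM2r// ler_wpM2r// invr_ge0 ltW.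
have := nondecreasing_measurable measurableT mono measurableT (measurable_set1 (k%:R : R)).
rewrite setTI; congr measurable; apply/seteqP; split => u /=; last by move=> ->.
by move/eqP; rewrite eqr_nat => /eqP.
Qed.

(** A process with continuous paths is the pointwise limit of its values at the preceding grid
    point, which are jointly measurable because the grid is discrete. Every path has to be
    continuous, not only almost every one. *)
Lemma joint_measurable dS (S : measurableType dS) (Y : R -> S -> R) :
  (forall t, 0 <= t <= T -> measurable_fun setT (Y t)) ->
  (forall w, {within `[0, T], continuous (Y ^~ w)}) ->
  measurable_fun setT (fun z : R * S => Y z.1 z.2 * (0 < z.1 <= T)%R%:R).
Proof.
move=> mY cY.
have mi : measurable_fun setT (fun z : R * S => (0 < z.1 <= T)%R%:R : R).
  exact: (measurableT_comp (@measurable_ind R 0 T) (@measurable_fst _ _ R S)).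
apply: (measurable_fun_cvg (h := fun N z => Y (grid N z.1) z.2 * (0 < z.1 <= T)%R%:R)).
  move=> N; apply: measurable_funM => //.
  apply: (@measurable_code _ _ setT measurableT _ R nat (fun z => grid_code N z.1) (fun k z => Y (grid_point N k) z.2)).
    move=> k; rewrite setTI.
    rewrite (_ : _ @^-1` _ = (grid_code N @^-1` [set k]) `*` setT); last first.
      by apply/seteqP; split => z //= [].
    by apply: measurableX => //; exact: measurable_grid_code.
  by move=> k; apply: measurableT_comp; [apply: mY; exact: grid_range|exact: measurable_snd].
move=> [u w] _ /=; case: (boolP (0 < u <= T)) => [/andP[u0 uT]|_]; last first.
  by under eq_fun do rewrite mulr0; rewrite mulr0; exact: cvg_cst.
under eq_fun do rewrite mulr1; rewrite mulr1.
have uT' : 0 <= u <= T by rewrite uT ltW.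
apply: (within_cvg_seq (cY w) _ _ (grid_cvg uT')); first by rewrite /= in_itv.
by move=> N; rewrite /= in_itv/= grid_range.
Qed.

End TimeGrid.

(** * Random variables as functionals of one path *)

Section Transfer.
Context {R : realType} {T : R} {d : nat} {mu : probability (cpath T d) R}.
Context {d0 : measure_display} {Omega : measurableType d0} {P : probability Omega R}.
Hypothesis cP : measure_is_complete P.
Variable W : nat -> {RV P >-> cpath T d}.
Hypothesis lawW : forall i A, measurable A -> distribution P (W i) A = mu A.
Local Notation NF := (noise_filtration W 1).
Local Notation cyl := (@cylinders R T d).

Lemma transfer_set t (B : set Omega) : <<s NF t >> B ->
  exists2 B' : set (cpath T d), <<s cyl t >> B' & {ae P, forall w, B w <-> B' (W 0%N w)}.
Proof.
suff : <<s NF t >> `<=` [set B | exists2 B' : set (cpath T d), <<s cyl t >> B' & {ae P, forall w, B w <-> B' (W 0%N w)}].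
  by move=> h /h.
apply: smallest_sub.
  split => [|A [A' mA' hA]|F hF].
  - by exists set0; [exact: sigma_algebra0|exact: aeW].
  - exists (~` A'); first by rewrite -setTD; exact: sigma_algebraCD.
    by apply: filterS hA => w h; rewrite setTD; split => h1 /h.
  - have [F' hF'] := choice (fun k => let: ex_intro2 A' h1 h2 := hF k in
        ex_intro (fun A' => <<s cyl t >> A' /\ {ae P, forall w, F k w <-> A' (W 0%N w)}) A' (conj h1 h2)).
    exists (\bigcup_k F' k); first by apply: sigma_algebra_bigcup => k; case: (hF' k).
    have := ae_foralln (fun k => (hF' k).2).
    by apply: filterS => w h; split => -[k _ /h hk]; exists k.
move=> E [[i /= hi [C hC <-]]|nB].
  move: hi; rewrite ltnS leqn0 => /eqP ->.
  by exists C; [exact: sub_sigma_algebra|exact: aeW].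
exists set0; first exact: sigma_algebra0.
have : {ae P, forall w, ~ E w} by apply: negligibleS nB => w /= /contrapT.
by apply: filterS => w h; split.
Qed.

(** The exceptional set must not depend on the time [u]. A rectangle involves a single event, and
    complements and countable unions keep a single null set. *)
Lemma transfer_joint_set t (A : set (R * g_sigma_algebraType (NF t))) : measurable A ->
  exists2 A' : set (R * g_sigma_algebraType (cyl t)), measurable A' &
    {ae P, forall w, forall u, A (u, w) <-> A' (u, W 0%N w)}.
Proof.
rewrite [X in X A -> _]measurable_prod_measurableType.
suff : <<s [set A `*` B | A in measurable & B in <<s NF t >>] >> `<=`
    [set A : set (R * Omega) | exists2 A' : set (R * g_sigma_algebraType (cyl t)), measurable A' &
       {ae P, forall w, forall u, A (u, w) <-> A' (u, W 0%N w)}].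
  by move=> h /h.
apply: smallest_sub.
  split => [|B [A' mA' hA]|F hF].
  - by exists set0; [exact: measurable0|exact: aeW].
  - exists (~` A'); first exact: measurableC.
    by apply: filterS hA => w h u; rewrite setTD; split => h1 /h.
  - have [F' hF'] := choice (fun k => let: ex_intro2 A' h1 h2 := hF k in
        ex_intro (fun A' : set (R * g_sigma_algebraType (cyl t)) => measurable A' /\ {ae P, forall w, forall u, F k (u, w) <-> A' (u, W 0%N w)}) A' (conj h1 h2)).
    exists (\bigcup_k F' k); first by apply: bigcup_measurable => k _; case: (hF' k).
    have := ae_foralln (fun k => (hF' k).2).
    by apply: filterS => w h u; split => -[k _ /h hk]; exists k.
move=> _ [C mC [B /transfer_set[B' mB' hB] <-]].
exists (C `*` B'); first exact: (@measurableX _ _ R (g_sigma_algebraType (cyl t))).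
by apply: filterS hB => w h u; split => -[h1 /h h2].
Qed.

(** The function is rebuilt from its rational level sets: it is the supremum of the rationals r with
    r < f, and each level set is transferred by itself. Countably many null sets are discarded. *)
Lemma transfer_joint t (f : R * Omega -> R) :
  measurable_fun setT (f : R * g_sigma_algebraType (NF t) -> R) ->
  exists2 phi : R * cpath T d -> R,
    measurable_fun setT (phi : R * g_sigma_algebraType (cyl t) -> R) &
    {ae P, forall w, forall u, f (u, w) = phi (u, W 0%N w)}.
Proof.
(* Every natural number has to code a rational; those that code none stand for 0, which only repeats
   a level. *)
move=> mf; pose r (k : nat) : R := ratr (odflt 0 (unpickle k : option rat)).
have mA k : measurable [set z : R * g_sigma_algebraType (NF t) | r k < f z].
  by apply: measurable_lt_set => //; exact: measurable_cst.
have [A' hA'] := choice (fun k => let: ex_intro2 A' h1 h2 := transfer_joint_set (mA k) in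
  ex_intro (fun A' : set (R * g_sigma_algebraType (cyl t)) => measurable A' /\
    {ae P, forall w, forall u, (r k < f (u, w)) <-> A' (u, W 0%N w)}) A' (conj h1 h2)).
pose h k (z : R * g_sigma_algebraType (cyl t)) : \bar R := if z \in A' k then (r k)%:E else -oo%E.
have mh k : measurable_fun setT (h k).
  apply: measurable_fun_ifT; [|exact: measurable_cst|exact: measurable_cst].
  have mi : measurable_fun setT (\1_(A' k) : R * g_sigma_algebraType (cyl t) -> R).
    by apply: measurable_indic; exact: (hA' k).1.
  have -> : (fun z => z \in A' k) = (fun z : R * g_sigma_algebraType (cyl t) => (0 : R) < \1_(A' k) z).
    by apply/funext => z; rewrite indicE; case: (_ \in _); rewrite /= ?ltr01 ?ltxx.
  by apply: measurable_fun_ltr => //; exact: measurable_cst.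
(* Off the null set the supremum may be infinite; [fine] then gives 0. *)
exists (fun z => fine (esups (h ^~ z) 0)).
  apply: (measurableT_comp (@fine_measurable R setT measurableT)).
  exact: measurable_fun_esups.
apply: filterS (ae_foralln (fun k => (hA' k).2)) => w hw u.
suff -> : esups (h ^~ (u, W 0%N w)) 0 = (f (u, w))%:E by [].
apply/eqP; rewrite eq_le; apply/andP; split.
  apply: ge_ereal_sup => _ [k _ <-]; rewrite /h; case: ifP => [/set_mem/hw|_]; last exact: leNye.
  by rewrite lee_fin => /ltW.
apply/lee_subgt0Pr => e e0.
have [q /itvP qe] := @rat_in_itvoo R (f (u, w) - e) (f (u, w)) (ltac:(by rewrite ltrBlDr ltrDl)).
have rk : r (pickle q) = ratr q by rewrite /r pickleK.
apply: (@le_ereal_sup_mem _ _ _ (r (pickle q))%:E); last by rewrite -EFinB lee_fin rk ltW// qe.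
exists (pickle q) => //; rewrite /h mem_set//; apply/hw; by rewrite rk qe.
Qed.

Lemma transfer t (f : Omega -> R) : smeas (NF t) f ->
  exists2 phi : cpath T d -> R, smeas (cyl t) phi & {ae P, forall w, f w = phi (W 0%N w)}.
Proof.
move=> mf.
have mf' : measurable_fun setT ((fun z : R * g_sigma_algebraType (NF t) => f z.2) : _ -> R).
  by apply: (measurableT_comp mf); exact: measurable_snd.
have [phi mphi hphi] := transfer_joint mf'.
exists (fun x => phi (0, x)).
  have m1 : measurable_fun setT (fun x : g_sigma_algebraType (cyl t) => (0 : R, x)) by exact: measurable_pair1.
  exact: (measurableT_comp mphi m1).
by apply: filterS hphi => w /(_ 0).
Qed.

Lemma path_completion (A : set (cpath T d)) : <<s path_filtration mu T >> A ->
  exists2 A' : set (cpath T d), measurable A' & {ae mu, forall x, A x <-> A' x}.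
Proof.
suff : <<s path_filtration mu T >> `<=` [set A | exists2 A' : set (cpath T d), measurable A' & {ae mu, forall x, A x <-> A' x}].
  by move=> h /h.
apply: smallest_sub.
  split => [|B [A' mA' hA]|F hF].
  - by exists set0; [exact: measurable0|exact: aeW].
  - exists (~` A'); first exact: measurableC.
    by apply: filterS hA => w h; rewrite setTD; split => h1 /h.
  - have [F' hF'] := choice (fun k => let: ex_intro2 A' h1 h2 := hF k in
        ex_intro (fun A' : set (cpath T d) => measurable A' /\ {ae mu, forall x, F k x <-> A' x}) A' (conj h1 h2)).
    exists (\bigcup_k F' k); first by apply: bigcup_measurable => k _; case: (hF' k).
    have := ae_foralln (fun k => (hF' k).2).
    by apply: filterS => w h; split => -[k _ /h hk]; exists k.
move=> E [hB|nB]; first by exists E; [exact: sub_sigma_algebra|exact: aeW].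
exists set0; first exact: measurable0.
have : {ae mu, forall w, ~ E w} by apply: negligibleS nB => w /= /contrapT.
by apply: filterS => w h; split.
Qed.

Lemma ae_path i (Q : cpath T d -> Prop) : {ae mu, forall x, Q x} -> {ae P, forall w, Q (W i w)}.
Proof.
move=> [N [mN N0 QN]]; exists (W i @^-1` N); split.
- by rewrite -[X in measurable X]setTI; exact: measurable_noise.
- have := lawW i mN; rewrite N0; exact.
- by move=> w /= h; apply: QN.
Qed.

(** Almost sure statements about [W 0] become statements about the Wiener measure, and from there
    about any [W i]. The event is replaced by a Borel one first, since the drivers are measurable
    only for the completion. *)
Lemma ae_path_law (A : set (cpath T d)) : <<s path_filtration mu T >> A ->
  {ae P, forall w, A (W 0%N w)} -> {ae mu, forall x, A x}.
Proof.
move=> /path_completion[A' mA' hA] h0.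
have h1 : {ae P, forall w, A' (W 0%N w)}.
  by apply: filterS2 (ae_path 0%N hA) h0 => w h /h.
have mW : measurable (W 0%N @^-1` A') by rewrite -[X in measurable X]setTI; exact: measurable_noise.
have h2 : mu (~` A') = 0%E.
  rewrite -(lawW 0%N (measurableC mA')).
  have : P (~` (W 0%N @^-1` A')) = 0%E.
    by apply/negligibleP; [exact: measurableC|exact: h1].
  exact.
have h3 : {ae mu, forall x, A' x} by exists (~` A'); split => //; exact: measurableC.
by apply: filterS2 hA h3 => x h /h.
Qed.

Lemma path_measurable : measurable_fun setT (id : g_sigma_algebraType (path_filtration mu T) -> cpath T d).
Proof.
move=> _ B mB; rewrite setTI.
suff : <<s cyl T >> `<=` <<s path_filtration mu T >> by apply.
by apply: sub_sigma_algebra2 => C hC; left.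
Qed.

Lemma integral_path i (g : cpath T d -> \bar R) : measurable_fun setT g -> (forall x, (0 <= g x)%E) ->
  (\int[P]_w g (W i w) = \int[mu]_x g x)%E.
Proof.
move=> mg g0; rewrite -(@ge0_integral_distribution _ _ _ _ _ P (W i) g)//.
by apply: eq_measure_integral => A mA _; exact: lawW.
Qed.

End Transfer.

Section MatrixConvergence.
Context {R : realType}.

Lemma within_continuous_coord (A : set R) (a b : nat) (f : R -> 'M[R]_(a, b)) i j :
  {within A, continuous f} -> {within A, continuous (fun t => f t i j)}.
Proof.
move=> cf; apply/subspace_continuousP => x Ax.
have cfx := (subspace_continuousP _ _).1 cf x Ax.
exact: (cvg_comp _ (fun M : 'M[R]_(a, b) => M i j) cfx (@coord_continuous R a b i j (f x))).
Qed.

Lemma enorm_le_dim (a b : nat) (x : 'M[R]_(a, b)) (e : R) : 0 <= e ->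
  (forall i j, `|x i j| <= e) -> enorm x <= (a * b)%:R * e.
Proof.
move=> e0 h; have := enorm_le_coord e0 h => h2.
have x0 := enorm_ge0 x; have n0 : 0 <= (a * b)%:R * e :> R by rewrite mulr_ge0.
rewrite -(ler_sqr x0 n0)//; apply: (le_trans h2).
rewrite exprMn ler_wpM2r ?sqr_ge0// -natrX ler_nat.
by case: (a * b)%N => // k; rewrite expnS expn1 leq_pmull.
Qed.

Lemma enorm_cvg (a b : nat) (u : nat -> 'M[R]_(a, b)) (l : 'M[R]_(a, b)) (e : R) : 0 < e ->
  (forall i j, u n i j @[n --> \oo] --> l i j) -> \forall n \near \oo, enorm (u n - l) <= e.
Proof.
move=> e0 ul; pose c : R := e / ((a * b)%:R + 1).
have ab0 : 0 < (a * b)%:R + 1 :> R by rewrite ltr_pwDr.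
have c0 : 0 < c by rewrite divr_gt0.
have h : \forall n \near \oo, forall i j, `|l i j - u n i j| <= c.
  apply: filter_forall => i; apply: filter_forall => j.
  by have /cvgrPdist_le/(_ c c0) := ul i j.
apply: filterS h => n h.
apply: (@le_trans _ _ ((a * b)%:R * c)).
  by apply: enorm_le_dim; [exact: ltW|move=> i j; rewrite !mxE distrC].
rewrite /c mulrCA ler_piMr ?(ltW e0)// ler_pdivrMr// mul1r; lra.
Qed.

End MatrixConvergence.

Section Caratheodory.
Context {R : realType} {m d : nat} {dS : measure_display} {S : measurableType dS}.
Variables (D : set S) (T p LF : R).
Hypotheses (mD : measurable D) (T0 : 0 < T) (p12 : 1 <= p <= 2) (LF0 : 0 <= LF).
Local Notation V := 'rV[R]_m.
Variable F : S -> V -> 'M[R]_(m, d) -> probability V R -> V.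
Hypothesis mF : forall y z nu, finite_moment 2 nu -> measurable_fun D (fun s => F s y z nu).
Hypothesis lipF : forall s y y' z z' (nu nu' : probability V R), D s ->
  finite_moment p nu -> finite_moment p nu' ->
  ((enorm (F s y z nu - F s y' z' nu')%R)%:E <=
   LF%:E * ((enorm (y - y')%R)%:E + (enorm (z - z')%R)%:E + wasserstein p nu nu'))%E.

Definition code (a b N : nat) (x : 'M[R]_(a, b)) : 'M[int]_(a, b) := map_mx (fun r => Num.floor (2 ^+ N * r)) x.
Definition decode (a b N : nat) (c : 'M[int]_(a, b)) : 'M[R]_(a, b) := map_mx (fun k : int => k%:~R / 2 ^+ N) c.

Lemma decode_cvg a b (x : 'M[R]_(a, b)) i j : decode N (code N x) i j @[N --> \oo] --> x i j.
Proof.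
apply/cvgrPdist_le => e e0.
have : (2^-1 : R) ^+ N @[N --> \oo] --> (0 : R).
  by apply: cvg_expr; rewrite ger0_norm ?invr_ge0// invf_lt1// ltr1n.
move/cvgrPdist_le => /(_ e e0); apply: filterS => N.
rewrite sub0r normrN ger0_norm ?exprn_ge0 ?invr_ge0// => hN.
rewrite !mxE; have /andP[h1 h2] := floor_itv (2 ^+ N * x i j).
have p0 : 0 < 2 ^+ N :> R by rewrite exprn_gt0.
have E : x i j - (Num.floor (2 ^+ N * x i j))%:~R / 2 ^+ N =
    (2 ^+ N * x i j - (Num.floor (2 ^+ N * x i j))%:~R) / 2 ^+ N.
  by rewrite mulrBl mulrAC mulfV ?gt_eqF// mul1r.
rewrite E ger0_norm; last by apply: divr_ge0; [rewrite subr_ge0|exact: ltW].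
apply: le_trans hN; rewrite exprVn -[leRHS]mul1r ler_wpM2r ?invr_ge0 ?(ltW p0)//.
by rewrite lerBlDr; move: h2; rewrite intrD addrC => /ltW.
Qed.

Lemma measurable_floor_set (N : nat) (k : int) : measurable [set r : R | Num.floor (2 ^+ N * r) = k].
Proof.
have mono : {homo (fun r : R => (Num.floor (2 ^+ N * r))%:~R : R) : x y / x <= y}.
  by move=> x y xy; rewrite ler_int; apply: le_floor; rewrite ler_wpM2l// exprn_ge0.
have := nondecreasing_measurable measurableT mono measurableT (measurable_set1 (k%:~R : R)).
rewrite setTI; congr measurable; apply/seteqP; split => r /=; last by move=> ->.
by move/eqP; rewrite eqr_int => /eqP.
Qed.

Lemma measurable_code_set a b N (x : S -> 'M[R]_(a, b)) (c : 'M[int]_(a, b)) :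
  measurable_fun D x -> measurable (D `&` [set s | code N (x s) = c]).
Proof.
move=> mx.
rewrite (_ : _ `&` _ = D `&` \bigcap_(i in [set: 'I_a]) \bigcap_(j in [set: 'I_b])
   (D `&` (fun s => x s i j) @^-1` [set r | Num.floor (2 ^+ N * r) = c i j])).
  apply: measurableI => //; apply: fin_bigcap_measurable; first exact: finite_finset.
  move=> i _; apply: fin_bigcap_measurable; first exact: finite_finset.
  move=> j _; apply: (measurableT_comp (measurable_coord i j) mx) => //; exact: measurable_floor_set.
apply/seteqP; split => s /= [Ds h]; split => //.
  by move=> i _ j _; split => //=; rewrite -h !mxE.
by apply/matrixP => i j; rewrite !mxE; have [_ ->] := h i I j I.
Qed.

Variables (y : S -> V) (z : S -> 'M[R]_(m, d)) (tau : S -> R) (nu : R -> probability V R).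
Hypotheses (my : measurable_fun D y) (mz : measurable_fun D z) (mtau : measurable_fun D tau).
Hypothesis tauT : forall s, D s -> 0 <= tau s <= T.
Hypothesis nu2 : forall t, 0 <= t <= T -> finite_moment 2 (nu t) /\ finite_moment p (nu t).
Hypothesis nuc : forall s, D s -> forall e : R, 0 < e ->
  \forall N \near \oo, (wasserstein p (nu (grid T N (tau s))) (nu (tau s)) <= e%:E)%E.

(** For fixed arguments [F] is measurable in [s], and it is Lipschitz in the others. Rounding [y]
    and [z] to dyadic values and [tau] to the time grid leaves countably many argument triples; the
    Lipschitz bound gives convergence. For the flow of measures only convergence along the grid is
    required. *)
Lemma caratheodory : measurable_fun D (fun s => F s (y s) (z s) (nu (tau s))).
Proof.
apply: measurable_fun_mx => // i j.
pose C := ('M[int]_(1, m) * 'M[int]_(m, d) * nat)%type.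
pose c N s : C := (code N (y s), code N (z s), grid_code T N (tau s)).
pose g N (k : C) s : R := F s (decode N k.1.1) (decode N k.1.2) (nu (grid_point T N k.2)) i j.
apply: (measurable_fun_cvg (h := fun N s => g N (c N s) s)).
  move=> N; apply: (@measurable_code _ _ D mD _ R C (c N) (g N)).
    move=> [[k1 k2] k3].
    rewrite (_ : _ `&` _ = (D `&` [set s | code N (y s) = k1]) `&` (D `&` [set s | code N (z s) = k2]) `&`
       (D `&` tau @^-1` (grid_code T N @^-1` [set k3]))).
      apply: measurableI; first by apply: measurableI; exact: measurable_code_set.
      by apply: mtau => //; exact: measurable_grid_code.
    by apply/seteqP; split => s /=; [move=> [Ds [<- <- <-]]|move=> [[[Ds <-] [_ <-]] [_ <-]]].
  move=> k; apply: (measurableT_comp (measurable_coord i j)); apply: mF.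
  by case: (nu2 (grid_range T0 N k.2)).
move=> s Ds; apply/cvgrPdist_le => e e0.
pose dl := e / (3 * (LF + 1)).
have L1 : 0 < 3 * (LF + 1) by have := LF0; lra.
have dl0 : 0 < dl by rewrite divr_gt0.
have h1 : \forall N \near \oo, enorm (decode N (code N (y s)) - y s) <= dl.
  by apply: enorm_cvg => // i' j'; exact: decode_cvg.
have h2 : \forall N \near \oo, enorm (decode N (code N (z s)) - z s) <= dl.
  by apply: enorm_cvg => // i' j'; exact: decode_cvg.
have h3 := nuc Ds dl0.
near=> N.
have k1 : enorm (decode N (code N (y s)) - y s) <= dl by near: N.
have k2 : enorm (decode N (code N (z s)) - z s) <= dl by near: N.
have k3 : (wasserstein p (nu (grid T N (tau s))) (nu (tau s)) <= dl%:E)%E by near: N.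
have key : enorm (F s (decode N (code N (y s))) (decode N (code N (z s))) (nu (grid T N (tau s))) -
    F s (y s) (z s) (nu (tau s))) <= LF * (dl + dl + dl).
  rewrite -lee_fin; apply: (le_trans (lipF _ _ _ _ Ds _ _)).
  - by case: (nu2 (grid_range T0 N (grid_code T N (tau s)))).
  - by case: (nu2 (tauT Ds)).
  - rewrite EFinM lee_wpmul2l// !EFinD; apply: leeD => //; apply: leeD; by rewrite lee_fin.
rewrite distrC; apply: (@le_trans _ _ (LF * (dl + dl + dl))); last first.
  have -> : e = dl * (3 * (LF + 1)) by rewrite /dl divfK// gt_eqF.
  have := LF0; nra.
apply: le_trans key; have := coord_le_enorm (F s (decode N (code N (y s))) (decode N (code N (z s))) (nu (grid T N (tau s))) -
    F s (y s) (z s) (nu (tau s))) i j.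
by rewrite !mxE.
Unshelve. all: by end_near. Qed.

End Caratheodory.

Section LawFlow.
Context {R : realType} {m : nat} {d0 : measure_display} {Omega : measurableType d0}.
Variables (P : probability Omega R) (T p : R) (Y : R -> {RV P >-> 'rV[R]_m}).
Hypotheses (T0 : 0 < T) (p12 : 1 <= p <= 2).
Hypothesis cY : {ae P, forall w, {within `[0, T], continuous (fun t => Y t w)}}.
Hypothesis sY : (sup_norm2 P T Y < +oo)%E.

Lemma measurable_enorm_RV (X : {RV P >-> 'rV[R]_m}) : measurable_fun setT (fun w => enorm (X w) ^+ 2).
Proof.
apply: measurable_funX; apply: measurableT_comp; first exact: measurable_enorm.
exact: measurable_funPT.
Qed.

Lemma moment_le_sup t : 0 <= t <= T -> (\int[P]_w (enorm (Y t w) ^+ 2)%:E <= sup_norm2 P T Y)%E.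
Proof.
move=> tT; apply: le_integral_nonmeas => w; first by rewrite lee_fin sqr_ge0.
by apply: ereal_sup_ubound; exists t => //; rewrite /= in_itv.
Qed.

Lemma law_moments t : 0 <= t <= T ->
  finite_moment 2 (distribution P (Y t)) /\ finite_moment p (distribution P (Y t)).
Proof.
move=> tT; have h : (\int[P]_w (enorm (Y t w) ^+ 2)%:E < +oo)%E by exact: le_lt_trans (moment_le_sup tT) sY.
have e (q : R) : moment q (distribution P (Y t)) = (\int[P]_w (enorm (Y t w) `^ q)%:E)%E.
  rewrite /moment ge0_integral_distribution//; last by move=> x; rewrite lee_fin powR_ge0.
  by apply/measurable_EFinP; apply: (measurableT_comp (measurable_powR q)); exact: measurable_enorm.
have fin : (\int[P]_w (enorm (Y t w) ^+ 2)%:E)%E \is a fin_num.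
  by rewrite ge0_fin_numE// integral_ge0// => w _; rewrite lee_fin sqr_ge0.
split.
  rewrite /finite_moment e; under eq_integral do rewrite powR_mulrn ?enorm_ge0//.
  exact: h.
rewrite /finite_moment e.
have D0 : 0 <= fine (\int[P]_w (enorm (Y t w) ^+ 2)%:E)%E.
  by apply: fine_ge0; apply: integral_ge0 => w _; rewrite lee_fin sqr_ge0.
have me : measurable_fun setT (fun w => enorm (Y t w)).
  by apply: measurableT_comp; [exact: measurable_enorm|exact: measurable_funPT].
have := Lp_le_L2 p12 D0 me (fun w => enorm_ge0 (Y t w)) (ltac:(by rewrite fineK)).
move=> h2; rewrite ltNge leye_eq; apply/negP => /eqP h3.
have p0 : 0 < p by case/andP: p12; lra.
by move: h2; rewrite h3 poweRyr// invr_eq0 gt_eqF.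
Qed.

(** The joint law of the values at t and at its grid point couples the two measures, and its
    quadratic cost tends to 0 by path continuity and dominated convergence. *)
Lemma law_flow_cvg t : 0 <= t <= T -> forall e : R, 0 < e ->
  \forall N \near \oo, (wasserstein p (distribution P (Y (grid T N t))) (distribution P (Y t)) <= e%:E)%E.
Proof.
move=> tT e e0.
pose f_ N w := (enorm (Y (grid T N t) w - Y t w) ^+ 2)%:E.
have mY s : measurable_fun setT (Y s) by exact: measurable_funPT.
have mf N : measurable_fun setT (f_ N).
  apply/measurable_EFinP/measurable_funX; apply: (measurableT_comp (@measurable_enorm R 1 m)).
  apply: measurable_fun_mx => // i j; under eq_fun do rewrite !mxE.
  by apply: measurable_funB; apply: (measurableT_comp (measurable_coord i j)).
(* The majorant is a supremum over the grid points only: countable, hence measurable, and still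
   below the supremum over [0, T]. *)
pose S w := esups (fun N => (enorm (Y (grid T N t) w) ^+ 2)%:E) 0.
have mS : measurable_fun setT S.
  by apply: measurable_fun_esups => N; apply/measurable_EFinP; exact: measurable_enorm_RV.
have gT N : 0 <= grid T N t <= T by exact: grid_range.
have S0 w : (0 <= S w)%E.
  apply: (@le_ereal_sup_mem _ _ _ (enorm (Y (grid T 0 t) w) ^+ 2)%:E); last by rewrite lee_fin sqr_ge0.
  by exists 0%N.
have Sfin : (\int[P]_w S w < +oo)%E.
  apply: le_lt_trans sY; apply: le_integral_nonmeas => // w.
  apply: ge_ereal_sup => _ [N _ <-]; apply: ereal_sup_ubound.
  by exists (grid T N t) => //; rewrite /= in_itv/= gT.
pose g w := (2%:E * S w + 2%:E * (enorm (Y t w) ^+ 2)%:E)%E.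
have mt : measurable_fun setT (fun w => (enorm (Y t w) ^+ 2)%:E).
  by apply/measurable_EFinP; exact: measurable_enorm_RV.
have ig : P.-integrable setT g.
  apply: integrableD => //; apply: integrableZl => //; apply/integrableP; split => //.
    by under eq_integral do rewrite gee0_abs//.
  under eq_integral do rewrite gee0_abs ?lee_fin ?sqr_ge0//.
  exact: le_lt_trans (moment_le_sup tT) sY.
have cvgf : {ae P, forall w, setT w -> f_ ^~ w @ \oo --> cst 0%E w}.
  apply: filterS cY => w cw _; apply: cvg_EFin; first by near=> N.
  apply/cvgrPdist_le => eps eps0.
  have d0' : 0 < Num.min 1 eps by rewrite lt_min ltr01.
  have hc i j : Y (grid T N t) w i j @[N --> \oo] --> Y t w i j.
    apply: (@within_cvg_seq R R `[0, T]%classic (fun s => Y s w i j) (fun N => grid T N t) t).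
    - exact: within_continuous_coord.
    - by rewrite /= in_itv.
    - by move=> N; rewrite /= in_itv/= gT.
    - exact: grid_cvg.
  have := enorm_cvg (u := fun N => Y (grid T N t) w) (l := Y t w) d0' hc.
  apply: filterS => N hN.
  rewrite /= sub0r normrN ger0_norm ?sqr_ge0//.
  move: hN; rewrite le_min => /andP[h1 h2]; rewrite expr2.
  by apply: le_trans h2; rewrite ler_piMl// enorm_ge0.
have dom : {ae P, forall w, forall N, setT w -> (`|f_ N w| <= g w)%E}.
  apply: aeW => w N _; rewrite gee0_abs; last by rewrite lee_fin sqr_ge0.
  apply: (@le_trans _ _ (2 * enorm (Y (grid T N t) w) ^+ 2 + 2 * enorm (Y t w) ^+ 2)%:E).
    by rewrite lee_fin; have := enorm_sqrD (Y (grid T N t) w) (- Y t w); rewrite enormN.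
  rewrite EFinD !EFinM /g; apply: leeD => //; rewrite lee_wpmul2l//.
  by apply: ereal_sup_ubound; exists N.
have [_ _ h] := dominated_convergence measurableT mf (measurable_cst _) cvgf ig dom.
have e2 : 0 < e ^+ 2 by rewrite exprn_gt0.
have : nbhs (\int[P]_x (cst 0%E x))%E [set x : \bar R | (x < (e ^+ 2)%:E)%E].
  by rewrite integral0; apply: open_ereal_lt'; rewrite lte_fin.
move=> /h [N0 _ hN0]; exists N0 => // N /hN0 /= hN.
apply: (@le_trans _ _ (Num.sqrt (e ^+ 2))%:E).
  by apply: wasserstein_law => //; exact: ltW.
by rewrite lee_fin sqrtr_sqr ger0_norm// ltW.
Unshelve. all: by end_near. Qed.

End LawFlow.

Section EmpiricalFlow.
Context {R : realType} {m : nat} (T p : R) (n : nat) (y : 'I_n.+1 -> R -> 'rV[R]_m).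
Hypotheses (T0 : 0 < T) (p12 : 1 <= p <= 2).
Hypothesis cy : forall i, {within `[0, T], continuous (y i)}.

Lemma empirical_flow_cvg t : 0 <= t <= T -> forall e : R, 0 < e ->
  \forall N \near \oo, (wasserstein p (empirical (fun i => y i (grid T N t))) (empirical (fun i => y i t)) <= e%:E)%E.
Proof.
move=> tT e e0.
have h i : \forall N \near \oo, enorm (y i (grid T N t) - y i t) <= e.
  apply: enorm_cvg => // a b.
  apply: (@within_cvg_seq R R `[0, T]%classic (fun s => y i s a b) (fun N => grid T N t) t).
  - exact: within_continuous_coord.
  - by rewrite /= in_itv.
  - by move=> N; rewrite /= in_itv/= grid_range.
  - exact: grid_cvg.
have {}h : \forall N \near \oo, forall i, enorm (y i (grid T N t) - y i t) <= e.
  exact: filter_forall.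
apply: filterS h => N h.
apply: le_trans; first exact: wasserstein_empirical.
rewrite lee_fin -[leRHS](ger0_norm (ltW e0)) -sqrtr_sqr ler_wsqrtr//.
apply: (@le_trans _ _ (n.+1%:R^-1 * \sum_(i < n.+1) e ^+ 2)).
  rewrite ler_wpM2l ?invr_ge0//; apply: ler_sum => i _.
  by rewrite ler_sqr ?nnegrE ?enorm_ge0// ltW.
by rewrite sumr_const card_ord -[X in _ * X]mulr_natl mulKf// pnatr_eq0.
Qed.

End EmpiricalFlow.

Lemma cut_split {R : realType} {d0 : measure_display} {Omega : measurableType d0} (V : R -> Omega -> R) r s t (z : Omega * R) :
  r <= s -> s <= t -> cut r t V z ^+ 2 = cut r s V z ^+ 2 + cut s t V z ^+ 2.
Proof.
move=> rs st; rewrite /cut.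
have [h1|h1] := leP z.2 s.
  by rewrite andbT (le_trans h1 st) andbT mulr0 expr0n addr0.
by rewrite (le_lt_trans rs h1)/= mulr0 expr0n add0r.
Qed.

Lemma sqr_window {R : realType} (a : R) (b : bool) : (a * b%:R) ^+ 2 = b%:R * a ^+ 2.
Proof. by case: b; rewrite ?mulr1 ?mul1r// mulr0 mul0r expr0n. Qed.

Lemma sqr_step {R : realType} (a b x y : R) : (a * x + a * b) ^+ 2 <= 2 * (a * y) ^+ 2 + 2 * (a * (x + b - y)) ^+ 2.
Proof.
have := sqr_ge0 (a * y - a * (x + b - y)); set u := a * y; set v := a * (x + b - y).
have -> : a * x + a * b = u + v by rewrite /u /v; ring.
nra.
Qed.

Lemma sqr_scale_split {R : realType} (x a b c : R) : a ^+ 2 = b ^+ 2 + c ^+ 2 ->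
  (x * a) ^+ 2 = (x * b) ^+ 2 + (x * c) ^+ 2.
Proof. by move=> h; rewrite !exprMn h mulrDr. Qed.

(** Origin of the constant 2c(1 + T): for dt <= T the bracket dt M + b + q is at most (1 + T)(M + b
    + q). *)
Lemma step_arith {R : realType} (T c dt M b q : R) : 0 <= c -> 0 <= M -> 0 <= b -> 0 <= q -> 0 <= dt <= T ->
  2 * dt * (c * (dt * M + b + q)) <= 2 * c * (1 + T) * dt * (M + b + q).
Proof.
move=> c0 M0 b0 q0 /andP[d0 dT].
have -> : 2 * dt * (c * (dt * M + b + q)) = 2 * c * dt * (dt * M + b + q) by ring.
have -> : 2 * c * (1 + T) * dt * (M + b + q) = 2 * c * dt * ((1 + T) * (M + b + q)) by ring.
rewrite ler_wpM2l ?mulr_ge0//; nra.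
Qed.

(** * The stability estimate for a finite family of processes *)

Section Stability.
Context {R : realType} {T : R} {d : nat} {mu : probability (cpath T d) R}.
Hypothesis hmu : is_wiener mu.
Context {d0 : measure_display} {Omega : measurableType d0} {P : probability Omega R}.
Hypothesis cP : measure_is_complete P.
Variable W : nat -> {RV P >-> cpath T d}.
Hypothesis lawW : forall i A, measurable A -> distribution P (W i) A = mu A.
Hypothesis indW : mutually_independent W.
Hypothesis T0 : 0 < T.
Variable n : nat.
Local Notation NF := (noise_filtration W n.+1).
Local Notation leb := (@lebesgue_measure R).
Local Notation K := ('I_n.+1 * 'I_d)%type.
Local Notation PL := (P \x leb)%E.

Variables (I : finType) (X : I -> R -> Omega -> R) (H : I -> K -> R -> Omega -> R) (J : I -> R -> Omega -> R).
Variables (r : Omega * R -> R) (c : R).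
Hypothesis c0 : 0 <= c.
Hypothesis hI : forall i, ito_sum W (H i) (J i).
Hypothesis aX : forall i t, 0 <= t <= T -> smeas (NF t) (X i t).
Hypothesis bX : exists M : R, forall t, 0 <= t <= T -> (\sum_i \int[P]_w (X i t w ^+ 2)%:E <= M%:E)%E.
Hypothesis mX : forall i, measurable_fun setT (cut 0 T (X i)).
Hypotheses (mr : measurable_fun setT r) (r0 : forall z, 0 <= r z) (fr : (\int[PL]_z (r z)%:E < +oo)%E).

Let gam s t (z : Omega * R) : R := c * (\sum_i cut s t (X i) z ^+ 2 +
  \sum_i \sum_k cut s t (H i k) z ^+ 2 + (s < z.2 <= t)%R%:R * r z).

(** The only trace of the equation that is kept: X_s plus the noise increment minus X_t is a time
    integral, and by Cauchy-Schwarz its square is at most t - s times the integral of a bound on the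
    squared drift. The bound [gam] is linear in the squares of X and H and in the source [r]. *)
Hypothesis drift : forall s t, 0 <= s -> s <= t -> t <= T -> {ae P, forall w,
  ((\sum_i (X i s w + (J i t w - J i s w) - X i t w) ^+ 2)%:E <=
   (t - s)%:E * \int[leb]_u (gam s t (w, u))%:E)%E}.

Let sX i t : 0 <= t <= T -> sqint P (X i t).
Proof.
move=> tT; split; first by apply: (noise_measurable_fun cP _ (aX i tT)); case/andP: tT.
have [M hM] := bX; apply: le_lt_trans (ltry M); apply: le_trans (hM t tT).
rewrite (bigD1 i)//= leeDl// sume_ge0// => j _.
by apply: integral_ge0 => w _; rewrite lee_fin sqr_ge0.
Qed.

Let m_cut (V : R -> Omega -> R) s t : 0 <= s -> t <= T -> measurable_fun setT (cut 0 T V) ->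
  measurable_fun setT (cut s t V).
Proof.
move=> s0 tT mV; rewrite (cutM V s0 tT); apply: measurable_funM => //.
exact: measurable_window.
Qed.

Let sH i k s t : 0 <= s -> t <= T -> sqint PL (cut s t (H i k)).
Proof.
move=> s0 tT; rewrite (cutM _ s0 tT).
apply: (@sqint_bndM _ _ _ PL 1 (fun z => (s < z.2 <= t)%R%:R)).
- exact: measurable_window.
- by move=> z; exact: ind_le1.
- exact: ito_finite (hI i) k.
Qed.

Let gam_ge0 s t z : 0 <= gam s t z.
Proof.
rewrite mulr_ge0// !addr_ge0//.
- by apply: sumr_ge0 => i _; exact: sqr_ge0.
- by apply: sumr_ge0 => i _; apply: sumr_ge0 => k _; exact: sqr_ge0.
- by rewrite mulr_ge0.
Qed.

Let m_gam s t : 0 <= s -> t <= T -> measurable_fun setT (gam s t).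
Proof.
move=> s0 tT; apply: measurable_funM; first exact: measurable_cst.
apply: measurable_funD; last by apply: measurable_funM => //; exact: measurable_window.
apply: measurable_funD; apply: measurable_sum => i; first by apply: measurable_funX; exact: m_cut.
by apply: measurable_sum => k; apply: measurable_funX; case: (sH i k s0 tT).
Qed.

Section Weighted.
Variables (s0 : R) (th : Omega -> R).
Hypotheses (s00 : 0 <= s0) (s0T : s0 <= T) (hth : bounded_coef W n s0 th).

Let mth : measurable_fun setT th.
Proof. exact: (noise_measurable_fun cP s0T hth.1). Qed.

Let mth1 : measurable_fun setT (fun z : Omega * R => th z.1).
Proof. by apply: (measurableT_comp mth); exact: measurable_fst. Qed.

Let sthX i t : s0 <= t -> t <= T -> sqint P (fun w => th w * X i t w).
Proof.
move=> st tT; have [M hM] := hth.2; apply: (sqint_bndM mth hM); apply: sX.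
by rewrite (le_trans s00).
Qed.

Let sthH i k s t : 0 <= s -> t <= T -> sqint PL (fun z => th z.1 * cut s t (H i k) z).
Proof.
move=> s1 tT; have [M hM] := hth.2; apply: (@sqint_bndM _ _ _ PL M (fun z => th z.1)).
- exact: mth1.
- by move=> z; exact: hM.
- exact: sH.
Qed.

Let A t := (\sum_i \int[P]_w ((th w * X i t w) ^+ 2)%:E)%E.
Let B s t := (\sum_i \sum_(k : K) \int[PL]_z ((th z.1 * cut s t (H i k) z) ^+ 2)%:E)%E.
Let Q s t := (\int[PL]_z (th z.1 ^+ 2 * ((s < z.2 <= t)%R%:R * r z))%:E)%E.

Let sq0 dX (Y : measurableType dX) (nu : measure Y R) (f : Y -> R) : (0 <= \int[nu]_y (f y ^+ 2)%:E)%E.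
Proof. by apply: integral_ge0 => y _; rewrite lee_fin sqr_ge0. Qed.

(** By Pythagoras the left side is the second moment of th (X_s + J_t - J_s), and this variable
    equals th X_t plus the weighted drift. The inequality (u + v)^2 <= 2u^2 + 2v^2 finishes the
    step; the weight has to be known at [s]. *)
Let energy_step s t : s0 <= s -> s <= t -> t <= T ->
  (A s + B s t <= 2%:E * A t + (2 * (t - s))%:E * \int[PL]_z (th z.1 ^+ 2 * gam s t z)%:E)%E.
Proof.
move=> ss st tT; have sp : 0 <= s by exact: le_trans ss.
have hths : bounded_coef W n s th by exact: bounded_coef_le hth.
have sT : s <= T by exact: le_trans tT.
have s1 : 0 <= s <= T by rewrite sp.
have t1 : 0 <= t <= T by rewrite tT (le_trans sp).
pose D i w := th w * (X i s w + (J i t w - J i s w) - X i t w).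
have sJ i : sqint P (fun w => J i t w - J i s w).
  by apply: sqintB; exact: ito_sqint (hI i) _ _.
have sD i : sqint P (D i).
  have [M hM] := hth.2; apply: (sqint_bndM mth hM); apply: sqintB; last exact: sX.
  by apply: sqintD => //; exact: sX.
have per i : (\int[P]_w ((th w * X i s w) ^+ 2)%:E + \sum_(k : K) \int[PL]_z ((th z.1 * cut s t (H i k) z) ^+ 2)%:E <=
    2%:E * \int[P]_w ((th w * X i t w) ^+ 2)%:E + 2%:E * \int[P]_w (D i w ^+ 2)%:E)%E.
  have := ito_pythagoras hmu cP lawW indW (hI i) sp st tT hths (sthX i ss sT)
    (measurable_funM hths.1 (aX i s1)) => E.
  rewrite (_ : (\sum_(k : K) _)%E = (\sum_(k : K) \int[P]_w \int[leb]_u ((th w * (H i k u w * (s < u <= t)%R%:R)) ^+ 2)%:E)%E).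
    rewrite -E -sqint_int_sumZ//; [|by case: (sthX i (le_trans ss st) tT)|by case: (sD i)].
    apply: le_integral_nonmeas => w; rewrite lee_fin ?sqr_ge0//; exact: sqr_step.
  apply: eq_bigr => k _; rewrite fubini_tonelli1//; last by move=> z; rewrite lee_fin sqr_ge0.
  by apply: measurable_sqE; case: (sthH i k sp tT).
apply: (@le_trans _ _ (2%:E * A t + 2%:E * \sum_i \int[P]_w (D i w ^+ 2)%:E)%E).
  rewrite /A /B -big_split/= !ge0_sume_distrr//; try by move=> i _; exact: sq0.
  by rewrite -big_split/=; apply: lee_sum => i _; exact: per.
apply: leeD => //; rewrite EFinM -muleA; apply: lee_wpmul2l => //.
rewrite -ge0_integral_sum//; last first.
- by move=> i w _; rewrite lee_fin sqr_ge0.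
- by move=> i; apply: measurable_sqE; case: (sD i).
have mg : measurable_fun setT (fun z => (th z.1 ^+ 2 * gam s t z)%:E).
  by apply/measurable_EFinP; apply: measurable_funM; [apply: measurable_funX; exact: mth1|exact: m_gam].
have mgu w : measurable_fun setT (fun u => (gam s t (w, u))%:E).
  apply/measurable_EFinP; apply: (measurableT_comp (m_gam sp tT)); exact: pair1_measurable.
have ge0 z : (0 <= (th z.1 ^+ 2 * gam s t z)%:E)%E by rewrite lee_fin mulr_ge0// sqr_ge0.
rewrite fubini_tonelli1//= -ge0_integralZl//; last 3 first.
- exact: measurable_fun_fubini_tonelli_F.
- by move=> w _; apply: integral_ge0 => u _; exact: ge0.
- by rewrite lee_fin subr_ge0.
apply: ae_le_integral_nonmeas.
- by move=> w; apply: sume_ge0 => i _; rewrite lee_fin sqr_ge0.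
- move=> w; apply: mule_ge0; first by rewrite lee_fin subr_ge0.
  by apply: integral_ge0 => u _; exact: ge0.
- by apply: measurable_funeM; exact: measurable_fun_fubini_tonelli_F.
apply: filterS (drift sp st tT) => w h.
rewrite [X in (_ <= _ * X)%E](_ : _ = (th w ^+ 2)%:E * \int[leb]_u (gam s t (w, u))%:E)%E; last first.
    transitivity (\int[leb]_u ((th w ^+ 2)%:E * (gam s t (w, u))%:E))%E.
    by apply: eq_integral => u _; rewrite EFinM.
  rewrite ge0_integralZl//; first exact: mgu.
  - by move=> u _; rewrite lee_fin.
  - by rewrite lee_fin sqr_ge0.
rewrite muleCA sumEFin (_ : \sum_i D i w ^+ 2 = th w ^+ 2 * \sum_i (X i s w + (J i t w - J i s w) - X i t w) ^+ 2).
  by rewrite EFinM; apply: lee_wpmul2l => //; rewrite lee_fin sqr_ge0.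
by rewrite mulr_sumr; apply: eq_bigr => i _; rewrite /D exprMn.
Qed.

(** By Tonelli the time integral of the second moments is at most (t - s) M. The source is enlarged
    to the whole interval [s0, T], so that it is one constant throughout the iteration. *)
Let drift_split s t (M : R) : s0 <= s -> s <= t -> t <= T -> (forall u, s <= u <= t -> (A u <= M%:E)%E) ->
  (\int[PL]_z (th z.1 ^+ 2 * gam s t z)%:E <= c%:E * ((t - s)%:E * M%:E + B s t + Q s0 T))%E.
Proof.
move=> ss st tT hM; have sp : 0 <= s by exact: le_trans ss.
have mcX i : measurable_fun setT (cut s t (X i)) by exact: m_cut.
have mcH i k : measurable_fun setT (cut s t (H i k)) by case: (sH i k sp tT).
have mtX i : measurable_fun setT (fun z => ((th z.1 * cut s t (X i) z) ^+ 2)%:E).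
  by apply: measurable_sqE; apply: measurable_funM; [exact: mth1|].
have mtH i k : measurable_fun setT (fun z => ((th z.1 * cut s t (H i k) z) ^+ 2)%:E).
  by apply: measurable_sqE; apply: measurable_funM; [exact: mth1|].
have mr1 : measurable_fun setT (fun z : Omega * R => (th z.1 ^+ 2 * ((s < z.2 <= t)%R%:R * r z))%:E).
  apply/measurable_EFinP; apply: measurable_funM; first by apply: measurable_funX; exact: mth1.
  by apply: measurable_funM => //; exact: measurable_window.
have r1 (z : Omega * R) : (0 <= (th z.1 ^+ 2 * ((s < z.2 <= t)%R%:R * r z))%:E)%E.
  by rewrite lee_fin mulr_ge0 ?sqr_ge0// mulr_ge0.
have sqe (x : R) : (0 <= (x ^+ 2)%:E)%E by rewrite lee_fin sqr_ge0.
apply: (@le_trans _ _ (\int[PL]_z (c%:E * ((\sum_i ((th z.1 * cut s t (X i) z) ^+ 2)%:E +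
   \sum_i \sum_(k : K) ((th z.1 * cut s t (H i k) z) ^+ 2)%:E) + (th z.1 ^+ 2 * ((s < z.2 <= t)%R%:R * r z))%:E)))%E).
  apply: le_integral_nonmeas => z; first by rewrite lee_fin mulr_ge0// sqr_ge0.
  rewrite sumEFin (eq_bigr (fun i => (\sum_k (th z.1 * cut s t (H i k) z) ^+ 2)%:E)); last by move=> i _; rewrite sumEFin.
  rewrite sumEFin -!EFinD -EFinM lee_fin /gam.
  rewrite le_eqVlt; apply/orP; left; apply/eqP.
  rewrite mulrCA; congr (_ * _); rewrite !mulrDr; congr (_ + _ + _).
    by rewrite mulr_sumr; apply: eq_bigr => i _; rewrite [(th z.1 * _) ^+ 2]exprMn.
  by rewrite mulr_sumr; apply: eq_bigr => i _; rewrite mulr_sumr; apply: eq_bigr => k _; rewrite [(th z.1 * _) ^+ 2]exprMn.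
have mS1 : measurable_fun setT (fun z => (\sum_i ((th z.1 * cut s t (X i) z) ^+ 2)%:E)%E) by exact: emeasurable_sum.
have mS2 : measurable_fun setT (fun z => (\sum_i \sum_(k : K) ((th z.1 * cut s t (H i k) z) ^+ 2)%:E)%E).
  by apply: emeasurable_sum => i; exact: emeasurable_sum.
have S1 z : (0 <= \sum_i ((th z.1 * cut s t (X i) z) ^+ 2)%:E)%E by exact: sume_ge0.
have S2 z : (0 <= \sum_i \sum_(k : K) ((th z.1 * cut s t (H i k) z) ^+ 2)%:E)%E.
  by apply: sume_ge0 => i _; exact: sume_ge0.
rewrite ge0_integralZl//; last 2 first.
- by apply: emeasurable_funD => //; exact: emeasurable_funD.
- by move=> z _; apply: adde_ge0 => //; exact: adde_ge0.
apply: lee_wpmul2l; first by rewrite lee_fin.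
rewrite ge0_integralD//; last 2 first.
- by move=> z _; exact: adde_ge0.
- exact: emeasurable_funD.
rewrite ge0_integralD//; apply: leeD; first apply: leeD.
- rewrite ge0_integral_sum//.
  have mG i : measurable_fun setT (fun u => \int[P]_w ((th w * cut s t (X i) (w, u)) ^+ 2)%:E)%E.
    by apply: (@measurable_fun_fubini_tonelli_G _ _ _ _ R P (fun z => ((th z.1 * cut s t (X i) z) ^+ 2)%:E)).
  rewrite (eq_bigr (fun i => \int[leb]_u \int[P]_w ((th w * cut s t (X i) (w, u)) ^+ 2)%:E)%E); last first.
    move=> i _; apply: (@fubini_tonelli2 _ _ _ _ R P leb (fun z => ((th z.1 * cut s t (X i) z) ^+ 2)%:E)); [exact: mtX|by move=> z; exact: sqe].
  rewrite -ge0_integral_sum//.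
  apply: (@le_trans _ _ (\int[leb]_u (\1_(`]s, t]%classic) u * M)%:E)%E).
    apply: le_integral_nonmeas => u; first by apply: sume_ge0 => i _; apply: integral_ge0.
    rewrite indicE mem_setE in_itv/= /cut/=; case: (boolP (s < u <= t)) => [/andP[su ut]|_].
      rewrite mul1r; apply: le_trans (hM u _); last by rewrite (ltW su).
      by apply: lee_sum => i _; apply: le_integral_nonmeas => w//; rewrite mulr1.
    rewrite mul0r big1// => i _; apply: integral0_eq => w _; by rewrite !mulr0 expr0n.
  under eq_integral do rewrite EFinM muleC.
  have M0 : 0 <= M.
    by rewrite -lee_fin; apply: le_trans (hM s _); [apply: sume_ge0 => i _; exact: sq0|rewrite lexx].
  rewrite ge0_integralZl//; last by apply/measurable_EFinP; exact: measurable_indic.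
  have -> : (\int[leb]_u (\1_(`]s, t]%classic) u)%:E = (t - s)%:E)%E.
    transitivity (\int[leb]_u ((s < u <= t)%R%:R)%:E)%E; first by apply: eq_integral => u _; rewrite indE.
    by have := @ind_int R s t; rewrite max_r// subr_ge0.
  by rewrite muleC.
- rewrite ge0_integral_sum//; last 2 first.
  + by move=> i; apply: emeasurable_sum => k; exact: mtH.
  + by move=> i z _; exact: sume_ge0.
  apply: lee_sum => i _; rewrite ge0_integral_sum//; exact: mtH.
- apply: le_integral_nonmeas => z //; rewrite lee_fin ler_wpM2l ?sqr_ge0// ler_wpM2r//.
  case: (boolP (s < z.2 <= t)) => [/andP[h1 h2]|_] //.
  by rewrite (le_lt_trans ss h1) (le_trans h2 tT).
Qed.

Let A_fin t : s0 <= t -> t <= T -> A t \is a fin_num.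
Proof.
move=> st tT; apply/sum_fin_numP => i _ _.
by rewrite ge0_fin_numE ?sq0//; case: (sthX i st tT).
Qed.

Let B_fin s t : 0 <= s -> t <= T -> B s t \is a fin_num.
Proof.
move=> sp tT; apply/sum_fin_numP => i _ _; apply/sum_fin_numP => k _ _.
by rewrite ge0_fin_numE ?sq0//; case: (sthH i k sp tT).
Qed.

Let A_ge0 t : (0 <= A t)%E. Proof. by apply: sume_ge0 => i _; exact: sq0. Qed.
Let B_ge0 s t : (0 <= B s t)%E.
Proof. by apply: sume_ge0 => i _; apply: sume_ge0 => k _; exact: sq0. Qed.
Let Q_ge0 s t : (0 <= Q s t)%E.
Proof. by apply: integral_ge0 => z _; rewrite lee_fin mulr_ge0 ?sqr_ge0// mulr_ge0. Qed.

Let Q_fin : Q s0 T \is a fin_num.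
Proof.
rewrite ge0_fin_numE//; have [M hM] := hth.2.
apply: (@le_lt_trans _ _ (\int[PL]_z ((M ^+ 2)%:E * (r z)%:E))%E).
  apply: le_integral_nonmeas => z; first by rewrite lee_fin mulr_ge0 ?sqr_ge0// mulr_ge0.
  rewrite -EFinM lee_fin ler_pM ?sqr_ge0// ?mulr_ge0//.
    rewrite -(real_normK (num_real (th z.1))) lerXn2r ?nnegrE//.
    exact: le_trans (hM z.1).
  by case: (_ < _ <= _); rewrite ?mul1r ?mul0r.
rewrite ge0_integralZl//; [|exact/measurable_EFinP|by move=> z _; rewrite lee_fin|by rewrite lee_fin sqr_ge0].
by apply: lte_mul_pinfty => //; rewrite lee_fin sqr_ge0.
Qed.

Let B_add r1 s t : 0 <= r1 -> r1 <= s -> s <= t -> t <= T -> B r1 t = (B r1 s + B s t)%E.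
Proof.
move=> h1 h2 h3 h4; rewrite /B -big_split/=; apply: eq_bigr => i _; rewrite -big_split/=; apply: eq_bigr => k _.
have h5 := le_trans h1 h2; have h6 := le_trans h3 h4.
rewrite -ge0_integralD//; last 4 first.
- by move=> z _; rewrite lee_fin sqr_ge0.
- by apply: measurable_sqE; case: (sthH i k h1 h6).
- by move=> z _; rewrite lee_fin sqr_ge0.
- by apply: measurable_sqE; case: (sthH i k h5 h4).
by apply: eq_integral => z _; rewrite -EFinD (sqr_scale_split _ (cut_split _ _ h2 h3)).
Qed.

(* The weight [th] is 1 when solutions are compared, and a truncated power of |Y| for the moment bound. *)
Lemma stability_iterate (K0 : R) :
  stability_constant T (2 * c * (1 + T)) K0 ->
  forall s, s0 <= s <= T -> (A s + B s T <= K0%:E * (A T + Q s0 T))%E.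
Proof.
move=> [_ iter] s hs; have /andP[ss sT] := hs.
have [Mth hMth] := hth.2.
have [MX hMX] := bX.
have fA t : s0 <= t -> t <= T -> A t = (fine (A t))%:E by move=> h1 h2; rewrite fineK// A_fin.
have fB r1 t : s0 <= r1 -> t <= T -> B r1 t = (fine (B r1 t))%:E.
  by move=> h1 h2; rewrite fineK// B_fin// (le_trans s00).
have fQ : Q s0 T = (fine (Q s0 T))%:E by rewrite (fineK Q_fin).
have := iter s0 (fun t => fine (A t)) (fun r1 t => fine (B r1 t)) (fine (Q s0 T)) s0T s00 _ _ _ _ _ _ s hs.
move=> h; rewrite (fA s)// (fB s T)// (fA T)// fQ -!EFinD -EFinM lee_fin.
have h2 : fine (A s) + fine (Q s0 T) + fine (B s T) <= K0 * (fine (A T) + fine (Q s0 T)).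
  apply: h.
  - exact: fine_ge0.
  - by move=> t _; exact: fine_ge0.
  - exists (Mth ^+ 2 * MX) => t /andP[h1 h2]; rewrite -lee_fin -fA// EFinM.
    have t1 : 0 <= t <= T by rewrite h2 (le_trans s00).
    apply: (@le_trans _ _ ((Mth ^+ 2)%:E * \sum_i \int[P]_w (X i t w ^+ 2)%:E)%E); last first.
      by apply: lee_wpmul2l; [rewrite lee_fin sqr_ge0|exact: hMX].
    rewrite ge0_sume_distrr; last by move=> i _; exact: sq0.
    apply: lee_sum => i _; rewrite -ge0_integralZl//; last 3 first.
    + by apply: measurable_sqE; case: (sX i t1).
    + by move=> w _; rewrite lee_fin sqr_ge0.
    + by rewrite lee_fin sqr_ge0.
    apply: le_integral_nonmeas => w; first by rewrite lee_fin sqr_ge0.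
    rewrite -EFinM lee_fin exprMn ler_wpM2r ?sqr_ge0//.
    rewrite -(real_normK (num_real (th w))) lerXn2r ?nnegrE//.
    exact: le_trans (hMth w).
  - by move=> r1 t _ _ _; exact: fine_ge0.
  - move=> r1 s1 t h1 h2 h3 h4.
    apply: EFin_inj; rewrite EFinD -!fB//; [exact: B_add (le_trans s00 h1) h2 h3 h4|exact: le_trans h2|exact: le_trans h4].
  - move=> r1 t M h1 h3 h4 hM; have r1T := le_trans h3 h4; have h5 := le_trans h1 h3.
    have M0 : 0 <= M by apply: le_trans (hM r1 _); [exact: fine_ge0|rewrite lexx].
    have := energy_step h1 h3 h4.
    have := @drift_split r1 t M h1 h3 h4 _.
    move=> hd he.
    have {}hd : (\int[PL]_z (th z.1 ^+ 2 * gam r1 t z)%:E <= (c * ((t - r1) * M + fine (B r1 t) + fine (Q s0 T)))%:E)%E.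
      rewrite EFinM !EFinD EFinM -fB// -fQ; apply: hd => u /andP[h6 h7].
      rewrite fA//; first by rewrite lee_fin hM// h6.
        exact: le_trans h6.
      exact: le_trans h4.
    have : (A r1 + B r1 t <= (2 * fine (A t) + 2 * (t - r1) * (c * ((t - r1) * M + fine (B r1 t) + fine (Q s0 T))))%:E)%E.
      apply: (le_trans he); rewrite [leRHS]EFinD; apply: leeD; first by rewrite (fA t)// EFinM.
      by rewrite [leRHS]EFinM; apply: lee_wpmul2l => //; rewrite lee_fin mulr_ge0// subr_ge0.
    rewrite (fA r1)// (fB r1 t)// -EFinD lee_fin => hh; apply: (le_trans hh); rewrite lerD2l.
    have b0 : 0 <= fine (B r1 t) by exact: fine_ge0.
    have q0 : 0 <= fine (Q s0 T) by exact: fine_ge0.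
    have tr : 0 <= t - r1 <= T by rewrite subr_ge0 h3/= lerBlDr (le_trans h4)// lerDl (le_trans s00).
    exact: step_arith.
by apply: le_trans h2; have : 0 <= fine (Q s0 T) by [exact: fine_ge0]; lra.
Qed.

End Weighted.
End Stability.

(** * Pathwise differences of two backward equations *)

Section Pathwise.
Context {R : realType}.
Local Notation leb := (@lebesgue_measure R).

Lemma integrable_sqr (T : R) (f : R -> R) (h : R -> \bar R) : measurable_fun `[0, T]%classic f ->
  (forall u, 0 < u <= T -> ((f u ^+ 2)%:E <= h u)%E) -> (forall u, (0 <= h u)%E) ->
  (\int[leb]_u h u < +oo)%E -> leb.-integrable `[0%R, T] (EFin \o f).
Proof.
move=> mf fh h0 hfin; apply/integrableP; split; first exact/measurable_EFinP.
have mf2 : measurable_fun `[0, T]%classic (fun u => (f u ^+ 2)%:E) by apply/measurable_EFinP/measurable_funX.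
have sub : `]0, T]%classic `<=` (`[0, T]%classic : set R).
  by move=> u /=; rewrite !in_itv/= => /andP[/ltW -> ->].
apply: (@le_lt_trans _ _ (\int[leb]_(u in `[0%R, T]) (1 + (f u ^+ 2)%:E))%E).
  apply: ge0_le_integral => //.
  - by apply: measurableT_comp => //; exact/measurable_EFinP.
  - by apply: emeasurable_funD.
  move=> u _; rewrite /= -EFinD lee_fin -(real_normK (num_real (f u))).
  have := sqr_ge0 (`|f u| - 1); have := normr_ge0 (f u); set x := `|_|; nra.
rewrite ge0_integralD//; last by move=> u _; rewrite lee_fin sqr_ge0.
rewrite integral_cst// mul1e lte_add_pinfty//.
  have h1 : (leb `[0%R, T]%classic < +oo)%E by rewrite lebesgue_measure_itv/= lte_fin; case: ifP => _; rewrite -?EFinB ltry.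
  exact: h1.
have -> : (\int[leb]_(u in `[0%R, T]) (f u ^+ 2)%:E = \int[leb]_(u in `]0%R, T]) (f u ^+ 2)%:E)%E.
  rewrite integral_itv_obnd_cbnd//; apply/measurable_EFinP/measurable_funX.
  exact: measurable_funS sub mf.
apply: le_lt_trans hfin; rewrite [leLHS]integral_mkcond.
apply: le_integral_nonmeas => u; rewrite !patchE; case: ifPn => // /set_mem/=; rewrite ?in_itv/= => hu.
  by rewrite lee_fin sqr_ge0.
exact: fh.
Qed.

(** Cauchy-Schwarz, from the nonnegative integral of the square of f minus its mean over the
    interval. The right side is infinite, and nothing is to be shown, when f is not square
    integrable. *)
Lemma sqr_Rintegral_le (s t : R) (f : R -> R) : s <= t -> leb.-integrable `]s, t] (EFin \o f) ->
  (((\int[leb]_(u in `]s, t]) f u) ^+ 2)%:E <=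
   (t - s)%:E * \int[leb]_u ((f u ^+ 2) * (s < u <= t)%R%:R)%:E)%E.
Proof.
move=> st fi; pose w u : R := (s < u <= t)%R%:R.
have mf : measurable_fun `]s, t] f by apply/measurable_EFinP; case/integrableP: fi.
pose g u := f u * w u.
have mw : measurable_fun setT w by exact: measurable_ind.
have gE : g = f \_ `]s, t].
  by apply/funext => u; rewrite patchE /g /w mem_setE in_itv/=; case: ifP => _; rewrite ?mulr1 ?mulr0.
have mg : measurable_fun setT g by rewrite gE; apply/(measurable_restrictT f (measurable_itv _)).
have -> : \int[leb]_(u in `]s, t]) f u = \int[leb]_u g u by rewrite Rintegral_mkcond gE.
have -> : (\int[leb]_u (f u ^+ 2 * w u)%:E = \int[leb]_u (g u ^+ 2)%:E)%E.
  by apply: eq_integral => u _; rewrite /g sqr_window mulrC.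
move: st; rewrite le_eqVlt => /predU1P[st|st].
  have -> : \int[leb]_u g u = 0.
    rewrite gE -Rintegral_mkcond st set_itv_ge ?Rintegral_set0//.
    by rewrite bnd_simp ltxx.
  by rewrite st subrr mul0e expr0n.
have l0 : 0 < t - s by rewrite subr_gt0.
have [gfin|] := ltP (\int[leb]_u (g u ^+ 2)%:E)%E +oo%E; last first.
  by rewrite leye_eq => /eqP ->; rewrite gt0_muley ?lte_fin// leey.
have sg : sqint leb g by split.
have sw : sqint leb w by have := ind_sqint (1 : R) s t; under eq_fun do rewrite mul1r.
pose a := \int[leb]_u g u; pose c := a / (t - s).
have h1 : ip leb g w = a.
  by apply: eq_Rintegral => u _; rewrite /g /w; case: (s < u <= t); rewrite ?mulr1// !mulr0.
have h2 : ip leb w w = t - s.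
  rewrite /ip /Rintegral; transitivity (fine (\int[leb]_u (w u)%:E)); last first.
    by have := @ind_int R s t => /(congr1 fine) -> /=; rewrite max_r// ltW.
  by congr fine; apply: eq_integral => u _; rewrite /w; case: (_ < _ <= _); rewrite ?mulr1 ?mulr0.
have scw : sqint leb (fun u => (- c) * w u) by exact: sqintZ.
have h3 : (0 <= \int[leb]_u ((g u + (- c) * w u) ^+ 2)%:E)%E by apply: integral_ge0 => u _; rewrite lee_fin sqr_ge0.
have h4 : ip leb g (fun u => - c * w u) = - c * a.
  rewrite -h1 /ip -RintegralZl//; last exact: sqint_mul_integrable.
  by apply: eq_Rintegral => u _; ring.
have h5 : (\int[leb]_u ((- c * w u) ^+ 2)%:E = (c ^+ 2 * (t - s))%:E)%E.
  rewrite -h2 EFinM (ip_sqr sw) -ge0_integralZl//; last 3 first.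
  - exact: measurable_sqE.
  - by move=> u _; rewrite lee_fin sqr_ge0.
  - by rewrite lee_fin sqr_ge0.
  by apply: eq_integral => u _; rewrite -EFinM exprMn sqrrN.
move: h3; rewrite (ip_sqrD sg scw) h4 h5 -(ip_sqr sg) -!EFinD -EFinM !lee_fin => h3.
have := mulr_ge0 (ltW l0) h3; have ca : c * (t - s) = a by rewrite /c divfK// gt_eqF.
rewrite -/a; set I := ip leb g g; move: ca; clear; set l := t - s => ca h.
have E : l * (I + 2 * (- c * a) + c ^+ 2 * l) = l * I - a ^+ 2 by rewrite -ca; ring.
by move: h; rewrite E subr_ge0.
Qed.

(** Subtracting the equations at s and at t cancels the terminal values and leaves the integral of f
    - f' over ]s, t]. The equations are required at these two times only, since the copies satisfy
    theirs almost surely at each fixed time. *)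
Lemma pathwise_drift (T s t : R) (I : finType) (g g' : I -> R) (y y' N N' f f' : I -> R -> R) (gam : R -> R) :
  0 <= s -> s <= t -> t <= T ->
  (forall j, leb.-integrable `[0%R, T] (EFin \o f j)) -> (forall j, leb.-integrable `[0%R, T] (EFin \o f' j)) ->
  (forall r, r \in [:: s; t] -> forall j, y j r = g j + \int[leb]_(u in `[r, T]) f j u - (N j T - N j r)) ->
  (forall r, r \in [:: s; t] -> forall j, y' j r = g' j + \int[leb]_(u in `[r, T]) f' j u - (N' j T - N' j r)) ->
  (forall u, s < u <= t -> \sum_j (f j u - f' j u) ^+ 2 <= gam u) ->
  ((\sum_j ((y j s - y' j s) + ((N j t - N' j t) - (N j s - N' j s)) - (y j t - y' j t)) ^+ 2)%:E <=
   (t - s)%:E * \int[leb]_u (gam u * (s < u <= t)%R%:R)%:E)%E.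
Proof.
move=> s0 st tT fi fi' ye ye' fg.
have tsub : `]s, t]%classic `<=` (`[0, T]%classic : set R).
  move=> u /=; rewrite !in_itv/= => /andP[h1 h2]; rewrite (le_trans s0 (ltW h1)) (le_trans h2) //.
have split_int (h : R -> R) : leb.-integrable `[0%R, T] (EFin \o h) ->
    \int[leb]_(u in `[s, T]) h u - \int[leb]_(u in `[t, T]) h u = \int[leb]_(u in `]s, t]) h u.
  move=> hi.
  have i1 : leb.-integrable `]s, T] (EFin \o h).
    apply: integrableS hi => // u /=; rewrite !in_itv/= => /andP[h1 ->]; by rewrite (le_trans s0 (ltW h1)).
  have i2 : leb.-integrable `]t, T] (EFin \o h).
    apply: integrableS i1 => // u /=; rewrite !in_itv/= => /andP[h1 ->]; by rewrite (le_lt_trans st h1).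
  rewrite -(Rintegral_itv_obnd_cbnd i1) -(Rintegral_itv_obnd_cbnd i2).
  have := @Rintegral_itvB R h (BRight s) (BRight T) t i1; rewrite !bnd_simp => /(_ st tT) <-.
  by rewrite opprB addrC subrK.
have E j : (y j s - y' j s) + ((N j t - N' j t) - (N j s - N' j s)) - (y j t - y' j t) =
    \int[leb]_(u in `]s, t]) (f j u - f' j u).
  rewrite RintegralB//; [|exact: integrableS (fi j)|exact: integrableS (fi' j)].
  rewrite -!split_int// !ye ?ye' ?inE ?eqxx ?orbT//; ring.
under eq_bigr do rewrite E.
have di j : leb.-integrable `]s, t] (EFin \o (fun u => f j u - f' j u)).
  have i1 : leb.-integrable `]s, t] (EFin \o f j) by exact: integrableS (fi j).
  have i2 : leb.-integrable `]s, t] (EFin \o f' j) by exact: integrableS (fi' j).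
  rewrite (_ : EFin \o _ = (fun u => (f j u)%:E - (f' j u)%:E)%E); last by apply/funext => u.
  exact: integrableB.
rewrite -sumEFin; apply: (@le_trans _ _ (\sum_j (t - s)%:E * \int[leb]_u (((f j u - f' j u) ^+ 2) * (s < u <= t)%R%:R)%:E)%E).
  by apply: lee_sum => j _; exact: sqr_Rintegral_le.
have p0 j u : (0 <= (((f j u - f' j u) ^+ 2) * (s < u <= t)%R%:R)%:E)%E by rewrite lee_fin mulr_ge0// sqr_ge0.
rewrite -ge0_sume_distrr; last by move=> j _; exact: integral_ge0.
apply: lee_wpmul2l; first by rewrite lee_fin subr_ge0.
rewrite -ge0_integral_sum//; last first.
  move=> j; apply/measurable_EFinP.
  rewrite (_ : (fun u => _) = (fun u => (f j u - f' j u) ^+ 2) \_ `]s, t]).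
    apply/(measurable_restrictT _ (measurable_itv _)); apply: measurable_funX; apply/measurable_EFinP.
    by case/integrableP: (di j).
  by apply/funext => u; rewrite patchE mem_setE in_itv/=; case: ifP => _; rewrite ?mulr1 ?mulr0.
apply: le_integral_nonmeas => u; first exact: sume_ge0.
rewrite sumEFin lee_fin -mulr_suml; case: (boolP (s < u <= t)) => h; last by rewrite !mulr0.
by rewrite !mulr1 fg.
Qed.

End Pathwise.

Lemma gam_window {R : realType} {d0} {Omega : measurableType d0} (I K : finType) (X : I -> R -> Omega -> R)
    (H : I -> K -> R -> Omega -> R) (r : Omega * R -> R) c s t w u :
  c * (\sum_i cut s t (X i) (w, u) ^+ 2 + \sum_i \sum_k cut s t (H i k) (w, u) ^+ 2 + (s < u <= t)%R%:R * r (w, u)) =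
  c * (\sum_i X i u w ^+ 2 + \sum_i \sum_k H i k u w ^+ 2 + r (w, u)) * (s < u <= t)%R%:R.
Proof.
rewrite /cut/=; case: (s < u <= t).
  rewrite mulr1 mul1r; congr (_ * (_ + _ + _)); apply: eq_bigr => i _; first by rewrite mulr1.
  by apply: eq_bigr => k _; rewrite mulr1.
rewrite mulr0 mul0r addr0 big1; last by move=> i _; rewrite mulr0 expr0n.
by rewrite add0r big1 ?mulr0// => i _; rewrite big1// => k _; rewrite mulr0 expr0n.
Qed.

Lemma sqint_section {R : realType} {d0} {Omega : measurableType d0} (P : probability Omega R) (h : Omega * R -> R) :
  sqint (P \x (@lebesgue_measure R))%E h ->
  {ae P, forall w, (\int[@lebesgue_measure R]_u (h (w, u) ^+ 2)%:E < +oo)%E}.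
Proof.
move=> [mh]; rewrite fubini_tonelli1; last 2 first.
- exact: measurable_sqE.
- by move=> z; rewrite lee_fin sqr_ge0.
have h0 w : (0 <= fubini_F (@lebesgue_measure R) (fun z => (h z ^+ 2)%:E) w)%E.
  by apply: integral_ge0 => u _; rewrite lee_fin sqr_ge0.
move=> hfin; have ig : P.-integrable setT (fubini_F (@lebesgue_measure R) (fun z => (h z ^+ 2)%:E)).
  apply/integrableP; split.
    apply: measurable_fun_fubini_tonelli_F; first exact: measurable_sqE.
    by move=> z; rewrite lee_fin sqr_ge0.
  by under eq_integral do rewrite gee0_abs//.
have := integrable_ae measurableT ig; apply: filterS => w /(_ I).
by rewrite ge0_fin_numE.
Qed.


(** * Transport of stochastic integrals to a larger noise filtration *)

Section IntegralConversion.
Context {R : realType} {T : R} {d : nat} {mu : probability (cpath T d) R}.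
Hypothesis hmu : is_wiener mu.
Context {d0 : measure_display} {Omega : measurableType d0} {P : probability Omega R}.
Hypothesis cP : measure_is_complete P.
Variable W : nat -> {RV P >-> cpath T d}.
Hypothesis lawW : forall i A, measurable A -> distribution P (W i) A = mu A.
Hypothesis indW : mutually_independent W.
Local Notation leb := (@lebesgue_measure R).
Local Notation PL := (P \x leb)%E.

Lemma noise_mono (n n' : nat) t : (n <= n')%N -> noise_filtration W n t `<=` noise_filtration W n' t.
Proof.
move=> nn E [[i hi [C hC <-]]|h]; last by right.
by left; exists i; [exact: leq_trans nn|exists C].
Qed.

Lemma smeas_mono (n n' : nat) t (f : Omega -> R) : (n <= n')%N ->
  smeas (noise_filtration W n t) f -> smeas (noise_filtration W n' t) f.
Proof.
by move=> nn; apply: smeas_sub => E /(noise_mono nn); exact: sub_sigma_algebra.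
Qed.

(** The filtration contains all negligible sets, so measurability survives changes on a null set. *)
Lemma smeas_ae n t (f g : Omega -> R) : t <= T -> smeas (noise_filtration W n.+1 t) f ->
  {ae P, forall w, f w = g w} -> smeas (noise_filtration W n.+1 t) g.
Proof.
move=> tT mf fg _ B mB; rewrite setTI.
change (<<s noise_filtration W n.+1 t >> (g @^-1` B)).
have mfB : <<s noise_filtration W n.+1 t >> (f @^-1` B) by have := mf measurableT B mB; rewrite setTI.
pose D := f @^-1` B `&` ~` (g @^-1` B); pose D' := g @^-1` B `&` ~` (f @^-1` B).
have neg (E : set Omega) : (forall w, E w -> f w <> g w) -> <<s noise_filtration W n.+1 t >> E.
  move=> hE; apply: sub_sigma_algebra; right; apply: negligibleS fg => w /hE.
  by [].
have -> : g @^-1` B = (f @^-1` B `&` ~` D) `|` D'.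
  apply/seteqP; split => w /=.
    by case: (pselect (B (f w))) => h1 h2; [left; split => // -[]|right].
  by move=> [[h1 h2]|[]//]; apply: contrapT => h3; apply: h2.
apply: (@measurableU _ (g_sigma_algebraType (noise_filtration W n.+1 t))).
  apply: measurableI => //; apply: measurableC; apply: neg => w [h1 h2] h3; apply: h2; by rewrite /= -h3.
by apply: neg => w [h1 h2] h3; apply: h2; rewrite /= h3.
Qed.

Lemma piece_of (n n' : nat) (S : simple_process T (noise_filtration W n')) (i : 'I_n.+1) (l : 'I_d) (a : nat) :
  (n' <= n.+1)%N ->
  exists e : piece W n, [/\ pk e = (i, l), pa e = sp_time S a, pb e = sp_time S a.+1 & pc e = sp_coef S a].
Proof.
move=> nn.
have hab : 0 <= sp_time S a <= sp_time S a.+1.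
  by have /andP[-> _] := sp_time_range S a; rewrite (sp_time_mono S).
have hbT : sp_time S a.+1 <= T by have /andP[] := sp_time_range S a.+1.
have hc : bounded_coef W n (sp_time S a) (sp_coef S a).
  split; last exact: sp_coef_bounded.
  have h : smeas (noise_filtration W n' (sp_time S a)) (sp_coef S a) by exact: sp_coef_meas.
  exact: smeas_mono nn h.
by exists (Piece (i, l) hab hbT hc).
Qed.

Lemma simple_pieces (n n' : nat) (S : simple_process T (noise_filtration W n')) (i : 'I_n.+1) (l : 'I_d) :
  (n' <= n.+1)%N -> exists es : seq (piece W n),
    (forall k u w, eval es k u w = (k == (i, l))%:R * sp_value S u w) /\
    (forall t w, epart es t w = sp_integral S (fun t w => W i w t 0 l) t w).
Proof.
move=> nn; have [f hf] := choice (fun a => piece_of S i l a nn).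
exists [seq f (nat_of_ord a) | a <- index_enum 'I_(sp_size S)]; split => [k u w|t w].
  rewrite /eval big_map /sp_value mulr_sumr; apply: eq_bigr => a _.
  by rewrite /pval; have [-> -> -> ->] := hf a; rewrite mulrA eq_sym.
rewrite /epart big_map /sp_integral; apply: eq_bigr => a _.
by rewrite /ppart; have [-> -> -> ->] := hf a.
Qed.

(** An integral against one coordinate, for the filtration of n' noises, is read as an integral
    against all coordinates for n + 1 noises. The McKean-Vlasov solution lives in the filtration of
    [W 0] but is compared with particles that see all noises. *)
Lemma ito_sum_of_integral (n n' : nat) (i : 'I_n.+1) (l : 'I_d) (h M : R -> Omega -> R) : (n' <= n.+1)%N -> 0 < T ->
  is_ito_integral P T (noise_filtration W n') (fun t w => W i w t 0 l) h M ->
  measurable_fun setT (cut 0 T h) -> sqint PL (cut 0 T h) ->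
  ito_sum W (fun (k : 'I_n.+1 * 'I_d) u w => (k == (i, l))%:R * h u w) M.
Proof.
move=> nn T0 [aM _ [S [Sh SM]]] mh sh.
have hS N := simple_pieces (S N) i l nn.
have [es hes] := choice hS.
have sM t : 0 <= t <= T -> sqint P (M t).
  move=> tT; have /andP[_ tT'] := tT.
  have mM : measurable_fun setT (M t) by exact: (noise_measurable_fun cP tT' (smeas_mono nn (aM t tT))).
  (* Square integrability of [M t] is not part of the definition of the integral; one approximating
     simple integral at finite distance provides it. *)
  have lt1 : nbhs (0 : \bar R)%E [set x : \bar R | (x < 1%:E)%E] by apply: open_ereal_lt'; rewrite lte_fin.
  have [N0 _ hN0] := SM t tT _ lt1.
  have := hN0 N0 (leqnn _); rewrite /= => hlt.
  have se : sqint P (epart (es N0) t) by exact: (epart_sqint hmu cP lawW indW (es N0) tT).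
  have sd : sqint P (fun w => epart (es N0) t w - M t w).
    split; first by apply: measurable_funB => //; case: se.
    by apply: le_lt_trans (lt_trans hlt (ltry 1)); under eq_integral do rewrite (hes N0).2.
  have := sqintB se sd; congr sqint; apply/funext => w; by rewrite opprB addrC subrK.
have cE k : cut 0 T (fun u w => (k == (i, l))%:R * h u w) = (fun z => (k == (i, l))%:R * cut 0 T h z).
  by apply/funext => z; rewrite /cut mulrA.
split.
- by move=> k; rewrite cE; apply: measurable_funM => //; exact: measurable_cst.
- by move=> k; rewrite cE; exact: sqintZ.
- move=> t tT; exact: (smeas_mono nn (aM t tT)).
- exact: sM.
- exists es; split=> [k|t tT]; last first.
    split.
    + by move=> N; case: (epart_sqint hmu cP lawW indW (es N) tT).
    + by case: (sM t tT).
    + rewrite (_ : (fun N => _) = (fun N => \int[P]_w ((sp_integral (S N) (fun t w => W i w t 0 l) t w - M t w) ^+ 2)%:E)%E).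
        exact: SM.
      by apply/funext => N; apply: eq_integral => w _; rewrite (hes N).2.
  have m1 N : measurable_fun setT (fun z : Omega * R => eval (es N) k z.2 z.1) by exact: measurable_eval_process.
  split => //; first by rewrite cE; apply: measurable_funM => //; exact: measurable_cst.
  have val0 N u w : ~~ (0 < u <= T) -> sp_value (S N) u w = 0.
    move=> hu; rewrite /sp_value big1// => a _.
    case: (boolP (_ < _ <= _)) => [/andP[h1 h2]|_]; last by rewrite mulr0.
    have /andP[h3 _] := sp_time_range (S N) a; have /andP[_ h4] := sp_time_range (S N) a.+1.
    by move: hu; rewrite (le_lt_trans h3 h1) (le_trans h2 h4).
  have le N : (0 <= \int[PL]_z ((eval (es N) k z.2 z.1 - cut 0 T (fun u w => (k == (i, l))%:R * h u w) z) ^+ 2)%:E <=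
     \int[P]_w \int[leb]_(t in `[0%R, T]) ((sp_value (S N) t w - h t w) ^+ 2)%:E)%E.
    apply/andP; split; first by apply: integral_ge0 => z _; rewrite lee_fin sqr_ge0.
    rewrite fubini_tonelli1//; last first.
    - by move=> z; rewrite lee_fin sqr_ge0.
    - apply: measurable_sqE; apply: measurable_funB; first exact: m1.
      by rewrite cE; apply: measurable_funM => //; exact: measurable_cst.
    apply: le_integral_nonmeas => w; first by apply: integral_ge0 => u _; rewrite lee_fin sqr_ge0.
    rewrite [leRHS]integral_mkcond; apply: le_integral_nonmeas => u; first by rewrite lee_fin sqr_ge0.
    rewrite patchE mem_setE in_itv/= (hes N).1 /cut/=.
    have [h1|h1] := boolP (0 < u <= T); last first.
      rewrite val0// !mulr0 subrr expr0n; case: ifP => // _; by rewrite lee_fin sqr_ge0.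
    rewrite (ltW (proj1 (andP h1))) (proj2 (andP h1))/= mulr1 -mulrBr lee_fin exprMn.
    by case: (_ == _); rewrite ?expr1n ?mul1r// expr0n mul0r sqr_ge0.
  by apply: (squeeze_cvge _ (cvg_cst 0%E) Sh); near=> N; exact: le.
Unshelve. all: by end_near. Qed.

End IntegralConversion.

Lemma sqr_sum4 {R : realType} (L a b c : R) : (L * (1 + a + b + c)) ^+ 2 <= 4 * L ^+ 2 * (1 + a ^+ 2 + b ^+ 2 + c ^+ 2).
Proof.
rewrite exprMn [4 * _]mulrC -[leRHS]mulrA ler_wpM2l ?sqr_ge0//.
have := sqr_ge0 (1 - a); have := sqr_ge0 (1 - b); have := sqr_ge0 (1 - c).
have := sqr_ge0 (a - b); have := sqr_ge0 (a - c); have := sqr_ge0 (b - c); nra.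
Qed.

Lemma sqr_sum3 {R : realType} (L a b c : R) : (L * (a + b + c)) ^+ 2 <= 3 * L ^+ 2 * (a ^+ 2 + b ^+ 2 + c ^+ 2).
Proof.
rewrite exprMn [3 * _]mulrC -[leRHS]mulrA ler_wpM2l ?sqr_ge0//.
have := sqr_ge0 (a - b); have := sqr_ge0 (a - c); have := sqr_ge0 (b - c); nra.
Qed.

Section Driver.
Context {R : realType} {m d : nat} {T p LF : R}.
Hypotheses (T0 : 0 < T) (p12 : 1 <= p <= 2) (LF0 : 0 <= LF).
Local Notation V := 'rV[R]_m.
Variable F : R -> cpath T d -> V -> 'M[R]_(m, d) -> probability V R -> V.
Hypothesis lipF : driver_lipschitz p LF F.

Lemma moment_le (nu : probability V R) (D : R) : 0 <= D -> (\int[nu]_x (enorm x ^+ 2)%:E <= D%:E)%E ->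
  [/\ (moment p nu `^ p^-1 <= (Num.sqrt D)%:E)%E, finite_moment p nu & finite_moment 2 nu].
Proof.
move=> D0 hD; have p0 : 0 < p by case/andP: p12; lra.
have h := Lp_le_L2 p12 D0 (@measurable_enorm R 1 m) (@enorm_ge0 R 1 m) hD.
split => //.
  rewrite /finite_moment ltNge leye_eq; apply/negP => /eqP h2.
  by move: h; rewrite -/(moment p nu) h2 poweRyr// invr_eq0 gt_eqF.
apply: le_lt_trans (ltry D); apply: le_trans hD.
by apply: le_integral_nonmeas => x; rewrite ?lee_fin ?powR_ge0// powR_mulrn ?enorm_ge0.
Qed.

Lemma driver_growth t x y z (nu : probability V R) D : 0 <= t <= T -> 0 <= D -> (\int[nu]_x (enorm x ^+ 2)%:E <= D%:E)%E ->
  enorm (F t x y z nu) ^+ 2 <= 4 * LF ^+ 2 * (1 + enorm y ^+ 2 + enorm z ^+ 2 + D).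
Proof.
move=> tT D0 hD; have [h1 h2 _] := moment_le D0 hD.
have := (lipF x tT).2 y z nu h2 => h3.
have h4 : enorm (F t x y z nu) <= LF * (1 + enorm y + enorm z + Num.sqrt D).
  rewrite -lee_fin; apply: (le_trans h3); rewrite EFinM; apply: lee_wpmul2l => //.
  by rewrite !EFinD; apply: leeD.
have n0 := enorm_ge0 (F t x y z nu).
have s0 := sqrtr_ge0 D; have y0 := enorm_ge0 y; have z0 := enorm_ge0 z.
apply: (@le_trans _ _ ((LF * (1 + enorm y + enorm z + Num.sqrt D)) ^+ 2)).
  by rewrite lerXn2r ?nnegrE ?mulr_ge0// !addr_ge0.
by have := sqr_sum4 LF (enorm y) (enorm z) (Num.sqrt D); rewrite (sqr_sqrtr D0).
Qed.

Lemma driver_diff t x y z y' z' (nu nu' : probability V R) D : 0 <= t <= T -> 0 <= D ->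
  finite_moment p nu -> finite_moment p nu' -> (wasserstein p nu nu' <= (Num.sqrt D)%:E)%E ->
  enorm (F t x y z nu - F t x y' z' nu') ^+ 2 <=
  3 * LF ^+ 2 * (enorm (y - y') ^+ 2 + enorm (z - z') ^+ 2 + D).
Proof.
move=> tT D0 h1 h2 h; have := (lipF x tT).1 y y' z z' nu nu' h1 h2 => h3.
have h4 : enorm (F t x y z nu - F t x y' z' nu') <= LF * (enorm (y - y') + enorm (z - z') + Num.sqrt D).
  rewrite -lee_fin; apply: (le_trans h3); rewrite EFinM; apply: lee_wpmul2l => //.
  by rewrite !EFinD; apply: leeD.
have n0 := enorm_ge0 (F t x y z nu - F t x y' z' nu').
have s0 := sqrtr_ge0 D; have y0 := enorm_ge0 (y - y'); have z0 := enorm_ge0 (z - z').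
apply: (@le_trans _ _ ((LF * (enorm (y - y') + enorm (z - z') + Num.sqrt D)) ^+ 2)).
  by rewrite lerXn2r ?nnegrE ?mulr_ge0// !addr_ge0.
by have := sqr_sum3 LF (enorm (y - y')) (enorm (z - z')) (Num.sqrt D); rewrite (sqr_sqrtr D0).
Qed.

Variable mu : probability (cpath T d) R.
Hypothesis mF : forall y z nu, finite_moment 2 nu -> progressive T (path_filtration mu) (fun t w => F t w y z nu).

Lemma driver_section x y z nu : finite_moment 2 nu -> measurable_fun `[0, T]%classic (fun u => F u x y z nu).
Proof.
move=> hnu; have TT : 0 <= T <= T by rewrite lexx ltW.
have h := mF y z hnu TT.
pose g (sx : R * g_sigma_algebraType (path_filtration mu T)) := F sx.1 sx.2 y z nu.
have mD : measurable (`[0, T]%classic `*` setT : set (R * g_sigma_algebraType (path_filtration mu T))).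
  by apply: measurableX => //; exact: measurable_itv.
apply: (@measurable_comp _ _ _ _ _ _ _ g _ (fun u => (u, x)) mD _ h).
  by move=> _ [u hu <-].
by apply: measurable_funTS; exact: (@pair2_measurable _ _ R (g_sigma_algebraType (path_filtration mu T)) x).
Qed.

Lemma driver_pathwise x (y : R -> V) (z : R -> 'M[R]_(m, d)) (nu : R -> probability V R) :
  measurable_fun `[0, T]%classic y -> measurable_fun `[0, T]%classic z ->
  (forall t, 0 <= t <= T -> finite_moment 2 (nu t) /\ finite_moment p (nu t)) ->
  (forall t, 0 <= t <= T -> forall e : R, 0 < e ->
     \forall N \near \oo, (wasserstein p (nu (grid T N t)) (nu t) <= e%:E)%E) ->
  measurable_fun `[0, T]%classic (fun u => F u x (y u) (z u) (nu u)).
Proof.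
move=> my mz hnu cnu.
apply: (@caratheodory R m d _ R `[0, T]%classic T p LF (measurable_itv _) T0 LF0 (fun u => F u x) _ _ y z id nu my mz) => //.
- by move=> y' z' nu' h; exact: driver_section.
- by move=> s y1 y2 z1 z2 nu1 nu2; rewrite /= in_itv/= => hs h1 h2; exact: ((lipF x hs).1).
Qed.

End Driver.

(** * Regular versions of solutions *)

Section SolutionData.
Context {R : realType} {T : R} {d m : nat} {mu : probability (cpath T d) R}.
Hypothesis hmu : is_wiener mu.
Context {d0 : measure_display} {Omega : measurableType d0} {P : probability Omega R}.
Hypothesis cP : measure_is_complete P.
Variable W : nat -> {RV P >-> cpath T d}.
Hypothesis lawW : forall i A, measurable A -> distribution P (W i) A = mu A.
Hypothesis indW : mutually_independent W.
Hypothesis T0 : 0 < T.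
Local Notation leb := (@lebesgue_measure R).
Local Notation PL := (P \x leb)%E.
Local Notation V := 'rV[R]_m.

Lemma measurable_cut_swap (g : R -> Omega -> R) :
  measurable_fun setT (fun z : R * Omega => g z.1 z.2 * (0 < z.1 <= T)%R%:R) -> measurable_fun setT (cut 0 T g).
Proof.
move=> h; have ms : measurable_fun setT (fun z : Omega * R => (z.2, z.1) : R * Omega).
  by apply: measurable_fun_pair; [exact: measurable_snd|exact: measurable_fst].
exact: (measurableT_comp h ms).
Qed.

Variable n : nat.

Lemma progressive_data (n' : nat) (Z : R -> Omega -> 'M[R]_(m, d)) : (n' <= n.+1)%N ->
  progressive T (noise_filtration W n') Z -> (int_norm2 P T Z < +oo)%E ->
  [/\ forall j l, measurable_fun setT (cut 0 T (fun u w => Z u w j l)),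
      forall j l, sqint PL (cut 0 T (fun u w => Z u w j l)) &
      forall w, measurable_fun `[0, T]%classic (fun u => Z u w)].
Proof.
move=> nn pZ fZ; have TT : 0 <= T <= T by rewrite lexx ltW.
have h := pZ T TT.
pose D : set (R * Omega) := `[0, T]%classic `*` setT.
have mD : measurable D by apply: measurableX => //; exact: measurable_itv.
have mD' : measurable (D : set (R * g_sigma_algebraType (noise_filtration W n' T))).
  by apply: measurableX => //; exact: measurable_itv.
have NFm : noise_filtration W n' T `<=` measurable.
  by move=> E /(noise_mono nn); exact: (noise_measurable cP (lexx T)).
have mid : measurable_fun setT (id : Omega -> g_sigma_algebraType (noise_filtration W n' T)).
  move=> _ B mB; rewrite setTI.
  by have : <<s noise_filtration W n' T >> `<=` @measurable _ Omega; [apply: smallest_sub => //; exact: sigma_algebra_measurable|exact].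
have h1 : measurable_fun D (fun z : R * Omega => Z z.1 z.2).
  have mj : measurable_fun setT (fun z : R * Omega => (z.1, z.2) : R * g_sigma_algebraType (noise_filtration W n' T)).
    by apply: measurable_fun_pair; [exact: measurable_fst|apply: (measurableT_comp mid); exact: measurable_snd].
  apply: (@measurable_comp _ _ _ _ _ _ _ (fun sx : R * g_sigma_algebraType (noise_filtration W n' T) => Z sx.1 sx.2) _ (fun z : R * Omega => (z.1, z.2)) mD' _ h).
    by move=> _ [[u w] hu <-].
  exact: measurable_funTS.
have mc j l : measurable_fun setT (cut 0 T (fun u w => Z u w j l)).
  apply: measurable_cut_swap.
  have h2 : measurable_fun D (fun z : R * Omega => Z z.1 z.2 j l) by exact: (measurableT_comp (measurable_coord j l) h1).
  have h3 : measurable_fun setT ((fun z : R * Omega => Z z.1 z.2 j l) \_ D) by apply/(measurable_restrictT _ mD).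
  rewrite (_ : (fun z => _) = (fun z : R * Omega => ((fun z : R * Omega => Z z.1 z.2 j l) \_ D) z * (0 < z.1 <= T)%R%:R)).
    apply: measurable_funM => //.
    exact: (measurableT_comp (@measurable_ind R 0 T) (@measurable_fst _ _ R Omega)).
  apply/funext => z; rewrite patchE; case: ifPn => // hz; case: (boolP (0 < z.1 <= T)); rewrite ?mulr0//.
  move=> /andP[z0 zT]; move: hz; rewrite notin_setE; case; split => //=; by rewrite in_itv/= zT ltW.
split => //.
  move=> j l; split; first exact: mc.
  apply: le_lt_trans fZ; rewrite int_cut//; apply: le_integral_nonmeas => w.
    by apply: integral_ge0 => u _; rewrite lee_fin sqr_ge0.
  rewrite [leRHS]integral_mkcond; apply: le_integral_nonmeas => u; first by rewrite lee_fin sqr_ge0.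
  rewrite patchE mem_setE in_itv/= /cut/=.
  case: (boolP (0 < u <= T)) => [/andP[u0 ->]|_].
    rewrite (ltW u0)/= mulr1 lee_fin -(real_normK (num_real (Z u w j l))) lerXn2r ?nnegrE ?enorm_ge0//.
    exact: coord_le_enorm.
  by rewrite mulr0 expr0n; case: ifP => // _; rewrite lee_fin sqr_ge0.
move=> w; apply: (@measurable_comp _ _ _ _ _ _ _ (fun z : R * Omega => Z z.1 z.2) _ (fun u => (u, w)) mD _ h1).
  by move=> _ [u hu <-].
by apply: measurable_funTS; exact: (@pair2_measurable _ _ R Omega w).
Qed.

Lemma enorm0 a b : enorm (0 : 'M[R]_(a, b)) = 0.
Proof.
by rewrite /enorm big1 ?sqrtr0// => i _; rewrite big1// => j _; rewrite mxE expr0n.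
Qed.

(** Discontinuous paths are replaced by 0. The replacement changes a null set, so adaptedness is
    kept by completeness, and continuity of every path gives joint measurability in time and
    sample. *)
Lemma regularize (n' : nat) (Y : R -> Omega -> V) : (n' <= n.+1)%N ->
  adapted T (noise_filtration W n') Y -> {ae P, forall w, {within `[0, T], continuous (Y ^~ w)}} ->
  (sup_norm2 P T Y < +oo)%E ->
  exists y : R -> Omega -> V,
  [/\ forall w, {within `[0, T], continuous (y ^~ w)},
      {ae P, forall w, forall t, y t w = Y t w},
      forall j t, 0 <= t <= T -> smeas (noise_filtration W n.+1 t) (fun w => y t w 0 j),
      forall j, measurable_fun setT (cut 0 T (fun u w => y u w 0 j)) &
      forall t, 0 <= t <= T -> (\int[P]_w (enorm (y t w) ^+ 2)%:E <= sup_norm2 P T Y)%E].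
Proof.
move=> nn aY cY sY.
pose C w := {within `[0, T], continuous (Y ^~ w)}.
pose y t w := if `[< C w >] then Y t w else 0.
have yE : {ae P, forall w, forall t, y t w = Y t w}.
  by apply: filterS cY => w h t; rewrite /y; case: asboolP.
have cy w : {within `[0, T], continuous (y ^~ w)}.
  rewrite /y; case: asboolP => // _; apply: continuous_subspaceT => x; exact: cvg_cst.
have ay j t : 0 <= t <= T -> smeas (noise_filtration W n.+1 t) (fun w => y t w 0 j).
  move=> tT; have /andP[_ tT'] := tT.
  have h : smeas (noise_filtration W n' t) (fun w => Y t w 0 j).
    exact: (measurableT_comp (measurable_coord 0 j) (aY t tT)).
  apply: (smeas_ae tT' (smeas_mono nn h)); apply: filterS yE => w h'; by rewrite h'.
exists y; split => //.
- move=> j; apply: measurable_cut_swap; apply: (joint_measurable T0 (Y := fun u w => y u w 0 j)).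
    by move=> t tT; apply: (noise_measurable_fun cP _ (ay j t tT)); case/andP: tT.
  by move=> w; apply: (within_continuous_coord (f := y ^~ w)).
- move=> t tT; apply: le_integral_nonmeas => w; first by rewrite lee_fin sqr_ge0.
  rewrite /y; case: asboolP => _.
    by apply: ereal_sup_ubound; exists t => //; rewrite /= in_itv.
  apply: (@le_ereal_sup_mem _ _ _ (enorm (Y t w) ^+ 2)%:E); first by exists t => //; rewrite /= in_itv.
  by rewrite enorm0 lee_fin expr0n sqr_ge0.
Qed.

Lemma continuous_sum_within (A : set R) (I : Type) (s : seq I) (f : I -> R -> R) :
  (forall i, {within A, continuous (f i)}) -> {within A, continuous (fun t => \sum_(i <- s) f i t)}.
Proof.
move=> h; elim: s => [|i s IH].
  under eq_fun do rewrite big_nil; apply: continuous_subspaceT => x; exact: cvg_cst.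
by under eq_fun do rewrite big_cons; move=> x; apply: cvgD; [exact: h|exact: IH].
Qed.

(** The integrals against the single coordinates are added into one process per component of the
    solution. The equation is kept for all times at once outside one null set, together with the
    continuity of the integrals. *)
Lemma solution_data (n' : nat) (nn : (n' <= n.+1)%N) xi f (Y : R -> Omega -> V) (Z : 'I_n' -> R -> Omega -> 'M[R]_(m, d)) :
  bsde_solution W xi f Y Z ->
  exists (y : R -> Omega -> V) (N : 'I_m -> R -> Omega -> R),
  [/\ [/\ forall w, {within `[0, T], continuous (y ^~ w)},
          {ae P, forall w, forall t, y t w = Y t w},
          forall j t, 0 <= t <= T -> smeas (noise_filtration W n.+1 t) (fun w => y t w 0 j),
          forall j, measurable_fun setT (cut 0 T (fun u w => y u w 0 j)) &
          forall t, 0 <= t <= T -> (\int[P]_w (enorm (y t w) ^+ 2)%:E <= sup_norm2 P T Y)%E],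
      forall j, ito_sum W (fun (k : 'I_n.+1 * 'I_d) u w => \sum_(i < n') (k.1 == widen_ord nn i)%:R * Z i u w j k.2) (N j),
      {ae P, forall w, forall j, {within `[0, T], continuous (N j ^~ w)}} &
      {ae P, forall w, forall t, 0 <= t <= T -> forall j,
        y t w 0 j = xi w 0 j + \int[leb]_(u in `[t, T]) f u w 0 j - (N j T w - N j t w)}].
Proof.
move=> [[aY cY] pZ sY fZ [M [hM eqM]]].
have [y hy] := regularize nn aY cY sY.
exists y, (fun j t w => \sum_(k < n') \sum_(l < d) M k j l t w).
have [_ yE _ _ _] := hy.
split => //.
- move=> j.
  have h (kl : 'I_n' * 'I_d) : ito_sum W (fun (k : 'I_n.+1 * 'I_d) u w => (k == (widen_ord nn kl.1, kl.2))%:R * Z kl.1 u w j kl.2) (M kl.1 j kl.2).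
    have [mc sc _] := progressive_data nn (pZ kl.1) (fZ kl.1).
    by have := ito_sum_of_integral hmu cP lawW indW (i := widen_ord nn kl.1) (l := kl.2) nn T0 (hM kl.1 j kl.2) (mc j kl.2) (sc j kl.2); exact.
  have := ito_sum_sum (index_enum _) h; congr ito_sum.
    apply/funext => -[k1 k2]; apply/funext => u; apply/funext => w.
    rewrite -(pair_big xpredT xpredT (fun i l => ((k1, k2) == (widen_ord nn i, l))%:R * Z i u w j l))/=.
    apply: eq_bigr => i _; rewrite (bigD1 k2)//= big1 ?addr0.
      by rewrite xpair_eqE eqxx andbT.
    by move=> l lk; rewrite xpair_eqE [k2 == l]eq_sym (negbTE lk) andbF mul0r.
  apply/funext => t; apply/funext => w.
  by rewrite -(pair_big xpredT xpredT (fun i l => M i j l t w)).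
- have : {ae P, forall w, forall klj : 'I_n' * 'I_d * 'I_m, {within `[0, T], continuous (M klj.1.1 klj.2 klj.1.2 ^~ w)}}.
    by apply: filter_forall => -[[k l] j]; have [_ h _] := hM k j l.
  apply: filterS => w h j.
  apply: (continuous_sum_within (f := fun k t => \sum_(l < d) M k j l t w)) => k.
  apply: (continuous_sum_within (f := fun l t => M k j l t w)) => l; exact: (h (k, l, j)).
- apply: filterS2 yE eqM => w yw h t tT j; rewrite yw h//; congr (_ - _).
  by rewrite -sumrB; apply: eq_bigr => k _; rewrite -sumrB.
Qed.

End SolutionData.

Section Absorption.
Context {R : realType} {d0 : measure_display} {X : measurableType d0} (P : probability X R).

Lemma powR_mulr1 (x e : R) : 0 <= x -> 1 < e -> x `^ (e - 1) * x = x `^ e.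
Proof.
move=> x0 e1; rewrite -{2}(powRr1 x0) -powRD ?subrK//.
by apply/implyP => /eqP h; exfalso; lra.
Qed.

(** Split according to whether 2Kx is below M: then half of M^e suffices, and otherwise M^(e-1) is
    at most (2Kx)^(e-1). *)
Lemma absorb_le (K e M x : R) : 0 <= K -> 1 < e -> 0 <= M -> 0 <= x ->
  K * (M `^ (e - 1) * x) <= 2^-1 * M `^ e + K * (2 * K) `^ (e - 1) * x `^ e.
Proof.
move=> K0 e1 M0 x0; have e0 : 0 <= e - 1 by lra.
have p1 := powR_ge0 M (e - 1); have p2 := powR_ge0 M e; have p3 := powR_ge0 x e; have p4 := powR_ge0 (2 * K) (e - 1).
have [h|h] := leP (2 * K * x) M.
  apply: (@le_trans _ _ (2^-1 * M `^ e)); last by rewrite lerDl !mulr_ge0.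
  have E := powR_mulr1 M0 e1; rewrite -E.
  move: h p1; set q := M `^ (e - 1) => h p1.
  have : 0 <= q * (M - 2 * K * x) by rewrite mulr_ge0// subr_ge0.
  by clear; lra.
apply: (@le_trans _ _ (K * (2 * K) `^ (e - 1) * x `^ e)); last by rewrite lerDr mulr_ge0.
rewrite -mulrA ler_wpM2l// -(@powR_mulr1 x)// mulrA ler_wpM2r// -powRM//; last by rewrite mulr_ge0.
by apply: ge0_ler_powR => //; rewrite ?nnegrE ?mulr_ge0// ltW.
Qed.

(* Truncating [U] at [M] makes its moment finite, so that half of it can be absorbed on the left; then [M] tends to infinity. *)
Lemma moment_absorb (U z : X -> R) (K e : R) : 0 <= K -> 1 < e ->
  measurable_fun setT U -> measurable_fun setT z -> (forall w, 0 <= U w) -> (forall w, 0 <= z w) ->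
  (forall M : R, 0 <= M -> (\int[P]_w (Num.min (U w) M `^ (e - 1) * U w)%:E <=
     K%:E * \int[P]_w (Num.min (U w) M `^ (e - 1) * z w)%:E)%E) ->
  (\int[P]_w (U w `^ e)%:E <= (2 * (K * (2 * K) `^ (e - 1)))%:E * \int[P]_w (z w `^ e)%:E)%E.
Proof.
move=> K0 e1 mU mz U0 z0 h; pose C := K * (2 * K) `^ (e - 1).
have C0 : 0 <= C by rewrite mulr_ge0// powR_ge0.
have e0 : 0 <= e by lra.
pose m M w := Num.min (U w) M.
have mm M : measurable_fun setT (m M) by apply: measurable_minr => //; exact: measurable_cst.
have mp (f : X -> R) a : measurable_fun setT f -> measurable_fun setT (fun w => (f w `^ a)%:E).
  by move=> mf; apply/measurable_EFinP; apply: (measurableT_comp (measurable_powR a)).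
have key (N : nat) : (\int[P]_w (m N%:R w `^ e)%:E <= (2 * C)%:E * \int[P]_w (z w `^ e)%:E)%E.
  set M : R := N%:R; have M0 : 0 <= M by rewrite ler0n.
  have mge w : 0 <= m M w by rewrite le_min U0.
  have fin : (\int[P]_w (m M w `^ e)%:E)%E \is a fin_num.
    rewrite ge0_fin_numE; last by apply: integral_ge0 => w _; rewrite lee_fin powR_ge0.
    apply: (@le_lt_trans _ _ (\int[P]_w (M `^ e)%:E)%E).
      apply: le_integral_nonmeas => w; rewrite lee_fin ?powR_ge0//.
      by apply: ge0_ler_powR => //; rewrite ?nnegrE// ge_min lexx orbT.
    by rewrite integral_cst//= probability_setT mule1 ltry.
  have step : (\int[P]_w (m M w `^ e)%:E <= (2^-1)%:E * \int[P]_w (m M w `^ e)%:E + C%:E * \int[P]_w (z w `^ e)%:E)%E.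
    apply: (@le_trans _ _ (\int[P]_w (m M w `^ (e - 1) * U w)%:E)%E).
      apply: le_integral_nonmeas => w; rewrite lee_fin ?powR_ge0// -powR_mulr1//.
      by rewrite ler_wpM2l ?powR_ge0// ge_min lexx.
    apply: (le_trans (h M M0)).
    rewrite -!ge0_integralZl//; try (by move=> w _; rewrite lee_fin ?powR_ge0// mulr_ge0// powR_ge0); try exact: mp.
      rewrite -ge0_integralD//; try (by move=> w _; rewrite -EFinM lee_fin mulr_ge0// powR_ge0); try by apply: measurable_funeM; exact: mp.
      apply: le_integral_nonmeas => w; rewrite -!EFinM; first by rewrite lee_fin !mulr_ge0// powR_ge0.
      by rewrite -EFinD lee_fin; exact: (absorb_le K0 e1 (mge w) (z0 w)).
    apply/measurable_EFinP; apply: measurable_funM; last exact: mz.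
    exact: (measurableT_comp (measurable_powR (e - 1)) (mm M)).
  have z1 : (0 <= \int[P]_w (z w `^ e)%:E)%E by apply: integral_ge0 => w _; rewrite lee_fin powR_ge0.
  move: step; rewrite -(fineK fin); set a := fine _.
  move: z1; case: (\int[P]_w (z w `^ e)%:E)%E => [b| |]//.
    by rewrite -!EFinM -EFinD !lee_fin => _; lra.
  (* With an infinite right-hand integral the bound is trivial unless the constant is 0; this forces
     K = 0, and the hypothesis makes the truncated moment vanish. *)
  move=> _ _; have := C0; rewrite le_eqVlt => /predU1P[C00|C1]; last by rewrite gt0_muley ?leey// lte_fin mulr_gt0.
  rewrite -C00 mulr0 mul0e lee_fin.
  have := h M M0; rewrite -[K](_ : 0 = K) ?mul0e; last first.
    have := C00; rewrite /C => /esym/eqP; rewrite mulf_eq0 => /predU1P[->//|].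
    by rewrite powR_eq0 => /andP[/eqP]; lra.
  move=> h0; rewrite -lee_fin /a fineK//; apply: le_trans h0.
  apply: le_integral_nonmeas => w; rewrite lee_fin ?powR_ge0// -powR_mulr1//.
  by rewrite ler_wpM2l ?powR_ge0// ge_min lexx.
have lim w : (m N%:R w `^ e)%:E @[N --> \oo] --> (U w `^ e)%:E.
  apply: cvg_EFin; first by near=> N.
  apply: cvg_near_cst; near=> N; rewrite /= /m min_l//; apply: (@le_trans _ _ (Num.truncn (U w)).+1%:R).
    by have /andP[_ /ltW] := truncn_itv (U0 w).
  by rewrite ler_nat; near: N; exact: nbhs_infty_ge.
have mono w : {homo (fun N : nat => (m N%:R w `^ e)%:E) : i j / (i <= j)%N >-> (i <= j)%E}.
  move=> i j ij; rewrite lee_fin; apply: ge0_ler_powR => //; rewrite ?nnegrE ?le_min ?U0//.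
  - by rewrite ler0n.
  - by rewrite ler0n.
  by rewrite /m !ge_min lexx ler_nat ij orbT.
have cv : (\int[P]_w (m N%:R w `^ e)%:E)%E @[N --> \oo] --> (\int[P]_w (U w `^ e)%:E)%E.
  have -> : (\int[P]_w (U w `^ e)%:E = \int[P]_w (limn (fun N => (m N%:R w `^ e)%:E)))%E.
    by apply: eq_integral => w _; apply/esym/cvg_lim.
  apply: cvg_monotone_convergence => //.
  - by move=> N; exact: mp.
  - by move=> N w _; rewrite lee_fin powR_ge0.
rewrite -(cvg_lim _ cv)//; apply: lime_le; first by apply/cvg_ex; eexists; exact: cv.
by near=> N; exact: key.
Unshelve. all: by end_near. Qed.

End Absorption.

Section DriverPath.
Context {R : realType} {m d : nat} {T p LF : R}.
Hypotheses (T0 : 0 < T) (p12 : 1 <= p <= 2) (LF0 : 0 <= LF).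
Local Notation V := 'rV[R]_m.
Local Notation leb := (@lebesgue_measure R).
Variable F : R -> cpath T d -> V -> 'M[R]_(m, d) -> probability V R -> V.
Hypothesis lipF : driver_lipschitz p LF F.
Variable mu : probability (cpath T d) R.
Hypothesis mF : forall y z nu, finite_moment 2 nu -> progressive T (path_filtration mu) (fun t w => F t w y z nu).

Lemma driver_integrable x (y : R -> V) (z : R -> 'M[R]_(m, d)) (nu : R -> probability V R) (D : R -> R) :
  measurable_fun `[0, T]%classic y -> measurable_fun `[0, T]%classic z ->
  (forall t, 0 <= t <= T -> 0 <= D t /\ (\int[nu t]_x (enorm x ^+ 2)%:E <= (D t)%:E)%E) ->
  (forall t, 0 <= t <= T -> forall e : R, 0 < e ->
     \forall N \near \oo, (wasserstein p (nu (grid T N t)) (nu t) <= e%:E)%E) ->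
  (\int[leb]_u (4 * LF ^+ 2 * (1 + enorm (y u) ^+ 2 + enorm (z u) ^+ 2 + D u) * (0 < u <= T)%R%:R)%:E < +oo)%E ->
  forall j, leb.-integrable `[0%R, T] (EFin \o (fun u => F u x (y u) (z u) (nu u) 0 j)).
Proof.
move=> my mz hD cnu fin j.
pose b u := 4 * LF ^+ 2 * (1 + enorm (y u) ^+ 2 + enorm (z u) ^+ 2 + D u) * (0 < u <= T)%R%:R.
(* The maximum with 0 supplies the nonnegativity that [integrable_sqr] asks at every time, before
   that of [b] is derived. *)
apply: (@integrable_sqr _ _ _ (fun u => (Num.max 0 (b u))%:E)).
- apply: (measurableT_comp (measurable_coord 0 j)); apply: (driver_pathwise T0 LF0 lipF mF x my mz) => //.
  by move=> t tT; have [h1 h2] := hD t tT; have [_ ? ?] := moment_le p12 h1 h2.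
- move=> u /andP[u0 uT]; have uT' : 0 <= u <= T by rewrite uT ltW.
  have [h1 h2] := hD u uT'.
  rewrite lee_fin le_max; apply/orP; right; rewrite /b u0 uT mulr1.
  apply: le_trans (driver_growth p12 LF0 lipF x (y u) (z u) uT' h1 h2).
  rewrite -(real_normK (num_real (F _ _ _ _ _ _ _))) lerXn2r ?nnegrE ?enorm_ge0//; exact: coord_le_enorm.
- by move=> u; rewrite lee_fin le_max lexx.
- have b0 u : 0 <= b u.
    rewrite /b; case: (boolP (0 < u <= T)) => [/andP[u0 uT]|_]; last by rewrite mulr0.
    have uT' : 0 <= u <= T by rewrite uT ltW.
    have [h1 _] := hD u uT'; rewrite !mulr_ge0 ?sqr_ge0// !addr_ge0 ?sqr_ge0//.
  apply: le_lt_trans fin; apply: le_integral_nonmeas => u; first by rewrite lee_fin le_max lexx.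
  by rewrite lee_fin ge_max lexx b0.
Qed.

End DriverPath.

Lemma half_gt1 {R : realType} (k : R) : 2 < k -> 1 < k / 2. Proof. lra. Qed.

Lemma half_pred_ge0 {R : realType} (e : R) : 1 < e -> 0 <= (e - 1) / 2. Proof. lra. Qed.

Lemma drift_rearrange {R : realType} (a b s : R) : 1 + a + b + s <= a + b + (1 + s). Proof. lra. Qed.

Lemma drift_rearrange' {R : realType} (a b s : R) : 1 + a + b + s <= 1 + s + (a + b). Proof. lra. Qed.

Lemma add_le_max {R : realType} (a b : R) : a + b <= 2 * Num.max a b.
Proof.
have : a <= Num.max a b by rewrite le_max lexx.
have : b <= Num.max a b by rewrite le_max lexx orbT.
lra.
Qed.

Lemma half_ge0 {R : realType} (k : R) : 2 < k -> 0 <= k / 2. Proof. lra. Qed.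

Lemma affine_window_finite {R : realType} (c s T : R) (f : R -> R) : 0 <= c -> 0 <= s ->
  measurable_fun setT f -> (forall u, 0 <= f u) -> (\int[@lebesgue_measure R]_u (f u)%:E < +oo)%E ->
  (\int[@lebesgue_measure R]_u (c * (s * (0 < u <= T)%R%:R + f u))%:E < +oo)%E.
Proof.
move=> c0 s0 mf f0 ff.
have mw : measurable_fun setT (fun u : R => ((0 < u <= T)%R%:R : R)) by exact: measurable_ind.
have w0 u : 0 <= (0 < u <= T)%R%:R :> R by [].
under eq_integral do rewrite EFinM.
rewrite ge0_integralZl//; last 2 first.
- by apply/measurable_EFinP; apply: measurable_funD => //; apply: measurable_funM => //; exact: measurable_cst.
- by move=> u _; rewrite lee_fin addr_ge0// mulr_ge0.
apply: lte_mul_pinfty => //.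
under eq_integral do rewrite EFinD.
rewrite ge0_integralD//; last 4 first.
- by move=> u _; rewrite lee_fin mulr_ge0.
- by apply/measurable_EFinP; apply: measurable_funM => //; exact: measurable_cst.
- by move=> u _; rewrite lee_fin.
- exact/measurable_EFinP.
rewrite lte_add_pinfty//; under eq_integral do rewrite EFinM.
rewrite ge0_integralZl//; last exact/measurable_EFinP.
have -> : (\int[@lebesgue_measure R]_u ((0 < u <= T)%R%:R)%:E = (Num.max 0 (T - 0))%:E)%E by exact: ind_int.
by rewrite -EFinM ltry.
Qed.

Lemma enorm_row {R : realType} m (x : 'rV[R]_m) : enorm x ^+ 2 = \sum_j x 0 j ^+ 2.
Proof. by rewrite enorm_sqr big_ord1. Qed.

Lemma measurable_path {R : realType} m (T : R) (y : R -> 'rV[R]_m) : {within `[0, T], continuous y} ->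
  measurable_fun `[0, T]%classic y.
Proof.
move=> cy; apply: measurable_fun_mx => [|i j]; first exact: measurable_itv.
apply: subspace_continuous_measurable_fun; first exact: measurable_itv.
exact: within_continuous_coord.
Qed.

Lemma measurable_window_path {R : realType} (T : R) a b (z : R -> 'M[R]_(a, b)) : measurable_fun `[0, T]%classic z ->
  measurable_fun setT (fun u => enorm (z u) ^+ 2 * (0 < u <= T)%R%:R).
Proof.
move=> mz; rewrite (_ : (fun u => _) = (fun u => ((fun u => enorm (z u) ^+ 2) \_ `[0, T]%classic) u * (0 < u <= T)%R%:R)).
  apply: measurable_funM; last exact: measurable_ind.
  apply/(measurable_restrictT _ (measurable_itv _)); apply: measurable_funX.
  by apply: measurableT_comp => //; exact: measurable_enorm.
apply/funext => u; rewrite patchE mem_setE in_itv/=; case: (boolP (0 < u <= T)) => [/andP[/ltW -> ->]//|_].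
by rewrite !mulr0.
Qed.

Lemma measurable_ae_eq {R : realType} {d0} {X : measurableType d0} (P : probability X R) (A B : set X) :
  measure_is_complete P -> measurable A -> {ae P, forall w, A w <-> B w} -> measurable B.
Proof.
move=> cP mA AB.
have neg (E : set X) : (forall w, E w -> ~ (A w <-> B w)) -> measurable E.
  by move=> hE; apply: cP; apply: negligibleS AB => w /hE.
have -> : B = (A `&` ~` (A `&` ~` B)) `|` (B `&` ~` A).
  apply/seteqP; split => w /=.
    by case: (pselect (A w)) => h1 h2; [left; split => // -[]|right].
  by move=> [[h1 h2]|[]//]; apply: contrapT => h3; apply: h2.
apply: measurableU.
  by apply: measurableI => //; apply: measurableC; apply: neg => w [h1 h2] [h3 _]; apply: h2; exact: h3.
by apply: neg => w [h1 h2] [_ h3]; apply: h2; exact: h3.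
Qed.

(** * Uniform k-th moment of the McKean-Vlasov solution *)

Section SupMoment.
Context {R : realType} {T : R} {d m : nat} {mu : probability (cpath T d) R}.
Hypothesis hmu : is_wiener mu.
Context {d0 : measure_display} {Omega : measurableType d0} {P : probability Omega R}.
Hypothesis cP : measure_is_complete P.
Variable W : nat -> {RV P >-> cpath T d}.
Hypothesis lawW : forall i A, measurable A -> distribution P (W i) A = mu A.
Hypothesis indW : mutually_independent W.
Hypothesis T0 : 0 < T.
Variables p LF k : R.
Hypotheses (p12 : 1 <= p <= 2) (LF0 : 0 <= LF) (k2 : 2 < k).
Local Notation leb := (@lebesgue_measure R).
Local Notation PL := (P \x leb)%E.
Local Notation V := 'rV[R]_m.
Variables (F : R -> cpath T d -> V -> 'M[R]_(m, d) -> probability V R -> V) (G : cpath T d -> V).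
Hypothesis lipF : driver_lipschitz p LF F.
Hypothesis mF : forall y z nu, finite_moment 2 nu -> progressive T (path_filtration mu) (fun t w => F t w y z nu).
Hypothesis fG : (\int[P]_w (enorm (G (W 0%N w)) `^ k)%:E < +oo)%E.
Variables (Y : R -> {RV P >-> V}) (Z : R -> Omega -> 'M[R]_(m, d)).
Hypothesis solY : mckean_vlasov_solution W F G Y Z.

Let sY : (sup_norm2 P T Y < +oo)%E. Proof. by case: solY. Qed.
Let cY : {ae P, forall w, {within `[0, T], continuous (fun t => Y t w)}}. Proof. by case: solY => -[]. Qed.

Definition flow_bound : R := fine (sup_norm2 P T Y).

Lemma sup_norm2_ge0 a b (X : R -> Omega -> 'M[R]_(a, b)) : (0 <= sup_norm2 P T X)%E.
Proof.
apply: integral_ge0 => w _; apply: (@le_ereal_sup_mem _ _ _ (enorm (X 0 w) ^+ 2)%:E).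
  by exists 0 => //=; rewrite in_itv/= lexx ltW.
by rewrite lee_fin sqr_ge0.
Qed.

Lemma flow_boundE : sup_norm2 P T Y = flow_bound%:E.
Proof. by rewrite fineK// ge0_fin_numE// sup_norm2_ge0. Qed.

Lemma flow_bound_ge0 : 0 <= flow_bound.
Proof. by rewrite fine_ge0// sup_norm2_ge0. Qed.

Lemma flow_moment t : 0 <= t <= T ->
  0 <= flow_bound /\ (\int[distribution P (Y t)]_x (enorm x ^+ 2)%:E <= flow_bound%:E)%E.
Proof.
move=> tT; split; first exact: flow_bound_ge0.
rewrite ge0_integral_distribution//.
- by rewrite -flow_boundE; exact: moment_le_sup.
- by apply/measurable_EFinP/measurable_funX; exact: measurable_enorm.
- by move=> x; rewrite lee_fin sqr_ge0.
Qed.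

Lemma flow_driver_integrable x (y : R -> V) (z : R -> 'M[R]_(m, d)) :
  measurable_fun `[0, T]%classic y -> measurable_fun `[0, T]%classic z ->
  (\int[leb]_u ((enorm (y u) ^+ 2 + enorm (z u) ^+ 2) * (0 < u <= T)%R%:R)%:E < +oo)%E ->
  forall j, leb.-integrable `[0%R, T] (EFin \o (fun u => F u x (y u) (z u) (distribution P (Y u)) 0 j)).
Proof.
move=> my mz fyz j; have S0 := flow_bound_ge0; pose S := flow_bound.
apply: (@driver_integrable _ _ _ _ _ _ T0 p12 LF0 _ lipF _ mF _ _ _ _ (fun=> S)) => //.
- by move=> u; exact: flow_moment.
- by move=> u uT; exact: law_flow_cvg.
apply: (@le_lt_trans _ _ (\int[leb]_u (4 * LF ^+ 2 * ((1 + S) * (0 < u <= T)%R%:R + (enorm (y u) ^+ 2 + enorm (z u) ^+ 2) * (0 < u <= T)%R%:R))%:E)%E).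
  apply: le_integral_nonmeas => u.
    by rewrite lee_fin !mulr_ge0// ?sqr_ge0// !addr_ge0// sqr_ge0.
  rewrite lee_fin -[leLHS]mulrA ler_wpM2l ?mulr_ge0 ?sqr_ge0// -mulrDl ler_wpM2r//.
  exact: drift_rearrange'.
apply: affine_window_finite => //; first by rewrite mulr_ge0// sqr_ge0.
- exact: addr_ge0.
- by under eq_fun do rewrite mulrDl; apply: measurable_funD; apply: measurable_window_path.
- by move=> u; rewrite mulr_ge0// addr_ge0// sqr_ge0.
Qed.

Lemma ae_section_finite (y : R -> Omega -> V) (z : R -> Omega -> 'M[R]_(m, d)) :
  (forall j, measurable_fun setT (cut 0 T (fun u w => y u w 0 j))) ->
  (forall j l, sqint PL (cut 0 T (fun u w => z u w j l))) ->
  (exists M : R, forall t, 0 <= t <= T -> (\int[P]_w (enorm (y t w) ^+ 2)%:E <= M%:E)%E) ->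
  {ae P, forall w, (\int[leb]_u ((enorm (y u w) ^+ 2 + enorm (z u w) ^+ 2) * (0 < u <= T)%R%:R)%:E < +oo)%E}.
Proof.
move=> my sz [M hM].
have sy j : sqint PL (cut 0 T (fun u w => y u w 0 j)).
  split; first exact: my.
  rewrite fubini_tonelli2; last 2 first.
  - by apply: measurable_sqE; exact: my.
  - by move=> x; rewrite lee_fin sqr_ge0.
  apply: (@le_lt_trans _ _ (\int[leb]_u ((Num.max 0 M)%:E * ((0 < u <= T)%R%:R)%:E))%E).
    apply: le_integral_nonmeas => u; first by apply: integral_ge0 => w _; rewrite lee_fin sqr_ge0.
    rewrite /fubini_G /cut/=; case: (boolP (0 < u <= T)) => [/andP[u0 uT]|_]; last first.
      by rewrite mule0; under eq_integral do rewrite mulr0 expr0n; rewrite integral0.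
    have uT' : 0 <= u <= T by rewrite uT ltW.
    rewrite mule1; apply: (@le_trans _ _ M%:E); last by rewrite lee_fin le_max lexx orbT.
    apply: le_trans (hM u uT'); apply: le_integral_nonmeas => w; rewrite lee_fin ?sqr_ge0// mulr1.
    rewrite -(real_normK (num_real (y u w 0 j))) lerXn2r ?nnegrE ?enorm_ge0//; exact: coord_le_enorm.
  rewrite ge0_integralZl//.
  - have -> : (\int[leb]_u ((0 < u <= T)%R%:R)%:E = (Num.max 0 (T - 0))%:E)%E by exact: ind_int.
    by rewrite -EFinM ltry.
  - by apply/measurable_EFinP; exact: measurable_ind.
  - by rewrite lee_fin le_max lexx.
have h1 : {ae P, forall w, forall j, (\int[leb]_u (cut 0 T (fun u w => y u w 0 j) (w, u) ^+ 2)%:E < +oo)%E}.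
  by apply: filter_forall => j; exact: sqint_section.
have h2 : {ae P, forall w, forall jl : 'I_m * 'I_d, (\int[leb]_u (cut 0 T (fun u w => z u w jl.1 jl.2) (w, u) ^+ 2)%:E < +oo)%E}.
  by apply: filter_forall => jl; apply: sqint_section; exact: sz.
apply: filterS2 h1 h2 => w k1 k2'.
have msec (h : Omega * R -> R) : measurable_fun setT h -> measurable_fun setT (fun u : R => (h (w, u) ^+ 2)%:E).
  move=> mh; apply: measurable_sqE; apply: (measurableT_comp mh); exact: pair1_measurable.
have m1 j : measurable_fun setT (fun u => (cut 0 T (fun u w => y u w 0 j) (w, u) ^+ 2)%:E) by exact: msec.
have m2 j l : measurable_fun setT (fun u => (cut 0 T (fun u w => z u w j l) (w, u) ^+ 2)%:E).
  by apply: msec; case: (sz j l).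
have sqe (x : R) : (0 <= (x ^+ 2)%:E)%E by rewrite lee_fin sqr_ge0.
rewrite (_ : (fun u => _) = (fun u => \sum_j (cut 0 T (fun u w => y u w 0 j) (w, u) ^+ 2)%:E +
    \sum_j \sum_l (cut 0 T (fun u w => z u w j l) (w, u) ^+ 2)%:E)%E); last first.
  apply/funext => u; rewrite sumEFin (eq_bigr (fun j => (\sum_l cut 0 T (fun u w => z u w j l) (w, u) ^+ 2)%:E)); last by move=> j _; rewrite sumEFin.
  rewrite sumEFin -EFinD !enorm_sqr big_ord1; congr _%:E; rewrite mulrDl; congr (_ + _).
    by rewrite mulr_suml; apply: eq_bigr => j _; rewrite /cut/= sqr_window mulrC.
  rewrite mulr_suml; apply: eq_bigr => j _; rewrite mulr_suml; apply: eq_bigr => l _.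
  by rewrite /cut/= sqr_window mulrC.
have M1 : measurable_fun setT (fun u => \sum_j (cut 0 T (fun u w => y u w 0 j) (w, u) ^+ 2)%:E)%E by exact: emeasurable_sum.
have M3 j : measurable_fun setT (fun u => \sum_l (cut 0 T (fun u w => z u w j l) (w, u) ^+ 2)%:E)%E by exact: emeasurable_sum.
have M2 : measurable_fun setT (fun u => \sum_j \sum_l (cut 0 T (fun u w => z u w j l) (w, u) ^+ 2)%:E)%E by exact: emeasurable_sum.
rewrite ge0_integralD//; last 2 first.
- by move=> u _; exact: sume_ge0.
- by move=> u _; apply: sume_ge0 => j _; exact: sume_ge0.
rewrite lte_add_pinfty//.
  rewrite ge0_integral_sum//; apply/lte_sum_pinfty => j _; exact: k1.
rewrite ge0_integral_sum//; last by move=> j u _; exact: sume_ge0.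
apply/lte_sum_pinfty => j _; rewrite ge0_integral_sum//; last by move=> l; exact: m2.
apply/lte_sum_pinfty => l _; exact: (k2' (j, l)).
Qed.

Lemma weighted_sum (th : Omega -> R) (y : Omega -> V) : measurable_fun setT th ->
  (forall j, measurable_fun setT (fun w => y w 0 j)) ->
  (\sum_j \int[P]_w ((th w * y w 0 j) ^+ 2)%:E = \int[P]_w (th w ^+ 2 * enorm (y w) ^+ 2)%:E)%E.
Proof.
move=> mth my; rewrite -ge0_integral_sum//.
- apply: eq_integral => w _; rewrite sumEFin enorm_row mulr_sumr; congr _%:E.
  by apply: eq_bigr => j _; rewrite exprMn.
- by move=> j; apply: measurable_sqE; apply: measurable_funM.
- by move=> j w _; rewrite lee_fin sqr_ge0.
Qed.

(** The stability estimate is applied to the difference of [Y] and the zero process, started at the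
    time t in question, with a weight that is a power of the truncated |Y_t|^2. The weight is known
    at t, so it can be carried along the whole interval [t, T]. The outcome is the hypothesis of
    [moment_absorb] for U = |Y_t|^2 and e = k/2. *)
Lemma sup_moment_finite : (sup_moment P T Y k < +oo)%E.
Proof.
have [y [N [[cy yE ay jy hy] hN _ eqN]]] := solution_data hmu cP lawW indW T0 (leqnn 1) solY.
pose c := 4 * LF ^+ 2; pose S := flow_bound.
have c0 : 0 <= c by rewrite mulr_ge0 ?sqr_ge0.
have S0 : 0 <= S by exact: flow_bound_ge0.
pose X j t w := y t w 0 j.
pose H j (kl : 'I_1 * 'I_d) u w := \sum_(i < 1) (kl.1 == widen_ord (leqnn 1) i)%:R * Z u w j kl.2.
have HZ u w : \sum_j \sum_kl H j kl u w ^+ 2 = enorm (Z u w) ^+ 2.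
  rewrite enorm_sqr; apply: eq_bigr => j _.
  rewrite -(pair_big xpredT xpredT (fun a l => H j (a, l) u w ^+ 2))/= big_ord1; apply: eq_bigr => l _.
  by rewrite /H big_ord1/= mul1r.
(* Source from the growth bound of the driver: 1 plus a bound on the second moment of the law. *)
pose r (z : Omega * R) := (0 < z.2 <= T)%R%:R * (1 + S).
have mT : 0 <= T <= T by rewrite lexx ltW.
have ymeas t j : 0 <= t <= T -> measurable_fun setT (fun w => y t w 0 j).
  by move=> tT; apply: (noise_measurable_fun cP _ (ay j t tT)); case/andP: tT.
have [_ /(_ ord0) pZ _ /(_ ord0) fZ _] := solY.
have [_ sZ secZ] := progressive_data cP T0 (leqnn 1) pZ fZ.
have finw : {ae P, forall w, (\int[leb]_u ((enorm (y u w) ^+ 2 + enorm (Z u w) ^+ 2) * (0 < u <= T)%R%:R)%:E < +oo)%E}.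
  apply: ae_section_finite => //; exists S => t tT; by rewrite -flow_boundE; exact: hy.
have mr : measurable_fun setT r.
  by apply: measurable_funM; [exact: measurable_window|exact: measurable_cst].
have r0 z : 0 <= r z by rewrite mulr_ge0// addr_ge0.
have window_int : (\int[leb]_u ((0 < u <= T)%R%:R)%:E = T%:E)%E.
  by have := @ind_int R 0 T; rewrite subr0 max_r ?ltW.
have rint (th : Omega -> R) s : 0 <= s -> measurable_fun setT th ->
    (\int[PL]_z (th z.1 ^+ 2 * ((s < z.2 <= T)%R%:R * r z))%:E <= \int[P]_w (th w ^+ 2 * ((1 + S) * T))%:E)%E.
  move=> s0 mth; rewrite fubini_tonelli1; last 2 first.
  - apply/measurable_EFinP; apply: measurable_funM.
      by apply: measurable_funX; apply: (measurableT_comp mth); exact: measurable_fst.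
    by apply: measurable_funM; [exact: measurable_window|exact: mr].
  - by move=> z; rewrite lee_fin mulr_ge0 ?sqr_ge0// mulr_ge0.
  apply: le_integral_nonmeas => w; first by apply: integral_ge0 => u _; rewrite lee_fin mulr_ge0 ?sqr_ge0// mulr_ge0.
  rewrite /fubini_F/=; apply: (@le_trans _ _ (\int[leb]_u ((th w ^+ 2 * (1 + S))%:E * ((0 < u <= T)%R%:R)%:E))%E).
    apply: le_integral_nonmeas => u; first by rewrite lee_fin mulr_ge0 ?sqr_ge0// mulr_ge0.
    rewrite -EFinM lee_fin -[leRHS]mulrA ler_wpM2l ?sqr_ge0// /r/= [leRHS]mulrC.
    by case: (s < u <= T); rewrite ?mul1r// mul0r mulr_ge0// addr_ge0.
  rewrite ge0_integralZl//.
  - by rewrite window_int -EFinM mulrA.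
  - by apply/measurable_EFinP; exact: measurable_ind.
  - by rewrite lee_fin mulr_ge0 ?sqr_ge0 ?addr_ge0.
have fr : (\int[PL]_z (r z)%:E < +oo)%E.
  have := rint (fun=> 1) 0 (lexx 0) (measurable_cst _); rewrite [X in (_ <= X -> _)%E]integral_cst//= probability_setT mule1.
  move=> h; apply: le_lt_trans (ltry (1 ^+ 2 * ((1 + S) * T))); apply: le_trans h.
  apply: le_integral_nonmeas => z; rewrite lee_fin// expr1n mul1r /r mulrA.
  by case: (0 < z.2 <= T); rewrite ?mulr1 ?mul0r ?mulr0.
have bX : exists M : R, forall t, 0 <= t <= T -> (\sum_j \int[P]_w (X j t w ^+ 2)%:E <= M%:E)%E.
  exists S => t tT; have := weighted_sum (th := fun=> 1) (measurable_cst _) (fun j => ymeas t j tT).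
  under eq_bigr do under eq_integral do rewrite mul1r.
  move=> ->; under eq_integral do rewrite expr1n mul1r.
  by rewrite -flow_boundE; exact: hy.
have drift s t : 0 <= s -> s <= t -> t <= T -> {ae P, forall w,
  ((\sum_j (X j s w + (N j t w - N j s w) - X j t w) ^+ 2)%:E <=
   (t - s)%:E * \int[leb]_u (c * (\sum_j cut s t (X j) (w, u) ^+ 2 +
     \sum_j \sum_kl cut s t (H j kl) (w, u) ^+ 2 + (s < u <= t)%R%:R * r (w, u)))%:E)%E}.
  move=> s0 st tT; apply: filterS3 yE eqN finw => w yw ew fw.
  under [X in (_ <= _ * X)%E]eq_integral do rewrite gam_window.
  have yE' : (fun u => (Y u w : V)) = (fun u => y u w) by apply/funext => u; rewrite yw.
  have fE : (fun u => F u (W 0%N w) (Y u w) (Z u w) (distribution P (Y u))) =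
      (fun u => F u (W 0%N w) (y u w) (Z u w) (distribution P (Y u))) by apply/funext => u; rewrite yw.
  have fi j : leb.-integrable `[0%R, T] (EFin \o (fun u => F u (W 0%N w) (Y u w) (Z u w) (distribution P (Y u)) 0 j)).
    rewrite (_ : (fun u => _) = (fun u => F u (W 0%N w) (y u w) (Z u w) (distribution P (Y u)) 0 j)); last first.
      by apply/funext => u; rewrite yw.
    by apply: flow_driver_integrable; [exact: measurable_path|exact: secZ|exact: fw].
  have i0 (a : R) : \int[leb]_(_ in `[a, T]) (0 : R) = 0 by rewrite Rintegral_cst ?mul0r//; exact: measurable_itv.
  have z0 j : leb.-integrable `[0%R, T] (EFin \o ((fun _ _ => 0) : 'I_m -> R -> R) j) by exact: integrable0.
  (* The second equation is the zero one: terminal value, driver and noise all vanish. *)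
  have := @pathwise_drift R T s t 'I_m (fun j => G (W 0%N w) 0 j) (fun=> 0) (fun j u => X j u w) (fun _ _ => 0)
    (fun j u => N j u w) (fun _ _ => 0) (fun j u => F u (W 0%N w) (Y u w) (Z u w) (distribution P (Y u)) 0 j) (fun _ _ => 0)
    (fun u => c * (\sum_j X j u w ^+ 2 + \sum_j \sum_kl H j kl u w ^+ 2 + r (w, u))) s0 st tT fi z0.
  move=> h; apply: le_trans (h _ _ _).
  - by rewrite lee_fin; apply: ler_sum => j _; rewrite !subr0.
  - move=> u; rewrite !inE => hu j; apply: ew; case/predU1P: hu => [->|/eqP ->]; first by rewrite s0 (le_trans st).
    by rewrite tT (le_trans s0).
  - by move=> u _ j; rewrite i0 !subr0 addr0.
  - move=> u /andP[su ut]; have u0 : 0 < u by exact: le_lt_trans su.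
    have uT : u <= T by exact: le_trans tT.
    have uT' : 0 <= u <= T by rewrite uT ltW.
    have [D0 hD] := flow_moment uT'.
    have EX : \sum_j X j u w ^+ 2 = enorm (Y u w) ^+ 2 by rewrite enorm_row; apply: eq_bigr => j _; rewrite /X yw.
    have := driver_growth p12 LF0 lipF (W 0%N w) (y u w) (Z u w) uT' D0 hD.
    rewrite enorm_row yw; under eq_bigr do rewrite -[X in X ^+ 2]subr0.
    move/le_trans; apply; rewrite HZ EX /r/= u0 uT mul1r -/S -/c; apply: ler_wpM2l => //.
    exact: drift_rearrange.
have cc : 0 <= 2 * c * (1 + T) by rewrite !mulr_ge0// addr_ge0// ltW.
have [K hK] := backward_iteration (ltW T0) cc; have [K0 _] := hK.
pose e := k / 2; have e1 : 1 < e := half_gt1 k2.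
pose z w := enorm (y T w) ^+ 2 + (1 + S) * T.
have mU t : 0 <= t <= T -> measurable_fun setT (fun w => enorm (y t w) ^+ 2).
  move=> tT; under eq_fun do rewrite enorm_row.
  by apply: measurable_sum => j; apply: measurable_funX; exact: ymeas.
have bound t : 0 <= t <= T ->
    (\int[P]_w ((enorm (y t w) ^+ 2) `^ e)%:E <= (2 * (K * (2 * K) `^ (e - 1)))%:E * \int[P]_w (z w `^ e)%:E)%E.
  move=> tT; have /andP[t0 tT'] := tT.
  apply: moment_absorb => //.
  - exact: mU.
  - by apply: measurable_funD; [exact: mU|exact: measurable_cst].
  - by move=> w; exact: sqr_ge0.
  - by move=> w; rewrite addr_ge0 ?sqr_ge0// mulr_ge0 ?addr_ge0// ltW.
  (* The exponent is halved because the estimate squares the weight. *)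
  move=> M M0; pose th w := Num.min (enorm (y t w) ^+ 2) M `^ ((e - 1) / 2).
  have thE w : th w ^+ 2 = Num.min (enorm (y t w) ^+ 2) M `^ (e - 1).
    by rewrite -powR_mulrn ?powR_ge0// /th -powRrM; congr (_ `^ _); field.
  have mth0 : smeas (noise_filtration W 1 t) th.
    apply: (measurableT_comp (measurable_powR ((e - 1) / 2))); apply: measurable_minr; last exact: measurable_cst.
    under eq_fun do rewrite enorm_row.
    by apply: measurable_sum => j; apply: measurable_funX; exact: ay.
  have hth : bounded_coef W 0 t th.
    split => //; exists (M `^ ((e - 1) / 2)) => w; rewrite ger0_norm ?powR_ge0//.
    apply: ge0_ler_powR; rewrite ?nnegrE ?le_min ?sqr_ge0//; [exact: half_pred_ge0|by rewrite ge_min lexx orbT].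
  have mth : measurable_fun setT th := noise_measurable_fun cP tT' mth0.
  have := stability_iterate hmu cP lawW indW c0 hN (fun j t tT => ay j t tT) bX jy mr r0 fr drift t0 tT' hth hK
    (introT andP (conj (lexx t) tT')).
  rewrite weighted_sum//; last by move=> j; exact: ymeas.
  rewrite weighted_sum//; last by move=> j; exact: ymeas.
  under eq_integral do rewrite thE; move=> h.
  apply: le_trans (le_trans h _); first by rewrite leeDl// sume_ge0// => j _; apply: sume_ge0 => kl _; apply: integral_ge0 => x _; rewrite lee_fin sqr_ge0.
  apply: lee_wpmul2l => //.
  apply: (@le_trans _ _ (\int[P]_w (th w ^+ 2 * enorm (y T w) ^+ 2)%:E + \int[P]_w (th w ^+ 2 * ((1 + S) * T))%:E)%E).
    by apply: leeD => //; exact: rint.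
  rewrite -ge0_integralD//.
  - apply: le_integral_nonmeas => w; rewrite -EFinD lee_fin -mulrDr thE// mulr_ge0 ?powR_ge0//.
    by rewrite addr_ge0 ?sqr_ge0// mulr_ge0 ?addr_ge0// ltW.
  - by move=> w _; rewrite lee_fin mulr_ge0 ?sqr_ge0.
  - by apply/measurable_EFinP; apply: measurable_funM; [exact: measurable_funX|exact: mU].
  - by move=> w _; rewrite lee_fin mulr_ge0 ?sqr_ge0// mulr_ge0 ?addr_ge0// ltW.
  - by apply/measurable_EFinP; apply: measurable_funM; [exact: measurable_funX|exact: measurable_cst].
have sqp (x : V) : (enorm x ^+ 2) `^ e = enorm x `^ k.
  by rewrite -powR_mulrn ?enorm_ge0// -powRrM; congr (_ `^ _); rewrite /e; field.
have Sq0 : 0 <= (1 + S) * T by rewrite mulr_ge0 ?addr_ge0// ltW.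
have zfin : (\int[P]_w (z w `^ e)%:E < +oo)%E.
  have mG : measurable_fun setT (fun w => (enorm (y T w) `^ k)%:E).
    by under eq_fun do rewrite -sqp; apply/measurable_EFinP; apply: (measurableT_comp (measurable_powR e)); exact: mU.
  apply: (@le_lt_trans _ _ (\int[P]_w ((2 `^ e)%:E * ((enorm (y T w) `^ k)%:E + (((1 + S) * T) `^ e)%:E)))%E).
    apply: le_integral_nonmeas => w; first by rewrite lee_fin powR_ge0.
    rewrite -EFinD -EFinM lee_fin -sqp /z.
    have x0 : 0 <= enorm (y T w) ^+ 2 := sqr_ge0 _.
    move: Sq0 x0; set a := enorm _ ^+ 2; set b := _ * T => b0 a0.
    apply: (@le_trans _ _ ((2 * Num.max a b) `^ e)).
      apply: ge0_ler_powR; rewrite ?nnegrE; [exact: half_ge0|exact: addr_ge0|by rewrite mulr_ge0// le_max a0|exact: add_le_max].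
    rewrite powRM ?le_max ?a0// ler_wpM2l ?powR_ge0//.
    have [ab|ab] := leP a b; rewrite ?lerDl ?lerDr ?powR_ge0//.
  rewrite ge0_integralZl//; last 2 first.
  - by apply: emeasurable_funD => //; exact: measurable_cst.
  - by move=> w _; rewrite -EFinD lee_fin addr_ge0 ?powR_ge0.
  apply: lte_mul_pinfty; rewrite ?lee_fin ?powR_ge0//.
  rewrite ge0_integralD//; last 2 first.
  - by move=> w _; rewrite lee_fin powR_ge0.
  - by move=> w _; rewrite lee_fin powR_ge0.
  apply: lte_add_pinfty; last by rewrite integral_cst//= probability_setT mule1 ltry.
  apply: le_lt_trans fG.
  have yG : {ae P, forall w, y T w = G (W 0%N w)}.
    apply: filterS eqN => w /(_ T mT) h; apply/matrixP => a j; rewrite ord1 h subrr subr0.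
    by rewrite set_itv1 Rintegral_set1 addr0.
  have h1 : (\int[P]_w (enorm (y T w) `^ k)%:E = \int[P]_w (enorm (G (W 0%N w)) `^ k)%:E)%E.
    apply: ae_eq_integral => //; last by apply: filterS yG => w -> _.
    move=> _ B mB; rewrite setTI.
    have mGB : measurable ((fun w => (enorm (y T w) `^ k)%:E) @^-1` B) by rewrite -[X in measurable X]setTI; exact: mG.
    apply: (measurable_ae_eq cP mGB); apply: filterS yG => w /= ->; by split.
  by rewrite h1.
apply: (@le_lt_trans _ _ ((2 * (K * (2 * K) `^ (e - 1)))%:E * \int[P]_w (z w `^ e)%:E)%E); last first.
  by apply: lte_mul_pinfty; rewrite ?lee_fin ?mulr_ge0 ?powR_ge0.
apply: ge_ereal_sup => _ [t tT <-]; have tT' : 0 <= t <= T by move: tT; rewrite /= in_itv.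
apply: le_trans (bound t tT'); apply: ae_le_integral_nonmeas.
- by move=> w; rewrite lee_fin powR_ge0.
- by move=> w; rewrite lee_fin powR_ge0.
- by apply/measurable_EFinP; apply: (measurableT_comp (measurable_powR e)); exact: mU.
by apply: filterS yE => w yw; rewrite -yw sqp.
Qed.

End SupMoment.

Lemma measurable_integral_param {R : realType} {dS} {S : measurableType dS} (g : S * R -> \bar R) :
  measurable_fun setT g -> (forall z, (0 <= g z)%E) ->
  measurable_fun setT (fun x => \int[@lebesgue_measure R]_u g (x, u))%E.
Proof.
move=> mg g0.
exact: (@measurable_fun_fubini_tonelli_F _ _ _ _ _ (@lebesgue_measure R) g mg g0).
Qed.

Lemma measurable_Rintegral_param {R : realType} {dS} {S : measurableType dS} (f : S * R -> R) :
  measurable_fun setT f -> measurable_fun setT (fun x => \int[@lebesgue_measure R]_u f (x, u)).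
Proof.
move=> mf; apply: (measurableT_comp (@fine_measurable R setT measurableT)).
have mE : measurable_fun setT (fun z => (f z)%:E) by exact/measurable_EFinP.
have h : measurable_fun setT (fun x => \int[@lebesgue_measure R]_u (fun z => (f z)%:E)^\+ (x, u) -
    \int[@lebesgue_measure R]_u (fun z => (f z)%:E)^\- (x, u))%E.
  apply: emeasurable_funB; apply: measurable_integral_param.
  - exact: measurable_funepos.
  - by move=> z; exact: funepos_ge0.
  - exact: measurable_funeneg.
  - by move=> z; exact: funeneg_ge0.
move: h; congr measurable_fun; apply/funext => x; rewrite [RHS]integralE; congr (_ - _)%E.
  by apply: eq_integral => u _; rewrite !funeposE.
by apply: eq_integral => u _; rewrite !funenegE.
Qed.

(** Counterpart of [ae_le_integral_nonmeas] with only the smaller function measurable: that function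
    is set to 0 on the null set, after which the comparison holds everywhere. It applies to the
    iterated integrals in the definition of the stochastic integral. *)
Lemma ae_le_integral_left {R : realType} {d0} {X : measurableType d0} (P : probability X R) (f g : X -> \bar R) :
  (forall x, (0 <= f x)%E) -> (forall x, (0 <= g x)%E) -> measurable_fun setT f ->
  {ae P, forall x, (f x <= g x)%E} -> (\int[P]_x f x <= \int[P]_x g x)%E.
Proof.
move=> f0 g0 mf [N [mN N0 hN]].
apply: (@le_trans _ _ (\int[P]_x (f x * (\1_(~` N) x)%:E))%E).
  apply: ae_le_integral_nonmeas => //.
  - by move=> x; rewrite mule_ge0// lee_fin.
  - apply: emeasurable_funM => //; apply/measurable_EFinP; apply: measurable_indic; exact: measurableC.
  exists N; split => // x /= h; apply: contrapT => nN; apply: h.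
  by rewrite indicE mem_set ?mule1.
apply: le_integral_nonmeas => x; first by rewrite mule_ge0// lee_fin.
rewrite indicE; case: (boolP (x \in ~` N)) => [/set_mem xN|_]; last by rewrite mule0.
by rewrite mule1; apply: contrapT => h; apply: xN; exact: hN.
Qed.

(** * Independent copies of the McKean-Vlasov solution *)

Section PathTransfer.
Context {R : realType} {T : R} {d : nat} {mu : probability (cpath T d) R}.
Hypothesis hmu : is_wiener mu.
Context {d0 : measure_display} {Omega : measurableType d0} {P : probability Omega R}.
Hypothesis cP : measure_is_complete P.
Variable W : nat -> {RV P >-> cpath T d}.
Hypothesis lawW : forall i A, measurable A -> distribution P (W i) A = mu A.
Hypothesis indW : mutually_independent W.
Hypothesis T0 : 0 < T.
Local Notation leb := (@lebesgue_measure R).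
Local Notation PL := (P \x leb)%E.
Local Notation cyl := (@cylinders R T d).

Lemma path_set_completed (A : set (cpath T d)) : measurable A -> <<s path_filtration mu T >> A.
Proof. by move=> mA; have := path_measurable (mu := mu) measurableT mA; rewrite setTI. Qed.

Lemma ae_copy i (A : set (cpath T d)) : <<s path_filtration mu T >> A ->
  {ae P, forall w, A (W 0%N w)} -> {ae P, forall w, A (W i w)}.
Proof. by move=> mA h; apply: (ae_path lawW); exact: (ae_path_law lawW mA h). Qed.

Lemma measurable_eq_set {dS} {S : measurableType dS} (f g : S -> R) :
  measurable_fun setT f -> measurable_fun setT g -> measurable [set x | f x = g x].
Proof.
move=> mf mg; have : measurable_fun setT (fun x => f x - g x) by exact: measurable_funB.
move=> /(_ measurableT [set 0] (measurable_set1 _)); rewrite setTI; congr measurable.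
by apply/seteqP; split => x /= h; apply/eqP; [rewrite -subr_eq0 h|rewrite subr_eq0 h].
Qed.

Lemma smeas_cyl_measurable t (f : cpath T d -> R) : t <= T -> smeas (cyl t) f -> measurable_fun setT f.
Proof.
move=> tT; apply: smeas_measurable => A hA; apply: (cyl_measurable tT); exact: sub_sigma_algebra.
Qed.

(** Here [g] is only known to represent [f] almost surely. A version measurable for the paths up to
    t agrees with [g] almost surely along [W 0], hence along [W i], and the completed filtration
    absorbs the difference. *)
Lemma copy_smeas n (i : 'I_n.+1) t (f : Omega -> R) (g : cpath T d -> R) : 0 <= t <= T ->
  smeas (noise_filtration W 1 t) f -> measurable_fun setT g -> {ae P, forall w, f w = g (W 0%N w)} ->
  smeas (noise_filtration W n.+1 t) (fun w => g (W i w)).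
Proof.
move=> tT mf mg fg; have /andP[_ tT'] := tT.
have [h mh fh] := transfer mf.
have mh' := smeas_cyl_measurable tT' mh.
have hs : smeas (noise_filtration W n.+1 t) (fun w => h (W i w)) := smeas_path (ltn_ord i) mh.
apply: (smeas_ae tT' hs).
apply: (ae_copy i (A := [set x | h x = g x])).
  by apply: path_set_completed; exact: measurable_eq_set.
by apply: filterS2 fg fh => w /= -> ->.
Qed.

Lemma simple_transfer (S : simple_process T (noise_filtration W 1)) :
  exists g : nat -> cpath T d -> R, forall a, [/\ smeas (cyl (sp_time S a)) (g a),
    exists b : R, forall x, `|g a x| <= b & {ae P, forall w, sp_coef S a w = g a (W 0%N w)}].
Proof.
suff : forall a, exists g : cpath T d -> R, [/\ smeas (cyl (sp_time S a)) g,
    exists b : R, forall x, `|g x| <= b & {ae P, forall w, sp_coef S a w = g (W 0%N w)}].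
  by move=> /choice[g hg]; exists g.
move=> a; have h : smeas (noise_filtration W 1 (sp_time S a)) (sp_coef S a) by exact: sp_coef_meas.
have [b hb] := sp_coef_bounded S a.
have [g mg hg] := transfer h.
have b0 : 0 <= b by apply: le_trans (hb point).
(* The transferred functional is known to be bounded only along almost every path of [W 0]; clamping
   restores the bound everywhere. *)
exists (fun x => Num.max (- b) (Num.min b (g x))); split.
- apply: measurable_maxr; first exact: measurable_cst.
  by apply: measurable_minr => //; exact: measurable_cst.
- exists b => x; rewrite ler_norml le_max lexx/= ge_max ge_min lexx andbT.
  by rewrite -subr_ge0 opprK addr_ge0.
- apply: filterS hg => w hw; rewrite -hw; have := hb w; rewrite ler_norml => /andP[h1 h2].
  by rewrite min_r// max_r.
Qed.

Section OneIntegral.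
Variables (l : 'I_d) (h M : R -> Omega -> R) (z : R * cpath T d -> R).
Hypothesis hM : is_ito_integral P T (noise_filtration W 1) (fun t w => W 0%N w t 0 l) h M.
Hypotheses (mh : measurable_fun setT (cut 0 T h)) (sh : sqint PL (cut 0 T h)).
Hypotheses (mz : measurable_fun setT z) (hz : {ae P, forall w, forall u, 0 <= u <= T -> h u w = z (u, W 0%N w)}).

Let wz (x : cpath T d) (u : R) : R := z (u, x) * (0 < u <= T)%R%:R.

Let mwz : measurable_fun setT (fun p : cpath T d * R => wz p.1 p.2).
Proof.
apply: measurable_funM.
  apply: (measurableT_comp mz); apply: measurable_fun_pair; [exact: measurable_snd|exact: measurable_fst].
exact: (measurableT_comp (@measurable_ind R 0 T) (@measurable_snd _ _ (cpath T d) R)).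
Qed.

Let m_copy i (f : cpath T d * R -> R) : measurable_fun setT f ->
  measurable_fun setT (fun p : Omega * R => f (W i p.1, p.2)).
Proof.
move=> mf; apply: (measurableT_comp mf); apply: measurable_fun_pair; last exact: measurable_snd.
by apply: (measurableT_comp (measurable_noise W i)); exact: measurable_fst.
Qed.

Let int_copy i (f : cpath T d * R -> R) : measurable_fun setT f -> 
  (\int[PL]_p ((f (W i p.1, p.2)) ^+ 2)%:E = \int[P]_w \int[leb]_u ((f (W 0%N w, u)) ^+ 2)%:E)%E.
Proof.
move=> mf; rewrite fubini_tonelli1; last 2 first.
- by apply: measurable_sqE; exact: m_copy.
- by move=> p; rewrite lee_fin sqr_ge0.
have mg : measurable_fun setT (fun x => \int[leb]_u ((f (x, u)) ^+ 2)%:E)%E.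
  apply: (@measurable_fun_fubini_tonelli_F _ _ _ _ _ leb (fun p : cpath T d * R => (f p ^+ 2)%:E)).
    exact: measurable_sqE.
  by move=> p; rewrite lee_fin sqr_ge0.
have g0 x : (0 <= \int[leb]_u ((f (x, u)) ^+ 2)%:E)%E by apply: integral_ge0 => u _; rewrite lee_fin sqr_ge0.
by have := integral_path lawW i mg g0; rewrite -(integral_path lawW 0%N mg g0).
Qed.

(** The coefficients of the approximating simple processes are functionals of the path as well.
    Evaluated along [W i] they form pieces of the larger filtration, and their L^2 errors are those
    along [W 0], because both paths have the same law. The functional [psi] is chosen at each time
    separately, so nothing is said about its continuity. *)
Lemma copy_integral : exists psi : R -> cpath T d -> R,
  [/\ forall t, 0 <= t <= T -> measurable_fun setT (psi t),
      forall t, 0 <= t <= T -> {ae P, forall w, M t w = psi t (W 0%N w)} &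
      forall n (i : 'I_n.+1), ito_sum W (fun (k : 'I_n.+1 * 'I_d) u w => (k == (i, l))%:R * z (u, W i w)) (fun t w => psi t (W i w))].
Proof.
have hI := ito_sum_of_integral hmu cP lawW indW (n := 0) (i := ord0) (l := l) (leqnn 1) T0 hM mh sh.
have aM t : 0 <= t <= T -> smeas (noise_filtration W 1 t) (M t) by move=> tT; exact: (ito_adapted hI tT).
have [psi hpsi] : exists psi : R -> cpath T d -> R, forall t, 0 <= t <= T ->
    smeas (cyl t) (psi t) /\ {ae P, forall w, M t w = psi t (W 0%N w)}.
  suff /choice[psi ?] : forall t, exists f : cpath T d -> R, 0 <= t <= T ->
      smeas (cyl t) f /\ {ae P, forall w, M t w = f (W 0%N w)} by exists psi.
  move=> t; have [tT|ntT] := boolP (0 <= t <= T); last by exists (fun=> 0).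
  by have [f mf hf] := transfer (aM t tT); exists f.
have mpsi t : 0 <= t <= T -> measurable_fun setT (psi t).
  by move=> tT; have /andP[_ tT'] := tT; exact: smeas_cyl_measurable tT' (hpsi t tT).1.
exists psi; split => //; first by move=> t tT; case: (hpsi t tT).
move=> n i.
have [_ _ [S [Sh SM]]] := hM.
have [g hg] := choice (fun N => simple_transfer (S N)).
have tau_T N a : sp_time (S N) a <= T by have /andP[] := sp_time_range (S N) a.
have mg N a : measurable_fun setT (g N a) by case: (hg N a) => h1 _ _; exact: smeas_cyl_measurable (tau_T N a) h1.
pose val N (p : cpath T d * R) := \sum_(a < sp_size (S N)) g N a p.1 * (sp_time (S N) a < p.2 <= sp_time (S N) a.+1)%R%:R.
pose int N t (x : cpath T d) := \sum_(a < sp_size (S N)) g N a x *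
  (x (Num.min t (sp_time (S N) a.+1)) 0 l - x (Num.min t (sp_time (S N) a)) 0 l).
have hS N : exists es : seq (piece W n),
    (forall k u w, eval es k u w = (k == (i, l))%:R * val N (W i w, u)) /\
    (forall t w, epart es t w = int N t (W i w)).
  have piece_a a : exists e : piece W n, [/\ pk e = (i, l), pa e = sp_time (S N) a, pb e = sp_time (S N) a.+1 &
      pc e = (fun w => g N a (W i w))].
    have [h1 [b h2] _] := hg N a.
    have hab : 0 <= sp_time (S N) a <= sp_time (S N) a.+1.
      by have /andP[-> _] := sp_time_range (S N) a; rewrite (sp_time_mono (S N)).
    have hc : bounded_coef W n (sp_time (S N) a) (fun w => g N a (W i w)).
      by split; [exact: smeas_path (ltn_ord i) h1|exists b => w; exact: h2].
    by exists (Piece (i, l) hab (tau_T N a.+1) hc).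
  have [f hf] := choice piece_a.
  exists [seq f (nat_of_ord a) | a <- index_enum 'I_(sp_size (S N))]; split => [k u w|t w].
    rewrite /eval big_map /val mulr_sumr; apply: eq_bigr => a _.
    by rewrite /pval; have [-> -> -> ->] := hf a; rewrite mulrA eq_sym.
  rewrite /epart big_map /int; apply: eq_bigr => a _.
  by rewrite /ppart; have [-> -> -> ->] := hf a.
have [es hes] := choice hS.
have mval N : measurable_fun setT (val N).
  apply: measurable_sum => a; apply: measurable_funM.
    by apply: (measurableT_comp (mg N a)); exact: measurable_fst.
  exact: (measurableT_comp (@measurable_ind R _ _) (@measurable_snd _ _ (cpath T d) R)).
have min_T t s : 0 <= t <= T -> 0 <= s -> 0 <= Num.min t s <= T.
  by move=> /andP[t1 t2] s1; rewrite le_min t1 s1 ge_min t2.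
have mint N t : 0 <= t <= T -> measurable_fun setT (int N t).
  move=> tT; apply: measurable_sum => a; apply: measurable_funM => //.
  have tau0 b : 0 <= sp_time (S N) b by have /andP[] := sp_time_range (S N) b.
  by apply: measurable_funB; apply: measurable_eval; exact: min_T.
have aeN : {ae P, forall w, forall N a, sp_coef (S N) a w = g N a (W 0%N w)}.
  by apply: ae_foralln => N; apply: ae_foralln => a; case: (hg N a).
have cE k : cut 0 T (fun u w => (k == (i, l))%:R * z (u, W i w)) = (fun p => (k == (i, l))%:R * wz (W i p.1) p.2).
  by apply/funext => p; rewrite /cut/wz mulrA.
have mcopy : measurable_fun setT (fun p : Omega * R => wz (W i p.1) p.2) by exact: (m_copy i mwz).
have spsi t : 0 <= t <= T -> sqint P (fun w => psi t (W i w)).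
  move=> tT; split; first by apply: (measurableT_comp (mpsi t tT)); exact: measurable_noise.
  have m2 : measurable_fun setT (fun x => (psi t x ^+ 2)%:E) by exact: measurable_sqE (mpsi t tT).
  have p2 x : (0 <= (psi t x ^+ 2)%:E)%E by rewrite lee_fin sqr_ge0.
  rewrite (integral_path lawW i m2 p2) -(integral_path lawW 0%N m2 p2).
  have [_ h2] := ito_sqint hI tT; apply: le_lt_trans h2; apply: ae_le_integral_nonmeas => //.
  - by move=> w; rewrite lee_fin sqr_ge0.
  - by apply: measurable_sqE; case: (ito_sqint hI tT).
  by have [_ h3] := hpsi t tT; apply: filterS h3 => w ->.
split.
- by move=> k; rewrite cE; apply: measurable_funM => //; exact: measurable_cst.
- move=> k; rewrite cE; apply: sqintZ; split => //.
  rewrite (int_copy i mwz); have [_ h2] := sh; apply: le_lt_trans h2; rewrite int_cut//.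
  apply: ae_le_integral_nonmeas.
  + by move=> w; apply: integral_ge0 => u _; rewrite lee_fin sqr_ge0.
  + by move=> w; apply: integral_ge0 => u _; rewrite lee_fin sqr_ge0.
  + apply: (@measurable_fun_fubini_tonelli_F _ _ _ _ _ leb (fun p => (cut 0 T h p ^+ 2)%:E)); first exact: measurable_sqE.
    by move=> p; rewrite lee_fin sqr_ge0.
  apply: filterS hz => w hw; apply: le_integral_nonmeas => u; first by rewrite lee_fin sqr_ge0.
  rewrite lee_fin /wz /cut/=; case: (boolP (0 < u <= T)) => [/andP[u0 uT]|_]; last by rewrite !mulr0.
  by rewrite hw// uT ltW.
- by move=> t tT; apply: (smeas_path (ltn_ord i)); case: (hpsi t tT).
- exact: spsi.
- exists es; split=> [k|t tT]; last first.
    split.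
    + by move=> N; case: (epart_sqint hmu cP lawW indW (es N) tT).
    + by case: (spsi t tT).
    + rewrite (_ : (fun N => _) = (fun N => \int[P]_w ((sp_integral (S N) (fun t w => W 0%N w t 0 l) t w - M t w) ^+ 2)%:E)%E); first exact: SM.
      apply/funext => N.
      have mf : measurable_fun setT (fun x => ((int N t x - psi t x) ^+ 2)%:E).
        by apply: measurable_sqE; apply: measurable_funB; [exact: mint|exact: mpsi].
      have f0 x : (0 <= ((int N t x - psi t x) ^+ 2)%:E)%E by rewrite lee_fin sqr_ge0.
      transitivity (\int[P]_w ((int N t (W i w) - psi t (W i w)) ^+ 2)%:E)%E.
        by apply: eq_integral => w _; rewrite (hes N).2.
      rewrite (integral_path lawW i mf f0) -(integral_path lawW 0%N mf f0).
      have [_ h3] := hpsi t tT.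
      have E : {ae P, forall w, ((int N t (W 0%N w) - psi t (W 0%N w)) ^+ 2)%:E = ((sp_integral (S N) (fun t w => W 0%N w t 0 l) t w - M t w) ^+ 2)%:E}.
        apply: filterS2 aeN h3 => w k1 k2; congr ((_ - _) ^+ 2)%:E; last by rewrite k2.
        by apply: eq_bigr => a _; rewrite k1.
      have mw : measurable_fun setT (fun w => ((int N t (W 0%N w) - psi t (W 0%N w)) ^+ 2)%:E).
        by apply: (measurableT_comp mf); exact: measurable_noise.
      apply/eqP; rewrite eq_le; apply/andP; split; last first.
        apply: ae_le_integral_nonmeas => //.
        - by move=> w; rewrite lee_fin sqr_ge0.
        by apply: filterS E => w ->.
      have [e0 [_ hsp]] : exists e0 : seq (piece W 0), (forall k u w, eval e0 k u w = (k == (ord0, l))%:R * sp_value (S N) u w) /\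
          (forall t w, epart e0 t w = sp_integral (S N) (fun t w => W (@ord0 0) w t 0 l) t w).
        exact: simple_pieces.
      have mM : measurable_fun setT (M t) by case: (ito_sqint hI tT).
      apply: ae_le_integral_nonmeas => //.
      - by move=> w; rewrite lee_fin sqr_ge0.
      - apply: measurable_sqE; apply: measurable_funB => //.
        have [h4 _] := epart_sqint hmu cP lawW indW e0 tT; move: h4; congr measurable_fun.
        by apply/funext => w; rewrite hsp.
      by apply: filterS E => w ->.
  have mev N : measurable_fun setT (fun p : Omega * R => eval (es N) k p.2 p.1) by exact: measurable_eval_process.
  split => //; first by rewrite cE; apply: measurable_funM => //; exact: measurable_cst.
  have val0 N u x : ~~ (0 < u <= T) -> val N (x, u) = 0.
    move=> hu; rewrite /val big1// => a _.
    case: (boolP (_ < _ <= _)) => [/andP[h1 h2]|_]; last by rewrite mulr0.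
    have /andP[h3 _] := sp_time_range (S N) a; have /andP[_ h4] := sp_time_range (S N) a.+1.
    by move: hu; rewrite (le_lt_trans h3 h1) (le_trans h2 h4).
  have le N : (0 <= \int[PL]_p ((eval (es N) k p.2 p.1 - cut 0 T (fun u w => (k == (i, l))%:R * z (u, W i w)) p) ^+ 2)%:E <=
     \int[P]_w \int[leb]_(t in `[0%R, T]) ((sp_value (S N) t w - h t w) ^+ 2)%:E)%E.
    apply/andP; split; first by apply: integral_ge0 => p _; rewrite lee_fin sqr_ge0.
    pose f (p : cpath T d * R) := (k == (i, l))%:R * (val N p - wz p.1 p.2).
    have mf : measurable_fun setT f.
      by apply: measurable_funM; [exact: measurable_cst|exact: measurable_funB].
    have -> : (\int[PL]_p ((eval (es N) k p.2 p.1 - cut 0 T (fun u w => (k == (i, l))%:R * z (u, W i w)) p) ^+ 2)%:E =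
        \int[PL]_p ((f (W i p.1, p.2)) ^+ 2)%:E)%E.
      by apply: eq_integral => p _; rewrite cE (hes N).1 /f/= mulrBr.
    rewrite (int_copy i mf).
    have mG : measurable_fun setT (fun w => \int[leb]_u ((f (W 0%N w, u)) ^+ 2)%:E)%E.
      apply: (@measurable_fun_fubini_tonelli_F _ _ _ _ _ leb (fun p : Omega * R => ((f (W 0%N p.1, p.2)) ^+ 2)%:E)).
        by apply: measurable_sqE; exact: (m_copy 0%N mf).
      by move=> p; rewrite lee_fin sqr_ge0.
    apply: ae_le_integral_left => //.
    + by move=> w; apply: integral_ge0 => u _; rewrite lee_fin sqr_ge0.
    + by move=> w; apply: integral_ge0 => u _; rewrite lee_fin sqr_ge0.
    apply: filterS2 aeN hz => w k1 k2.
    rewrite [leRHS]integral_mkcond; apply: le_integral_nonmeas => u; first by rewrite lee_fin sqr_ge0.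
    rewrite patchE mem_setE in_itv/= /f /wz/=.
    have [h1|h1] := boolP (0 < u <= T); last first.
      rewrite val0// mulr0 subrr mulr0 expr0n; case: ifP => // _; by rewrite lee_fin sqr_ge0.
    have /andP[u0 uT] := h1.
    rewrite (ltW u0) uT/= mulr1 -k2 ?uT ?(ltW u0)// lee_fin exprMn.
    rewrite (_ : val N (W 0%N w, u) = sp_value (S N) u w); last by apply: eq_bigr => a _; rewrite k1.
    by case: (_ == _); rewrite ?expr1n ?mul1r// expr0n mul0r sqr_ge0.
  by apply: (squeeze_cvge _ (cvg_cst 0%E) Sh); near=> N; exact: le.
Unshelve. all: by end_near. Qed.

End OneIntegral.
End PathTransfer.

Section Copies.
Context {R : realType} {T : R} {d m : nat} {mu : probability (cpath T d) R}.
Hypothesis hmu : is_wiener mu.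
Context {d0 : measure_display} {Omega : measurableType d0} {P : probability Omega R}.
Hypothesis cP : measure_is_complete P.
Variable W : nat -> {RV P >-> cpath T d}.
Hypothesis lawW : forall i A, measurable A -> distribution P (W i) A = mu A.
Hypothesis indW : mutually_independent W.
Hypothesis T0 : 0 < T.
Variables p LF : R.
Hypotheses (p12 : 1 <= p <= 2) (LF0 : 0 <= LF).
Local Notation leb := (@lebesgue_measure R).
Local Notation PL := (P \x leb)%E.
Local Notation V := 'rV[R]_m.
Local Notation cyl := (@cylinders R T d).
Variables (F : R -> cpath T d -> V -> 'M[R]_(m, d) -> probability V R -> V) (G : cpath T d -> V).
Hypothesis lipF : driver_lipschitz p LF F.
Hypothesis mF : forall y z nu, finite_moment 2 nu -> progressive T (path_filtration mu) (fun t w => F t w y z nu).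
Hypothesis mG : measurable_fun setT (G : g_sigma_algebraType (path_filtration mu T) -> V).
Variables (Y : R -> {RV P >-> V}) (Z : R -> Omega -> 'M[R]_(m, d)).
Hypothesis solY : mckean_vlasov_solution W F G Y Z.

Let TT : 0 <= T <= T. Proof. by rewrite lexx ltW. Qed.

Lemma transfer_window (f : R -> Omega -> R) :
  measurable_fun setT (fun z : R * g_sigma_algebraType (noise_filtration W 1 T) => f z.1 z.2 * (0 <= z.1 <= T)%R%:R) ->
  exists2 phi : R * cpath T d -> R, measurable_fun setT phi &
    {ae P, forall w, forall u, 0 <= u <= T -> phi (u, W 0%N w) = f u w}.
Proof.
move=> mf; have [phi mphi hphi] := transfer_joint mf.
exists phi; first exact: mphi.
by apply: filterS hphi => w h u uT; rewrite -h/= uT mulr1.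
Qed.

Lemma transfer_continuous (y : R -> Omega -> V) j : (forall w, {within `[0, T], continuous (y ^~ w)}) ->
  (forall t, 0 <= t <= T -> smeas (noise_filtration W 1 t) (fun w => y t w 0 j)) ->
  exists2 phi : R * cpath T d -> R, measurable_fun setT phi &
    {ae P, forall w, forall u, 0 <= u <= T -> phi (u, W 0%N w) = y u w 0 j}.
Proof.
move=> cy ay; apply: transfer_window.
pose S := g_sigma_algebraType (noise_filtration W 1 T).
have ayT t : 0 <= t <= T -> measurable_fun setT ((fun w => y t w 0 j) : S -> R).
  by move=> tT; have /andP[_ tT'] := tT; exact: (smeas_noise_le tT' (ay t tT)).
have cyj w : {within `[0, T], continuous (fun u => y u w 0 j)}.
  by apply: (within_continuous_coord (f := y ^~ w)).
have h := @joint_measurable R T T0 _ S (fun u w => y u w 0 j) ayT cyj.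
(* Joint measurability is available on ]0, T] only; time 0 is added as a separate term. *)
have h0 : measurable_fun setT (fun z : R * S => y 0 z.2 0 j * \1_([set 0] : set R) z.1).
  apply: measurable_funM.
    by apply: (measurableT_comp (ayT 0 _)); [rewrite lexx ltW|exact: measurable_snd].
  by apply: (measurableT_comp (measurable_indic (measurable_set1 0))); exact: measurable_fst.
have := measurable_funD h h0; congr measurable_fun; apply/funext => z /=.
rewrite indicE; case: (eqVneq z.1 0) => [->|z0].
  by rewrite mem_set// ltxx lexx ltW//= mulr0 add0r.
rewrite memNset ?mulr0 ?addr0//; last by move=> /= h1; rewrite h1 eqxx in z0.
by rewrite lt_neqAle eq_sym z0.
Qed.

Lemma transfer_progressive j l : progressive T (noise_filtration W 1) Z ->
  exists2 phi : R * cpath T d -> R, measurable_fun setT phi &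
    {ae P, forall w, forall u, 0 <= u <= T -> phi (u, W 0%N w) = Z u w j l}.
Proof.
move=> pZ; apply: transfer_window.
pose S := g_sigma_algebraType (noise_filtration W 1 T).
have mD : measurable (`[0, T]%classic `*` setT : set (R * S)).
  by apply: measurableX => //; exact: measurable_itv.
have h : measurable_fun (`[0, T]%classic `*` setT) (fun z : R * S => Z z.1 z.2 j l).
  exact: (measurableT_comp (measurable_coord j l) (pZ T TT)).
have := (measurable_restrictT _ mD).1 h; congr measurable_fun; apply/funext => z /=.
rewrite patchE; case: ifPn => [/set_mem[/=]|].
  by rewrite in_itv/= => ->; rewrite mulr1.
rewrite notin_setE/= in_itv/= => hz; rewrite (_ : (0 <= z.1 <= T) = false) ?mulr0//.
by apply/negP => h1; apply: hz.
Qed.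

(* The McKean-Vlasov solution is written as a functional of the path of [W 0]; evaluating it at the path of
   [W i] gives the i.i.d. copies with which the particles are compared. *)
Lemma copy_data : exists (phi : R -> cpath T d -> V) (zeta : R -> cpath T d -> 'M[R]_(m, d)) (psi : 'I_m -> R -> cpath T d -> R),
  [/\ [/\ forall j, measurable_fun setT (fun z : R * cpath T d => phi z.1 z.2 0 j),
          forall j l, measurable_fun setT (fun z : R * cpath T d => zeta z.1 z.2 j l) &
          {ae P, forall w, forall u, 0 <= u <= T -> phi u (W 0%N w) = Y u w /\ zeta u (W 0%N w) = Z u w}],
      forall n (i : 'I_n.+1) j t, 0 <= t <= T -> smeas (noise_filtration W n.+1 t) (fun w => phi t (W i w) 0 j),
      forall n (i : 'I_n.+1) j, ito_sum W (fun (k : 'I_n.+1 * 'I_d) u w => (k.1 == i)%:R * zeta u (W i w) j k.2) (fun t w => psi j t (W i w)) &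
      forall i t, 0 <= t <= T -> {ae P, forall w, forall j, phi t (W i w) 0 j = G (W i w) 0 j +
        \int[leb]_(u in `[t, T]) F u (W i w) (phi u (W i w)) (zeta u (W i w)) (distribution P (Y u)) 0 j -
        (psi j T (W i w) - psi j t (W i w))}].
Proof.
have [[aY cY] /(_ ord0) pZ sY /(_ ord0) fZ [M [hM eqM]]] := solY.
have [y [cy yE ay jy hy]] := regularize cP T0 (leqnn 1) aY cY sY.
have [mZ sZ _] := progressive_data cP T0 (leqnn 1) pZ fZ.
have [f hf] : exists f : 'I_m -> R * cpath T d -> R, forall j, measurable_fun setT (f j) /\
    {ae P, forall w, forall u, 0 <= u <= T -> f j (u, W 0%N w) = y u w 0 j}.
  suff /choice[f ?] : forall j, exists f : R * cpath T d -> R, measurable_fun setT f /\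
    {ae P, forall w, forall u, 0 <= u <= T -> f (u, W 0%N w) = y u w 0 j} by exists f.
  by move=> j; have [f h1 h2] := transfer_continuous cy (ay j); exists f.
have [g hg] : exists g : 'I_m * 'I_d -> R * cpath T d -> R, forall jl, measurable_fun setT (g jl) /\
    {ae P, forall w, forall u, 0 <= u <= T -> g jl (u, W 0%N w) = Z u w jl.1 jl.2}.
  suff /choice[g ?] : forall jl : 'I_m * 'I_d, exists g : R * cpath T d -> R, measurable_fun setT g /\
    {ae P, forall w, forall u, 0 <= u <= T -> g (u, W 0%N w) = Z u w jl.1 jl.2} by exists g.
  by move=> jl; have [g h1 h2] := transfer_progressive jl.1 jl.2 pZ; exists g.
pose phi u x : V := \row_j f j (u, x).
pose zeta u x : 'M[R]_(m, d) := \matrix_(j, l) g (j, l) (u, x).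
have aephi : {ae P, forall w, forall u, 0 <= u <= T -> phi u (W 0%N w) = Y u w /\ zeta u (W 0%N w) = Z u w}.
  have h1 : {ae P, forall w, forall j, forall u, 0 <= u <= T -> f j (u, W 0%N w) = y u w 0 j}.
    by apply: filter_forall => j; exact: (hf j).2.
  have h2 : {ae P, forall w, forall jl, forall u, 0 <= u <= T -> g jl (u, W 0%N w) = Z u w jl.1 jl.2}.
    by apply: filter_forall => jl; exact: (hg jl).2.
  apply: filterS3 h1 h2 yE => w k1 k2 k3 u uT; split.
    by rewrite -k3; apply/rowP => j; rewrite mxE k1.
  by apply/matrixP => j l; rewrite mxE k2.
have mphi j : measurable_fun setT (fun z : R * cpath T d => phi z.1 z.2 0 j).
  have := (hf j).1; congr measurable_fun; apply/funext => z; by rewrite mxE -surjective_pairing.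
have mzeta j l : measurable_fun setT (fun z : R * cpath T d => zeta z.1 z.2 j l).
  have := (hg (j, l)).1; congr measurable_fun; apply/funext => z; by rewrite mxE -surjective_pairing.
have mphit t j : measurable_fun setT (fun x => phi t x 0 j).
  exact: (measurableT_comp (mphi j) (@pair1_measurable _ _ R (cpath T d) t)).
have hpsi (j : 'I_m) (l : 'I_d) : exists psi : R -> cpath T d -> R,
  [/\ forall t, 0 <= t <= T -> measurable_fun setT (psi t),
      forall t, 0 <= t <= T -> {ae P, forall w, M ord0 j l t w = psi t (W 0%N w)} &
      forall n (i : 'I_n.+1), ito_sum W (fun (k : 'I_n.+1 * 'I_d) u w => (k == (i, l))%:R * g (j, l) (u, W i w)) (fun t w => psi t (W i w))].
  apply: (copy_integral hmu cP lawW indW T0 (hM ord0 j l) (mZ j l) (sZ j l) (hg (j, l)).1).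
  by apply: filterS (hg (j, l)).2 => w h u uT; rewrite h.
have [psi0 hpsi0] := choice (fun jl : 'I_m * 'I_d => hpsi jl.1 jl.2).
pose psi j t x := \sum_l psi0 (j, l) t x.
have mpsi j t : 0 <= t <= T -> measurable_fun setT (psi j t).
  by move=> tT; apply: measurable_sum => l; have [h _ _] := hpsi0 (j, l); exact: h.
exists phi, zeta, psi; split => //.
- move=> n i j t tT; apply: (copy_smeas lawW i tT (ay j t tT) (mphit t j)).
  by apply: filterS2 aephi yE => w h1 h2; rewrite h2 (h1 t tT).1.
- move=> n i j.
  have h (l : 'I_d) : ito_sum W (fun (k : 'I_n.+1 * 'I_d) u w => (k == (i, l))%:R * g (j, l) (u, W i w)) (fun t w => psi0 (j, l) t (W i w)).
    by have [_ _ h] := hpsi0 (j, l); exact: h.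
  have := ito_sum_sum (index_enum _) h; congr ito_sum.
  apply/funext => -[k1 k2]; apply/funext => u; apply/funext => w.
  rewrite (bigD1 k2)//= big1 ?addr0.
    by rewrite xpair_eqE eqxx andbT mxE.
  by move=> l lk; rewrite xpair_eqE [k2 == l]eq_sym (negbTE lk) andbF mul0r.
- move=> i t tT; have /andP[t0 tT'] := tT.
  pose S := g_sigma_algebraType (path_filtration mu T).
  have toS (h : cpath T d -> R) : measurable_fun setT h -> measurable_fun setT (h : S -> R).
    by move=> mh; exact: (measurableT_comp mh (path_measurable (mu := mu))).
  pose D : set (R * S) := `[0, T]%classic `*` setT.
  have mD : measurable D by apply: measurableX => //; exact: measurable_itv.
  have toRS (h : R * cpath T d -> R) : measurable_fun setT h -> measurable_fun setT (h : R * S -> R).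
    move=> mh; have mj : measurable_fun setT (fun z : R * S => (z.1, z.2) : R * cpath T d).
      apply: measurable_fun_pair; first exact: measurable_fst.
      by apply: (measurableT_comp (path_measurable (mu := mu))); exact: measurable_snd.
    have := measurableT_comp mh mj; congr measurable_fun; by apply/funext => -[].
  have mphiS : measurable_fun D (fun z : R * S => phi z.1 z.2).
    by apply: measurable_funTS; apply: measurable_fun_mx => // a j; rewrite ord1; exact: toRS (mphi j).
  have mzetaS : measurable_fun D (fun z : R * S => zeta z.1 z.2).
    by apply: measurable_funTS; apply: measurable_fun_mx => // j l; exact: toRS (mzeta j l).
  pose h (z : R * S) := F z.1 z.2 (phi z.1 z.2) (zeta z.1 z.2) (distribution P (Y z.1)).
  have mh : measurable_fun D h.
    apply: (@caratheodory R m d _ (R * S)%type D T p LF mD T0 LF0 (fun z => F z.1 z.2) _ _ (fun z => phi z.1 z.2) (fun z => zeta z.1 z.2)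
      fst (fun u => distribution P (Y u)) mphiS mzetaS).
    - by move=> y' z' nu' hnu; exact: (mF y' z' hnu TT).
    - by move=> s y1 y2 z1 z2 nu1 nu2 [/= hs _] h1 h2; move: hs; rewrite in_itv/= => hs; exact: ((lipF s.2 hs).1).
    - by apply: measurable_funTS; exact: measurable_fst.
    - by move=> s [/=]; rewrite in_itv.
    - by move=> u uT; exact: (law_moments p12 sY uT).
    - by move=> s [/= hs _]; move: hs; rewrite in_itv/= => hs; exact: (law_flow_cvg T0 p12 cY sY hs).
  pose I j (x : cpath T d) := \int[leb]_(u in `[t, T]) F u x (phi u x) (zeta u x) (distribution P (Y u)) 0 j.
  have mI j : measurable_fun setT (I j : S -> R).
    have mhj : measurable_fun setT (fun q : S * R => ((fun z => h z 0 j) \_ D) (q.2, q.1) * \1_(`[t, T]%classic : set R) q.2).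
      apply: measurable_funM.
        have m1 : measurable_fun setT ((fun z => h z 0 j) \_ D).
          by apply/(measurable_restrictT _ mD); exact: (measurableT_comp (measurable_coord 0 j) mh).
        by apply: (measurableT_comp m1); apply: measurable_fun_pair; [exact: measurable_snd|exact: measurable_fst].
      by apply: (measurableT_comp (measurable_indic (measurable_itv _))); exact: measurable_snd.
    have := measurable_Rintegral_param mhj; congr measurable_fun; apply/funext => x.
    rewrite /I [RHS]Rintegral_mkcond; apply: eq_Rintegral => u _; rewrite !patchE indicE mem_setE in_itv/=.
    case: (boolP (t <= u <= T)) => [/andP[tu uT]|_]; last by rewrite mulr0.
    by rewrite mulr1 mem_set//; split => //=; rewrite in_itv/= uT (le_trans t0).
  have mGj j : measurable_fun setT (fun x : S => G x 0 j) by exact: (measurableT_comp (measurable_coord 0 j) mG).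
  (* At a fixed time the equation defines an event of the completed path space. It holds along
     [W 0], hence along [W i]; the null set may depend on t. *)
  have mE j : <<s path_filtration mu T >> [set x | phi t x 0 j = G x 0 j + I j x - (psi j T x - psi j t x)].
    change (measurable ([set x | phi t x 0 j = G x 0 j + I j x - (psi j T x - psi j t x)] : set S)).
    apply: measurable_eq_set; first exact: toS (mphit t j).
    apply: measurable_funB; first exact: measurable_funD.
    by apply: measurable_funB; apply: toS; exact: mpsi.
  apply: filter_forall => j; apply: (ae_copy lawW i (mE j)) => /=.
  have e1 : {ae P, forall w, forall l, M ord0 j l t w = psi0 (j, l) t (W 0%N w)}.
    by apply: filter_forall => l; have [_ h1 _] := hpsi0 (j, l); exact: h1.
  have e2 : {ae P, forall w, forall l, M ord0 j l T w = psi0 (j, l) T (W 0%N w)}.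
    by apply: filter_forall => l; have [_ h1 _] := hpsi0 (j, l); exact: h1.
  have e3 : {ae P, forall w, (forall l, M ord0 j l t w = psi0 (j, l) t (W 0%N w)) /\ (forall l, M ord0 j l T w = psi0 (j, l) T (W 0%N w))}.
    by apply: filterS2 e1 e2.
  apply: filterS3 aephi eqM e3 => w k1 k2 [k3 k4].
  rewrite (k1 t tT).1 (k2 t tT j) big_ord1; congr (_ + _ - _).
    apply: eq_Rintegral => u; rewrite inE/= in_itv/= => /andP[tu uT].
    have uT' : 0 <= u <= T by rewrite uT (le_trans t0).
    by have [-> ->] := k1 u uT'.
  by rewrite /psi -sumrB; apply: eq_bigr => l _; rewrite k3 k4.
Qed.

End Copies.

Lemma measurable_transport_cost {R : realType} {m : nat} {dS} {S : measurableType dS} (D : set S) N L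
    (nu nu' : S -> probability 'rV[R]_m R) : measurable D ->
  (forall f : 'rV[R]_m -> R, measurable_fun setT f -> (forall x, 0 <= f x) ->
     measurable_fun D (fun z => fine (\int[nu z]_x (f x)%:E)%E)) ->
  (forall f : 'rV[R]_m -> R, measurable_fun setT f -> (forall x, 0 <= f x) ->
     measurable_fun D (fun z => fine (\int[nu' z]_x (f x)%:E)%E)) ->
  measurable_fun D (fun z => transport_cost N L (nu z) (nu' z)).
Proof.
move=> mD h h'.
have set_fun (mes : S -> probability 'rV[R]_m R) (A : set 'rV[R]_m) : measurable A ->
    (forall f : 'rV[R]_m -> R, measurable_fun setT f -> (forall x, 0 <= f x) ->
      measurable_fun D (fun z => fine (\int[mes z]_x (f x)%:E)%E)) ->
    measurable_fun D (fun z => fine (mes z A)).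
  move=> mA /(_ (\1_A : 'rV[R]_m -> R)); rewrite (_ : (fun z => fine (mes z A)) = (fun z => fine (\int[mes z]_x (\1_A x)%:E)%E)).
    by apply => // x; rewrite indicE.
  by apply/funext => z; rewrite integral_indic// setIT.
have mg i j : measurable_fun D (fun z => @cell_gap R m N L i j (nu z) (nu' z)).
  apply: measurable_sum => q; apply: measurableT_comp => //.
  by apply: measurable_funB; apply: set_fun => //; exact: measurable_coarsen.
have o0 (x : 'rV[R]_m) : 0 <= outer N x by rewrite /outer mulr_ge0// sqr_ge0.
have mo := measurable_outer (R := R) (m := m) N 0%N.
apply: measurable_funD; last by apply: measurable_funM => //; apply: h'.
apply: measurable_funD; last by apply: measurable_funM => //; apply: h.
apply: measurable_sum => j; apply: measurable_funM => //.
apply: measurable_funD; last by apply: measurable_funM.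
apply: measurable_funD; first by apply: measurable_funM => //; apply: set_fun => //; exact: measurable_shell.
by apply: measurable_sum => i; apply: measurable_funM.
Qed.

Section CopyFlow.
Context {R : realType} {T : R} {d m : nat} {mu : probability (cpath T d) R}.
Context {d0 : measure_display} {Omega : measurableType d0} {P : probability Omega R}.
Variable W : nat -> {RV P >-> cpath T d}.
Hypothesis lawW : forall i A, measurable A -> distribution P (W i) A = mu A.
Hypothesis indW : mutually_independent W.
Hypothesis T0 : 0 < T.
Local Notation leb := (@lebesgue_measure R).
Local Notation PL := (P \x leb)%E.
Local Notation V := 'rV[R]_m.
Variables (Y : R -> {RV P >-> V}) (phi : R -> cpath T d -> V).
Hypothesis mphi : forall j, measurable_fun setT (fun z : R * cpath T d => phi z.1 z.2 0 j).
Hypothesis hphi : {ae P, forall w, forall u, 0 <= u <= T -> phi u (W 0%N w) = Y u w}.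

Lemma copy_section u : measurable_fun setT (phi u).
Proof.
apply: measurable_fun_mx => // a j; rewrite ord1.
exact: (measurableT_comp (mphi j) (@pair1_measurable _ _ R (cpath T d) u)).
Qed.

Lemma copy_measurable i u : measurable_fun setT (fun w => phi u (W i w)).
Proof. by apply: (measurableT_comp (copy_section u)). Qed.

Lemma copy_joint i j : measurable_fun setT (fun z : Omega * R => phi z.2 (W i z.1) 0 j).
Proof.
apply: (measurableT_comp (mphi j)) (_ : measurable_fun setT (fun z : Omega * R => (z.2, W i z.1))).
apply: measurable_fun_pair; first exact: measurable_snd.
by apply: (measurableT_comp (measurable_funPT (W i))); exact: measurable_fst.
Qed.

Lemma integral_copy i u (f : V -> R) : 0 <= u <= T -> measurable_fun setT f -> (forall x, 0 <= f x) ->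
  (\int[P]_w (f (phi u (W i w)))%:E = \int[distribution P (Y u)]_x (f x)%:E)%E.
Proof.
move=> uT mf f0.
have mg : measurable_fun setT (fun x => (f (phi u x))%:E).
  by apply/measurable_EFinP; apply: (measurableT_comp mf); exact: copy_section.
have g0 x : (0 <= (f (phi u x))%:E)%E by rewrite lee_fin.
rewrite (integral_path lawW i mg g0) -(integral_path lawW 0%N mg g0).
rewrite ge0_integral_distribution//; last exact/measurable_EFinP.
- apply: ae_eq_integral => //.
  + by apply/measurable_EFinP; apply: (measurableT_comp mf); exact: copy_measurable.
  + by apply/measurable_EFinP; apply: (measurableT_comp mf).
  + by apply: filterS hphi => w h _; rewrite /= h.
Qed.

Lemma copy_law i u A : 0 <= u <= T -> measurable A ->
  P ((fun w => phi u (W i w)) @^-1` A) = distribution P (Y u) A.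
Proof.
move=> uT mA; have mA' : measurable ((fun w => phi u (W i w)) @^-1` A).
  by rewrite -[X in measurable X]setTI; exact: copy_measurable.
have i0 (x : V) : 0 <= \1_A x :> R by rewrite indicE.
have h := integral_copy i uT (measurable_indic mA) i0.
have e1 := integral_indic P measurableT mA'; rewrite setIT in e1.
have e2 := integral_indic (distribution P (Y u)) measurableT mA; rewrite setIT in e2.
by rewrite -e1 -e2 -h.
Qed.

Lemma copy_independent i i' u A : i != i' -> 0 <= u <= T -> measurable A ->
  P ((fun w => phi u (W i w)) @^-1` A `&` (fun w => phi u (W i' w)) @^-1` A) =
  (distribution P (Y u) A * distribution P (Y u) A)%E.
Proof.
move=> ii uT mA; rewrite -{1}(copy_law i uT mA) -(copy_law i' uT mA).
have mB : measurable (phi u @^-1` A) by rewrite -[X in measurable X]setTI; exact: copy_section.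
have := @indW [:: i; i'] (fun=> phi u @^-1` A); rewrite /= inE ii => /(_ isT (fun=> mB)).
rewrite big_cons big_seq1 => <-; congr (P _).
apply/seteqP; split => w /=; first by move=> [h1 h2] l /=; rewrite !inE => /orP[/eqP ->|/eqP ->].
by move=> h; split; apply: h => /=; rewrite !inE eqxx ?orbT.
Qed.

(** The source term of the comparison: a jointly measurable bound, on ]0, T], for the squared
    distance between the law of [Y] and the empirical measure of the copies. *)
Definition transport_window n N L (z : Omega * R) : R :=
  transport_cost N L (distribution P (Y z.2)) (empirical (fun l : 'I_n.+1 => phi z.2 (W l z.1))) * (0 < z.2 <= T)%R%:R.

Lemma measurable_transport_window n N L : measurable_fun setT (transport_window n N L).
Proof.
pose D : set (Omega * R) := [set z | 0 < z.2 <= T].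
have mD : measurable D.
  rewrite (_ : D = setT `*` `]0, T]%classic); last by apply/seteqP; split => z /=; rewrite in_itv//= => -[].
  exact: measurableX.
suff h : measurable_fun D (fun z : Omega * R => transport_cost N L (distribution P (Y z.2)) (empirical (fun l : 'I_n.+1 => phi z.2 (W l z.1)))).
  have := (measurable_restrictT _ mD).1 h; congr measurable_fun; apply/funext => z; rewrite patchE /transport_window.
  case: ifPn => [/set_mem /= ->|]; first by rewrite mulr1.
  by rewrite notin_setE /D/= => /negP/negbTE ->; rewrite mulr0.
apply: measurable_transport_cost => // f mf f0.
- apply: (@eq_measurable_fun _ _ _ _ _ (fun z => fine (\int[P]_w (f (phi z.2 (W 0%N w)))%:E)%E)).
    by move=> z; rewrite inE /D/= => /andP[z0 zT]; rewrite integral_copy// zT ltW.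
  apply: measurable_funTS; apply: (measurableT_comp (fine_measurable _)) => //.
  have mg : measurable_fun setT (fun z : Omega * R => (f (phi z.2 (W 0%N z.1)))%:E).
    apply/measurable_EFinP; apply: (measurableT_comp mf); apply: measurable_fun_mx => // a j; rewrite ord1; exact: copy_joint.
  have := @measurable_fun_fubini_tonelli_G _ _ _ _ R P (fun z : Omega * R => (f (phi z.2 (W 0%N z.1)))%:E) mg.
  move=> h; apply: (measurableT_comp (h _)); last exact: measurable_snd.
  by move=> z; rewrite lee_fin.
- under eq_fun do rewrite integral_empirical//=.
  apply: measurable_funTS; apply: measurable_funM => //; apply: measurable_sum => l.
  by apply: (measurableT_comp mf); apply: measurable_fun_mx => // a j; rewrite ord1; exact: copy_joint.
Qed.

Lemma transport_window_bound (k : R) n N L (M rho : R) :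
  (sup_moment P T Y k <= M%:E)%E -> 
  (forall (nu : probability V R) (X : 'I_n.+1 -> Omega -> V),
    (\int[nu]_x (enorm x `^ k)%:E <= M%:E)%E ->
    (forall l, measurable_fun setT (X l)) -> (forall l A, measurable A -> P (X l @^-1` A) = nu A) ->
    (forall (l l' : 'I_n.+1) A, l != l' -> measurable A -> P (X l @^-1` A `&` X l' @^-1` A) = (nu A * nu A)%E) ->
    ibound P (fun w => transport_cost N L nu (empirical (fun l => X l w))) rho) ->
  (forall z, 0 <= transport_window n N L z) /\ (\int[PL]_z (transport_window n N L z)%:E <= (T * rho)%:E)%E.
Proof.
move=> hM hrho.
have ib u : 0 <= u <= T -> ibound P (fun w => transport_cost N L (distribution P (Y u)) (empirical (fun l : 'I_n.+1 => phi u (W l w)))) rho.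
  move=> uT; apply: (hrho _ (fun l w => phi u (W l w))).
  - rewrite ge0_integral_distribution//.
    + apply: le_trans hM; apply: ereal_sup_ubound; exists u => //=; by rewrite in_itv.
    + by apply/measurable_EFinP; exact: measurable_enorm_powR.
    + by move=> x; rewrite lee_fin powR_ge0.
  - by move=> l; exact: copy_measurable.
  - by move=> l A mA; exact: copy_law.
  - by move=> l l' A ll mA; apply: copy_independent.
have t0 z : 0 <= transport_window n N L z.
  rewrite /transport_window; case: (boolP (0 < z.2 <= T)) => [/andP[z0 zT]|_]; last by rewrite mulr0.
  have zT' : 0 <= z.2 <= T by rewrite zT ltW.
  by have [_ h _] := ib z.2 zT'; rewrite mulr1.
have rho0 : 0 <= rho.
  have T1 : 0 <= T <= T by rewrite lexx ltW.
  have [_ h1 h2] := ib T T1; rewrite -lee_fin; apply: le_trans h2; apply: integral_ge0 => w _; by rewrite lee_fin.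
split => //; rewrite (@fubini_tonelli2 _ _ _ _ R P leb (fun z => (transport_window n N L z)%:E)); last 2 first.
- by apply/measurable_EFinP; exact: measurable_transport_window.
- by move=> z; rewrite lee_fin.
apply: (@le_trans _ _ (\int[leb]_u (rho%:E * ((0 < u <= T)%R%:R)%:E))%E).
  apply: le_integral_nonmeas => u; first by apply: integral_ge0 => w _; rewrite lee_fin.
  rewrite /fubini_G/= /transport_window/=; case: (boolP (0 < u <= T)) => [/andP[u0 uT]|_]; last first.
    by rewrite mule0; under eq_integral do rewrite mulr0; rewrite integral0.
  have uT' : 0 <= u <= T by rewrite uT ltW.
  by under eq_integral do rewrite mulr1; rewrite mule1; have [_ _ h] := ib u uT'.
rewrite ge0_integralZl//.
- have -> : (\int[leb]_u ((0 < u <= T)%R%:R)%:E = (Num.max 0 (T - 0))%:E)%E by exact: ind_int.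
  by rewrite subr0 max_r ?(ltW T0)// -EFinM lee_fin mulrC.
- by apply/measurable_EFinP; exact: measurable_ind.
Qed.

End CopyFlow.

Lemma empirical_second_moment {R : realType} {m : nat} n (x : 'I_n.+1 -> 'rV[R]_m) :
  (\int[empirical x]_z (enorm z ^+ 2)%:E = (n.+1%:R^-1 * \sum_k enorm (x k) ^+ 2)%:E)%E.
Proof.
apply: integral_empirical => [|z]; last exact: sqr_ge0.
by apply: measurable_funX; exact: measurable_enorm.
Qed.

Lemma enorm_sqrB {R : realType} a b (x y z : 'M[R]_(a, b)) :
  enorm (x - z) ^+ 2 <= 2 * enorm (x - y) ^+ 2 + 2 * enorm (z - y) ^+ 2.
Proof.
rewrite !enorm_sqr !mulr_sumr -big_split/=; apply: ler_sum => i _.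
rewrite !mulr_sumr -big_split/=; apply: ler_sum => j _; rewrite !mxE.
by have := sqr_ge0 ((x i j - y i j) + (z i j - y i j)); nra.
Qed.

Lemma compare_arith {R : realType} (c A v B u s q : R) : A <= 3 * c * (B + u + s) -> v <= 3 * c * q ->
  2 * A + 2 * v <= 6 * c * (B + u + s + q).
Proof. by move=> h1 h2; have := lerD (ler_wpM2l (ler0n R 2) h1) (ler_wpM2l (ler0n R 2) h2); lra. Qed.

(* The Lipschitz bound is applied twice, through the empirical measure of the copies, which avoids the
   triangle inequality for the Wasserstein distance. *)
Lemma driver_compare {R : realType} {m d : nat} {T p LF : R} (p12 : 1 <= p <= 2) (LF0 : 0 <= LF)
    (F : R -> cpath T d -> 'rV[R]_m -> 'M[R]_(m, d) -> probability 'rV[R]_m R -> 'rV[R]_m)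
    (lipF : driver_lipschitz p LF F) t x y z y' z' n (a b : 'I_n.+1 -> 'rV[R]_m)
    (nu : probability 'rV[R]_m R) N L : 0 <= t <= T -> (\int[nu]_v (enorm v ^+ 2)%:E < +oo)%E ->
  finite_moment p nu -> 0 <= transport_cost N L nu (empirical b) ->
  enorm (F t x y z (empirical a) - F t x y' z' nu) ^+ 2 <=
  6 * LF ^+ 2 * (enorm (y - y') ^+ 2 + enorm (z - z') ^+ 2 + n.+1%:R^-1 * \sum_i enorm (a i - b i) ^+ 2 +
    transport_cost N L nu (empirical b)).
Proof.
move=> tT nu2 nup Q0.
have avg0 (e : 'I_n.+1 -> R) : 0 <= n.+1%:R^-1 * \sum_i e i ^+ 2.
  by rewrite mulr_ge0// sumr_ge0// => i _; exact: sqr_ge0.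
have fe (e : 'I_n.+1 -> 'rV[R]_m) : finite_moment p (empirical e).
  have h := avg0 (fun i => enorm (e i)).
  have h' : (\int[empirical e]_z (enorm z ^+ 2)%:E <= (n.+1%:R^-1 * \sum_i enorm (e i) ^+ 2)%:E)%E by rewrite empirical_second_moment.
  by have [_ ? _] := moment_le p12 h h'.
have h1 := driver_diff LF0 lipF x y z y' z' tT (avg0 (fun i => enorm (a i - b i))) (fe a) (fe b) (wasserstein_empirical a b p12).
have e2 : (\int[empirical b]_v (enorm v ^+ 2)%:E < +oo)%E by rewrite empirical_second_moment ltry.
have h2 := driver_diff LF0 lipF x y' z' y' z' tT Q0 nup (fe b) (wasserstein_transport N L p12 nu2 e2).
apply: le_trans (enorm_sqrB _ (F t x y' z' (empirical b)) _) _.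
by apply: compare_arith h1 _; move: h2; rewrite !subrr !enorm0 expr0n/= !add0r.
Qed.

(** The case of weight 1 on [0, T] for differences of solutions with the same terminal value: only
    the source remains on the right. *)
Lemma stability_zero_terminal {R : realType} {T : R} {d : nat} {mu : probability (cpath T d) R} (hmu : is_wiener mu)
    {d0} {Omega : measurableType d0} {P : probability Omega R} (cP : measure_is_complete P)
    (W : nat -> {RV P >-> cpath T d}) (lawW : forall i A, measurable A -> distribution P (W i) A = mu A)
    (indW : mutually_independent W) (n : nat) (I : finType) (X : I -> R -> Omega -> R)
    (H : I -> 'I_n.+1 * 'I_d -> R -> Omega -> R) (J : I -> R -> Omega -> R) (r : Omega * R -> R) (c K : R) :
  0 < T -> 0 <= c -> stability_constant T (2 * c * (1 + T)) K -> (forall i, ito_sum W (H i) (J i)) ->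
  (forall i t, 0 <= t <= T -> smeas (noise_filtration W n.+1 t) (X i t)) ->
  (exists M : R, forall t, 0 <= t <= T -> (\sum_i (\int[P]_w (X i t w ^+ 2)%:E) <= M%:E)%E) ->
  (forall i, measurable_fun setT (cut 0 T (X i))) ->
  measurable_fun setT r -> (forall z, 0 <= r z) -> (\int[P \x @lebesgue_measure R]_z (r z)%:E < +oo)%E ->
  (forall s t, 0 <= s -> s <= t -> t <= T -> {ae P, forall w,
    ((\sum_i (X i s w + (J i t w - J i s w) - X i t w) ^+ 2)%:E <=
     (t - s)%:E * \int[@lebesgue_measure R]_u
       (c * (\sum_i X i u w ^+ 2 + \sum_i \sum_k H i k u w ^+ 2 + r (w, u)) * (s < u <= t)%R%:R)%:E)%E}) ->
  {ae P, forall w, forall i, X i T w = 0} ->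
  forall s, 0 <= s <= T ->
  (\sum_i (\int[P]_w (X i s w ^+ 2)%:E) +
   \sum_i \sum_k (\int[P \x @lebesgue_measure R]_z (cut s T (H i k) z ^+ 2)%:E) <=
   K%:E * \int[P \x @lebesgue_measure R]_z (r z)%:E)%E.
Proof.
move=> T0 c0 hK hI aX bX mX mr r0 fr drift XT s sT; have [K0 _] := hK.
have drift' s' t : 0 <= s' -> s' <= t -> t <= T -> {ae P, forall w,
  ((\sum_i (X i s' w + (J i t w - J i s' w) - X i t w) ^+ 2)%:E <=
   (t - s')%:E * \int[@lebesgue_measure R]_u (c * (\sum_i cut s' t (X i) (w, u) ^+ 2 +
     \sum_i \sum_k cut s' t (H i k) (w, u) ^+ 2 + (s' < (w, u).2 <= t)%R%:R * r (w, u)))%:E)%E}.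
  move=> h1 h2 h3; apply: filterS (drift s' t h1 h2 h3) => w hw.
  by under [X in (_ <= _ * X)%E]eq_integral do rewrite gam_window.
have h1 : bounded_coef W n 0 (fun=> 1 : R).
  by split; [exact: measurable_cst|exists 1 => w; rewrite normr1].
have := stability_iterate hmu cP lawW indW c0 hI aX bX mX mr r0 fr drift' (lexx 0) (ltW T0) h1 hK sT.
have -> : (\sum_i \int[P]_w ((1 * X i T w) ^+ 2)%:E = 0)%E.
  apply: big1 => i _; under eq_integral do rewrite mul1r.
  have TT : 0 <= T <= T by rewrite lexx ltW.
  have mXT : measurable_fun setT (X i T) by apply: (noise_measurable_fun cP _ (aX i T TT)).
  rewrite (@ae_eq_integral _ _ _ P setT (fun=> 0%E))//; first by rewrite integral0.
  - exact: measurable_sqE.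
  - by apply: filterS XT => w /(_ i) -> _; rewrite expr0n.
rewrite add0e => h; apply: le_trans (le_trans h _).
  apply: leeD; apply: lee_sum => i _; first by under [leRHS]eq_integral do rewrite mul1r.
  by apply: lee_sum => k _; under [leRHS]eq_integral do rewrite mul1r.
apply: lee_wpmul2l; first by rewrite lee_fin.
apply: le_integral_nonmeas => z; rewrite expr1n mul1r lee_fin; first by rewrite mulr_ge0.
by case: (0 < z.2 <= T); rewrite ?mul1r// mul0r.
Qed.

Lemma sum_pair {R : realType} (I J : finType) (f : I -> J -> R) : \sum_i \sum_j f i j = \sum_(x : I * J) f x.1 x.2.
Proof. by rewrite (pair_big xpredT xpredT f). Qed.

Lemma sum_average {R : realType} n (c q : R) (A B : 'I_n.+1 -> R) :
  \sum_i 6 * c * (A i + B i + n.+1%:R^-1 * \sum_i A i + q) =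
  6 * c * (\sum_i A i + \sum_i B i + \sum_i A i + n.+1%:R * q).
Proof.
rewrite -mulr_sumr !big_split/= !sumr_const card_ord; congr (_ * (_ + _ + _ + _)).
  by rewrite -[LHS]mulr_natl mulrA divff ?pnatr_eq0// mul1r.
by rewrite -[LHS]mulr_natl.
Qed.

Lemma total_drift_arith {R : realType} (c q A B S : R) : 0 <= c -> 0 <= A -> 0 <= B -> B <= S -> 0 <= q ->
  6 * c * (A + B + A + q) <= 12 * c * (A + S + q).
Proof.
move=> c0 A0 B0 BS q0; have -> : 12 * c * (A + S + q) = 6 * c * (2 * (A + S + q)) by ring.
by rewrite ler_wpM2l ?mulr_ge0//; lra.
Qed.

Lemma solution_sup {R : realType} {T : R} {d m : nat} {d0} {Omega : measurableType d0} {P : probability Omega R}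
    (W : nat -> {RV P >-> cpath T d}) n xi f (Y : R -> Omega -> 'rV[R]_m) (Z : 'I_n -> R -> Omega -> 'M[R]_(m, d)) :
  bsde_solution W xi f Y Z -> (sup_norm2 P T Y < +oo)%E.
Proof. by case. Qed.

Lemma time_energy {R : realType} {T : R} {d0} {Omega : measurableType d0} (P : probability Omega R) (I : finType)
    (X : I -> R -> Omega -> R) (M : R) : 0 < T -> 0 <= M -> (forall i, measurable_fun setT (cut 0 T (X i))) ->
  (forall t, 0 <= t <= T -> (\sum_i \int[P]_w (X i t w ^+ 2)%:E <= M%:E)%E) ->
  (\sum_i \int[P \x @lebesgue_measure R]_z (cut 0 T (X i) z ^+ 2)%:E <= (T * M)%:E)%E.
Proof.
move=> T0 M0 mX hM; pose f i (z : Omega * R) := (cut 0 T (X i) z ^+ 2)%:E.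
have mf i : measurable_fun setT (f i) by apply: measurable_sqE; exact: mX.
have f0 i z : (0 <= f i z)%E by rewrite lee_fin sqr_ge0.
rewrite (eq_bigr (fun i => \int[@lebesgue_measure R]_u fubini_G P (f i) u)%E); last first.
  by move=> i _; exact: (@fubini_tonelli2 _ _ _ _ R P (@lebesgue_measure R) (f i) (mf i) (f0 i)).
rewrite -ge0_integral_sum//; last 2 first.
- by move=> i; exact: (@measurable_fun_fubini_tonelli_G _ _ _ _ R P (f i) (mf i) (f0 i)).
- by move=> i u _; apply: integral_ge0.
apply: (@le_trans _ _ (\int[@lebesgue_measure R]_u (M%:E * ((0 < u <= T)%R%:R)%:E))%E).
  apply: le_integral_nonmeas => u; first by apply: sume_ge0 => i _; exact: integral_ge0.
  rewrite /fubini_G /f /cut/=; case: (boolP (0 < u <= T)) => [/andP[u0 uT]|_]; last first.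
    rewrite mule0; under eq_bigr do under eq_integral do rewrite mulr0 expr0n.
    by rewrite big1// => i _; rewrite integral0.
  rewrite mule1; under eq_bigr do under eq_integral do rewrite mulr1.
  by apply: hM; rewrite uT ltW.
rewrite ge0_integralZl//.
- have -> : (\int[@lebesgue_measure R]_u ((0 < u <= T)%R%:R)%:E = (Num.max 0 (T - 0))%:E)%E by exact: ind_int.
  by rewrite subr0 max_r ?(ltW T0)// -EFinM lee_fin mulrC.
- by apply/measurable_EFinP; exact: measurable_ind.
Qed.

Lemma particle_drift_arith {R : realType} (c q A B C S : R) : 0 <= c -> 0 <= A -> 0 <= B -> 0 <= C -> B <= S -> 0 <= q ->
  6 * c * (A + B + C + q) <= 12 * c * (A + S + (C + q)).
Proof.
move=> c0 A0 B0 C0 BS q0; have -> : 12 * c * (A + S + (C + q)) = 6 * c * (2 * (A + S + (C + q))) by ring.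
by rewrite ler_wpM2l ?mulr_ge0//; lra.
Qed.

Lemma sup_split_arith {R : realType} (x a b : R) :
  ((x ^+ 2)%:E <= 2%:E * ((x + (a - b) - 0) ^+ 2)%:E + 4%:E * ((a ^+ 2)%:E + (b ^+ 2)%:E))%E.
Proof.
suff : x ^+ 2 <= 2 * (x + (a - b) - 0) ^+ 2 + 4 * (a ^+ 2 + b ^+ 2) by rewrite -lee_fin; exact.
have := sqr_ge0 (x + 2 * (a - b)); have := sqr_ge0 (a + b); nra.
Qed.

(** * Comparison of the particles with the copies *)

Section Chaos.
Context {R : realType} {T : R} {d m : nat} {mu : probability (cpath T d) R}.
Hypothesis hmu : is_wiener mu.
Context {d0 : measure_display} {Omega : measurableType d0} {P : probability Omega R}.
Hypothesis cP : measure_is_complete P.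
Variable W : nat -> {RV P >-> cpath T d}.
Hypothesis lawW : forall i A, measurable A -> distribution P (W i) A = mu A.
Hypothesis indW : mutually_independent W.
Hypothesis T0 : 0 < T.
Variables p LF : R.
Hypotheses (p12 : 1 <= p <= 2) (LF0 : 0 <= LF).
Local Notation leb := (@lebesgue_measure R).
Local Notation PL := (P \x leb)%E.
Local Notation V := 'rV[R]_m.
Variables (F : R -> cpath T d -> V -> 'M[R]_(m, d) -> probability V R -> V) (G : cpath T d -> V).
Hypothesis lipF : driver_lipschitz p LF F.
Hypothesis mF : forall y z nu, finite_moment 2 nu -> progressive T (path_filtration mu) (fun t w => F t w y z nu).
Variables (Y : R -> {RV P >-> V}) (Z : R -> Omega -> 'M[R]_(m, d)).
Hypothesis solY : mckean_vlasov_solution W F G Y Z.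
Variables (n : nat) (Yn : 'I_n.+1 -> R -> Omega -> V) (Zn : 'I_n.+1 -> 'I_n.+1 -> R -> Omega -> 'M[R]_(m, d)).
Hypothesis solN : interacting_solution W F G Yn Zn.

Let sY : (sup_norm2 P T Y < +oo)%E. Proof. by case: solY. Qed.
Let cY : {ae P, forall w, {within `[0, T], continuous (fun t => Y t w)}}. Proof. by case: solY => -[]. Qed.

Definition interacting_driver (l : 'I_n.+1) u w :=
  F u (W l w) (Yn l u w) (Zn l l u w) (empirical (fun i => Yn i u w)).

Variable y : 'I_n.+1 -> R -> Omega -> V.
Hypothesis cy : forall l w, {within `[0, T], continuous (y l ^~ w)}.
Hypothesis yE : {ae P, forall w, forall l t, y l t w = Yn l t w}.
Hypothesis ay : forall l j t, 0 <= t <= T -> smeas (noise_filtration W n.+1 t) (fun w => y l t w 0 j).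
Hypothesis jy : forall l j, measurable_fun setT (cut 0 T (fun u w => y l u w 0 j)).
Hypothesis hy : forall l t, 0 <= t <= T -> (\int[P]_w (enorm (y l t w) ^+ 2)%:E <= sup_norm2 P T (Yn l))%E.

Variables (phi : R -> cpath T d -> V) (zeta : R -> cpath T d -> 'M[R]_(m, d)).
Hypothesis mphi : forall j, measurable_fun setT (fun z : R * cpath T d => phi z.1 z.2 0 j).
Hypothesis mzeta : forall j l, measurable_fun setT (fun z : R * cpath T d => zeta z.1 z.2 j l).
Hypothesis hphi : {ae P, forall w, forall u, 0 <= u <= T -> phi u (W 0%N w) = Y u w /\ zeta u (W 0%N w) = Z u w}.

Definition copy_driver (l : nat) u w :=
  F u (W l w) (phi u (W l w)) (zeta u (W l w)) (distribution P (Y u)).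

Let hphi1 : {ae P, forall w, forall u, 0 <= u <= T -> phi u (W 0%N w) = Y u w}.
Proof. by apply: filterS hphi => w h u uT; have [] := h u uT. Qed.

Definition particle_bound l : R := fine (sup_norm2 P T (Yn l)).

Lemma particle_boundE l : sup_norm2 P T (Yn l) = (particle_bound l)%:E.
Proof. by have [_ _ h _ _] := solN l; rewrite fineK// ge0_fin_numE// sup_norm2_ge0. Qed.

(** Along a sample the empirical measures move continuously with the particles, so the measure
    argument is handled as for the law; the growth bound then gives integrability for all particles
    outside one null set. *)
Lemma interacting_driver_integrable :
  {ae P, forall w, forall l j, leb.-integrable `[0%R, T] (EFin \o (fun u => interacting_driver l u w 0 j))}.
Proof.
pose e l u w := (enorm (y l u w) ^+ 2 + enorm (Zn l l u w) ^+ 2) * (0 < u <= T)%R%:R.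
have secZ l w : measurable_fun `[0, T]%classic (Zn l l ^~ w).
  by have [_ pZ _ fZ _] := solN l; have [_ _ h] := progressive_data cP T0 (leqnn _) (pZ l) (fZ l); exact: h.
have me l w : measurable_fun setT (e l ^~ w).
  under eq_fun do rewrite /e mulrDl; apply: measurable_funD; apply: measurable_window_path => //.
  by apply: measurable_path; exact: cy.
have e0 l u w : 0 <= e l u w by rewrite mulr_ge0// addr_ge0// sqr_ge0.
have finw : {ae P, forall w, forall l, (\int[leb]_u (e l u w)%:E < +oo)%E}.
  apply: filter_forall => l; apply: ae_section_finite => //.
    by move=> j k; have [_ pZ _ fZ _] := solN l; have [_ h _] := progressive_data cP T0 (leqnn _) (pZ l) (fZ l); exact: h.
  by exists (particle_bound l) => t tT; rewrite -particle_boundE; exact: hy.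
apply: filterS2 yE finw => w yw fw l j.
have -> : (fun u => interacting_driver l u w 0 j) = (fun u => F u (W l w) (y l u w) (Zn l l u w) (empirical (fun i => y i u w)) 0 j).
  apply/funext => u; rewrite /interacting_driver yw; congr (F _ _ _ _ (empirical _) _ _).
  by apply/funext => i; rewrite yw.
pose D u := n.+1%:R^-1 * \sum_i enorm (y i u w) ^+ 2.
have D0 u : 0 <= D u by rewrite mulr_ge0// sumr_ge0// => i _; exact: sqr_ge0.
apply: (@driver_integrable _ _ _ _ _ _ T0 p12 LF0 _ lipF _ mF _ _ _ _ D).
- by apply: measurable_path; exact: cy.
- exact: secZ.
- by move=> u uT; split => //; rewrite empirical_second_moment.
- by move=> u uT; apply: (empirical_flow_cvg (y := fun i u => y i u w)) => // i; exact: cy.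
- apply: (@le_lt_trans _ _ (\int[leb]_u (4 * LF ^+ 2 * (1 * (0 < u <= T)%R%:R + 2 * \sum_i e i u w))%:E)%E).
    apply: le_integral_nonmeas => u.
      by rewrite lee_fin !mulr_ge0// ?sqr_ge0// !addr_ge0// sqr_ge0.
    rewrite lee_fin -[leLHS]mulrA ler_wpM2l ?mulr_ge0 ?sqr_ge0//.
    rewrite /e -mulr_suml mulrA -mulrDl ler_wpM2r// -!addrA lerD2l.
    set a := \sum_i _; have h1 : enorm (y l u w) ^+ 2 + enorm (Zn l l u w) ^+ 2 <= a.
      by rewrite /a (bigD1 l)//= lerDl sumr_ge0// => i _; rewrite addr_ge0// sqr_ge0.
    have h2 : D u <= a.
      apply: (@le_trans _ _ (\sum_i enorm (y i u w) ^+ 2)).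
        rewrite ler_piMl ?sumr_ge0// => [i _|]; first exact: sqr_ge0.
        by rewrite invf_le1// ler1n.
      by apply: ler_sum => i _; rewrite lerDl sqr_ge0.
    by rewrite addrA (le_trans (lerD h1 h2))// mulr_natl.
  apply: affine_window_finite => //; first by rewrite mulr_ge0// sqr_ge0.
  + by apply: measurable_funM => //; apply: measurable_sum => i; exact: me.
  + by move=> u; rewrite mulr_ge0// sumr_ge0.
  + under eq_integral do rewrite EFinM.
    have ms : measurable_fun setT (fun u => (\sum_i e i u w)%:E) by apply/measurable_EFinP; apply: measurable_sum => i; exact: me.
    rewrite ge0_integralZl//; last by move=> u _; rewrite lee_fin sumr_ge0.
    apply: lte_mul_pinfty => //; under eq_integral do rewrite -sumEFin.
    rewrite ge0_integral_sum//; last 2 first.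
    * by move=> i; apply/measurable_EFinP; exact: me.
    * by move=> i u _; rewrite lee_fin.
    by apply/lte_sum_pinfty => i _.
Qed.

Lemma zeta_joint l j k : measurable_fun setT (fun z : Omega * R => zeta z.2 (W l z.1) j k).
Proof.
apply: (measurableT_comp (mzeta j k)) (_ : measurable_fun setT (fun z : Omega * R => (z.2, W l z.1))).
apply: measurable_fun_pair; first exact: measurable_snd.
by apply: (measurableT_comp (measurable_funPT (W l))); exact: measurable_fst.
Qed.

Lemma copy_second_moment l t : 0 <= t <= T ->
  (\int[P]_w (enorm (phi t (W l w)) ^+ 2)%:E <= (flow_bound (T:=T) Y)%:E)%E.
Proof.
move=> tT; have [_ h] := flow_moment T0 solY tT; apply: le_trans h.
rewrite (integral_copy lawW mphi hphi1 l tT (f := fun v => enorm v ^+ 2))//.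
- by apply: measurable_funX; exact: measurable_enorm.
- by move=> v; exact: sqr_ge0.
Qed.

Lemma copy_driver_integrable l : (forall j k, sqint PL (cut 0 T (fun u w => zeta u (W l w) j k))) ->
  {ae P, forall w, forall j, leb.-integrable `[0%R, T] (EFin \o (fun u => copy_driver l u w 0 j))}.
Proof.
move=> sz.
have finw : {ae P, forall w, (\int[leb]_u ((enorm (phi u (W l w)) ^+ 2 + enorm (zeta u (W l w)) ^+ 2) * (0 < u <= T)%R%:R)%:E < +oo)%E}.
  apply: ae_section_finite => //.
    move=> j; apply: measurable_funM; last exact: measurable_window.
    exact: (copy_joint W mphi l j).
  by exists (flow_bound (T:=T) Y) => t tT; exact: copy_second_moment.
have mp w : measurable_fun `[0, T]%classic (fun u => phi u (W l w)).
  apply: measurable_funTS; apply: measurable_fun_mx => // a j; rewrite ord1.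
  exact: (measurableT_comp (copy_joint W mphi l j) (@pair1_measurable _ _ Omega R w)).
have mz w : measurable_fun `[0, T]%classic (fun u => zeta u (W l w)).
  apply: measurable_funTS; apply: measurable_fun_mx => // j k.
  exact: (measurableT_comp (zeta_joint l j k) (@pair1_measurable _ _ Omega R w)).
apply: filterS finw => w fw j; exact: (flow_driver_integrable T0 p12 LF0 lipF mF solY).
Qed.

Variable K : R.
(** Twice the constant 6 LF^2 of [driver_compare]: after summation over the particles, the empirical
    term contributes a second copy of the sum of squared gaps. *)
Local Notation c := (12 * LF ^+ 2).
Hypothesis hK : stability_constant T (2 * c * (1 + T)) K.
Variable N : 'I_n.+1 -> 'I_m -> R -> Omega -> R.
Hypothesis hN : forall l j, ito_sum W (fun (k : 'I_n.+1 * 'I_d) u w =>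
  \sum_(i < n.+1) (k.1 == widen_ord (leqnn n.+1) i)%:R * Zn l i u w j k.2) (N l j).
Hypothesis eN : {ae P, forall w, forall l t, 0 <= t <= T -> forall j, y l t w 0 j = G (W l w) 0 j +
  \int[leb]_(u in `[t, T]) interacting_driver l u w 0 j - (N l j T w - N l j t w)}.
Variable psi : 'I_m -> R -> cpath T d -> R.
Hypothesis aphi : forall (l : 'I_n.+1) j t, 0 <= t <= T -> smeas (noise_filtration W n.+1 t) (fun w => phi t (W l w) 0 j).
Hypothesis ipsi : forall (l : 'I_n.+1) j, ito_sum W (fun (k : 'I_n.+1 * 'I_d) u w => (k.1 == l)%:R * zeta u (W l w) j k.2) (fun t w => psi j t (W l w)).
Hypothesis ephi : forall (l : 'I_n.+1) t, 0 <= t <= T -> {ae P, forall w, forall j, phi t (W l w) 0 j = G (W l w) 0 j +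
  \int[leb]_(u in `[t, T]) copy_driver l u w 0 j - (psi j T (W l w) - psi j t (W l w))}.

Variables (NN LL : nat) (rho : R).
Local Notation Q := (transport_window W Y phi n NN LL).
Hypotheses (Q0 : forall z, 0 <= Q z) (rho0 : 0 <= rho) (intQ : (\int[PL]_z (Q z)%:E <= (T * rho)%:E)%E).

Let mQ : measurable_fun setT Q.
Proof. exact: (measurable_transport_window lawW mphi hphi1). Qed.

Let c0 : 0 <= c. Proof. by rewrite mulr_ge0// sqr_ge0. Qed.
Let K0 : 0 <= K. Proof. by case: hK. Qed.
Let TT : 0 <= T <= T. Proof. by rewrite lexx ltW. Qed.

Definition gap (lj : 'I_n.+1 * 'I_m) t w : R := y lj.1 t w 0 lj.2 - phi t (W lj.1 w) 0 lj.2.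

(** The copy of index l integrates against [W l] only. Its integrand is therefore 0 in the other
    coordinates, and the difference also contains the off-diagonal integrands of the particle. *)
Definition noise_gap (lj : 'I_n.+1 * 'I_m) (k : 'I_n.+1 * 'I_d) u w : R :=
  \sum_(i < n.+1) (k.1 == widen_ord (leqnn n.+1) i)%:R * Zn lj.1 i u w lj.2 k.2
  - (k.1 == lj.1)%:R * zeta u (W lj.1 w) lj.2 k.2.

Lemma noise_sum_diag (l i : 'I_n.+1) j k u w :
  \sum_(i0 < n.+1) (i == widen_ord (leqnn n.+1) i0)%:R * Zn l i0 u w j k = Zn l i u w j k.
Proof.
rewrite (bigD1 i)//= big1 ?addr0 => [|i0 ii].
  by rewrite (_ : i == widen_ord _ i) ?mul1r//; apply/eqP/val_inj.
rewrite (_ : (i == widen_ord _ i0) = false) ?mul0r//; apply: contraNF ii => /eqP ->; apply/eqP; exact/val_inj.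
Qed.

(** The driver sees only the diagonal integrands, which are part of the full energy. *)
Lemma diagonal_le u w : \sum_l enorm (Zn l l u w - zeta u (W l w)) ^+ 2 <= \sum_lj \sum_k noise_gap lj k u w ^+ 2.
Proof.
rewrite -(sum_pair (fun l j => \sum_k noise_gap (l, j) k u w ^+ 2)); apply: ler_sum => l _.
rewrite enorm_sqr; apply: ler_sum => j _.
rewrite -(sum_pair (fun i k => noise_gap (l, j) (i, k) u w ^+ 2)) (bigD1 l)//=; apply: ler_wpDr.
  by apply: sumr_ge0 => i _; apply: sumr_ge0 => k _; exact: sqr_ge0.
by apply: ler_sum => k _; rewrite /noise_gap/= noise_sum_diag eqxx mul1r !mxE.
Qed.

Lemma gap_sum t w : \sum_lj gap lj t w ^+ 2 = \sum_l enorm (y l t w - phi t (W l w)) ^+ 2.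
Proof.
rewrite -(sum_pair (fun l j => gap (l, j) t w ^+ 2)); apply: eq_bigr => l _.
by rewrite enorm_row; apply: eq_bigr => j _; rewrite !mxE.
Qed.

Lemma gap_terminal : {ae P, forall w, forall lj, gap lj T w = 0}.
Proof.
have h : {ae P, forall w, forall (l : 'I_n.+1) j, phi T (W l w) 0 j = G (W l w) 0 j}.
  apply: filter_forall => l; apply: filterS (ephi l TT) => w h j.
  by rewrite h subrr subr0 set_itv1 Rintegral_set1 addr0.
apply: filterS2 h eN => w h1 h2 [l j]; rewrite /gap/= h1 h2//.
by rewrite subrr subr0 set_itv1 Rintegral_set1 addr0 subrr.
Qed.

Lemma gap_adapted lj t : 0 <= t <= T -> smeas (noise_filtration W n.+1 t) (gap lj t).
Proof. by move=> tT; apply: measurable_funB; [exact: ay|exact: aphi]. Qed.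

Lemma gap_measurable lj : measurable_fun setT (cut 0 T (gap lj)).
Proof.
rewrite (_ : cut 0 T (gap lj) = fun z => cut 0 T (fun u w => y lj.1 u w 0 lj.2) z - phi z.2 (W lj.1 z.1) 0 lj.2 * (0 < z.2 <= T)%R%:R).
  apply: measurable_funB => //; apply: measurable_funM; last exact: measurable_window.
  exact: (copy_joint W mphi lj.1 lj.2).
by apply/funext => z; rewrite /cut /gap mulrBl.
Qed.

Lemma gap_bounded : exists M : R, forall t, 0 <= t <= T -> (\sum_lj \int[P]_w (gap lj t w ^+ 2)%:E <= M%:E)%E.
Proof.
exists (\sum_(lj : 'I_n.+1 * 'I_m) (2 * particle_bound lj.1 + 2 * flow_bound (T:=T) Y)) => t tT.
rewrite -sumEFin; apply: lee_sum => -[l j] _.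
have my : measurable_fun setT (fun w => (enorm (y l t w) ^+ 2)%:E).
  apply/measurable_EFinP; under eq_fun do rewrite enorm_row.
  apply: measurable_sum => i; apply: measurable_funX; apply: (noise_measurable_fun cP _ (ay l i tT)).
  by case/andP: tT.
have mp : measurable_fun setT (fun w => (enorm (phi t (W l w)) ^+ 2)%:E).
  apply/measurable_EFinP; apply: measurable_funX.
  exact: (measurableT_comp (@measurable_enorm R 1 m) (copy_measurable W mphi l t)).
have e0 a b (x : 'M[R]_(a, b)) : (0 <= (enorm x ^+ 2)%:E)%E by rewrite lee_fin sqr_ge0.
apply: (@le_trans _ _ (\int[P]_w (2%:E * (enorm (y l t w) ^+ 2)%:E + 2%:E * (enorm (phi t (W l w)) ^+ 2)%:E))%E).
  apply: le_integral_nonmeas => w; first by rewrite lee_fin sqr_ge0.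
  rewrite -!EFinM -EFinD lee_fin /gap/=.
  have h a (x : V) : x 0 a ^+ 2 <= enorm x ^+ 2.
    by rewrite -(real_normK (num_real (x 0 a))) lerXn2r ?nnegrE ?enorm_ge0//; exact: coord_le_enorm.
  have := h j (y l t w); have := h j (phi t (W l w)); set a := y _ _ _ _ _; set b := phi _ _ _ _.
  have := sqr_ge0 (a + b); set u := enorm _ ^+ 2; set v := enorm _ ^+ 2; nra.
rewrite ge0_integralD//; last 4 first.
- by move=> w _; rewrite mule_ge0.
- by apply: emeasurable_funM => //; exact: measurable_cst.
- by move=> w _; rewrite mule_ge0.
- by apply: emeasurable_funM => //; exact: measurable_cst.
have -> (a b : R) : (2 * a + 2 * b)%:E = (2%:E * a%:E + 2%:E * b%:E)%E by rewrite EFinD !EFinM.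
rewrite !ge0_integralZl//; apply: leeD; apply: lee_wpmul2l => //.
  by rewrite -particle_boundE; exact: hy.
exact: copy_second_moment.
Qed.

Lemma copies_integrable :
  {ae P, forall w, forall (l : 'I_n.+1) j, leb.-integrable `[0%R, T] (EFin \o (fun u => copy_driver l u w 0 j))}.
Proof.
apply: filter_forall => l; apply: copy_driver_integrable => j k.
have <- : cut 0 T (fun u w => (l == l)%:R * zeta u (W l w) j k) = cut 0 T (fun u w => zeta u (W l w) j k).
  by apply/funext => z; rewrite /cut eqxx mul1r.
exact: (ito_finite (ipsi l j) (l, k)).
Qed.

Lemma particle_drift u w l : 0 < u <= T -> (forall l t, y l t w = Yn l t w) ->
  \sum_j (interacting_driver l u w 0 j - copy_driver l u w 0 j) ^+ 2 <=
  6 * LF ^+ 2 * (enorm (y l u w - phi u (W l w)) ^+ 2 + enorm (Zn l l u w - zeta u (W l w)) ^+ 2 +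
    n.+1%:R^-1 * \sum_lj gap lj u w ^+ 2 + Q (w, u)).
Proof.
move=> /andP[u0 uT] yw; have uT' : 0 <= u <= T by rewrite uT ltW.
have [_ fp] := law_moments p12 (solution_sup solY) uT'.
have f2 := le_lt_trans (flow_moment T0 solY uT').2 (ltry _).
have qE : transport_cost NN LL (distribution P (Y u)) (empirical (fun l : 'I_n.+1 => phi u (W l w))) = Q (w, u).
  by rewrite /transport_window/= u0 uT mulr1.
have -> : \sum_j (interacting_driver l u w 0 j - copy_driver l u w 0 j) ^+ 2 =
    enorm (interacting_driver l u w - copy_driver l u w) ^+ 2.
  by rewrite enorm_row; apply: eq_bigr => j _; rewrite !mxE.
have -> : interacting_driver l u w = F u (W l w) (y l u w) (Zn l l u w) (empirical (fun i => y i u w)).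
  by rewrite /interacting_driver yw; congr (F _ _ _ _ (empirical _)); apply/funext => i; rewrite yw.
have q0 := Q0 (w, u); rewrite -qE in q0; rewrite gap_sum -qE.
exact: (driver_compare p12 LF0 lipF _ _ _ _ _ _ uT' f2 fp q0).
Qed.

Lemma good_paths : {ae P, forall w, [/\ forall l t, y l t w = Yn l t w,
  forall l t, 0 <= t <= T -> forall j, y l t w 0 j = G (W l w) 0 j +
    \int[leb]_(u in `[t, T]) interacting_driver l u w 0 j - (N l j T w - N l j t w),
  forall l j, leb.-integrable `[0%R, T] (EFin \o (fun u => interacting_driver l u w 0 j)) &
  forall (l : 'I_n.+1) j, leb.-integrable `[0%R, T] (EFin \o (fun u => copy_driver l u w 0 j))]}.
Proof.
have h : {ae P, forall w, (forall l j, leb.-integrable `[0%R, T] (EFin \o (fun u => interacting_driver l u w 0 j))) /\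
  (forall (l : 'I_n.+1) j, leb.-integrable `[0%R, T] (EFin \o (fun u => copy_driver l u w 0 j)))}.
  by apply: filterS2 interacting_driver_integrable copies_integrable.
by apply: filterS3 yE eN h => w h1 h2 [h3 h4].
Qed.

(** Summed over the particles, the average inside each driver becomes the sum of gaps itself, so the
    joint system closes without a symmetry argument. Every particle contributes the same source [Q],
    whence the factor n + 1, which disappears in the average. *)
Lemma total_gap s : 0 <= s <= T -> (\sum_lj \int[P]_w (gap lj s w ^+ 2)%:E <= (K * (n.+1%:R * (T * rho)))%:E)%E.
Proof.
move=> sT; pose r z := n.+1%:R * Q z.
have rE : (\int[PL]_z (r z)%:E <= (n.+1%:R * (T * rho))%:E)%E.
  under eq_integral do rewrite EFinM.
  rewrite ge0_integralZl//; first by rewrite EFinM; apply: lee_wpmul2l.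
  - exact/measurable_EFinP.
  - by move=> z _; rewrite lee_fin.
have hJ lj : ito_sum W (noise_gap lj) (fun t w => N lj.1 lj.2 t w - psi lj.2 t (W lj.1 w)).
  exact: ito_sumD (hN lj.1 lj.2) (ito_sumN (ipsi lj.1 lj.2)).
have drift s' t : 0 <= s' -> s' <= t -> t <= T -> {ae P, forall w,
    ((\sum_lj (gap lj s' w + ((N lj.1 lj.2 t w - psi lj.2 t (W lj.1 w)) - (N lj.1 lj.2 s' w - psi lj.2 s' (W lj.1 w))) - gap lj t w) ^+ 2)%:E <=
     (t - s')%:E * \int[leb]_u
       (c * (\sum_lj gap lj u w ^+ 2 + \sum_lj \sum_k noise_gap lj k u w ^+ 2 + r (w, u)) * (s' < u <= t)%R%:R)%:E)%E}.
  move=> s0 st tT.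
  have e1 : {ae P, forall w, forall (l : 'I_n.+1) j, phi s' (W l w) 0 j = G (W l w) 0 j +
      \int[leb]_(u in `[s', T]) copy_driver l u w 0 j - (psi j T (W l w) - psi j s' (W l w))}.
    by apply: filter_forall => l; apply: ephi; rewrite s0 (le_trans st).
  have e2 : {ae P, forall w, forall (l : 'I_n.+1) j, phi t (W l w) 0 j = G (W l w) 0 j +
      \int[leb]_(u in `[t, T]) copy_driver l u w 0 j - (psi j T (W l w) - psi j t (W l w))}.
    by apply: filter_forall => l; apply: ephi; rewrite tT (le_trans s0).
  apply: filterS3 good_paths e1 e2 => w [yw ew fi fc] k1 k2.
  apply: (@pathwise_drift R T s' t ('I_n.+1 * 'I_m)%type (fun lj => G (W lj.1 w) 0 lj.2) (fun lj => G (W lj.1 w) 0 lj.2)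
    (fun lj u => y lj.1 u w 0 lj.2) (fun lj u => phi u (W lj.1 w) 0 lj.2)
    (fun lj u => N lj.1 lj.2 u w) (fun lj u => psi lj.2 u (W lj.1 w))
    (fun lj u => interacting_driver lj.1 u w 0 lj.2) (fun lj u => copy_driver lj.1 u w 0 lj.2)
    (fun u => c * (\sum_lj gap lj u w ^+ 2 + \sum_lj \sum_k noise_gap lj k u w ^+ 2 + r (w, u)))) => //.
  - by move=> u; rewrite !inE => hu lj; apply: ew; case/predU1P: hu => [->|/eqP ->]; [rewrite s0 (le_trans st)|rewrite tT (le_trans s0)].
  - by move=> u; rewrite !inE => /predU1P[->|/eqP ->] lj; [exact: k1|exact: k2].
  - move=> u /andP[su ut]; have uT : 0 < u <= T by rewrite (le_lt_trans s0 su) (le_trans ut).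
    rewrite -(sum_pair (fun l j => (interacting_driver l u w 0 j - copy_driver l u w 0 j) ^+ 2)).
    apply: (le_trans (ler_sum _ (fun l _ => particle_drift l uT yw))).
    rewrite gap_sum sum_average; apply: total_drift_arith; rewrite ?sqr_ge0//.
    + by apply: sumr_ge0 => l _; exact: sqr_ge0.
    + by apply: sumr_ge0 => l _; exact: sqr_ge0.
    + exact: diagonal_le.
    + by rewrite mulr_ge0.
apply: (@le_trans _ _ (K%:E * \int[PL]_z (r z)%:E)%E); last by rewrite EFinM; apply: lee_wpmul2l.
apply: le_trans (stability_zero_terminal hmu cP lawW indW T0 c0 hK hJ gap_adapted gap_bounded gap_measurable _ _ _ drift gap_terminal sT).
- by rewrite leeDl// sume_ge0// => lj _; apply: sume_ge0 => k _; apply: integral_ge0 => z _; rewrite lee_fin sqr_ge0.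
- by apply: measurable_funM => //; exact: measurable_cst.
- by move=> z; rewrite mulr_ge0.
- exact: le_lt_trans rE (ltry _).
Qed.

(** For the first particle the comparison is with [Y] itself: its integral is continuous in time and
    its equation holds for all times outside one null set. Neither is known for the functionals
    [psi], and the supremum over time needs both. *)
Variable NM : 'I_m -> R -> Omega -> R.
Hypothesis hNM : forall j, ito_sum W (fun (k : 'I_n.+1 * 'I_d) u w =>
  \sum_(i < 1) (k.1 == widen_ord (ltn0Sn n) i)%:R * Z u w j k.2) (NM j).
Hypothesis cN : {ae P, forall w, forall j, {within `[0, T], continuous (fun t => N ord0 j t w - NM j t w)}}.
Hypothesis eM : {ae P, forall w, forall t, 0 <= t <= T -> forall j, phi t (W 0%N w) 0 j = G (W 0%N w) 0 j +
  \int[leb]_(u in `[t, T]) copy_driver 0%N u w 0 j - (NM j T w - NM j t w)}.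

Let X0 j := gap (ord0, j).
Let J0 j t w : R := N ord0 j t w - NM j t w.
Let H0 j (k : 'I_n.+1 * 'I_d) u w : R :=
  \sum_(i < n.+1) (k.1 == widen_ord (leqnn n.+1) i)%:R * Zn ord0 i u w j k.2
  - \sum_(i < 1) (k.1 == widen_ord (ltn0Sn n) i)%:R * Z u w j k.2.
(** For a single particle, the average of all gaps is a source like [Q], no longer part of the
    unknown. *)
Let r0 z := n.+1%:R^-1 * (\sum_lj cut 0 T (gap lj) z ^+ 2) + Q z.
(** Bound for the integral of [r0]: T rho from [Q], and T times the average gap K T rho. *)
Let eps := T * rho * (1 + T * K).

Let r0_ge0 z : 0 <= r0 z.
Proof. by rewrite addr_ge0// mulr_ge0// sumr_ge0// => lj _; exact: sqr_ge0. Qed.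

Let mr0 : measurable_fun setT r0.
Proof.
apply: measurable_funD => //; apply: measurable_funM => //; apply: measurable_sum => lj.
by apply: measurable_funX; exact: gap_measurable.
Qed.

Let r0_int : (\int[PL]_z (r0 z)%:E <= eps%:E)%E.
Proof.
have ms : measurable_fun setT (fun z => (\sum_lj cut 0 T (gap lj) z ^+ 2)%:E).
  apply/measurable_EFinP; apply: measurable_sum => lj; apply: measurable_funX; exact: gap_measurable.
have s0 z : 0 <= \sum_lj cut 0 T (gap lj) z ^+ 2 by rewrite sumr_ge0// => lj _; exact: sqr_ge0.
under eq_integral do rewrite EFinD EFinM.
rewrite ge0_integralD//; last 4 first.
- by move=> z _; rewrite mule_ge0// lee_fin.
- by apply: emeasurable_funM => //; exact: measurable_cst.
- by move=> z _; rewrite lee_fin.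
- exact/measurable_EFinP.
have -> : eps = n.+1%:R^-1 * (T * (K * (n.+1%:R * (T * rho)))) + T * rho.
  rewrite (_ : n.+1%:R^-1 * _ = n.+1%:R^-1 * n.+1%:R * (T * (K * (T * rho)))); last by ring.
  by rewrite mulVf ?pnatr_eq0// mul1r /eps; ring.
rewrite EFinD; apply: leeD => //; rewrite ge0_integralZl//; last by move=> z _; rewrite lee_fin.
rewrite EFinM; apply: lee_wpmul2l; first by rewrite lee_fin.
under eq_integral do rewrite -sumEFin.
rewrite ge0_integral_sum//; last 2 first.
- by move=> lj; apply: measurable_sqE; exact: gap_measurable.
- by move=> lj z _; rewrite lee_fin sqr_ge0.
apply: time_energy => //; last exact: total_gap.
  by rewrite !mulr_ge0// ltW.
exact: gap_measurable.
Qed.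

Let hJ0 j : ito_sum W (H0 j) (J0 j).
Proof. exact: ito_sumD (hN ord0 j) (ito_sumN (hNM j)). Qed.

Let H0_diag u w : enorm (Zn ord0 ord0 u w - Z u w) ^+ 2 <= \sum_j \sum_k H0 j k u w ^+ 2.
Proof.
rewrite enorm_sqr; apply: ler_sum => j _.
rewrite -(sum_pair (fun i k => H0 j (i, k) u w ^+ 2)) (bigD1 ord0)//=; apply: ler_wpDr.
  by apply: sumr_ge0 => i _; apply: sumr_ge0 => k _; exact: sqr_ge0.
apply: ler_sum => k _; rewrite /H0/= noise_sum_diag big_ord1 !mxE.
by rewrite (_ : ord0 == widen_ord _ ord0) ?mul1r//; apply/eqP/val_inj.
Qed.

Let particle_drift0 : {ae P, forall w, forall s t, 0 <= s -> s <= t -> t <= T ->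
  ((\sum_j (X0 j s w + (J0 j t w - J0 j s w) - X0 j t w) ^+ 2)%:E <=
   (t - s)%:E * \int[leb]_u
     (c * (\sum_j X0 j u w ^+ 2 + \sum_j \sum_k H0 j k u w ^+ 2 + r0 (w, u)) * (s < u <= t)%R%:R)%:E)%E}.
Proof.
apply: filterS3 good_paths eM hphi => w [yw ew fi fc] k1 hz s t s0 st tT.
apply: (@pathwise_drift R T s t 'I_m (fun j => G (W 0%N w) 0 j) (fun j => G (W 0%N w) 0 j)
  (fun j u => y ord0 u w 0 j) (fun j u => phi u (W 0%N w) 0 j) (fun j u => N ord0 j u w) (fun j u => NM j u w)
  (fun j u => interacting_driver ord0 u w 0 j) (fun j u => copy_driver 0%N u w 0 j)
  (fun u => c * (\sum_j X0 j u w ^+ 2 + \sum_j \sum_k H0 j k u w ^+ 2 + r0 (w, u)))) => //.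
- by move=> j; exact: (fc ord0 j).
- by move=> u; rewrite !inE => hu j; apply: (ew ord0); case/predU1P: hu => [->|/eqP ->]; [rewrite s0 (le_trans st)|rewrite tT (le_trans s0)].
- by move=> u; rewrite !inE => hu j; apply: k1; case/predU1P: hu => [->|/eqP ->]; [rewrite s0 (le_trans st)|rewrite tT (le_trans s0)].
- move=> u /andP[su ut]; have uT : 0 < u <= T by rewrite (le_lt_trans s0 su) (le_trans ut).
  have /andP[u0 uT'] := uT; have uT0 : 0 <= u <= T by rewrite uT' ltW.
  apply: (le_trans (particle_drift ord0 uT yw)).
  have [_ ->] := hz u uT0.
  have -> : enorm (y ord0 u w - phi u (W 0%N w)) ^+ 2 = \sum_j X0 j u w ^+ 2.
    by rewrite enorm_row; apply: eq_bigr => j _; rewrite !mxE.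
  have -> : r0 (w, u) = n.+1%:R^-1 * \sum_lj gap lj u w ^+ 2 + Q (w, u).
    rewrite /r0; congr (_ * _ + _); apply: eq_bigr => lj _; by rewrite /cut/= uT mulr1.
  apply: particle_drift_arith; rewrite ?sqr_ge0//.
  + by apply: sumr_ge0 => j _; exact: sqr_ge0.
  + by rewrite mulr_ge0// sumr_ge0// => lj _; exact: sqr_ge0.
Qed.

Let particle_stability s : 0 <= s <= T ->
  (\sum_j (\int[P]_w (X0 j s w ^+ 2)%:E) + \sum_j \sum_k (\int[PL]_z (cut s T (H0 j k) z ^+ 2)%:E) <= (K * eps)%:E)%E.
Proof.
move=> sT; apply: (@le_trans _ _ (K%:E * \int[PL]_z (r0 z)%:E)%E); last first.
  by rewrite (EFinM K eps); apply: lee_wpmul2l; [rewrite lee_fin|exact: r0_int].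
apply: (stability_zero_terminal hmu cP lawW indW T0 c0 hK hJ0 _ _ _ mr0 r0_ge0 _ _ _ sT).
- by move=> j; exact: gap_adapted.
- have [M hM] := gap_bounded; exists (\sum_(j < m) M) => t tT; rewrite -sumEFin; apply: lee_sum => j _.
  apply: le_trans (hM t tT); rewrite (bigD1 (ord0, j))//= leeDl// sume_ge0// => lj _.
  by apply: integral_ge0 => w _; rewrite lee_fin sqr_ge0.
- by move=> j; exact: gap_measurable.
- exact: le_lt_trans r0_int (ltry _).
- by move=> a b a0 ab bT; apply: filterS particle_drift0 => w h; exact: h.
- by apply: filterS gap_terminal => w h j; exact: h.
Qed.

Let eps0 : 0 <= eps.
Proof. by rewrite !mulr_ge0 ?addr_ge0 ?mulr_ge0// ltW. Qed.

Let value_bound s : 0 <= s <= T -> (\sum_j (\int[P]_w (X0 j s w ^+ 2)%:E) <= (K * eps)%:E)%E.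
Proof.
move=> sT; apply: le_trans (particle_stability sT); rewrite leeDl// sume_ge0// => j _; apply: sume_ge0 => k _.
by apply: integral_ge0 => z _; rewrite lee_fin sqr_ge0.
Qed.

Let noise_bound : (\sum_j \sum_k (\int[PL]_z (cut 0 T (H0 j k) z ^+ 2)%:E) <= (K * eps)%:E)%E.
Proof.
have T1 : (0 : R) <= 0 <= T by rewrite lexx ltW.
apply: le_trans (particle_stability T1); rewrite leeDr// sume_ge0// => j _.
by apply: integral_ge0 => z _; rewrite lee_fin sqr_ge0.
Qed.

Let mH0 j k : measurable_fun setT (cut 0 T (H0 j k)).
Proof. by have [h _ _ _ _] := hJ0 j; exact: h. Qed.

(** With T as right end the gap vanishes there, and X_t + J_T - J_t is the integral of the drift
    difference over [t, T]. Its square is at most T times one random variable [D], simultaneously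
    for all t. *)
Let drift_int : exists2 D : Omega -> \bar R, [/\ measurable_fun setT D, forall w, (0 <= D w)%E &
    (\int[P]_w D w <= (c * (T * (K * eps) + K * eps + eps))%:E)%E] &
  {ae P, forall w, forall t, 0 <= t <= T -> ((\sum_j (X0 j t w + (J0 j T w - J0 j t w) - 0) ^+ 2)%:E <= T%:E * D w)%E}.
Proof.
pose g z := (c%:E * ((\sum_j (cut 0 T (X0 j) z ^+ 2)%:E + \sum_j \sum_k (cut 0 T (H0 j k) z ^+ 2)%:E) + (r0 z)%:E))%E.
have sq0 (x : R) : (0 <= (x ^+ 2)%:E)%E by rewrite lee_fin sqr_ge0.
have g1 z : (0 <= \sum_j (cut 0 T (X0 j) z ^+ 2)%:E)%E by exact: sume_ge0.
have g2 z : (0 <= \sum_j \sum_k (cut 0 T (H0 j k) z ^+ 2)%:E)%E by apply: sume_ge0 => j _; exact: sume_ge0.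
have m1 : measurable_fun setT (fun z => \sum_j (cut 0 T (X0 j) z ^+ 2)%:E)%E.
  by apply: emeasurable_sum => j; apply: measurable_sqE; exact: gap_measurable.
have m2' j : measurable_fun setT (fun z => \sum_k (cut 0 T (H0 j k) z ^+ 2)%:E)%E.
  by apply: emeasurable_sum => k; apply: measurable_sqE; exact: mH0.
have m2 : measurable_fun setT (fun z => \sum_j \sum_k (cut 0 T (H0 j k) z ^+ 2)%:E)%E by exact: emeasurable_sum.
have m12 := emeasurable_funD m1 m2.
have m3 : measurable_fun setT (fun z => (r0 z)%:E) by exact/measurable_EFinP.
have m123 := emeasurable_funD m12 m3.
have gE z : g z = (c * (\sum_j cut 0 T (X0 j) z ^+ 2 + \sum_j \sum_k cut 0 T (H0 j k) z ^+ 2 + r0 z))%:E.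
  rewrite [RHS]EFinM; congr (_ * _)%E; rewrite [RHS]EFinD; congr (_ + _)%E; rewrite [RHS]EFinD -!sumEFin; congr (_ + _)%E.
  by apply: eq_bigr => j _; rewrite -sumEFin.
have g0 z : (0 <= g z)%E by rewrite mule_ge0 ?lee_fin ?adde_ge0 ?lee_fin.
have mg : measurable_fun setT g by apply: emeasurable_funM => //; exact: measurable_cst.
exists (fubini_F leb g); first split.
- exact: (@measurable_fun_fubini_tonelli_F _ _ _ _ _ leb g mg g0).
- by move=> w; exact: integral_ge0.
- rewrite -(@fubini_tonelli1 _ _ _ _ R P leb g)// /g ge0_integralZl//; last first.
    by move=> z _; rewrite adde_ge0 ?lee_fin ?adde_ge0.
  rewrite [leRHS]EFinM; apply: lee_wpmul2l; first by rewrite lee_fin.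
  rewrite ge0_integralD//; last 2 first.
  + by move=> z _; rewrite adde_ge0.
  + by move=> z _; rewrite lee_fin.
  rewrite ge0_integralD// [leRHS]EFinD; apply: leeD => //; rewrite [leRHS]EFinD; apply: leeD.
    rewrite ge0_integral_sum//; last by move=> j; apply: measurable_sqE; exact: gap_measurable.
    apply: time_energy => //; [by rewrite mulr_ge0|by move=> j; exact: gap_measurable].
  rewrite ge0_integral_sum//; last by move=> j z _; exact: sume_ge0.
  apply: le_trans noise_bound; apply: lee_sum => j _.
  by rewrite ge0_integral_sum//; move=> k; apply: measurable_sqE; exact: mH0.
- apply: filterS2 particle_drift0 gap_terminal => w h XT t tT; have /andP[t0 tT'] := tT.
  have := h t T t0 tT' (lexx T).
  under eq_bigr do rewrite [X0 _ T w]XT.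
  move/le_trans; apply; apply: (@le_trans _ _ ((T - t)%:E * fubini_F leb g w)%E).
    apply: lee_wpmul2l; first by rewrite lee_fin subr_ge0.
    have s1 (f : 'I_m -> R) : 0 <= \sum_j f j ^+ 2 by apply: sumr_ge0 => j _; exact: sqr_ge0.
    have s2 (f : 'I_m -> 'I_n.+1 * 'I_d -> R) : 0 <= \sum_j \sum_k f j k ^+ 2.
      by apply: sumr_ge0 => j _; apply: sumr_ge0 => k _; exact: sqr_ge0.
    apply: le_integral_nonmeas => u; first by rewrite lee_fin mulr_ge0// mulr_ge0// addr_ge0// addr_ge0.
    rewrite gE lee_fin -mulrA ler_wpM2l//.
    case: (boolP (t < u <= T)) => [/andP[tu uT]|_]; last first.
      by rewrite mulr0 addr_ge0// addr_ge0.
    rewrite mulr1 le_eqVlt; apply/orP; left; apply/eqP; congr (_ + _ + _).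
      by apply: eq_bigr => j _; rewrite /cut/= uT (le_lt_trans t0 tu) mulr1.
    by apply: eq_bigr => j _; apply: eq_bigr => k _; rewrite /cut/= uT (le_lt_trans t0 tu) mulr1.
  by apply: lee_wpmul2r; [exact: integral_ge0|rewrite lee_fin gerBl].
Qed.

(** The gap at t is the remaining drift minus the noise increment from t to T. The drift is bounded
    by [D]; the increment is the difference of J_T - J_0 and J_t - J_0, both under Doob's majorant.
    The factor 32 is 8 from splitting the squares times 4 from Doob's inequality. *)
Lemma particle_sup : (sup_norm2 P T (fun t w => Yn ord0 t w - Y t w)%R <=
  (2 * T * (c * (T * (K * eps) + K * eps + eps)) + 32 * (K * eps))%:E)%E.
Proof.
have [D [mD D0 iD] hD] := drift_int.
have /choice[L hL] : forall j, exists L : Omega -> \bar R, [/\ measurable_fun setT L, forall w, (0 <= L w)%E,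
    (\int[P]_w L w <= 4%:E * \sum_k (\int[P]_w \int[leb]_u ((H0 j k u w * (0 < u <= T)%R%:R) ^+ 2)%:E))%E &
    {ae P, forall w, forall t, 0 <= t <= T -> (((J0 j t w - J0 j 0 w) ^+ 2)%:E <= L w)%E}].
  move=> j; have cJ : {ae P, forall w, {within `[0, T], continuous (J0 j ^~ w)}} by apply: filterS cN => w; exact.
  by have [L [h1 h2 h3] h4] := doob hmu cP lawW indW (hJ0 j) T0 cJ; exists L.
have hL' : {ae P, forall w, forall j t, 0 <= t <= T -> (((J0 j t w - J0 j 0 w) ^+ 2)%:E <= L j w)%E}.
  by apply: filter_forall => j; have [] := hL j.
have mL : measurable_fun setT (fun w => \sum_j L j w)%E by apply: emeasurable_sum => j; have [] := hL j.
have L0 w : (0 <= \sum_j L j w)%E by apply: sume_ge0 => j _; have [] := hL j.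
pose B w := ((2 * T)%:E * D w + 8%:E * \sum_j L j w)%E.
have TT0 : (0 <= (2 * T)%:E)%E by rewrite lee_fin mulr_ge0// ltW.
have mB1 : measurable_fun setT (fun w => (2 * T)%:E * D w)%E by apply: emeasurable_funM => //; exact: measurable_cst.
have mB2 : measurable_fun setT (fun w => 8%:E * \sum_j L j w)%E by apply: emeasurable_funM => //; exact: measurable_cst.
apply: (@le_trans _ _ (\int[P]_w B w)%E).
  apply: ae_le_integral_nonmeas.
  - by move=> w; apply: (@le_ereal_sup_mem _ _ _ (enorm (Yn ord0 0 w - Y 0 w) ^+ 2)%:E); [exists 0 => //=; rewrite in_itv/= lexx ltW|rewrite lee_fin sqr_ge0].
  - by move=> w; rewrite adde_ge0// mule_ge0.
  - exact: emeasurable_funD.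
  have h : {ae P, forall w, (forall j t, 0 <= t <= T -> (((J0 j t w - J0 j 0 w) ^+ 2)%:E <= L j w)%E) /\
    (forall t, 0 <= t <= T -> ((\sum_j (X0 j t w + (J0 j T w - J0 j t w) - 0) ^+ 2)%:E <= T%:E * D w)%E)}.
    by apply: filterS2 hL' hD.
  apply: filterS3 h yE hphi => w [h1 h2] yw hp; apply: ge_ereal_sup => _ [t + <-]; rewrite /= in_itv/= => tT.
  have -> : enorm (Yn ord0 t w - Y t w) ^+ 2 = \sum_j X0 j t w ^+ 2.
    have [<- _] := hp t tT; rewrite -yw enorm_row; apply: eq_bigr => j _; by rewrite !mxE.
  apply: (@le_trans _ _ (\sum_j (2%:E * ((X0 j t w + (J0 j T w - J0 j t w) - 0) ^+ 2)%:E + 8%:E * L j w))%E).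
    rewrite -sumEFin; apply: lee_sum => j _.
    have e1 := h1 j T TT; have e2 := h1 j t tT.
    apply: (@le_trans _ _ (2%:E * ((X0 j t w + (J0 j T w - J0 j t w) - 0) ^+ 2)%:E + 4%:E * (((J0 j T w - J0 j 0 w) ^+ 2)%:E + ((J0 j t w - J0 j 0 w) ^+ 2)%:E))%E).
      have := sup_split_arith (X0 j t w) (J0 j T w - J0 j 0 w) (J0 j t w - J0 j 0 w).
      by have -> : J0 j T w - J0 j 0 w - (J0 j t w - J0 j 0 w) = J0 j T w - J0 j t w by ring.
    apply: leeD => //; apply: (@le_trans _ _ (4%:E * (L j w + L j w))%E).
      by apply: lee_wpmul2l => //; apply: leeD.
    have [_ l0 _ _] := hL j; rewrite ge0_muleDr//; by rewrite -ge0_muleDl// -EFinD -natrD.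
  rewrite big_split/= -ge0_sume_distrr; last by move=> j _; rewrite lee_fin sqr_ge0.
  rewrite -ge0_sume_distrr; last by move=> j _; have [] := hL j.
  apply: leeD => //; rewrite sumEFin EFinM -muleA; apply: lee_wpmul2l => //; exact: h2.
rewrite ge0_integralD//; last 2 first.
- by move=> w _; rewrite mule_ge0.
- by move=> w _; rewrite mule_ge0.
rewrite !ge0_integralZl// [leRHS]EFinD; apply: leeD; first by rewrite [leRHS]EFinM; apply: lee_wpmul2l.
have -> : 32 * (K * eps) = 8 * (4 * (K * eps)) by ring.
rewrite [leRHS]EFinM; apply: lee_wpmul2l => //; rewrite ge0_integral_sum//; last 2 first.
- by move=> j; have [] := hL j.
- by move=> j w _; have [] := hL j.
apply: (@le_trans _ _ (\sum_j 4%:E * \sum_k (\int[P]_w \int[leb]_u ((H0 j k u w * (0 < u <= T)%R%:R) ^+ 2)%:E))%E).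
  by apply: lee_sum => j _; have [] := hL j.
rewrite -ge0_sume_distrr; last first.
  by move=> j _; apply: sume_ge0 => k _; apply: integral_ge0 => w _; apply: integral_ge0 => u _; rewrite lee_fin sqr_ge0.
rewrite [leRHS]EFinM; apply: lee_wpmul2l => //; apply: le_trans noise_bound; apply: lee_sum => j _; apply: lee_sum => k _.
by rewrite int_cut.
Qed.

Lemma particle_noise : (int_norm2 P T (fun t w => Zn ord0 ord0 t w - Z t w)%R <= (K * eps)%:E)%E.
Proof.
apply: le_trans noise_bound.
have sq0 (x : R) : (0 <= (x ^+ 2)%:E)%E by rewrite lee_fin sqr_ge0.
have mc j k : measurable_fun setT (fun z => (cut 0 T (H0 j k) z ^+ 2)%:E) by apply: measurable_sqE; exact: mH0.
have ms w j k : measurable_fun setT (fun u => (cut 0 T (H0 j k) (w, u) ^+ 2)%:E).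
  exact: (measurableT_comp (mc j k) (@pair1_measurable _ _ Omega R w)).
have mi j k : measurable_fun setT (fun w => \int[leb]_u (cut 0 T (H0 j k) (w, u) ^+ 2)%:E)%E.
  exact: (@measurable_fun_fubini_tonelli_F _ _ _ _ _ leb (fun z => (cut 0 T (H0 j k) z ^+ 2)%:E) (mc j k) (fun=> sq0 _)).
apply: (@le_trans _ _ (\int[P]_w \sum_j \sum_k \int[leb]_u (cut 0 T (H0 j k) (w, u) ^+ 2)%:E)%E); last first.
  rewrite ge0_integral_sum//; last 2 first.
  - by move=> j; apply: emeasurable_sum => k; exact: mi.
  - by move=> j w _; apply: sume_ge0 => k _; exact: integral_ge0.
  apply: lee_sum => j _; rewrite ge0_integral_sum//; last by move=> k w _; exact: integral_ge0.
  by apply: lee_sum => k _; rewrite int_cut.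
apply: le_integral_nonmeas => w; first by apply: integral_ge0 => u _.
apply: (@le_trans _ _ (\int[leb]_u \sum_j \sum_k (cut 0 T (H0 j k) (w, u) ^+ 2)%:E)%E); last first.
  rewrite ge0_integral_sum//; last 2 first.
  - by move=> j; apply: emeasurable_sum => k; exact: ms.
  - by move=> j u _; exact: sume_ge0.
  by apply: lee_sum => j _; rewrite ge0_integral_sum//; move=> k; exact: ms.
rewrite integral_mkcond; apply: ae_le_integral_nonmeas.
- by move=> u; rewrite patchE; case: ifP.
- by move=> u; apply: sume_ge0 => j _; exact: sume_ge0.
- by apply: emeasurable_sum => j; apply: emeasurable_sum => k; exact: ms.
(* The norm integrates over [0, T] and [cut] over ]0, T]; they differ at time 0 only. *)
exists [set 0]; split; [exact: measurable_set1|exact: lebesgue_measure_set1|].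
move=> u /= hu; apply: contrapT => u0; apply: hu; rewrite patchE mem_setE in_itv/=.
case: ifP => [/andP[u1 uT]|_]; last by apply: sume_ge0 => j _; exact: sume_ge0.
have u1' : 0 < u by rewrite lt_neqAle u1 andbT eq_sym; apply/eqP.
rewrite (eq_bigr (fun j => (\sum_k H0 j k u w ^+ 2)%:E)); last first.
  by move=> j _; rewrite -sumEFin; apply: eq_bigr => k _; rewrite /cut/= u1' uT mulr1.
by rewrite sumEFin lee_fin; exact: H0_diag.
Qed.

End Chaos.

(** * The constant and the final estimate *)

Lemma final_arith {R : realType} (T K c C M r : R) :
  2 * T * (c * (T * (K * (T * (C * (1 + M) * r) * (1 + T * K))) + K * (T * (C * (1 + M) * r) * (1 + T * K)) +
    T * (C * (1 + M) * r) * (1 + T * K))) + 32 * (K * (T * (C * (1 + M) * r) * (1 + T * K))) +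
    K * (T * (C * (1 + M) * r) * (1 + T * K)) =
  (2 * T * c * (T * K + K + 1) + 33 * K) * (T * (1 + T * K) * C) * (1 + M) * r.
Proof. ring. Qed.

(** The constant is a function of the k-th moment of the solution, fixed before the noise dimension,
    the exponent p, the probability space and the data. Finiteness of that moment is proved, not
    assumed. There are n + 1 particles, the first with index 0. *)
Theorem theorem8 (R : realType) (m : nat) (T LF k q : R) :
  (0 < m)%N -> 0 < T -> 0 <= LF -> 2 < k -> 2 < q < k -> rate_defined m q ->
  exists C : \bar R -> R,
  forall (d : nat) (p : R), (0 < d)%N -> 1 <= p <= 2 ->
  forall (mu : probability (cpath T d) R), is_wiener mu ->
  forall (d0 : measure_display) (Omega : measurableType d0)
    (P : probability Omega R), measure_is_complete P ->
  forall (W : nat -> {RV P >-> cpath T d}),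
    (forall i A, measurable A -> distribution P (W i) A = mu A) ->
    mutually_independent W ->
  forall (G : cpath T d -> 'rV[R]_m)
    (F : R -> cpath T d -> 'rV[R]_m -> 'M[R]_(m, d) ->
         probability 'rV[R]_m R -> 'rV[R]_m),
    measurable_fun setT
      (G : g_sigma_algebraType (path_filtration mu T) -> 'rV[R]_m) ->
    (\int[P]_w (enorm (G (W 0%N w)) `^ k)%:E < +oo)%E ->
    (forall y z nu, finite_moment 2 nu ->
       progressive T (path_filtration mu) (fun t w => F t w y z nu)) ->
    driver_lipschitz p LF F ->
  forall (Y : R -> {RV P >-> 'rV[R]_m}) (Z : R -> Omega -> 'M[R]_(m, d)),
    mckean_vlasov_solution W F G Y Z ->
  forall (n : nat) (Yn : 'I_n.+1 -> R -> Omega -> 'rV[R]_m)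
    (Zn : 'I_n.+1 -> 'I_n.+1 -> R -> Omega -> 'M[R]_(m, d)),
    interacting_solution W F G Yn Zn ->
    (sup_norm2 P T (fun t w => Yn ord0 t w - Y t w)%R
     + int_norm2 P T (fun t w => Zn ord0 ord0 t w - Z t w)%R
     <= (C (sup_moment P T Y k) * rate n.+1 m q)%:E)%E.
Proof.
move=> m0 T0 LF0 k2 qk _; have /andP[q2 _] := qk.
have [C C0 hC] := empirical_transport_rate m0 qk.
pose c := 12 * LF ^+ 2.
have c0 : 0 <= 2 * c * (1 + T) by rewrite !mulr_ge0 ?sqr_ge0// addr_ge0// ltW.
have [K cK] := backward_iteration (ltW T0) c0.
(* The sum of the two final bounds, expanded by [final_arith]: 33 is 32 from the supremum plus 1
   from the integrand. [K] comes from T and LF, [C] from m, k and q. *)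
exists (fun x => (2 * T * c * (T * K + K + 1) + 33 * K) * (T * (1 + T * K) * C) * (1 + fine x)).
move=> d p _ p12 mu hmu d0 Omega P cP W lawW indW G F mG fG mF lipF Y Z solY n Yn Zn solN.
pose M := fine (sup_moment P T Y k).
have T1 : (0 : R) <= 0 <= T by rewrite lexx ltW.
have sm0 : (0 <= sup_moment P T Y k)%E.
  apply: (@le_ereal_sup_mem _ _ _ (\int[P]_w (enorm (Y 0 w) `^ k)%:E)%E); first by exists 0 => //=; rewrite in_itv.
  by apply: integral_ge0 => w _; rewrite lee_fin powR_ge0.
have smE : sup_moment P T Y k = M%:E.
  by rewrite fineK// ge0_fin_numE//; exact: (sup_moment_finite hmu cP lawW indW T0 p12 LF0 k2 lipF mF fG solY).
have M0 : 0 <= M by rewrite fine_ge0.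
have [NN [LL hNL]] := hC n.
pose rho := C * (1 + M) * rate n.+1 m q.
have rate0 : 0 <= rate n.+1 m q by apply: (le_trans _ (rate_ge (m := m) n q2)); rewrite invr_ge0.
have rho0 : 0 <= rho by rewrite mulr_ge0// mulr_ge0// addr_ge0.
have [phi [zeta [psi [[mphi mzeta hphi] aphi ipsi ephi]]]] := copy_data hmu cP lawW indW T0 p12 LF0 lipF mF mG solY.
have hphi1 : {ae P, forall w, forall u, 0 <= u <= T -> phi u (W 0%N w) = Y u w}.
  by apply: filterS hphi => w h u uT; have [] := h u uT.
have smM : (sup_moment P T Y k <= M%:E)%E by rewrite smE.
have [Q0 intQ] := transport_window_bound lawW indW T0 mphi hphi1 (n := n) (N := NN) (L := LL) (rho := rho) smM
  (fun nu X h => hNL nu M M0 h _ _ P X).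
have /choice[yN hyN] := fun l => solution_data hmu cP lawW indW T0 (leqnn n.+1) (solN l).
have /choice[N hN] := hyN.
(* The McKean-Vlasov solution is read once more, now in the filtration of all n + 1 noises. *)
have [yM [NM [[_ yME _ _ _] hNM cNM eNM]]] := solution_data hmu cP lawW indW T0 (ltn0Sn n) solY.
have cy l w : {within `[0, T], continuous (yN l ^~ w)} by have [[h _ _ _ _] _ _ _] := hN l; exact: h.
have yE : {ae P, forall w, forall l t, yN l t w = Yn l t w}.
  by apply: filter_forall => l; have [[_ h _ _ _] _ _ _] := hN l; exact: h.
have ay l j t : 0 <= t <= T -> smeas (noise_filtration W n.+1 t) (fun w => yN l t w 0 j).
  by have [[_ _ h _ _] _ _ _] := hN l; exact: h.
have jy l j : measurable_fun setT (cut 0 T (fun u w => yN l u w 0 j)).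
  by have [[_ _ _ h _] _ _ _] := hN l; exact: h.
have hy l t : 0 <= t <= T -> (\int[P]_w (enorm (yN l t w) ^+ 2)%:E <= sup_norm2 P T (Yn l))%E.
  by have [[_ _ _ _ h] _ _ _] := hN l; exact: h.
have iN l j := let: And4 _ h _ _ := hN l in h j.
have eN : {ae P, forall w, forall l t, 0 <= t <= T -> forall j, yN l t w 0 j = G (W l w) 0 j +
    \int[@lebesgue_measure R]_(u in `[t, T]) interacting_driver W F Yn Zn l u w 0 j - (N l j T w - N l j t w)}.
  by apply: filter_forall => l; have [_ _ _ h] := hN l; exact: h.
have cN : {ae P, forall w, forall j, {within `[0, T], continuous (fun t => N ord0 j t w - NM j t w)}}.
  have [_ _ h _] := hN ord0; apply: filterS2 h cNM => w h1 h2 j u.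
  by apply: cvgB; [exact: h1|exact: h2].
have eM : {ae P, forall w, forall t, 0 <= t <= T -> forall j, phi t (W 0%N w) 0 j = G (W 0%N w) 0 j +
    \int[@lebesgue_measure R]_(u in `[t, T]) copy_driver W F Y phi zeta 0%N u w 0 j - (NM j T w - NM j t w)}.
  apply: filterS3 hphi yME eNM => w h1 h2 h3 t tT j; have /andP[t0 _] := tT.
  rewrite (h1 t tT).1 -h2 h3//; congr (_ + _ - _); apply: eq_Rintegral => u; rewrite inE/= in_itv/= => /andP[tu uT].
  have uT' : 0 <= u <= T by rewrite uT (le_trans t0).
  by rewrite /copy_driver; have [-> ->] := h1 u uT'.
have B1 := particle_sup hmu cP lawW indW T0 p12 LF0 lipF mF solY solN cy yE ay jy hy mphi mzeta hphi cK iN eN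
  (aphi n) (ipsi n) (fun l => ephi l) Q0 rho0 intQ hNM cN eM.
have B2 := particle_noise hmu cP lawW indW T0 p12 LF0 lipF mF solY solN cy yE ay jy hy mphi mzeta hphi cK iN eN
  (aphi n) (ipsi n) (fun l => ephi l) Q0 rho0 intQ hNM eM.
by apply: le_trans (leeD B1 B2) _; rewrite -EFinD lee_fin smE /= final_arith.
Qed.
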